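(* Let $T>0$, let $\beta>2$, and let $\lambda\in C^\beta[0,T]$ be real-valued. Let $\gamma$ be the Loewner curve generated by $\lambda$, parametrized by halfplane capacity. If $\beta+\tfrac12\notin\mathbb{N}$, then $\gamma\in C^{\beta+\frac12}[s_0,T]$ for every $s_0\in(0,T)$ (i.e. $\gamma\in C^{\beta+\frac12}(0,T]$). If $\beta+\tfrac12\in\mathbb{N}$, then $\gamma\in\Lambda_*^{\beta-\frac12}[s_0,T]$ for every $s_0\in(0,T)$ (i.e. $\gamma\in\Lambda_*^{\beta-\frac12}(0,T]$).
   Context: Chordal Loewner equation: for a continuous real function $\lambda$ on $[0,T]$ and $z\in\mathbb{H}=\{\operatorname{Im} z>0\}$, $g_t(z)$ solves $\partial_t g_t(z)=\frac{2}{g_t(z)-\lambda(t)}$, $g_0(z)=z$, up to $T_z=\inf\{t: g_t(z)=\lambda(t)\}$; $K_t=\{z\in\mathbb{H}:T_z\le t\}$, and $g_t:\mathbb{H}\setminus K_t\to\mathbb{H}$ is conformal with $g_t(z)=z+\frac{2t}{z}+O(z^{-2})$ at $\infty$. $\lambda$ generates the curve $\gamma:[0,T]\to\overline{\mathbb{H}}$ if, for each $t$, $\mathbb{H}\setminus K_t$ is the unbounded component of $\mathbb{H}\setminus\gamma(0,t]$; then $\lambda(t)=g_t(\gamma(t))$ and $\gamma$ is said to be parametrized by halfplane capacity. Function spaces on an interval $I$: for $n\in\mathbb{N}_0$, $\alpha\in[0,1]$, $M>0$, $\phi\in C^{n,\alpha}(I;M)$ means $\phi',\dots,\phi^{(n)}$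 exist and are continuous, $\sup_I|\phi^{(k)}|\le M$ for $0\le k\le n$, and $\sup_{s\ne t}\frac{|\phi^{(n)}(t)-\phi^{(n)}(s)|}{|t-s|^\alpha}\le M$; $C^{n,\alpha}(I)$ is the union over $M$; $C^n=C^{n,0}$; for $\alpha\in(0,1)$, $C^{n+\alpha}:=C^{n,\alpha}$. Zygmund class: $\phi\in\Lambda_*(I)$ if $\phi$ is continuous and $\sup_{\delta>0,\ s\pm\delta\in I}\frac{|\phi(s+\delta)+\phi(s-\delta)-2\phi(s)|}{\delta}<\infty$; $\phi\in\Lambda_*^n(I)$ if $\phi',\dots,\phi^{(n)}$ exist, are continuous and bounded, and $\phi^{(n)}\in\Lambda_*(I)$. *)

(* Defs.v *)
(* classical reals. Complex numbers are represented as R*R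
   (real part, imaginary part). *)
From Stdlib Require Import Reals Lra.
Open Scope R_scope.

Definition cont_on (a b : R) (f : R -> R) : Prop :=
  forall x, a <= x <= b -> limit1_in f (fun y => a <= y <= b) (f x) x.

Definition has_deriv_on (a b : R) (f f' : R -> R) : Prop :=
  forall x, a <= x <= b ->
    limit1_in (fun y => (f y - f x) / (y - x)) (fun y => a <= y <= b /\ y <> x) (f' x) x.

Definition derivs_on (a b : R) (f : R -> R) (D : nat -> R -> R) (n : nat) : Prop :=
  (forall x, a <= x <= b -> D 0%nat x = f x) /\
  (forall k, (k < n)%nat -> has_deriv_on a b (D k) (D (S k))).

Definition Cnalpha_M (a b : R) (n : nat) (alpha M : R) (f : R -> R) : Prop :=
  exists D : nat -> R -> R,
    derivs_on a b f D n /\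
    (forall k, (k <= n)%nat -> cont_on a b (D k)) /\
    (forall k x, (k <= n)%nat -> a <= x <= b -> Rabs (D k x) <= M) /\
    (forall s t, a <= s <= b -> a <= t <= b -> s <> t ->
        Rabs (D n t - D n s) / Rpower (Rabs (t - s)) alpha <= M).

Definition Cnalpha (a b : R) (n : nat) (alpha : R) (f : R -> R) : Prop :=
  exists M, 0 < M /\ Cnalpha_M a b n alpha M f.

Definition Cbeta (a b : R) (beta : R) (f : R -> R) : Prop :=
  exists (n : nat) (alpha : R), beta = INR n + alpha /\ 0 <= alpha < 1 /\
    Cnalpha a b n alpha f.

Definition Zygmund (a b : R) (f : R -> R) : Prop :=
  cont_on a b f /\
  exists M, forall s d, 0 < d -> a <= s - d -> s + d <= b ->
    Rabs (f (s + d) + f (s - d) - 2 * f s) / d <= M.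

Definition Zygmund_n (a b : R) (n : nat) (f : R -> R) : Prop :=
  exists D : nat -> R -> R,
    derivs_on a b f D n /\
    (forall k, (1 <= k <= n)%nat -> cont_on a b (D k)) /\
    (exists M, forall k x, (1 <= k <= n)%nat -> a <= x <= b -> Rabs (D k x) <= M) /\
    Zygmund a b (D n).

Definition Hp (z : R * R) : Prop := 0 < snd z.

(* (u,v) = g_s(z), s in [0,t], solves  d/ds g_s(z) = 2/(g_s(z) - lam(s)),  g_0(z) = z,
   with g_s(z) <> lam(s) for all s in [0,t].  Written in real/imaginary parts:
   2/(w) = (2 Re w, -2 Im w)/|w|^2 with w = g - lam. *)
Definition loewner_sol (lam : R -> R) (z : R * R) (t : R) (u v : R -> R) : Prop :=
  u 0 = fst z /\ v 0 = snd z /\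
  (forall s, 0 <= s <= t -> (u s - lam s, v s) <> (0, 0)) /\
  has_deriv_on 0 t u (fun s => 2 * (u s - lam s) / ((u s - lam s) ^ 2 + (v s) ^ 2)) /\
  has_deriv_on 0 t v (fun s => - 2 * v s / ((u s - lam s) ^ 2 + (v s) ^ 2)).

(* z in H \ K_t, i.e. z in H and T_z > t (the solution exists on [0,t] and never
   hits lam) *)
Definition not_in_hull (lam : R -> R) (t : R) (z : R * R) : Prop :=
  Hp z /\ exists u v, loewner_sol lam z t u v.

Definition avoids (gam : R -> R * R) (t : R) (w : R * R) : Prop :=
  Hp w /\ forall s, 0 < s <= t -> gam s <> w.

Definition Cnorm (w : R * R) : R := sqrt (fst w ^ 2 + snd w ^ 2).

(* z lies in the unbounded (path-)component of the open set H \ gam(0,t]: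
   z can be joined inside H \ gam(0,t] to points of arbitrarily large modulus. *)
Definition in_unbounded_comp (gam : R -> R * R) (t : R) (z : R * R) : Prop :=
  avoids gam t z /\
  forall Rb : R, exists p : R -> R * R,
    cont_on 0 1 (fun r => fst (p r)) /\ cont_on 0 1 (fun r => snd (p r)) /\
    p 0 = z /\ (forall r, 0 <= r <= 1 -> avoids gam t (p r)) /\
    Rb < Cnorm (p 1).

Definition generates (lam : R -> R) (T : R) (gam : R -> R * R) : Prop :=
  cont_on 0 T (fun s => fst (gam s)) /\ cont_on 0 T (fun s => snd (gam s)) /\
  (forall s, 0 <= s <= T -> 0 <= snd (gam s)) /\
  (forall t, 0 <= t <= T -> forall z, not_in_hull lam t z <-> in_unbounded_comp gam t z).

(* Main.v *)
Require Import Defs.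
From Stdlib Require Import Reals Lra Lia Psatz Arith ClassicalEpsilon.
From Coquelicot Require Import Coquelicot.
Open Scope R_scope.

(** The tip [gam s] is the value at time [s] of the backward Loewner flow
    [W' = -2 / (W - xi)], [xi r = lam (s - r)], started on the singularity [W 0 = xi 0].
    Near a fixed time [c0] replace [lam] by its Taylor polynomial [q]: up to a high power of
    [r] the flow from the singularity is then explicit, a truncated power series in
    [sqrt (s - c0 + r)] with coefficients polynomial in those of [q], hence holomorphic in
    [s] in a disc of radius comparable to [a] when [r = a].  Following this value from
    [r = a] up to [r = c0] with the true driver gives a holomorphic function of [s] which
    differs from [gam s] by [O (a^(beta + 1/2))]: the error of [q] is [O (a^beta)], and
    differences of two flows decrease like [r^(-1/2)] while both stay close to
    [xi + 2 i sqrt r], which gains the factor [a^(1/2)].  Comparing the scales [a] and [2 a]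
    and using Cauchy's estimates, [gam] is approximated at every point and every scale [a]
    by a polynomial of fixed degree within [O (a^(beta + 1/2))], and a Campanato-type
    argument turns this into the Hölder and Zygmund classes. *)

(** * Derivatives of complex-valued functions and growth estimates *)

(** Why closeness is measured by [Z^2 + 4 r], with [Z = W - xi]: the difference [d] of two flow
    lines satisfies [d' = 2 / (Z1 * Z2) * d], and [Z] close to [2 i sqrt r] makes the coefficient
    close to [- 1 / (2 r)]. The gain of one half survives only if the deviation from this is
    integrable in [r], and the derivative of [Z^2 + 4 r] is just [- 2 Z xi']. The driver has too few
    derivatives for differentiating the flow repeatedly in time, so smoothness is taken from a
    complex time [s] that enters only the polynomial model; at [r = a] the branch point [s = - a] of
    its square root lies at distance [a]. In the sum over dyadic scales the constants in Cauchy's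
    estimates are harmless, since Taylor remainders beyond degree [m] shrink by [2^-(m+1)] per
    scale, faster than the errors decrease. The definition of [generates] knows [gam] only through
    the hulls, so the tips have to be recognised as its points, by stability of the flow at the
    singularity. Near time 0 the method stops: the factor [a^(1/2)] is gained over a flow time [r0],
    which must fit below [s0]. *)

Definition cder (f : R -> C) (t : R) (l : C) : Prop :=
  is_derive (fun x => fst (f x)) t (fst l) /\
  is_derive (fun x => snd (f x)) t (snd l).

Lemma is_derive_eq (f : R -> R) (x l l' : R) :
  is_derive f x l -> l = l' -> is_derive f x l'.
Proof. now intros H <-. Qed.

Lemma cder_eq (f : R -> C) t l l' : cder f t l -> l = l' -> cder f t l'.
Proof. now intros H <-. Qed.

Lemma cder_ext (f g : R -> C) t l : (forall x, f x = g x) -> cder f t l -> cder g t l.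
Proof.
  intros E [H1 H2]; split.
  - eapply is_derive_ext; [|exact H1]; intros; simpl; now rewrite E.
  - eapply is_derive_ext; [|exact H2]; intros; simpl; now rewrite E.
Qed.

Lemma cder_const (c : C) t : cder (fun _ => c) t 0%C.
Proof. split; simpl; apply @is_derive_const. Qed.

Lemma cder_RtoC (f : R -> R) t l : is_derive f t l -> cder (fun x => RtoC (f x)) t (RtoC l).
Proof. intros H; split; simpl; auto. apply @is_derive_const. Qed.

Lemma cder_plus f g t lf lg : cder f t lf -> cder g t lg ->
  cder (fun x => (f x + g x)%C) t (lf + lg)%C.
Proof. intros [A B] [D E]; split; simpl; now apply @is_derive_plus. Qed.

Lemma cder_opp f t lf : cder f t lf -> cder (fun x => (- f x)%C) t (- lf)%C.
Proof. intros [A B]; split; simpl; now apply @is_derive_opp. Qed.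

Lemma cder_minus f g t lf lg : cder f t lf -> cder g t lg ->
  cder (fun x => (f x - g x)%C) t (lf - lg)%C.
Proof. intros; apply cder_plus; auto; now apply cder_opp. Qed.

Lemma cder_mult f g t lf lg : cder f t lf -> cder g t lg ->
  cder (fun x => (f x * g x)%C) t (lf * g t + f t * lg)%C.
Proof.
  intros [A B] [D E]; split; simpl.
  - eapply is_derive_eq.
    + apply @is_derive_minus; apply Derive.is_derive_mult; eassumption.
    + unfold minus, plus, opp; simpl; ring.
  - eapply is_derive_eq.
    + apply @is_derive_plus; apply Derive.is_derive_mult; eassumption.
    + unfold plus; simpl; ring.
Qed.

Lemma cder_scal (f : R -> C) (m : R -> R) t lf lm : cder f t lf -> is_derive m t lm ->
  cder (fun x => (m x * f x)%C) t (lm * f t + m t * lf)%C.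
Proof. intros; apply (cder_mult (fun x => RtoC (m x))); auto; now apply cder_RtoC. Qed.

Lemma cder_comp (f : R -> C) (g : R -> R) t lf lg : cder f (g t) lf -> is_derive g t lg ->
  cder (fun x => f (g x)) t (lg * lf)%C.
Proof.
  intros [A B] D; split; simpl.
  - eapply is_derive_eq. { apply (is_derive_comp (fun x => fst (f x)) g); eauto. }
    unfold scal; simpl; unfold mult; simpl; ring.
  - eapply is_derive_eq. { apply (is_derive_comp (fun x => snd (f x)) g); eauto. }
    unfold scal; simpl; unfold mult; simpl; ring.
Qed.

Lemma Cmod_sq (z : C) : Cmod z ^ 2 = fst z ^ 2 + snd z ^ 2.
Proof. unfold Cmod; rewrite pow2_sqrt; nra. Qed.

Lemma Cmod_fst (z : C) : Rabs (fst z) <= Cmod z.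
Proof. eapply Rle_trans; [|apply Rmax_Cmod]; apply Rmax_l. Qed.

Lemma Cmod_snd (z : C) : Rabs (snd z) <= Cmod z.
Proof. eapply Rle_trans; [|apply Rmax_Cmod]; apply Rmax_r. Qed.

Lemma pow2_le_inv x y : 0 <= y -> x ^ 2 <= y ^ 2 -> x <= y.
Proof. intros; apply Rnot_lt_le; intro; nra. Qed.

Lemma Cmod_le_sum (z : C) : Cmod z <= Rabs (fst z) + Rabs (snd z).
Proof.
  assert (H := Cmod_sq z).
  assert (A := Rabs_pos (fst z)); assert (B := Rabs_pos (snd z)).
  apply pow2_le_inv; [lra|].
  rewrite <- (pow2_abs (fst z)), <- (pow2_abs (snd z)) in H; nra.
Qed.

Lemma Re_mult_conj_le (a b : C) : Rabs (fst a * fst b + snd a * snd b) <= Cmod a * Cmod b.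
Proof.
  apply pow2_le_inv. { apply Rmult_le_pos; apply Cmod_ge_0. }
  rewrite pow2_abs, Rpow_mult_distr, !Cmod_sq.
  assert (0 <= (fst a * snd b - snd a * fst b) ^ 2) by apply pow2_ge_0; nra.
Qed.

Lemma cder_inv (f : R -> C) t lf : f t <> 0%C -> cder f t lf ->
  cder (fun x => (/ f x)%C) t (- lf / (f t * f t))%C.
Proof.
  intros N [A B].
  assert (P : fst (f t) ^ 2 + snd (f t) ^ 2 <> 0).
  { rewrite <- Cmod_sq; apply pow_nonzero; intro E; apply N; now apply Cmod_eq_0. }
  assert (D : is_derive (fun x => fst (f x) ^ 2 + snd (f x) ^ 2) t
     (2 * fst lf * fst (f t) + 2 * snd lf * snd (f t))).
  { eapply is_derive_eq.
    - apply @is_derive_plus; apply is_derive_pow; eassumption.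
    - unfold plus; simpl; ring. }
  split.
  - eapply is_derive_eq.
    { exact (is_derive_div (fun x => fst (f x)) _ t _ _ A D P). }
    simpl; simpl in P; field; split; nra.
  - eapply is_derive_eq.
    { exact (is_derive_div (fun x => - snd (f x)) _ t _ _ (is_derive_opp _ _ _ B) D P). }
    unfold opp; simpl; simpl in P; field; split; nra.
Qed.

Lemma cder_continuous f t l : cder f t l ->
  continuous (fun x => fst (f x)) t /\ continuous (fun x => snd (f x)) t.
Proof. intros [A B]; split; apply @ex_derive_continuous; eexists; eassumption. Qed.

Lemma MVT_decr (h h' : R -> R) a b : a <= b ->
  (forall t, a <= t <= b -> is_derive h t (h' t)) ->
  (forall t, a <= t <= b -> h' t <= 0) -> h b <= h a.
Proof.
  intros ab D N.
  destruct (MVT_gen h a b h') as [c [Hc E]].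
  - rewrite Rmin_left, Rmax_right by lra; intros; apply D; lra.
  - rewrite Rmin_left, Rmax_right by lra; intros.
    apply continuity_pt_filterlim, @ex_derive_continuous; eexists; now apply D.
  - rewrite Rmin_left, Rmax_right in Hc by lra. specialize (N c Hc). nra.
Qed.

(* [Cmod] is not differentiable at 0, hence the regularisation [sqrt (|y|^2 + e^2)]. *)
Lemma growth (y A B : R -> C) (phi phi' : R -> R) a b : a <= b ->
  (forall t, a <= t <= b -> cder y t (A t * y t + B t)%C) ->
  (forall t, a <= t <= b -> fst (A t) <= 0) ->
  (forall t, a <= t <= b -> is_derive phi t (phi' t)) ->
  (forall t, a <= t <= b -> Cmod (B t) <= phi' t) ->
  Cmod (y b) <= Cmod (y a) + (phi b - phi a).
Proof.
  intros ab Dy NA Dphi HB.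
  apply le_epsilon; intros e he.
  assert (H := MVT_decr (fun t => sqrt (fst (y t) ^ 2 + snd (y t) ^ 2 + e ^ 2) - phi t)
     (fun t => (fst (y t) * fst (A t * y t + B t)%C + snd (y t) * snd (A t * y t + B t)%C) /
        sqrt (fst (y t) ^ 2 + snd (y t) ^ 2 + e ^ 2) - phi' t) a b ab).
  assert (P : forall t, 0 < fst (y t) ^ 2 + snd (y t) ^ 2 + e ^ 2)
    by (intro; nra).
  assert (S : sqrt (fst (y b) ^ 2 + snd (y b) ^ 2 + e ^ 2) - phi b <=
              sqrt (fst (y a) ^ 2 + snd (y a) ^ 2 + e ^ 2) - phi a).
  { apply H.
    - intros t Ht; apply @is_derive_minus; [|now apply Dphi].
      destruct (Dy t Ht) as [D1 D2].
      eapply is_derive_eq.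
      { apply is_derive_sqrt; [|apply P].
        apply @is_derive_plus; [|apply @is_derive_const].
        apply @is_derive_plus; apply is_derive_pow; eassumption. }
      unfold plus, zero; simpl; field.
      apply Rgt_not_eq; apply sqrt_lt_R0; specialize (P t); simpl in P; lra.
    - intros t Ht. set (q := sqrt _).
      assert (Q : 0 < q) by (apply sqrt_lt_R0, P).
      assert (Q2 : q ^ 2 = fst (y t) ^ 2 + snd (y t) ^ 2 + e ^ 2)
        by (apply pow2_sqrt; specialize (P t); lra).
      assert (Cq : Cmod (y t) <= q) by (apply pow2_le_inv; [lra|rewrite Cmod_sq; nra]).
      specialize (NA t Ht); specialize (HB t Ht).
      assert (C1 := Re_mult_conj_le (y t) (B t)).
      assert (C2 := Rle_abs (fst (y t) * fst (B t) + snd (y t) * snd (B t))).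
      assert (C3 := Cmod_ge_0 (B t)). assert (C4 := Cmod_ge_0 (y t)).
      assert (C5 : Cmod (y t) * Cmod (B t) <= q * phi' t) by (apply Rmult_le_compat; lra).
      assert (C6 : (fst (y t) * fst (A t * y t + B t)%C + snd (y t) * snd (A t * y t + B t)%C)
        = fst (A t) * (fst (y t) ^ 2 + snd (y t) ^ 2) +
          (fst (y t) * fst (B t) + snd (y t) * snd (B t))) by (simpl; ring).
      rewrite C6.
      assert (C7 : fst (A t) * (fst (y t) ^ 2 + snd (y t) ^ 2) <= 0) by nra.
      apply Rmult_le_reg_r with q; [lra|].
      unfold Rminus; rewrite Rmult_plus_distr_r.
      unfold Rdiv; rewrite Rmult_assoc, Rinv_l by lra. lra. }
  assert (U : Cmod (y b) <= sqrt (fst (y b) ^ 2 + snd (y b) ^ 2 + e ^ 2)).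
  { unfold Cmod; apply sqrt_le_1_alt; nra. }
  assert (V : sqrt (fst (y a) ^ 2 + snd (y a) ^ 2 + e ^ 2) <= Cmod (y a) + e).
  { assert (C4 := Cmod_ge_0 (y a)). apply pow2_le_inv; [lra|].
    rewrite pow2_sqrt by (specialize (P a); lra). rewrite <- Cmod_sq; nra. }
  lra.
Qed.

(** This is [growth] for [m * y]: an integrating factor [m] adds [m' / m] to the coefficient, so it
    can absorb a positive real part of [A] or exploit a negative one. *)
Lemma growth_weighted (y A B : R -> C) (m m' phi phi' : R -> R) a b : a <= b ->
  (forall t, a <= t <= b -> cder y t (A t * y t + B t)%C) ->
  (forall t, a <= t <= b -> is_derive m t (m' t)) ->
  (forall t, a <= t <= b -> 0 < m t) ->
  (forall t, a <= t <= b -> m' t + m t * fst (A t) <= 0) ->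
  (forall t, a <= t <= b -> is_derive phi t (phi' t)) ->
  (forall t, a <= t <= b -> m t * Cmod (B t) <= phi' t) ->
  m b * Cmod (y b) <= m a * Cmod (y a) + (phi b - phi a).
Proof.
  intros ab Dy Dm Pm HA Dphi HB.
  assert (E : forall t, a <= t <= b -> Cmod (m t * y t)%C = m t * Cmod (y t)).
  { intros; rewrite Cmod_mult, Cmod_R, Rabs_right; auto; apply Rle_ge, Rlt_le, Pm; auto. }
  rewrite <- !E by lra.
  apply (growth (fun t => (m t * y t)%C) (fun t => (m' t / m t + A t)%C)
    (fun t => (m t * B t)%C) phi phi'); auto.
  - intros t Ht. specialize (Pm t Ht).
    eapply cder_eq. { apply cder_scal; [now apply Dy|now apply Dm]. }
    field. intro H; apply (f_equal fst) in H; simpl in H; lra.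
  - intros t Ht. specialize (Pm t Ht); specialize (HA t Ht).
    replace (fst (m' t / m t + A t)%C) with (m' t / m t + fst (A t)).
    2: { simpl; field; try split; nra. }
    apply Rmult_le_reg_l with (m t); auto. field_simplify; lra.
  - intros t Ht. rewrite Cmod_mult, Cmod_R, Rabs_right; auto. apply Rle_ge, Rlt_le, Pm; auto.
Qed.

(** * Picard iteration *)

Lemma fun_choice {A B : Type} (P : A -> B -> Prop) :
  (forall a, exists b, P a b) -> exists f, forall a, P a (f a).
Proof.
  intros H. exists (fun a => proj1_sig (constructive_indefinite_description _ (H a))).
  intros a; apply proj2_sig.
Qed.

Definition ccont (f : R -> C) (t : R) : Prop :=
  continuous (fun x => fst (f x)) t /\ continuous (fun x => snd (f x)) t.

Lemma geom_small (q B e : R) : 0 <= q < 1 -> 0 < e -> exists n, B * q ^ n < e.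
Proof.
  intros Hq He. destruct (Rle_dec B 0) as [HB|HB].
  { exists 0%nat; simpl; lra. }
  assert (H := is_lim_seq_geom q). rewrite Rabs_right in H by lra.
  specialize (H (proj2 Hq)).
  apply is_lim_seq_spec in H. destruct (H (mkposreal (e / B) ltac:(apply Rdiv_lt_0_compat; lra))) as [N HN].
  exists N. specialize (HN N (Nat.le_refl N)). simpl in HN.
  rewrite Rminus_0_r, Rabs_right in HN by (apply Rle_ge, pow_le; lra).
  apply Rmult_lt_compat_l with (r := B) in HN; [|lra].
  replace (B * (e / B)) with e in HN by (field; lra). exact HN.
Qed.

Lemma geom_eq_0 (q B x : R) : 0 <= q < 1 -> (forall n, Rabs x <= B * q ^ n) -> x = 0.
Proof.
  intros Hq H. destruct (Req_dec x 0) as [E|E]; auto.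
  destruct (geom_small q B (Rabs x) Hq (Rabs_pos_lt _ E)) as [n Hn].
  specialize (H n); lra.
Qed.

Lemma geom_lim (u : nat -> R) (K q : R) : 0 <= q < 1 ->
  (forall n, Rabs (u (S n) - u n) <= K * q ^ n) ->
  exists l, forall n, Rabs (u n - l) <= K / (1 - q) * q ^ n.
Proof.
  intros Hq H.
  assert (HK : 0 <= K).
  { specialize (H 0%nat); simpl in H. assert (P := Rabs_pos (u 1%nat - u 0%nat)). lra. }
  assert (G : forall k n, Rabs (u (n + k)%nat - u n) <= K / (1 - q) * q ^ n).
  { intros k n.
    assert (Rabs (u (n + k)%nat - u n) <= K / (1 - q) * (q ^ n - q ^ (n + k))).
    { induction k.
      - rewrite Nat.add_0_r, !Rminus_diag, Rabs_R0; lra.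
      - replace (n + S k)%nat with (S (n + k)) by lia.
        replace (u (S (n + k)) - u n) with ((u (S (n + k)) - u (n + k)%nat) + (u (n + k)%nat - u n)) by ring.
        eapply Rle_trans; [apply Rabs_triang|].
        eapply Rle_trans; [apply Rplus_le_compat; [apply H|apply IHk]|].
        simpl; right; field; lra. }
    eapply Rle_trans; [exact H0|].
    apply Rmult_le_compat_l. { apply Rdiv_le_0_compat; lra. }
    assert (0 <= q ^ (n + k)) by (apply pow_le; lra). lra. }
  assert (CC : Cauchy_crit u).
  { intros e he.
    destruct (geom_small q (2 * (K / (1 - q))) e Hq he) as [N HN].
    exists N. intros n m Hn Hm. unfold Rdist.
    replace n with (N + (n - N))%nat by lia. replace m with (N + (m - N))%nat by lia.
    assert (A := G (n - N)%nat N). assert (B := G (m - N)%nat N).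
    eapply Rle_lt_trans; [|exact HN].
    set (x := u (N + (n - N))%nat) in *. set (y := u (N + (m - N))%nat) in *.
    replace (x - y) with ((x - u N) - (y - u N)) by ring.
    unfold Rminus at 1; eapply Rle_trans; [apply Rabs_triang|]. rewrite Rabs_Ropp. lra. }
  destruct (Rcomplete.R_complete u CC) as [l Hl]. exists l. intros n.
  apply le_epsilon; intros e he.
  destruct (Hl e he) as [N HN].
  specialize (HN (n + N)%nat ltac:(lia)). unfold Rdist in HN.
  specialize (G N n).
  replace (u n - l) with ((u (n + N)%nat - l) - (u (n + N)%nat - u n)) by ring.
  unfold Rminus at 1; eapply Rle_trans; [apply Rabs_triang|]. rewrite Rabs_Ropp. lra.
Qed.

Lemma exp_mono x y : x <= y -> exp x <= exp y.
Proof. intros [H|H]; [left; now apply exp_increasing|rewrite H; lra]. Qed.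

Lemma is_derive_exp_lin (k t0 t : R) : is_derive (fun t => exp (k * (t - t0))) t (k * exp (k * (t - t0))).
Proof. auto_derive; auto. unfold Rminus; ring. Qed.

Lemma is_derive_primitive (f : R -> R) t0 : (forall t, continuous f t) ->
  forall t, is_derive (fun t => RInt f t0 t) t (f t).
Proof.
  intros Hf t. apply @is_derive_RInt with (a := t0); auto.
  apply filter_forall; intros; apply @RInt_correct, @ex_RInt_continuous; auto.
Qed.

(** Bielecki's weight: integrating [exp (c * |t - t0|)] gains the factor [1 / c], so for large [c]
    Picard's map contracts on the whole line at once and no local solutions have to be glued. *)
Lemma RInt_exp_bound (f : R -> R) (K c t0 : R) : 0 < c -> (forall t, continuous f t) ->
  (forall t, Rabs (f t) <= K * exp (c * Rabs (t - t0))) ->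
  forall t, Rabs (RInt f t0 t) <= K / c * exp (c * Rabs (t - t0)).
Proof.
  intros Hc Hf Hb t.
  assert (HK : 0 <= K).
  { specialize (Hb t0). rewrite Rminus_diag, Rabs_R0, Rmult_0_r, exp_0 in Hb.
    assert (P := Rabs_pos (f t0)); lra. }
  assert (HK2 : 0 <= K / c) by (apply Rdiv_le_0_compat; lra).
  assert (D := is_derive_primitive f t0 Hf).
  assert (Z : RInt f t0 t0 = 0) by apply @RInt_point.
  destruct (Rle_dec t0 t) as [Ht|Ht].
  - rewrite (Rabs_right (t - t0)) by lra.
    assert (Hb' : forall s, t0 <= s <= t -> Rabs (f s) <= K * exp (c * (s - t0))).
    { intros s Hs; specialize (Hb s). rewrite (Rabs_right (s - t0)) in Hb by lra; auto. }
    apply Rabs_le. split.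
    + assert (H := MVT_decr (fun s => - RInt f t0 s - K / c * exp (c * (s - t0)))
        (fun s => - f s - K / c * (c * exp (c * (s - t0)))) t0 t Ht).
      cbv beta in H; rewrite Z, Rminus_diag, Rmult_0_r, exp_0 in H.
      enough (- RInt f t0 t - K / c * exp (c * (t - t0)) <= - 0 - K / c * 1) by lra.
      apply H.
      * intros; apply @is_derive_minus; [apply @is_derive_opp, D|].
        apply is_derive_scal, is_derive_exp_lin.
      * intros s Hs. specialize (Hb' s Hs). apply Rabs_le_between in Hb'.
        replace (K / c * (c * exp (c * (s - t0)))) with (K * exp (c * (s - t0))) by (field; lra). lra.
    + assert (H := MVT_decr (fun s => RInt f t0 s - K / c * exp (c * (s - t0)))
        (fun s => f s - K / c * (c * exp (c * (s - t0)))) t0 t Ht).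
      cbv beta in H; rewrite Z, Rminus_diag, Rmult_0_r, exp_0 in H.
      enough (RInt f t0 t - K / c * exp (c * (t - t0)) <= 0 - K / c * 1) by lra.
      apply H.
      * intros; apply @is_derive_minus; [apply D|].
        apply is_derive_scal, is_derive_exp_lin.
      * intros s Hs. specialize (Hb' s Hs). apply Rabs_le_between in Hb'.
        replace (K / c * (c * exp (c * (s - t0)))) with (K * exp (c * (s - t0))) by (field; lra). lra.
  - assert (Ht' : t <= t0) by lra. clear Ht.
    replace (c * Rabs (t - t0)) with (- c * (t - t0)) by (rewrite Rabs_left1 by lra; ring).
    assert (Hb' : forall s, t <= s <= t0 -> Rabs (f s) <= K * exp (- c * (s - t0))).
    { intros s Hs; specialize (Hb s).
      replace (- c * (s - t0)) with (c * Rabs (s - t0)) by (rewrite Rabs_left1 by lra; ring). auto. }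
    apply Rabs_le. split.
    + assert (H := MVT_decr (fun s => RInt f t0 s + K / c * exp (- c * (s - t0)))
        (fun s => f s + K / c * (- c * exp (- c * (s - t0)))) t t0 Ht').
      cbv beta in H; rewrite Z, Rminus_diag, Rmult_0_r, exp_0 in H.
      enough (0 + K / c * 1 <= RInt f t0 t + K / c * exp (- c * (t - t0))) by lra.
      apply H.
      * intros; apply @is_derive_plus; [apply D|].
        apply is_derive_scal, is_derive_exp_lin.
      * intros s Hs. specialize (Hb' s Hs). apply Rabs_le_between in Hb'.
        replace (K / c * (- c * exp (- c * (s - t0)))) with (- (K * exp (- c * (s - t0)))) by (field; lra). lra.
    + assert (H := MVT_decr (fun s => - RInt f t0 s + K / c * exp (- c * (s - t0)))
        (fun s => - f s + K / c * (- c * exp (- c * (s - t0)))) t t0 Ht').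
      cbv beta in H; rewrite Z, Rminus_diag, Rmult_0_r, exp_0 in H.
      enough (- 0 + K / c * 1 <= - RInt f t0 t + K / c * exp (- c * (t - t0))) by lra.
      apply H.
      * intros; apply @is_derive_plus; [apply @is_derive_opp, D|].
        apply is_derive_scal, is_derive_exp_lin.
      * intros s Hs. specialize (Hb' s Hs). apply Rabs_le_between in Hb'.
        replace (K / c * (- c * exp (- c * (s - t0)))) with (- (K * exp (- c * (s - t0)))) by (field; lra). lra.
Qed.

Lemma continuous_eps (f : R -> R) x :
  (forall e, 0 < e -> exists d, 0 < d /\ forall y, Rabs (y - x) < d -> Rabs (f y - f x) < e) ->
  continuous f x.
Proof.
  intros H P [e He]. destruct (H e (cond_pos e)) as [d [Hd Hy]].
  exists (mkposreal d Hd). intros y Hyx. apply He. apply Hy, Hyx.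
Qed.

Lemma continuous_eps_inv (f : R -> R) x : continuous f x ->
  forall e, 0 < e -> exists d, 0 < d /\ forall y, Rabs (y - x) < d -> Rabs (f y - f x) < e.
Proof.
  intros H e He.
  destruct (proj1 (filterlim_locally f (f x)) H (mkposreal e He)) as [d Hd].
  exists d. split; [apply cond_pos|]. intros y Hy. apply Hd, Hy.
Qed.

Lemma unif_lim_continuous (f : R -> R) (u : nat -> R -> R) (B r x : R) : 0 < r ->
  (forall n, continuous (u n) x) ->
  (forall n y, Rabs (y - x) < r -> Rabs (u n y - f y) <= B * (/ 2) ^ n) -> continuous f x.
Proof.
  intros Hr Hu Hb. apply continuous_eps. intros e he.
  destruct (geom_small (/ 2) B (e / 3)) as [n Hn]; [lra|lra|].
  destruct (continuous_eps_inv _ _ (Hu n) (e / 3)) as [d [Hd Hy]]; [lra|].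
  exists (Rmin d r). split; [now apply Rmin_pos|].
  intros y Hyx. assert (Hyd : Rabs (y - x) < d) by (eapply Rlt_le_trans; [exact Hyx|apply Rmin_l]).
  assert (Hyr : Rabs (y - x) < r) by (eapply Rlt_le_trans; [exact Hyx|apply Rmin_r]).
  assert (A1 := Hb n y Hyr).
  assert (A2 := Hb n x ltac:(rewrite Rminus_diag, Rabs_R0; lra)).
  assert (A3 := Hy y Hyd).
  apply Rabs_le_between in A1. apply Rabs_le_between in A2. apply Rabs_lt_between in A3.
  apply Rabs_lt_between. lra.
Qed.

(** * Integrals of complex-valued functions of a real variable *)

Definition CInt (f : R -> C) (a b : R) : C :=
  (RInt (fun t => fst (f t)) a b, RInt (fun t => snd (f t)) a b).

Lemma CInt_exp_bound (f : R -> C) (K c t0 : R) : 0 < c -> (forall t, ccont f t) ->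
  (forall t, Cmod (f t) <= K * exp (c * Rabs (t - t0))) ->
  forall t, Cmod (CInt f t0 t) <= 2 * K / c * exp (c * Rabs (t - t0)).
Proof.
  intros Hc Hf Hb t. eapply Rle_trans; [apply Cmod_le_sum|].
  assert (A := RInt_exp_bound (fun t => fst (f t)) K c t0 Hc (fun t => proj1 (Hf t))
    (fun t => Rle_trans _ _ _ (Cmod_fst (f t)) (Hb t)) t).
  assert (B := RInt_exp_bound (fun t => snd (f t)) K c t0 Hc (fun t => proj2 (Hf t))
    (fun t => Rle_trans _ _ _ (Cmod_snd (f t)) (Hb t)) t).
  unfold CInt; simpl. lra.
Qed.

Lemma cder_primitive (f : R -> C) t0 (w0 : C) : (forall t, ccont f t) ->
  forall t, cder (fun t => (w0 + CInt f t0 t)%C) t (f t).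
Proof.
  intros Hf t. eapply cder_eq.
  - apply cder_plus with (lg := f t); [apply cder_const|].
    split; simpl.
    + exact (is_derive_primitive (fun x => fst (f x)) t0 (fun x => proj1 (Hf x)) t).
    + exact (is_derive_primitive (fun x => snd (f x)) t0 (fun x => proj2 (Hf x)) t).
  - ring.
Qed.

Lemma RInt_minus_cont (f g : R -> R) a b : (forall t, continuous f t) ->
  (forall t, continuous g t) -> RInt f a b - RInt g a b = RInt (fun t => f t - g t) a b.
Proof.
  intros Hf Hg. symmetry.
  exact (@RInt_minus R_CompleteNormedModule f g a b
    (ex_RInt_continuous f a b (fun t _ => Hf t)) (ex_RInt_continuous g a b (fun t _ => Hg t))).
Qed.

Lemma CInt_minus (f g : R -> C) a b : (forall t, ccont f t) -> (forall t, ccont g t) ->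
  (CInt f a b - CInt g a b)%C = CInt (fun t => (f t - g t)%C) a b.
Proof.
  intros Hf Hg. unfold CInt, Cminus, Cplus, Copp; simpl. f_equal.
  - exact (RInt_minus_cont _ _ a b (fun t => proj1 (Hf t)) (fun t => proj1 (Hg t))).
  - exact (RInt_minus_cont _ _ a b (fun t => proj2 (Hf t)) (fun t => proj2 (Hg t))).
Qed.

Lemma cder_ccont f t l : cder f t l -> ccont f t.
Proof. intros H; exact (cder_continuous f t l H). Qed.

Lemma ccont_minus f g t : ccont f t -> ccont g t -> ccont (fun x => (f x - g x)%C) t.
Proof.
  intros [A B] [D E]; split; simpl; apply @continuous_plus; auto; now apply @continuous_opp.
Qed.

(** The field is globally Lipschitz in [w], so the solution exists for all times. Continuity of [F]
    is asked along continuous curves, the form in which the integrals use it. *)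
Theorem picard (F : R -> C -> C) (L M t0 : R) (w0 : C) : 0 < L ->
  (forall t w w', Cmod (F t w - F t w')%C <= L * Cmod (w - w')%C) ->
  (forall t, Cmod (F t w0) <= M) ->
  (forall w, (forall t, ccont w t) -> forall t, ccont (fun x => F x (w x)) t) ->
  exists W, W t0 = w0 /\ forall t, cder W t (F t (W t)).
Proof.
  intros HL HF HM HC.
  set (step := fun (w : R -> C) (t : R) => (w0 + CInt (fun x => F x (w x)) t0 t)%C).
  set (u := fix u n := match n with O => fun _ : R => w0 | S n => step (u n) end).
  assert (Hu : forall n t, ccont (u n) t).
  { induction n; intros t.
    - split; simpl; apply @continuous_const.
    - eapply cder_ccont. apply cder_primitive. intros; now apply HC. }
  assert (HM0 : 0 <= M) by (eapply Rle_trans; [apply Cmod_ge_0|apply (HM t0)]).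
  (* Each iteration multiplies the weighted distance by [2 * L / c = / 2]; the 2 comes from
     estimating real and imaginary parts separately in [CInt_exp_bound]. *)
  set (c := 4 * L). assert (Hc : 0 < c) by (unfold c; lra).
  set (K := 2 * M / c).
  assert (He : forall t, 1 <= exp (c * Rabs (t - t0))).
  { intros t. rewrite <- exp_0 at 1. destruct (Rle_lt_or_eq_dec 0 (c * Rabs (t - t0))) as [H|H].
    - apply Rmult_le_pos; [lra|apply Rabs_pos].
    - left; now apply exp_increasing.
    - rewrite <- H; lra. }
  assert (Step : forall n t, Cmod (u (S n) t - u n t)%C <= K * (/ 2) ^ n * exp (c * Rabs (t - t0))).
  { induction n; intros t.
    - simpl u; unfold step.
      replace (w0 + CInt (fun x => F x w0) t0 t - w0)%C with (CInt (fun x => F x w0) t0 t) by ring.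
      simpl; rewrite Rmult_1_r. apply CInt_exp_bound; auto.
      + intros s; apply (HC (fun _ => w0)). intros; split; apply @continuous_const.
      + intros s. eapply Rle_trans; [apply HM|]. specialize (He s). nra.
    - replace (u (S (S n)) t - u (S n) t)%C with
        (CInt (fun x => F x (u (S n) x) - F x (u n x))%C t0 t).
      2: { rewrite <- CInt_minus by (intros; apply HC; auto).
           simpl u; unfold step; ring. }
      replace (K * (/ 2) ^ S n) with (2 * (L * (K * (/ 2) ^ n)) / c).
      2: { simpl; unfold c; field; lra. }
      apply CInt_exp_bound; auto.
      + intros; apply ccont_minus; apply HC; auto.
      + intros s. eapply Rle_trans; [apply HF|]. rewrite Rmult_assoc.
        apply Rmult_le_compat_l; [lra|]. apply IHn. }
  assert (Lim : forall t, exists l : C, forall n,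
     Rabs (fst (u n t) - fst l) <= (2 * K * exp (c * Rabs (t - t0))) * (/ 2) ^ n /\
     Rabs (snd (u n t) - snd l) <= (2 * K * exp (c * Rabs (t - t0))) * (/ 2) ^ n).
  { intros t.
    destruct (geom_lim (fun n => fst (u n t)) (K * exp (c * Rabs (t - t0))) (/ 2)) as [l1 H1]; [lra| |].
    { intros n. eapply Rle_trans; [apply (Cmod_fst (u (S n) t - u n t)%C)|].
      eapply Rle_trans; [apply Step|]. right; ring. }
    destruct (geom_lim (fun n => snd (u n t)) (K * exp (c * Rabs (t - t0))) (/ 2)) as [l2 H2]; [lra| |].
    { intros n. eapply Rle_trans; [apply (Cmod_snd (u (S n) t - u n t)%C)|].
      eapply Rle_trans; [apply Step|]. right; ring. }
    exists (l1, l2). intros n; simpl.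
    replace (2 * K * exp (c * Rabs (t - t0))) with (K * exp (c * Rabs (t - t0)) / (1 - / 2)) by field.
    auto. }
  apply fun_choice in Lim. destruct Lim as [W HW].
  assert (HK : 0 <= K) by (unfold K; apply Rdiv_le_0_compat; lra).
  assert (Hloc : forall t y, Rabs (y - t) < 1 ->
    exp (c * Rabs (y - t0)) <= exp (c * (Rabs (t - t0) + 1))).
  { intros t y Hy. apply exp_mono. apply Rmult_le_compat_l; [lra|].
    replace (y - t0) with ((y - t) + (t - t0)) by ring.
    eapply Rle_trans; [apply Rabs_triang|]. lra. }
  assert (P2 : forall n, 0 < (/ 2) ^ n) by (intros; apply pow_lt; lra).
  assert (CW : forall t, ccont W t).
  { intros t. split.
    - apply unif_lim_continuous with (u := fun n y => fst (u n y)) (r := 1)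
        (B := 2 * K * exp (c * (Rabs (t - t0) + 1))); [lra|intros; apply Hu|].
      intros n y Hy. eapply Rle_trans; [apply HW|].
      apply Rmult_le_compat_r; [left; apply P2|]. apply Rmult_le_compat_l; [lra|]. now apply Hloc.
    - apply unif_lim_continuous with (u := fun n y => snd (u n y)) (r := 1)
        (B := 2 * K * exp (c * (Rabs (t - t0) + 1))); [lra|intros; apply Hu|].
      intros n y Hy. eapply Rle_trans; [apply HW|].
      apply Rmult_le_compat_r; [left; apply P2|]. apply Rmult_le_compat_l; [lra|]. now apply Hloc. }
  assert (Dist : forall n t, Cmod (u n t - W t)%C <= 4 * K * (/ 2) ^ n * exp (c * Rabs (t - t0))).
  { intros n t. eapply Rle_trans; [apply Cmod_le_sum|]. simpl.
    destruct (HW t n) as [A B]. unfold Rminus in *. lra. }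
  assert (EW : forall t, W t = step W t).
  { intros t.
    assert (Z : forall n, Cmod (step W t - W t)%C <= (4 * K * exp (c * Rabs (t - t0))) * (/ 2) ^ n).
    { intros n.
      replace (step W t - W t)%C with (- (u (S n) t - step W t) + (u (S n) t - W t))%C by ring.
      eapply Rle_trans; [apply Cmod_triangle|]. rewrite Cmod_opp.
      assert (A : Cmod (u (S n) t - step W t)%C <= 2 * (L * (4 * K * (/ 2) ^ n)) / c * exp (c * Rabs (t - t0))).
      { replace (u (S n) t - step W t)%C with (CInt (fun x => F x (u n x) - F x (W x))%C t0 t).
        2: { rewrite <- CInt_minus by (intros; apply HC; auto).
             simpl u; unfold step; ring. }
        apply CInt_exp_bound; auto.
        + intros; apply ccont_minus; apply HC; auto.
        + intros s. eapply Rle_trans; [apply HF|]. rewrite Rmult_assoc.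
          apply Rmult_le_compat_l; [lra|]. apply Dist. }
      assert (B := Dist (S n) t). simpl pow in B.
      replace (2 * (L * (4 * K * (/ 2) ^ n)) / c) with (2 * K * (/ 2) ^ n) in A by (unfold c; field; lra).
      lra. }
    assert (E : Cmod (step W t - W t)%C = 0).
    { apply geom_eq_0 with (q := / 2) (B := 4 * K * exp (c * Rabs (t - t0))); [lra|].
      intros n; rewrite Rabs_right by (apply Rle_ge, Cmod_ge_0). apply Z. }
    apply Cmod_eq_0 in E. replace (W t) with (step W t - (step W t - W t))%C by ring.
    rewrite E; ring. }
  exists W. split.
  - rewrite EW. unfold step, CInt. rewrite !RInt_point.
    unfold zero; simpl. change ((0, 0) : C) with (RtoC 0). ring.
  - intros t. apply cder_ext with (f := step W); [intros; now rewrite <- EW|].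
    apply cder_primitive. intros; apply HC; auto.
Qed.

(** * The backward Loewner flow *)

Lemma sq_sum_pos x y : 0 < y -> 0 < x ^ 2 + y ^ 2.
Proof. intros H. assert (P := pow2_ge_0 x). assert (Q := pow_lt _ 2 H). lra. Qed.

(* If [g] solves the Loewner equation up to time [s], then [r |-> g_(s-r) (z)] solves this
   equation with [xi r = lam (s - r)]. *)
Definition bl (xi : R -> R) (W : R -> C) (r : R) : Prop :=
  cder W r (- 2 / (W r - xi r))%C /\ 0 < snd (W r).

(* Globally Lipschitz, and equal to [1 / conj z] when [d <= |z|] and [0 <= Im z]. *)
Definition trunc_inv (d : R) (z : C) : C :=
  (fst z / Rmax (Cmod z) d ^ 2, Rabs (snd z) / Rmax (Cmod z) d ^ 2).

Lemma Rmax_lip x y d : Rabs (Rmax x d - Rmax y d) <= Rabs (x - y).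
Proof.
  unfold Rmax; repeat destruct Rle_dec; unfold Rabs; repeat destruct Rcase_abs; lra.
Qed.

Lemma Cmod_lip (z w : C) : Rabs (Cmod z - Cmod w) <= Cmod (z - w)%C.
Proof.
  assert (A := Cmod_triangle (z - w)%C w). assert (B := Cmod_triangle (w - z)%C z).
  replace (z - w + w)%C with z in A by ring. replace (w - z + z)%C with w in B by ring.
  replace (w - z)%C with (- (z - w))%C in B by ring. rewrite Cmod_opp in B.
  apply Rabs_le; lra.
Qed.

Lemma trunc_inv_bound d z : 0 < d -> Cmod (trunc_inv d z) <= / d.
Proof.
  intros Hd. set (N := Rmax (Cmod z) d).
  assert (N1 : Cmod z <= N) by apply Rmax_l. assert (N2 : d <= N) by apply Rmax_r.
  apply Rle_trans with (/ N); [|apply Rinv_le_contravar; lra].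
  apply pow2_le_inv; [left; apply Rinv_0_lt_compat; lra|].
  rewrite Cmod_sq; unfold trunc_inv; cbn [fst snd]; fold N.
  assert (S := Cmod_sq z). assert (Cmod z ^ 2 <= N ^ 2) by (apply pow_incr; split; [apply Cmod_ge_0|auto]).
  replace ((fst z / N ^ 2) ^ 2 + (Rabs (snd z) / N ^ 2) ^ 2) with
    ((fst z ^ 2 + Rabs (snd z) ^ 2) / N ^ 2 * (/ N) ^ 2) by (field; lra).
  rewrite pow2_abs, <- S.
  assert (Cmod z ^ 2 / N ^ 2 <= 1).
  { apply Rmult_le_reg_r with (N ^ 2); [nra|]. unfold Rdiv; rewrite Rmult_assoc, Rinv_l by nra. lra. }
  assert (0 <= (/ N) ^ 2) by apply pow2_ge_0. nra.
Qed.

Lemma trunc_inv_lip d z w : 0 < d ->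
  Cmod (trunc_inv d z - trunc_inv d w)%C <= 3 / d ^ 2 * Cmod (z - w)%C.
Proof.
  intros Hd.
  set (N := Rmax (Cmod z) d). set (N' := Rmax (Cmod w) d).
  assert (N2 : d <= N) by apply Rmax_r.
  assert (N1' : Cmod w <= N') by apply Rmax_l. assert (N2' : d <= N') by apply Rmax_r.
  set (a := ((fst z, Rabs (snd z)) : C)). set (b := ((fst w, Rabs (snd w)) : C)).
  assert (Hb : Cmod b = Cmod w).
  { unfold Cmod; simpl. f_equal. rewrite !Rmult_1_r, <- Rabs_mult, Rabs_right; nra. }
  assert (Hab : Cmod (a - b)%C <= Cmod (z - w)%C).
  { apply pow2_le_inv; [apply Cmod_ge_0|]. rewrite !Cmod_sq. simpl.
    assert (Q := Rabs_triang_inv2 (snd z) (snd w)).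
    assert (Q2 := Rsqr_le_abs_1 _ _ Q).
    unfold Rsqr in Q2. unfold Rminus in Q2. nra. }
  assert (HN : Rabs (N' - N) <= Cmod (z - w)%C).
  { eapply Rle_trans; [apply Rmax_lip|]. rewrite <- Rabs_Ropp, Ropp_minus_distr. apply Cmod_lip. }
  (* The first term changes the numerator, the second the denominator; they cost [1 / d ^ 2] and
     [2 / d ^ 2]. *)
  replace (trunc_inv d z - trunc_inv d w)%C with
    (RtoC (/ N ^ 2) * (a - b) + RtoC ((N' - N) * (N' + N) / (N ^ 2 * N' ^ 2)) * b)%C.
  2: { unfold trunc_inv, a, b; fold N N'. apply injective_projections; simpl; field; lra. }
  eapply Rle_trans; [apply Cmod_triangle|]. rewrite !Cmod_mult, !Cmod_R, Hb.
  assert (I1 : Rabs (/ N ^ 2) <= / d ^ 2).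
  { rewrite Rabs_right; [apply Rinv_le_contravar; nra|apply Rle_ge; left; apply Rinv_0_lt_compat; nra]. }
  assert (I2 : Rabs ((N' - N) * (N' + N) / (N ^ 2 * N' ^ 2)) * Cmod w <= 2 / d ^ 2 * Cmod (z - w)%C).
  { unfold Rdiv at 1. rewrite !Rabs_mult, (Rabs_right (N' + N)) by lra.
    rewrite (Rabs_right (/ _)) by (apply Rle_ge; left; apply Rinv_0_lt_compat, Rmult_lt_0_compat; apply pow_lt; lra).
    replace (Rabs (N' - N) * (N' + N) * / (N ^ 2 * N' ^ 2) * Cmod w) with
     (Rabs (N' - N) * ((/ (N * N') + / N ^ 2) * (Cmod w / N'))) by (field; lra).
    assert (J1 : / (N * N') <= / d ^ 2) by (apply Rinv_le_contravar; nra).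
    assert (J2 : / N ^ 2 <= / d ^ 2) by (apply Rinv_le_contravar; nra).
    assert (J3 : 0 <= Cmod w / N' <= 1).
    { split; [apply Rdiv_le_0_compat; [apply Cmod_ge_0|lra]|].
      apply Rmult_le_reg_r with N'; [lra|]. unfold Rdiv; rewrite Rmult_assoc, Rinv_l by lra. lra. }
    assert (J4 : 0 < / (N * N')) by (apply Rinv_0_lt_compat; nra).
    assert (J5 : 0 < / N ^ 2) by (apply Rinv_0_lt_compat; nra).
    rewrite (Rmult_comm (2 / d ^ 2)).
    apply Rmult_le_compat; [apply Rabs_pos| |exact HN|]; [nra|].
    unfold Rdiv. nra. }
  assert (0 <= Cmod (a - b)%C) by apply Cmod_ge_0.
  assert (0 < / d ^ 2) by (apply Rinv_0_lt_compat; nra).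
  unfold Rdiv in *. assert (T := Rmult_le_compat _ _ _ _ (Rabs_pos (/ N ^ 2)) H I1 Hab). lra.
Qed.

Lemma ccont_lip (G : C -> C) (K : R) (z : R -> C) t :
  (forall a b, Cmod (G a - G b)%C <= K * Cmod (a - b)%C) -> ccont z t -> ccont (fun x => G (z x)) t.
Proof.
  intros HG [A B].
  assert (H : forall e, 0 < e -> exists d, 0 < d /\ forall y, Rabs (y - t) < d ->
     Cmod (G (z y) - G (z t))%C < e).
  { intros e He. set (K' := Rabs K + 1). assert (0 < K') by (assert (Q := Rabs_pos K); unfold K'; lra).
    assert (HK : K <= K') by (assert (Q := Rle_abs K); unfold K'; lra).
    destruct (continuous_eps_inv _ _ A (e / (2 * K'))) as [d1 [P1 Q1]]; [apply Rdiv_lt_0_compat; lra|].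
    destruct (continuous_eps_inv _ _ B (e / (2 * K'))) as [d2 [P2 Q2]]; [apply Rdiv_lt_0_compat; lra|].
    exists (Rmin d1 d2); split; [now apply Rmin_pos|]. intros y Hy.
    specialize (Q1 y (Rlt_le_trans _ _ _ Hy (Rmin_l _ _))).
    specialize (Q2 y (Rlt_le_trans _ _ _ Hy (Rmin_r _ _))).
    eapply Rle_lt_trans; [apply HG|].
    assert (C1 := Cmod_le_sum (z y - z t)%C). simpl in C1. unfold Rminus in Q1, Q2.
    assert (C2 := Cmod_ge_0 (z y - z t)%C).
    apply Rle_lt_trans with (K' * Cmod (z y - z t)%C); [nra|].
    apply Rlt_le_trans with (K' * (e / (2 * K') + e / (2 * K'))); [apply Rmult_lt_compat_l; lra|].
    right; field; lra. }
  split; apply continuous_eps; intros e He; destruct (H e He) as [d [Hd Hy]]; exists d; split; auto;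
    intros y Hyt; eapply Rle_lt_trans; [|apply (Hy y Hyt)| |apply (Hy y Hyt)].
  - apply (Cmod_fst (G (z y) - G (z t))%C).
  - apply (Cmod_snd (G (z y) - G (z t))%C).
Qed.

Lemma ccont_RtoC (f : R -> R) t : continuous f t -> ccont (fun x => RtoC (f x)) t.
Proof. intros H; split; simpl; auto. apply @continuous_const. Qed.

Lemma ccont_const (c : C) t : ccont (fun _ => c) t.
Proof. split; simpl; apply @continuous_const. Qed.

(** Up to the truncation this is [- 2 * sg / z]: [sg = 1] is the backward flow and [sg = -1] the
    forward flow. The absolute value in [trunc_inv] fixes the sign of the imaginary part on the
    whole plane. *)
Definition signed_field (sg d : R) (z : C) : C :=
  (- (sg * 2) * fst (trunc_inv d z), sg * 2 * snd (trunc_inv d z)).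

Lemma signed_field_sub sg d z w :
  Cmod (signed_field sg d z - signed_field sg d w)%C =
  2 * Rabs sg * Cmod (trunc_inv d z - trunc_inv d w)%C.
Proof.
  replace (2 * Rabs sg) with (Cmod (RtoC (2 * sg))) by (rewrite Cmod_R, Rabs_mult, (Rabs_right 2) by lra; ring).
  rewrite <- Cmod_mult, <- (Cmod_conj (_ * _)%C), <- (Cmod_opp (_ - _)%C). f_equal.
  apply injective_projections; simpl; ring.
Qed.

Lemma trunc_flow (xi : R -> R) (sg d a : R) (w0 : C) : (forall t, continuous xi t) ->
  Rabs sg = 1 -> 0 < d ->
  exists W, W a = w0 /\ forall t, cder W t (signed_field sg d (W t - xi t)%C).
Proof.
  intros Hxi Hs Hd.
  apply (picard (fun t w => signed_field sg d (w - xi t)%C) (6 / d ^ 2) (2 / d)).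
  - apply Rdiv_lt_0_compat; [lra|nra].
  - intros t w w'. rewrite signed_field_sub, Hs.
    eapply Rle_trans; [apply Rmult_le_compat_l; [lra|now apply trunc_inv_lip]|].
    replace (w - xi t - (w' - xi t))%C with (w - w')%C by ring. right; field; lra.
  - intros t.
    assert (H := signed_field_sub sg d (w0 - xi t)%C 0%C).
    assert (E : trunc_inv d 0%C = 0%C).
    { unfold trunc_inv; apply injective_projections; simpl; rewrite ?Rabs_R0; unfold Rdiv; ring. }
    assert (E' : signed_field sg d 0%C = 0%C).
    { unfold signed_field; rewrite E; apply injective_projections; simpl; ring. }
    rewrite E, E', Hs in H.
    replace (signed_field sg d (w0 - xi t) - 0)%C with (signed_field sg d (w0 - xi t)%C) in H by ring.
    replace (trunc_inv d (w0 - xi t) - 0)%C with (trunc_inv d (w0 - xi t)%C) in H by ring.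
    rewrite H. assert (B := trunc_inv_bound d (w0 - xi t)%C Hd). unfold Rdiv; lra.
  - intros w Hw t. apply ccont_lip with (K := 6 / d ^ 2) (z := fun x => (w x - xi x)%C).
    + intros u v. rewrite signed_field_sub, Hs.
      eapply Rle_trans; [apply Rmult_le_compat_l; [lra|now apply trunc_inv_lip]|].
      right; field; lra.
    + apply ccont_minus; auto. now apply ccont_RtoC.
Qed.

Lemma signed_field_inv sg d (z : C) : d <= Cmod z -> 0 < d -> 0 <= snd z ->
  signed_field sg d z = (- (RtoC (sg * 2)) / z)%C.
Proof.
  intros H Hd Hz. unfold signed_field, trunc_inv. rewrite Rmax_left by lra.
  rewrite Cmod_sq, Rabs_right by lra.
  assert (P : 0 < fst z ^ 2 + snd z ^ 2) by (rewrite <- Cmod_sq; apply pow_lt; lra).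
  apply injective_projections; simpl; simpl in P; field; nra.
Qed.

Lemma is_derive_incr (f f' : R -> R) a b : a <= b ->
  (forall t, a <= t <= b -> is_derive f t (f' t)) ->
  (forall t, a <= t <= b -> 0 <= f' t) -> f a <= f b.
Proof.
  intros ab D N. apply Ropp_le_cancel.
  apply (MVT_decr (fun t => - f t) (fun t => - f' t) a b); auto.
  - intros; apply @is_derive_opp; auto.
  - intros t Ht; specialize (N t Ht); lra.
Qed.

(** The imaginary part never decreases along the truncated backward flow, so it stays above
    [snd w0]; truncating at the level [snd w0] therefore changes nothing and the solution is
    global. *)
Lemma bl_exists (xi : R -> R) a (w0 : C) : (forall t, continuous xi t) -> 0 < snd w0 ->
  exists W, W a = w0 /\ forall r, a <= r -> bl xi W r.
Proof.
  intros Hxi Hw.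
  destruct (trunc_flow xi 1 (snd w0) a w0 Hxi) as [W [E D]]; [apply Rabs_R1|auto|].
  exists W; split; auto.
  assert (P : forall r, a <= r -> snd w0 <= snd (W r)).
  { intros r Hr. rewrite <- E at 1.
    apply (is_derive_incr (fun x => snd (W x)) (fun x => snd (signed_field 1 (snd w0) (W x - xi x)%C))); auto.
    - intros; apply D.
    - intros; simpl. assert (0 <= Rabs (snd (W t) + - 0)) by apply Rabs_pos.
      set (m := Rmax _ _). assert (0 < m) by (eapply Rlt_le_trans; [exact Hw|apply Rmax_r]).
      apply Rmult_le_pos; [lra|]. apply Rdiv_le_0_compat; auto. nra. }
  intros r Hr. specialize (P r Hr). split; [|lra].
  eapply cder_eq; [apply D|].
  rewrite signed_field_inv; auto.
  - rewrite <- RtoC_opp. do 2 f_equal. ring.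
  - eapply Rle_trans; [|apply Cmod_snd]. simpl. eapply Rle_trans; [|apply Rle_abs]. lra.
  - simpl; lra.
Qed.

(** * A priori estimates for the backward flow with a Lipschitz driver *)

Section Estimates.
Variables (xi xi' : R -> R) (L : R).
Hypothesis (Dxi : forall t, is_derive xi t (xi' t)) (Bxi : forall t, Rabs (xi' t) <= L).

Lemma bl_nonzero W r : bl xi W r -> (W r - xi r)%C <> 0%C.
Proof. intros [_ H] E. apply (f_equal snd) in E; simpl in E; lra. Qed.

Lemma bl_sq_pos W r : bl xi W r -> 0 < (fst (W r) - xi r) ^ 2 + snd (W r) ^ 2.
Proof. intros [_ H]; now apply sq_sum_pos. Qed.

Lemma bl_dX W r : bl xi W r -> is_derive (fun t => fst (W t) - xi t) r
  (- 2 * (fst (W r) - xi r) / ((fst (W r) - xi r) ^ 2 + snd (W r) ^ 2) - xi' r).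
Proof.
  intros H. assert (P := bl_sq_pos W r H). destruct H as [[H _] HY].
  apply @is_derive_minus; auto. eapply is_derive_eq; [exact H|].
  simpl; simpl in P; field; repeat split; nra.
Qed.

Lemma bl_dY W r : bl xi W r -> is_derive (fun t => snd (W t)) r
  (2 * snd (W r) / ((fst (W r) - xi r) ^ 2 + snd (W r) ^ 2)).
Proof.
  intros H. assert (P := bl_sq_pos W r H). destruct H as [[_ H] HY].
  eapply is_derive_eq; [exact H|].
  simpl; simpl in P; field; repeat split; nra.
Qed.

(** With [X = fst W - xi] one has [X' = - 2 X / |Z|^2 - xi']; the first term pulls [X] to 0, so only
    the driver can move it away. *)
Lemma bl_X_bound W a b : a <= b -> (forall r, a <= r <= b -> bl xi W r) ->
  Rabs (fst (W b) - xi b) <= Rabs (fst (W a) - xi a) + L * (b - a).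
Proof.
  intros ab H. rewrite <- !Cmod_R.
  replace (L * (b - a)) with (L * b - L * a) by ring.
  apply (growth (fun t => RtoC (fst (W t) - xi t))
    (fun t => RtoC (- 2 / ((fst (W t) - xi t) ^ 2 + snd (W t) ^ 2))) (fun t => RtoC (- xi' t))
    (fun t => L * t) (fun t => L)); auto.
  - intros t Ht. eapply cder_eq; [apply cder_RtoC, bl_dX; auto|].
    rewrite <- RtoC_mult, <- RtoC_plus. f_equal. specialize (bl_sq_pos W t (H t Ht)); intro; field; lra.
  - intros t Ht; simpl. assert (P := bl_sq_pos W t (H t Ht)).
    unfold Rdiv. assert (Q := Rinv_0_lt_compat _ P). simpl in Q. nra.
  - intros; auto_derive; auto; ring.
  - intros; rewrite Cmod_R, Rabs_Ropp; apply Bxi.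
Qed.

Lemma bl_Y_mono W a b : a <= b -> (forall r, a <= r <= b -> bl xi W r) ->
  snd (W a) <= snd (W b).
Proof.
  intros ab H.
  apply (is_derive_incr (fun t => snd (W t)) _ a b ab (fun t Ht => bl_dY W t (H t Ht))).
  intros t Ht. apply Rdiv_le_0_compat; [destruct (H t Ht); lra|apply bl_sq_pos; auto].
Qed.

Lemma bl_Y_upper W a b : a <= b -> (forall r, a <= r <= b -> bl xi W r) ->
  snd (W b) ^ 2 <= snd (W a) ^ 2 + 4 * (b - a).
Proof.
  intros ab H.
  assert (K := MVT_decr (fun t => snd (W t) ^ 2 - 4 * t) (fun t => INR 2 *
    (2 * snd (W t) / ((fst (W t) - xi t) ^ 2 + snd (W t) ^ 2)) * snd (W t) ^ pred 2 - 4 * 1) a b ab).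
  enough (snd (W b) ^ 2 - 4 * b <= snd (W a) ^ 2 - 4 * a) by lra. apply K.
  - intros t Ht. apply @is_derive_minus.
    + apply is_derive_pow, bl_dY; auto.
    + apply is_derive_scal, @is_derive_id.
  - intros t Ht. assert (P := bl_sq_pos W t (H t Ht)). simpl Init.Nat.pred. simpl INR.
    set (q := _ + snd (W t) ^ 2) in *.
    replace ((1 + 1) * (2 * snd (W t) / q) * snd (W t) ^ 1 - 4 * 1) with
      (4 * (snd (W t) ^ 2 - q) / q) by (field; lra).
    unfold Rdiv. assert (Q := Rinv_0_lt_compat _ P).
    assert (snd (W t) ^ 2 - q <= 0) by (unfold q; assert (R := pow2_ge_0 (fst (W t) - xi t)); lra). nra.
Qed.

(** This is the real part of [(Z^2)' = - 4 - 2 Z xi'] for [Z = W - xi]; no denominator remains, so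
    the bound survives near the singularity. *)
Lemma bl_Y_lower W a b M : a <= b -> (forall r, a <= r <= b -> bl xi W r) ->
  (forall r, a <= r <= b -> Rabs (fst (W r) - xi r) <= M) ->
  snd (W a) ^ 2 - (fst (W a) - xi a) ^ 2 + (4 - 2 * L * M) * (b - a) <=
  snd (W b) ^ 2 - (fst (W b) - xi b) ^ 2.
Proof.
  intros ab H HM.
  assert (K := is_derive_incr
    (fun t => snd (W t) ^ 2 - (fst (W t) - xi t) ^ 2 - (4 - 2 * L * M) * t)
    (fun t => 2 * L * M + 2 * (fst (W t) - xi t) * xi' t) a b ab).
  enough (snd (W a) ^ 2 - (fst (W a) - xi a) ^ 2 - (4 - 2 * L * M) * a <=
    snd (W b) ^ 2 - (fst (W b) - xi b) ^ 2 - (4 - 2 * L * M) * b) by lra.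
  apply K.
  - intros t Ht. assert (P := bl_sq_pos W t (H t Ht)). eapply is_derive_eq.
    + apply @is_derive_minus; [apply @is_derive_minus; apply is_derive_pow|].
      * apply bl_dY; auto.
      * apply bl_dX; auto.
      * apply is_derive_scal, @is_derive_id.
    + unfold minus, plus, opp, one; simpl; simpl in P; field; nra.
  - intros t Ht. specialize (HM t Ht). specialize (Bxi t).
    assert (Rabs ((fst (W t) - xi t) * xi' t) <= M * L).
    { rewrite Rabs_mult; apply Rmult_le_compat; auto using Rabs_pos. }
    apply Rabs_le_between in H0. nra.
Qed.

(** The added [0] is the inhomogeneity [B] in the form [A * y + B] that [growth_weighted] and
    [linear_bound] expect. *)
Lemma bl_diff W1 W2 r : bl xi W1 r -> bl xi W2 r ->
  cder (fun t => W1 t - W2 t)%C r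
   (2 / ((W1 r - xi r) * (W2 r - xi r)) * (W1 r - W2 r) + 0)%C.
Proof.
  intros H1 H2. assert (N1 := bl_nonzero W1 r H1). assert (N2 := bl_nonzero W2 r H2).
  eapply cder_eq; [apply cder_minus; [apply H1|apply H2]|]. field; auto.
Qed.

Lemma coef_fst (z w : C) : z <> 0%C -> w <> 0%C ->
  fst (2 / (z * w))%C = 2 * (fst z * fst w - snd z * snd w) / (Cmod z ^ 2 * Cmod w ^ 2).
Proof.
  intros Hz Hw. rewrite !Cmod_sq.
  assert (P1 : 0 < fst z ^ 2 + snd z ^ 2) by (rewrite <- Cmod_sq; apply pow_lt; now apply Cmod_gt_0).
  assert (P2 : 0 < fst w ^ 2 + snd w ^ 2) by (rewrite <- Cmod_sq; apply pow_lt; now apply Cmod_gt_0).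
  simpl. field. split; [nra|]. split; [nra|].
  assert (Q : 0 < (fst z ^ 2 + snd z ^ 2) * (fst w ^ 2 + snd w ^ 2)) by (apply Rmult_lt_0_compat; auto).
  intro E. apply (Rlt_irrefl 0). rewrite <- E at 2. nra.
Qed.

Lemma le_mult_exp (x D : R) : 0 <= D -> (forall e, 0 < e -> x <= D * exp e) -> x <= D.
Proof.
  intros HD H. apply Rnot_lt_le; intro K.
  destruct (Rle_lt_or_eq_dec 0 D HD) as [P|P].
  - assert (Q : 0 < ln (x / D)).
    { rewrite <- ln_1. apply ln_increasing; [lra|]. apply Rmult_lt_reg_r with D; auto.
      unfold Rdiv; rewrite Rmult_assoc, Rinv_l; lra. }
    assert (E := H (ln (x / D) / 2) ltac:(lra)).
    assert (F : exp (ln (x / D) / 2) < x / D).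
    { rewrite <- (exp_ln (x / D)) at 2 by (apply Rdiv_lt_0_compat; lra). apply exp_increasing; lra. }
    apply (Rmult_lt_compat_l D) in F; auto. replace (D * (x / D)) with x in F by (field; lra). lra.
  - specialize (H 1 Rlt_0_1). rewrite <- P in H; lra.
Qed.

(* [k * |X1|] decreases fast enough to absorb [Re (2 / (Z1 Z2))], even when [W1] starts
   close to the singularity. *)
Lemma bl_stability W1 W2 k a b : a <= b -> 0 <= k ->
  (forall r, a <= r <= b -> bl xi W1 r) -> (forall r, a <= r <= b -> bl xi W2 r) ->
  (forall r, a <= r <= b -> Rabs (fst (W2 r) - xi r) <= k * Cmod (W2 r - xi r)%C ^ 2) ->
  Cmod (W1 b - W2 b)%C <=
  Cmod (W1 a - W2 a)%C * exp (k * (Rabs (fst (W1 a) - xi a) + L * (b - a))).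
Proof.
  intros ab Hk H1 H2 HX2.
  apply le_mult_exp; [apply Rmult_le_pos; [apply Cmod_ge_0|left; apply exp_pos]|].
  intros e He. set (y0 := snd (W1 a)). assert (Hy0 : 0 < y0) by (apply H1; lra).
  (* [G * h] is the total price of smoothing [|X1|] at scale [h]: [k * h] at the start and
     [2 * k * h / y0 ^ 2] per unit of time. *)
  set (G := k + 2 * k * (b - a) / y0 ^ 2).
  assert (HG : 0 <= G).
  { unfold G. assert (0 <= 2 * k * (b - a) / y0 ^ 2); [|lra].
    apply Rdiv_le_0_compat; [|nra]. repeat apply Rmult_le_pos; lra. }
  set (h := e / (G + 1)). assert (Hh : 0 < h) by (apply Rdiv_lt_0_compat; lra).
  assert (Z : G * h <= e).
    { unfold h. apply Rmult_le_reg_r with (G + 1); [lra|].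
      replace (G * (e / (G + 1)) * (G + 1)) with (G * e) by (field; lra). nra. }
  clearbody h.
  (* A differentiable substitute for [|X1|]; the terms with [L] and with [h] in the exponent of [m]
     pay for the motion of the driver and for the smoothing. *)
  set (S := fun t => sqrt ((fst (W1 t) - xi t) ^ 2 + h ^ 2)).
  set (dX := fun t => - 2 * (fst (W1 t) - xi t) / ((fst (W1 t) - xi t) ^ 2 + snd (W1 t) ^ 2) - xi' t).
  set (m := fun t => exp (k * (S t - L * t) - 2 * k * h / y0 ^ 2 * t)).
  set (m' := fun t => (k * ((fst (W1 t) - xi t) * dX t / S t - L) - 2 * k * h / y0 ^ 2) * m t).
  assert (HP : forall t, 0 < (fst (W1 t) - xi t) ^ 2 + h ^ 2) by (intros; now apply sq_sum_pos).
  assert (HS : forall t, 0 < S t) by (intros; apply sqrt_lt_R0, HP).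
  assert (HS2 : forall t, S t ^ 2 = (fst (W1 t) - xi t) ^ 2 + h ^ 2).
  { intros; apply pow2_sqrt; left; apply HP. }
  assert (K := growth_weighted (fun t => W1 t - W2 t)%C
     (fun r => 2 / ((W1 r - xi r) * (W2 r - xi r)))%C (fun _ => 0%C) m m' (fun _ => 0) (fun _ => 0) a b ab).
  cbv beta in K.
  assert (K' : m b * Cmod (W1 b - W2 b)%C <= m a * Cmod (W1 a - W2 a)%C + (0 - 0)).
  { apply K.
    - intros; apply bl_diff; auto.
    - intros t Ht. unfold m, m'.
      eapply is_derive_eq.
      { apply (is_derive_comp exp); [apply is_derive_exp|].
        apply @is_derive_minus.
        - apply is_derive_scal, @is_derive_minus.
          + apply is_derive_sqrt; [|apply HP]. apply @is_derive_plus; [|apply @is_derive_const].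
            apply is_derive_pow, bl_dX; auto.
          + apply is_derive_scal, @is_derive_id.
        - apply is_derive_scal, @is_derive_id. }
      fold (dX t). fold (S t). unfold m.
      unfold scal, minus, plus, opp, one, zero; simpl. unfold mult; simpl.
      change (sqrt ((fst (W1 t) - xi t) * ((fst (W1 t) - xi t) * 1) + h * (h * 1))) with (S t).
      specialize (HS t). field. lra.
    - intros; apply exp_pos.
    - intros t Ht. unfold m'.
      rewrite (Rmult_comm _ (m t)), <- Rmult_plus_distr_l.
      apply Rmult_le_0_l; [left; apply exp_pos|].
      assert (B1 := bl_sq_pos W1 t (H1 t Ht)). assert (B2 := bl_sq_pos W2 t (H2 t Ht)).
      rewrite coef_fst by (apply bl_nonzero; auto).
      specialize (HX2 t Ht).
      assert (Y1 : y0 <= snd (W1 t)) by (apply bl_Y_mono; [lra|intros; apply H1; lra]).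
      assert (Y2 : 0 < snd (W2 t)) by apply (H2 t Ht).
      assert (N1 : Cmod (W1 t - xi t)%C ^ 2 = (fst (W1 t) - xi t) ^ 2 + snd (W1 t) ^ 2)
        by (rewrite Cmod_sq; simpl; ring).
      assert (N2 : Cmod (W2 t - xi t)%C ^ 2 = (fst (W2 t) - xi t) ^ 2 + snd (W2 t) ^ 2)
        by (rewrite Cmod_sq; simpl; ring).
      rewrite N2 in *. rewrite N1.
      replace (fst (W1 t - xi t)%C) with (fst (W1 t) - xi t) by (simpl; ring).
      replace (fst (W2 t - xi t)%C) with (fst (W2 t) - xi t) by (simpl; ring).
      replace (snd (W1 t - xi t)%C) with (snd (W1 t)) by (simpl; ring).
      replace (snd (W2 t - xi t)%C) with (snd (W2 t)) by (simpl; ring).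
      unfold dX. specialize (HS t). specialize (HS2 t). specialize (Bxi t).
      clear K m m' H1 H2.
      set (s := S t) in *. set (x1 := fst (W1 t) - xi t) in *. set (x2 := fst (W2 t) - xi t) in *.
      set (y1 := snd (W1 t)) in *. set (y2 := snd (W2 t)) in *.
      set (n1 := x1 ^ 2 + y1 ^ 2) in *. set (n2 := x2 ^ 2 + y2 ^ 2) in *.
      (* The term [- y1 * y2] of the numerator is negative and is dropped; the rest is bounded by
         [|x1| * |x2|] and the hypothesis on [W2]. *)
      assert (A1 : 2 * (x1 * x2 - y1 * y2) / (n1 * n2) <= 2 * Rabs x1 * k / n1).
      { apply Rmult_le_reg_r with (n1 * n2); [nra|].
        replace (2 * (x1 * x2 - y1 * y2) / (n1 * n2) * (n1 * n2)) with (2 * (x1 * x2 - y1 * y2)) by (field; lra).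
        replace (2 * Rabs x1 * k / n1 * (n1 * n2)) with (2 * (Rabs x1 * (k * n2))) by (field; lra).
        assert (T1 := Rle_abs (x1 * x2)). rewrite Rabs_mult in T1.
        assert (T2 := Rmult_le_compat_l _ _ _ (Rabs_pos x1) HX2). nra. }
      assert (S1 : Rabs x1 <= s) by (apply pow2_le_inv; [lra|]; rewrite pow2_abs, HS2; nra).
      assert (A2 : x1 * (- 2 * x1 / n1 - xi' t) / s <= - 2 * (x1 ^ 2 / s) / n1 + L).
      { replace (x1 * (- 2 * x1 / n1 - xi' t) / s) with (- 2 * (x1 ^ 2 / s) / n1 + (- (x1 * xi' t)) / s) by (field; lra).
        apply Rplus_le_compat_l. apply Rmult_le_reg_r with s; auto.
        unfold Rdiv; rewrite Rmult_assoc, Rinv_l by lra.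
        assert (T1 := Rle_abs (- (x1 * xi' t))). rewrite Rabs_Ropp, Rabs_mult in T1.
        assert (T2 := Rmult_le_compat _ _ _ _ (Rabs_pos x1) (Rabs_pos _) S1 Bxi). nra. }
      assert (A3 : Rabs x1 - x1 ^ 2 / s <= h).
      { apply Rmult_le_reg_r with s; auto. unfold Rdiv.
        rewrite Rmult_minus_distr_r, Rmult_assoc, Rinv_l by lra.
        rewrite <- (pow2_abs x1) in *. assert (0 <= Rabs x1) by apply Rabs_pos.
        assert (s <= Rabs x1 + h) by (apply pow2_le_inv; nra). nra. }
      assert (A4 : / n1 <= / y0 ^ 2) by (apply Rinv_le_contravar; unfold n1; nra).
      assert (A5 : 0 < / n1) by (apply Rinv_0_lt_compat; lra).
      assert (A6 : 2 * k * (Rabs x1 - x1 ^ 2 / s) / n1 <= 2 * k * h / y0 ^ 2).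
      { unfold Rdiv at 1 3. apply Rle_trans with (2 * k * h * / n1).
        - apply Rmult_le_compat_r; [lra|]. apply Rmult_le_compat_l; lra.
        - apply Rmult_le_compat_l; [nra|auto]. }
      assert (A7 : k * (x1 * (- 2 * x1 / n1 - xi' t) / s - L) <= k * (- 2 * (x1 ^ 2 / s) / n1))
        by (apply Rmult_le_compat_l; lra).
      replace (2 * Rabs x1 * k / n1) with (2 * k * (Rabs x1 - x1 ^ 2 / s) / n1 - k * (- 2 * (x1 ^ 2 / s) / n1)) in A1
        by (field; lra).
      lra.
    - intros; apply @is_derive_const.
    - intros; rewrite Cmod_0; lra. }
  assert (M : m a <= m b * (exp (k * (Rabs (fst (W1 a) - xi a) + L * (b - a))) * exp e)).
  { unfold m. rewrite <- !exp_plus. apply exp_mono.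
    assert (Sa : S a <= Rabs (fst (W1 a) - xi a) + h).
    { apply pow2_le_inv; [assert (Q := Rabs_pos (fst (W1 a) - xi a)); lra|].
      rewrite HS2. rewrite <- (pow2_abs (fst (W1 a) - xi a)).
      assert (Q := Rabs_pos (fst (W1 a) - xi a)). nra. }
    assert (Sb := HS b).
    unfold G in Z. rewrite Rmult_plus_distr_r in Z.
    replace (2 * k * (b - a) / y0 ^ 2 * h) with (2 * k * h / y0 ^ 2 * (b - a)) in Z by (field; lra).
    assert (k * (S a - S b) <= k * (Rabs (fst (W1 a) - xi a) + h)) by (apply Rmult_le_compat_l; lra).
    lra. }
  rewrite Rminus_diag, Rplus_0_r in K'.
  assert (Mb : 0 < m b) by apply exp_pos.
  apply Rmult_le_reg_l with (m b); auto.
  eapply Rle_trans; [apply K'|].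
  assert (Zc := Cmod_ge_0 (W1 a - W2 a)%C). nra.
Qed.

(** For use away from the singularity: both flow lines stay at height at least [c], so the
    coefficient of the difference is at most [2 / c ^ 2]. *)
Lemma bl_stability_crude W1 W2 c a b : a <= b -> 0 < c ->
  (forall r, a <= r <= b -> bl xi W1 r) -> (forall r, a <= r <= b -> bl xi W2 r) ->
  c <= snd (W1 a) -> c <= snd (W2 a) ->
  Cmod (W1 b - W2 b)%C <= Cmod (W1 a - W2 a)%C * exp (2 / c ^ 2 * (b - a)).
Proof.
  intros ab Hc H1 H2 C1 C2.
  assert (K := growth_weighted (fun t => W1 t - W2 t)%C
     (fun r => 2 / ((W1 r - xi r) * (W2 r - xi r)))%C (fun _ => 0%C)
     (fun t => exp (- (2 / c ^ 2) * (t - a))) (fun t => - (2 / c ^ 2) * exp (- (2 / c ^ 2) * (t - a)))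
     (fun _ => 0) (fun _ => 0) a b ab).
  cbv beta in K. rewrite (Rminus_diag a), Rmult_0_r, exp_0 in K.
  assert (K' : exp (- (2 / c ^ 2) * (b - a)) * Cmod (W1 b - W2 b)%C <= 1 * Cmod (W1 a - W2 a)%C + (0 - 0)).
  { apply K.
    - intros; apply bl_diff; auto.
    - intros; apply is_derive_exp_lin.
    - intros; apply exp_pos.
    - intros t Ht.
      rewrite (Rmult_comm (- _)), <- Rmult_plus_distr_l.
      apply Rmult_le_0_l; [left; apply exp_pos|].
      assert (N1 := bl_nonzero W1 t (H1 t Ht)). assert (N2 := bl_nonzero W2 t (H2 t Ht)).
      assert (Y1 : snd (W1 a) <= snd (W1 t)) by (apply bl_Y_mono; [lra|intros; apply H1; lra]).
      assert (Y2 : snd (W2 a) <= snd (W2 t)) by (apply bl_Y_mono; [lra|intros; apply H2; lra]).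
      assert (Z1 : c <= Cmod (W1 t - xi t)%C).
      { eapply Rle_trans; [|apply Cmod_snd]; simpl; eapply Rle_trans; [|apply Rle_abs]; lra. }
      assert (Z2 : c <= Cmod (W2 t - xi t)%C).
      { eapply Rle_trans; [|apply Cmod_snd]; simpl; eapply Rle_trans; [|apply Rle_abs]; lra. }
      enough (fst (2 / ((W1 t - xi t) * (W2 t - xi t)))%C <= 2 / c ^ 2) by lra.
      eapply Rle_trans; [apply Rle_abs|]. eapply Rle_trans; [apply Cmod_fst|].
      rewrite Cmod_div, Cmod_mult, Cmod_R, Rabs_right by (try lra; now apply Cmult_neq_0).
      apply Rmult_le_compat_l; [lra|]. apply Rinv_le_contravar; nra.
    - intros; apply @is_derive_const.
    - intros; rewrite Cmod_0; lra. }
  rewrite Rminus_diag, Rplus_0_r, Rmult_1_l in K'.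
  apply Rmult_le_reg_l with (exp (- (2 / c ^ 2) * (b - a))); [apply exp_pos|].
  eapply Rle_trans; [apply K'|].
  rewrite (Rmult_comm (exp _)), Rmult_assoc, <- exp_plus.
  replace (2 / c ^ 2 * (b - a) + - (2 / c ^ 2) * (b - a)) with 0 by ring. rewrite exp_0; lra.
Qed.

(** A start vertically above the singularity keeps the horizontal deviation quadratically small
    against the distance. The last estimate is the hypothesis of [bl_stability] with [k = L / 2],
    and its constant does not depend on the starting height. *)
Lemma bl_above_tip W a b : 0 < L -> a <= b -> (forall r, a <= r <= b -> bl xi W r) ->
  fst (W a) = xi a ->
  Rabs (fst (W b) - xi b) <= L * (b - a) /\
  2 * Rmin (b - a) (/ L ^ 2) <= snd (W b) ^ 2 /\
  Rabs (fst (W b) - xi b) <= L / 2 * Cmod (W b - xi b)%C ^ 2.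
Proof.
  intros HL ab H E.
  assert (X : forall r, a <= r <= b -> Rabs (fst (W r) - xi r) <= L * (r - a)).
  { intros r Hr. assert (Q := bl_X_bound W a r ltac:(lra) ltac:(intros; apply H; lra)).
    rewrite E, Rminus_diag, Rabs_R0 in Q. lra. }
  assert (Hi : 0 < / L ^ 2) by (apply Rinv_0_lt_compat; nra).
  (* As long as [r - a <= / L ^ 2], the drift [4 - 2 * L * M] of [bl_Y_lower], with
     [M = L * (r - a)], is at least 2. *)
  assert (Low : forall r, a <= r <= b -> r - a <= / L ^ 2 -> 2 * (r - a) <= snd (W r) ^ 2).
  { intros r Hr Hs.
    assert (Q := bl_Y_lower W a r (L * (r - a)) ltac:(lra) ltac:(intros; apply H; lra)).
    rewrite E in Q.
    assert (Q' := Q ltac:(intros s Hs'; eapply Rle_trans; [apply X; lra|apply Rmult_le_compat_l; lra])).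
    assert (T : L * (L * (r - a)) <= 1).
    { apply Rle_trans with (L ^ 2 * / L ^ 2); [|right; field; lra].
      replace (L * (L * (r - a))) with (L ^ 2 * (r - a)) by ring. apply Rmult_le_compat_l; [nra|auto]. }
    assert (0 <= (fst (W r) - xi r) ^ 2) by apply pow2_ge_0.
    assert (0 <= snd (W a) ^ 2) by apply pow2_ge_0. nra. }
  assert (Y : 2 * Rmin (b - a) (/ L ^ 2) <= snd (W b) ^ 2).
  { unfold Rmin; destruct Rle_dec; [apply Low; lra|].
    assert (Q := Low (a + / L ^ 2) ltac:(lra) ltac:(lra)).
    assert (M := bl_Y_mono W (a + / L ^ 2) b ltac:(lra) ltac:(intros; apply H; lra)).
    assert (P : 0 < snd (W (a + / L ^ 2))) by (apply H; lra).
    apply Rle_trans with (snd (W (a + / L ^ 2)) ^ 2); [lra|]. apply pow_incr; lra. }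
  split; [apply X; lra|split; [exact Y|]].
  assert (Xb := X b ltac:(lra)).
  rewrite Cmod_sq. replace (fst (W b - xi b)%C) with (fst (W b) - xi b) by (simpl; ring).
  replace (snd (W b - xi b)%C) with (snd (W b)) by (simpl; ring).
  rewrite <- (pow2_abs (fst _ - _)).
  assert (P : 0 < snd (W b)) by (apply H; lra).
  set (x := Rabs _) in *. set (y := snd (W b)) in *. assert (0 <= x) by apply Rabs_pos.
  (* Early on, [y ^ 2] is at least [2 * (b - a)] and so controls [x]; later [L * y >= 1], and
     [2 * x * y <= x ^ 2 + y ^ 2] suffices. *)
  unfold Rmin in Y; destruct Rle_dec.
  - assert (x <= L * (y ^ 2 / 2)) by (eapply Rle_trans; [exact Xb|apply Rmult_le_compat_l; lra]). nra.
  - assert (1 <= L * y).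
    { apply pow2_le_inv; [nra|]. rewrite Rpow_mult_distr.
      apply Rle_trans with (L ^ 2 * (2 * / L ^ 2)); [|apply Rmult_le_compat_l; nra].
      replace (L ^ 2 * (2 * / L ^ 2)) with 2 by (field; lra). lra. }
    assert (2 * x * y <= x ^ 2 + y ^ 2) by (assert (R := pow2_ge_0 (x - y)); ring_simplify in R; lra).
    assert (0 <= x * (L * y - 1)) by (apply Rmult_le_pos; lra).
    assert (L * (2 * x * y) <= L * (x ^ 2 + y ^ 2)) by (apply Rmult_le_compat_l; lra). lra.
Qed.

End Estimates.

(** * Flow lines started at the singularity *)

Lemma cder_ext_loc (f g : R -> C) t l r : 0 < r -> (forall x, Rabs (x - t) < r -> f x = g x) ->
  cder f t l -> cder g t l.
Proof.
  intros Hr E [A B]; split.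
  - eapply is_derive_ext_loc; [|exact A]. exists (mkposreal r Hr). intros y Hy; simpl. now rewrite E.
  - eapply is_derive_ext_loc; [|exact B]. exists (mkposreal r Hr). intros y Hy; simpl. now rewrite E.
Qed.

Lemma geom_le (q B x y : R) : 0 <= q < 1 -> (forall n, x <= y + B * q ^ n) -> x <= y.
Proof.
  intros Hq H. apply Rnot_lt_le; intro K.
  destruct (geom_small q B (x - y) Hq) as [n Hn]; [lra|]. specialize (H n); lra.
Qed.

Lemma geom_Cmod_eq (q B : R) (z w : C) : 0 <= q < 1 ->
  (forall n, Cmod (z - w)%C <= B * q ^ n) -> z = w.
Proof.
  intros Hq H. assert (E : Cmod (z - w)%C = 0).
  { apply Rle_antisym; [|apply Cmod_ge_0]. apply geom_le with q B; auto. intros; rewrite Rplus_0_l; auto. }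
  apply Cmod_eq_0 in E. replace z with (z - w + w)%C by ring. rewrite E; ring.
Qed.

Lemma geom_Clim (u : nat -> C) (K q : R) : 0 <= q < 1 ->
  (forall n, Cmod (u (S n) - u n)%C <= K * q ^ n) ->
  exists l : C, forall n, Cmod (u n - l)%C <= 2 * (K / (1 - q)) * q ^ n.
Proof.
  intros Hq H.
  destruct (geom_lim (fun n => fst (u n)) K q Hq) as [l1 H1].
  { intros n. eapply Rle_trans; [apply (Cmod_fst (u (S n) - u n)%C)|apply H]. }
  destruct (geom_lim (fun n => snd (u n)) K q Hq) as [l2 H2].
  { intros n. eapply Rle_trans; [apply (Cmod_snd (u (S n) - u n)%C)|apply H]. }
  exists (l1, l2). intros n. eapply Rle_trans; [apply Cmod_le_sum|].
  specialize (H1 n); specialize (H2 n). simpl. unfold Rminus in *. lra.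
Qed.

Lemma Csub_swap (a b c : C) : (a - c = (a - b) + (b - c))%C.
Proof. ring. Qed.

Lemma Cmod_sub_triangle (a b c : C) : Cmod (a - c)%C <= Cmod (a - b)%C + Cmod (b - c)%C.
Proof. rewrite (Csub_swap a b c). apply Cmod_triangle. Qed.

Lemma Cmod_sub_sym (a b : C) : Cmod (a - b)%C = Cmod (b - a)%C.
Proof. rewrite <- Cmod_opp. f_equal; ring. Qed.

(* [tip_stable] is what pins down this solution through a singular initial value: every
   regular flow line started close to [xi 0] stays close to it. *)
Record tip_solution (xi : R -> R) (L : R) (W : R -> C) : Prop := {
  tip_0 : W 0 = RtoC (xi 0);
  tip_bl : forall r, 0 < r -> bl xi W r;
  tip_X : forall r, 0 <= r -> Rabs (fst (W r) - xi r) <= L * r;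
  tip_Y : forall r, 0 <= r -> snd (W r) ^ 2 <= 4 * r;
  tip_stable : forall W1 b, 0 <= b -> (forall r, 0 <= r <= b -> bl xi W1 r) ->
    Cmod (W1 b - W b)%C <= Cmod (W1 0 - xi 0)%C * exp (L / 2 * (Rabs (fst (W1 0) - xi 0) + L * b))
}.

(** The solution is the limit of regular ones started at [xi 0 + i * 2^-n]. By [bl_above_tip] each
    of these can be the second flow line in [bl_stability], so they form a Cauchy sequence with a
    constant independent of the starting height. *)
Lemma tip_exists (xi xi' : R -> R) (L : R) : 0 < L -> (forall t, is_derive xi t (xi' t)) ->
  (forall t, Rabs (xi' t) <= L) -> exists W, tip_solution xi L W.
Proof.
  intros HL Dxi Bxi.
  assert (Cxi : forall t, continuous xi t) by (intros; apply @ex_derive_continuous; eexists; apply Dxi).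
  assert (Hp : forall n, 0 < (/ 2) ^ n) by (intros; apply pow_lt; lra).
  assert (Ex : forall n : nat, exists W, W 0 = ((xi 0, (/ 2) ^ n) : C) /\ forall r, 0 <= r -> bl xi W r).
  { intros n. apply bl_exists; auto. simpl; auto. }
  apply fun_choice in Ex. destruct Ex as [Wn HWn].
  assert (W0 : forall n, Wn n 0 = ((xi 0, (/ 2) ^ n) : C)) by apply HWn.
  assert (HB : forall n r, 0 <= r -> bl xi (Wn n) r) by apply HWn. clear HWn.
  assert (X0 : forall n, Rabs (fst (Wn n 0) - xi 0) = 0).
  { intros; rewrite W0; simpl. rewrite Rminus_diag, Rabs_R0; auto. }
  assert (St : forall W1 n b, 0 <= b -> (forall r, 0 <= r <= b -> bl xi W1 r) ->
    Cmod (W1 b - Wn n b)%C <= Cmod (W1 0 - Wn n 0)%C * exp (L / 2 * (Rabs (fst (W1 0) - xi 0) + L * b))).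
  { intros W1 n b Hb H1.
    assert (Q := bl_stability xi xi' L Dxi Bxi W1 (Wn n) (L / 2) 0 b Hb ltac:(lra) H1
      ltac:(intros; apply HB; lra)).
    rewrite Rminus_0_r in Q. apply Q. intros r Hr.
    apply (bl_above_tip xi xi' L Dxi Bxi (Wn n) 0 r); auto; try lra.
    - intros; apply HB; lra.
    - rewrite W0; auto. }
  set (E := fun r => exp (L / 2 * (L * r))).
  assert (Lim : forall r, exists l : C, 0 <= r -> forall n, Cmod (Wn n r - l)%C <= 4 * E r * (/ 2) ^ n).
  { intros r. destruct (Rle_dec 0 r) as [Hr|Hr]; [|exists 0%C; intros; lra].
    destruct (geom_Clim (fun n => Wn n r) (E r) (/ 2)) as [l Hl]; [lra| |].
    - intros n. eapply Rle_trans; [apply St; auto; intros; apply HB; lra|].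
      rewrite X0, Rplus_0_l. fold (E r). rewrite Rmult_comm. apply Rmult_le_compat_l; [left; apply exp_pos|].
      rewrite !W0. eapply Rle_trans; [apply Cmod_le_sum|]. simpl.
      replace (xi 0 + - xi 0) with 0 by ring. rewrite Rabs_R0.
      replace (/ 2 * (/ 2) ^ n + - (/ 2) ^ n) with (- (/ 2 * (/ 2) ^ n)) by field.
      rewrite Rabs_Ropp, Rabs_right; specialize (Hp n); lra.
    - exists l. intros _ n. eapply Rle_trans; [apply Hl|]. right; field. }
  apply fun_choice in Lim. destruct Lim as [W HW].
  (* A common positive lower bound for the heights at time [r], which the limit inherits; it keeps
     the limit off the real line. *)
  assert (Y2 : forall r, 0 < r -> exists c, 0 < c /\ c <= snd (W r) /\ forall n, c <= snd (Wn n r)).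
  { intros r Hr. set (c := sqrt (2 * Rmin (r - 0) (/ L ^ 2))).
    assert (Q : 0 < 2 * Rmin (r - 0) (/ L ^ 2)).
    { apply Rmult_lt_0_compat; [lra|]. apply Rmin_pos; [lra|]. apply Rinv_0_lt_compat; nra. }
    assert (Hc : 0 < c) by (apply sqrt_lt_R0; auto).
    assert (A : forall n, c <= snd (Wn n r)).
    { intros n. apply pow2_le_inv; [apply Rlt_le, HB; lra|].
      unfold c. rewrite pow2_sqrt by lra.
      apply (bl_above_tip xi xi' L Dxi Bxi (Wn n) 0 r); auto; try lra.
      - intros; apply HB; lra.
      - rewrite W0; auto. }
    exists c; repeat split; auto.
    apply geom_le with (/ 2) (4 * E r); [lra|]. intros n.
    specialize (HW r ltac:(lra) n). specialize (A n).
    assert (B := Cmod_snd (Wn n r - W r)%C). simpl in B. apply Rabs_le_between in B. lra. }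
  exists W. split.
  - apply geom_Cmod_eq with (/ 2) (4 * E 0 + 1); [lra|]. intros n.
    specialize (HW 0 (Rle_refl 0) n).
    eapply Rle_trans; [apply (Cmod_sub_triangle _ (Wn n 0))|]. rewrite Cmod_sub_sym.
    assert (Cmod (Wn n 0%R - xi 0)%C <= (/ 2) ^ n); [|lra].
    rewrite W0. eapply Rle_trans; [apply Cmod_le_sum|]. simpl.
    replace (xi 0 + - xi 0) with 0 by ring. rewrite Rabs_R0, Ropp_0, !Rplus_0_r, Rplus_0_l.
    rewrite Rabs_right; specialize (Hp n); lra.
  (* Differentiability of the limit: restart the flow at time [p] from the limit value; crude
     stability from [p] on shows that the restarted flow line is the limit. *)
  - intros r Hr. set (p := r / 2).
    destruct (Y2 p) as [c [Hc [Hcp Hcn]]]; [unfold p; lra|].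
    destruct (bl_exists xi p (W p) Cxi) as [V [V0 HV]]; [lra|].
    assert (EV : forall x, p <= x -> V x = W x).
    { intros x Hx. set (D := exp (2 / c ^ 2 * (x - p))).
      apply geom_Cmod_eq with (/ 2) (4 * E p * D + 4 * E x); [lra|]. intros n.
      eapply Rle_trans; [apply (Cmod_sub_triangle _ (Wn n x))|].
      specialize (HW x ltac:(unfold p in *; lra) n) as Q.
      assert (Q2 := bl_stability_crude xi V (Wn n) c p x Hx Hc
        ltac:(intros; apply HV; lra) ltac:(intros; apply HB; unfold p in *; lra)
        ltac:(rewrite V0; auto) ltac:(auto)).
      fold D in Q2. rewrite V0, Cmod_sub_sym in Q2.
      specialize (HW p ltac:(unfold p in *; lra) n).
      assert (0 < D) by apply exp_pos.
      assert (Cmod (Wn n p - W p)%C * D <= 4 * E p * (/ 2) ^ n * D) by (apply Rmult_le_compat_r; lra).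
      rewrite Cmod_sub_sym in Q2. rewrite (Cmod_sub_sym (W p)) in Q2. lra. }
    destruct (HV r) as [D P]; [unfold p; lra|].
    split.
    + apply cder_ext_loc with (f := V) (r := p); [unfold p; lra| |].
      * intros x Hx. apply EV. apply Rabs_lt_between in Hx. unfold p in *; lra.
      * rewrite <- EV by (unfold p; lra). auto.
    + rewrite <- EV by (unfold p; lra). auto.
  - intros r Hr. apply geom_le with (/ 2) (4 * E r); [lra|]. intros n.
    specialize (HW r Hr n).
    assert (Q := bl_X_bound xi xi' L Dxi Bxi (Wn n) 0 r Hr ltac:(intros; apply HB; lra)).
    rewrite X0 in Q. assert (B := Cmod_fst (Wn n r - W r)%C). simpl in B.
    replace (fst (W r) - xi r) with ((fst (Wn n r) - xi r) - (fst (Wn n r) + - fst (W r))) by ring.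
    unfold Rminus at 1. eapply Rle_trans; [apply Rabs_triang|]. rewrite Rabs_Ropp. lra.
  - intros r Hr. apply Rnot_lt_le. intro K.
    destruct (Req_dec r 0) as [Z|Z].
    { subst r. assert (E0 : W 0 = RtoC (xi 0)).
      2: { rewrite E0 in K; simpl in K; lra. }
      apply geom_Cmod_eq with (/ 2) (4 * E 0 + 1); [lra|]. intros n.
      specialize (HW 0 (Rle_refl 0) n).
      eapply Rle_trans; [apply (Cmod_sub_triangle _ (Wn n 0))|]. rewrite Cmod_sub_sym.
      assert (Cmod (Wn n 0%R - xi 0)%C <= (/ 2) ^ n); [|lra].
      rewrite W0. eapply Rle_trans; [apply Cmod_le_sum|]. simpl.
      replace (xi 0 + - xi 0) with 0 by ring. rewrite Rabs_R0, Ropp_0, !Rplus_0_r, Rplus_0_l.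
      rewrite Rabs_right; specialize (Hp n); lra. }
    destruct (Y2 r) as [c [Hc [Hcp Hcn]]]; [lra|].
    assert (snd (W r) <= sqrt (4 * r)).
    { apply geom_le with (/ 2) (4 * E r + 1); [lra|]. intros n.
      specialize (HW r Hr n).
      assert (Q := bl_Y_upper xi (Wn n) 0 r Hr ltac:(intros; apply HB; lra)).
      assert (B := Cmod_snd (Wn n r - W r)%C). simpl in B. apply Rabs_le_between in B.
      assert (snd (Wn n r) <= sqrt (4 * r) + (/ 2) ^ n).
      { assert (S0 := sqrt_pos (4 * r)). specialize (Hp n). apply pow2_le_inv; [lra|].
        eapply Rle_trans; [exact Q|]. rewrite W0. cbn [snd].
        assert (S2 := pow2_sqrt (4 * r) ltac:(lra)). nra. }
      lra. }
    assert (snd (W r) ^ 2 <= sqrt (4 * r) ^ 2) by (apply pow_incr; lra).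
    rewrite pow2_sqrt in H0 by lra. lra.
  - intros W1 b Hb H1. set (D := exp _).
    apply geom_le with (/ 2) (4 * E b + D); [lra|]. intros n.
    specialize (HW b Hb n). assert (Q := St W1 n b Hb H1). fold D in Q.
    eapply Rle_trans; [apply (Cmod_sub_triangle _ (Wn n b))|].
    assert (T : Cmod (W1 0%R - Wn n 0%R)%C <= Cmod (W1 0%R - xi 0)%C + (/ 2) ^ n).
    { eapply Rle_trans; [apply (Cmod_sub_triangle _ (RtoC (xi 0)))|]. apply Rplus_le_compat_l.
      rewrite W0. eapply Rle_trans; [apply Cmod_le_sum|]. simpl.
      replace (xi 0 + - xi 0) with 0 by ring. rewrite Rabs_R0, !Rplus_0_l.
      rewrite Rabs_Ropp, Rabs_right; specialize (Hp n); lra. }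
    assert (HD : 0 < D) by apply exp_pos.
    assert (Cmod (W1 0%R - Wn n 0%R)%C * D <= (Cmod (W1 0%R - xi 0)%C + (/ 2) ^ n) * D)
      by (apply Rmult_le_compat_r; lra).
    lra.
Qed.

(** * One-sided derivatives on an interval *)

Lemma is_derive_eps (f : R -> R) x l :
  (forall e, 0 < e -> exists d, 0 < d /\
     forall y, Rabs (y - x) < d -> Rabs (f y - f x - (y - x) * l) <= e * Rabs (y - x)) ->
  is_derive f x l.
Proof.
  intros H. apply is_derive_Reals. intros e He.
  destruct (H (e / 2)) as [d [Hd Hy]]; [lra|].
  exists (mkposreal d Hd). intros h Hh Hhd. simpl in Hhd.
  specialize (Hy (x + h)). replace (x + h - x) with h in Hy by ring. specialize (Hy Hhd).
  replace ((f (x + h) - f x) / h - l) with ((f (x + h) - f x - h * l) / h) by (field; auto).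
  assert (P := Rabs_pos_lt _ Hh).
  unfold Rdiv; rewrite Rabs_mult, Rabs_inv.
  apply Rmult_lt_reg_r with (Rabs h); auto. rewrite Rmult_assoc, Rinv_l by lra. nra.
Qed.

(** * Clamping to an interval and extension beyond its endpoints *)

Definition clamp (a b x : R) : R := Rmax a (Rmin b x).

Lemma clamp_in a b x : a <= b -> a <= clamp a b x <= b.
Proof. intros; unfold clamp, Rmax, Rmin; repeat destruct Rle_dec; lra. Qed.

Lemma clamp_id a b x : a <= x <= b -> clamp a b x = x.
Proof. intros; unfold clamp, Rmax, Rmin; repeat destruct Rle_dec; lra. Qed.

Lemma clamp_lip a b x y : Rabs (clamp a b x - clamp a b y) <= Rabs (x - y).
Proof.
  unfold clamp, Rmax, Rmin; repeat destruct Rle_dec; unfold Rabs; repeat destruct Rcase_abs; lra.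
Qed.

(** Continuation along the tangents at the endpoints turns one-sided derivatives into two-sided
    ones, so that the calculus of [is_derive] applies. *)
Lemma deriv_extension (f f' : R -> R) a b : a <= b -> has_deriv_on a b f f' ->
  exists g, (forall x, a <= x <= b -> g x = f x) /\
    forall x, is_derive g x (f' (clamp a b x)).
Proof.
  intros ab D.
  exists (fun x => f (clamp a b x) + f' (clamp a b x) * (x - clamp a b x)). split.
  { intros x Hx. rewrite clamp_id by auto. ring. }
  intros x. apply is_derive_eps. intros e He.
  destruct (Rlt_dec x a) as [Hxa|Hxa].
  { exists (a - x); split; [lra|]. intros y Hy. apply Rabs_lt_between in Hy.
    assert (E : forall z, z < a -> clamp a b z = a).
    { intros z Hz; unfold clamp, Rmax, Rmin; repeat destruct Rle_dec; lra. }
    rewrite !E by lra. ring_simplify (f a + f' a * (y - a) - (f a + f' a * (x - a)) - (y - x) * f' a).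
    rewrite Rabs_R0. apply Rmult_le_pos; [lra|apply Rabs_pos]. }
  destruct (Rlt_dec b x) as [Hxb|Hxb].
  { exists (x - b); split; [lra|]. intros y Hy. apply Rabs_lt_between in Hy.
    assert (E : forall z, b < z -> clamp a b z = b).
    { intros z Hz; unfold clamp, Rmax, Rmin; repeat destruct Rle_dec; lra. }
    rewrite !E by lra. ring_simplify (f b + f' b * (y - b) - (f b + f' b * (x - b)) - (y - x) * f' b).
    rewrite Rabs_R0. apply Rmult_le_pos; [lra|apply Rabs_pos]. }
  assert (Hx : a <= x <= b) by lra. rewrite (clamp_id a b x) by auto.
  destruct (D x Hx e He) as [d [Hd Hy]]. simpl in Hy. unfold Rdist in Hy.
  (* At an endpoint the value 1 is a dummy; at an interior point the radius keeps [y] inside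
     [[a, b]]. In both cases the product in [C] below vanishes. *)
  exists (Rmin d (Rmin (if Req_dec_T x a then 1 else x - a) (if Req_dec_T x b then 1 else b - x))).
  split.
  { repeat apply Rmin_pos; auto; destruct Req_dec_T; lra. }
  intros y Hyx.
  assert (Y1 := Rlt_le_trans _ _ _ Hyx (Rmin_l _ _)).
  assert (Y2 := Rlt_le_trans _ _ _ Hyx (Rmin_r _ _)).
  assert (Y3 := Rlt_le_trans _ _ _ Y2 (Rmin_l _ _)).
  assert (Y4 := Rlt_le_trans _ _ _ Y2 (Rmin_r _ _)). clear Hyx Y2.
  assert (C : (f' (clamp a b y) - f' x) * (y - clamp a b y) = 0).
  { destruct (Rle_dec a y) as [H1|H1]; [destruct (Rle_dec y b) as [H2|H2]|].
    - rewrite clamp_id by lra. ring.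
    - assert (x = b).
      { destruct (Req_dec_T x b); auto. apply Rabs_lt_between in Y4. lra. }
      subst x. replace (clamp a b y) with b; [ring|].
      unfold clamp, Rmax, Rmin; repeat destruct Rle_dec; lra.
    - assert (x = a).
      { destruct (Req_dec_T x a); auto. apply Rabs_lt_between in Y3. lra. }
      subst x. replace (clamp a b y) with a; [ring|].
      unfold clamp, Rmax, Rmin; repeat destruct Rle_dec; lra. }
  assert (C2 := clamp_in a b y ab).
  assert (C3 := clamp_lip a b y x). rewrite (clamp_id a b x) in C3 by auto.
  set (c := clamp a b y) in *.
  replace (f c + f' c * (y - c) - (f x + f' x * (x - x)) - (y - x) * f' x) with
    ((f c - f x - (c - x) * f' x) + (f' c - f' x) * (y - c)) by ring.
  rewrite C, Rplus_0_r.
  destruct (Req_dec c x) as [E|E].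
  { rewrite E. replace (f x - f x - (x - x) * f' x) with 0 by ring. rewrite Rabs_R0.
    apply Rmult_le_pos; [lra|apply Rabs_pos]. }
  specialize (Hy c ltac:(split; [split; auto|lra])).
  replace (f c - f x - (c - x) * f' x) with (((f c - f x) / (c - x) - f' x) * (c - x)) by (field; lra).
  rewrite Rabs_mult. apply Rmult_le_compat; try apply Rabs_pos; lra.
Qed.

Lemma has_deriv_on_of_is_derive (f f' : R -> R) a b :
  (forall x, a <= x <= b -> is_derive f x (f' x)) -> has_deriv_on a b f f'.
Proof.
  intros H x Hx e He. specialize (H x Hx). apply is_derive_Reals in H.
  destruct (H e He) as [d Hd]. exists d. split; [apply cond_pos|].
  intros y [[Hy Hyx] Hyd]. simpl in *. unfold Rdist in *.
  specialize (Hd (y - x) ltac:(lra) Hyd). replace (x + (y - x)) with y in Hd by ring. exact Hd.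
Qed.

Lemma has_deriv_on_ext (f f' g g' : R -> R) a b :
  (forall x, a <= x <= b -> f x = g x) -> (forall x, a <= x <= b -> f' x = g' x) ->
  has_deriv_on a b f f' -> has_deriv_on a b g g'.
Proof.
  intros E E' H x Hx e He. destruct (H x Hx e He) as [d [Hd Hy]].
  exists d; split; auto. intros y Hyy. rewrite <- !E, <- E' by (destruct Hyy; tauto). auto.
Qed.

Lemma cont_on_of_continuous (f : R -> R) a b :
  (forall x, a <= x <= b -> continuous f x) -> cont_on a b f.
Proof.
  intros H x Hx e He. destruct (continuous_eps_inv f x (H x Hx) e He) as [d [Hd Hy]].
  exists d; split; auto. intros y [_ Hyy]. apply Hy, Hyy.
Qed.

Lemma cont_on_clamp (f : R -> R) a b : a <= b -> cont_on a b f ->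
  forall x, continuous (fun y => f (clamp a b y)) x.
Proof.
  intros ab H x. apply continuous_eps. intros e He.
  destruct (H (clamp a b x) (clamp_in a b x ab) e He) as [d [Hd Hy]].
  exists d; split; auto. intros y Hyx.
  apply (Hy (clamp a b y)). split; [now apply clamp_in|]. simpl; unfold Rdist.
  eapply Rle_lt_trans; [apply clamp_lip|auto].
Qed.

Lemma continuous_min_attained (f : R -> R) a b : a <= b -> (forall x, continuous f x) ->
  exists m, a <= m <= b /\ forall x, a <= x <= b -> f m <= f x.
Proof.
  intros ab H. destruct (continuity_ab_min f a b ab) as [m [Hm Hab]].
  { intros; apply continuity_pt_filterlim, H. }
  exists m; split; auto.
Qed.

Lemma first_crossing (f : R -> R) (d b : R) : (forall x, continuous f x) -> d < f 0 ->
  0 <= b -> f b < d -> exists t, 0 <= t <= b /\ f t = d /\ forall r, 0 <= r <= t -> d <= f r.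
Proof.
  intros Hf H0 Hb Hfb.
  set (E := fun s => 0 <= s <= b /\ forall r, 0 <= r <= s -> d <= f r).
  assert (E0 : E 0).
  { split; [lra|]. intros r Hr. replace r with 0 by lra. lra. }
  destruct (completeness E) as [t [Ht1 Ht2]].
  { exists b. intros s [Hs _]; lra. }
  { exists 0; auto. }
  assert (T0 : 0 <= t) by (apply Ht1; auto).
  assert (Tb : t <= b) by (apply Ht2; intros s [Hs _]; lra).
  assert (Hlt : forall r, 0 <= r < t -> d <= f r).
  { intros r Hr. apply Rnot_lt_le; intro K.
    assert (t <= r); [|lra]. apply Ht2. intros s [Hs1 Hs2]. apply Rnot_lt_le; intro.
    specialize (Hs2 r ltac:(lra)); lra. }
  assert (Ht : d <= f t).
  { apply Rnot_lt_le; intro K.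
    destruct (continuous_eps_inv f t (Hf t) (d - f t)) as [e [He Hy]]; [lra|].
    destruct (Req_dec t 0) as [Z|Z]; [rewrite Z in K; lra|].
    set (r := Rmax 0 (t - e / 2)).
    assert (Hr : 0 <= r < t) by (unfold r, Rmax; destruct Rle_dec; lra).
    assert (Hr2 : Rabs (r - t) < e) by (apply Rabs_lt_between; unfold r, Rmax in *; destruct Rle_dec; lra).
    specialize (Hy r Hr2). specialize (Hlt r Hr). apply Rabs_lt_between in Hy. lra. }
  exists t. split; [lra|]. split.
  - apply Rle_antisym; auto. apply Rnot_lt_le; intro K.
    destruct (continuous_eps_inv f t (Hf t) (f t - d)) as [e [He Hy]]; [lra|].
    assert (t < b) by (destruct (Req_dec t b) as [Z|Z]; [rewrite Z in K; lra|lra]).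
    set (s := Rmin b (t + e / 2)).
    assert (Hs : t < s <= b) by (unfold s, Rmin; destruct Rle_dec; lra).
    assert (E s).
    { split; [lra|]. intros r Hr. destruct (Rlt_dec r t); [apply Hlt; lra|].
      assert (Rabs (r - t) < e) by (apply Rabs_lt_between; unfold s, Rmin in *; destruct Rle_dec; lra).
      specialize (Hy r H1). apply Rabs_lt_between in Hy. lra. }
    apply Ht1 in H1. lra.
  - intros r Hr. destruct (Req_dec r t) as [->|]; auto. apply Hlt; lra.
Qed.

(** * Identification of the curve with the tips *)

Lemma Cmod_cont (f : R -> C) t : ccont f t -> continuous (fun x => Cmod (f x)) t.
Proof.
  intros [A B]. apply continuous_eps. intros e He.
  destruct (continuous_eps_inv _ _ A (e / 2)) as [d1 [P1 Q1]]; [lra|].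
  destruct (continuous_eps_inv _ _ B (e / 2)) as [d2 [P2 Q2]]; [lra|].
  exists (Rmin d1 d2); split; [now apply Rmin_pos|]. intros y Hy.
  specialize (Q1 y (Rlt_le_trans _ _ _ Hy (Rmin_l _ _))).
  specialize (Q2 y (Rlt_le_trans _ _ _ Hy (Rmin_r _ _))).
  eapply Rle_lt_trans; [apply Cmod_lip|]. eapply Rle_lt_trans; [apply Cmod_le_sum|].
  simpl. unfold Rminus in *. lra.
Qed.

Lemma Cinv_coords (X Y : R) : 0 < X ^ 2 + Y ^ 2 ->
  (2 / ((X, Y) : C))%C = ((2 * X / (X ^ 2 + Y ^ 2), - 2 * Y / (X ^ 2 + Y ^ 2)) : C).
Proof. intros H. simpl in H. apply injective_projections; simpl; field; nra. Qed.

Lemma RtoC_m1 : RtoC (-1) = (- RtoC 1)%C.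
Proof. apply injective_projections; simpl; ring. Qed.

Lemma RtoC_m2 : RtoC (-2) = (- RtoC 2)%C.
Proof. apply injective_projections; simpl; ring. Qed.

Section Hull.
Variables (le le' : R -> R) (L : R).
Hypothesis (HL : 0 < L) (Dle : forall t, is_derive le t (le' t)) (Ble : forall t, Rabs (le' t) <= L).
Variable Wt : R -> R -> C.
Hypothesis HW : forall t, tip_solution (fun r => le (t - r)) L (Wt t).

Lemma driver_deriv t r : is_derive (fun r => le (t - r)) r (- le' (t - r)).
Proof.
  eapply is_derive_eq.
  - apply (is_derive_comp le (fun r => t - r)); [apply Dle|].
    apply @is_derive_minus; [apply @is_derive_const|apply @is_derive_id].
  - unfold scal, minus, plus, opp, zero, one; simpl; unfold mult; simpl; ring.
Qed.

Lemma le_cont t : continuous le t.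
Proof. apply @ex_derive_continuous; eexists; apply Dle. Qed.

Lemma driver_cont t r : continuous (fun r => le (t - r)) r.
Proof. apply @ex_derive_continuous; eexists; apply driver_deriv. Qed.

Definition tip_curve (t : R) : C := Wt t t.

Lemma tip_dist t r : 0 <= r -> Cmod (Wt t r - le (t - r))%C <= L * r + 2 * sqrt r.
Proof.
  intros Hr. eapply Rle_trans; [apply Cmod_le_sum|]. simpl.
  apply Rplus_le_compat; [apply (tip_X _ _ _ (HW t) r Hr)|].
  rewrite Ropp_0, Rplus_0_r. apply pow2_le_inv; [assert (P := sqrt_pos r); lra|].
  rewrite pow2_abs, Rpow_mult_distr, pow2_sqrt by auto.
  assert (Q := tip_Y _ _ _ (HW t) r Hr). lra.
Qed.

Lemma bl_shift t c r W : bl (fun r => le (t - r)) W (r + c) ->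
  bl (fun r => le (t - c - r)) (fun r => W (r + c)) r.
Proof.
  intros [D P]; split; auto. eapply cder_eq.
  - apply cder_comp; [apply D|]. apply @is_derive_plus; [apply @is_derive_id|apply @is_derive_const].
  - unfold plus, one, zero; simpl. rewrite Rplus_0_r.
    replace (t - c - r) with (t - (r + c)) by ring. ring.
Qed.

(** After the time shift, [Wt (s + d)] is a regular flow line for the driver seen from [s], started
    at distance at most [L * d + 2 * sqrt d] from the singularity, so [tip_stable] compares it with
    [Wt s]. *)
Lemma tip_curve_modulus s d : 0 <= s -> 0 <= d ->
  Cmod (tip_curve (s + d) - tip_curve s)%C <= (L * d + 2 * sqrt d) * exp (L / 2 * (L * (s + d))).
Proof.
  intros Hs [Hd| <-].
  2: { rewrite Rplus_0_r. replace (tip_curve s - tip_curve s)%C with (RtoC 0) by ring.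
       rewrite Cmod_0, sqrt_0, !Rmult_0_r, Rplus_0_l, Rmult_0_l; lra. }
  assert (Q := tip_stable _ _ _ (HW s) (fun r => Wt (s + d) (r + d)) s Hs).
  cbv beta in Q. rewrite Rplus_0_l, Rminus_0_r in Q.
  assert (Hb : forall r, 0 <= r <= s -> bl (fun r => le (s - r)) (fun r => Wt (s + d) (r + d)) r).
  { intros r Hr. assert (G := bl_shift (s + d) d r (Wt (s + d))).
    replace (s + d - d) with s in G by ring. apply G, (tip_bl _ _ _ (HW (s + d))); lra. }
  specialize (Q Hb). unfold tip_curve. eapply Rle_trans; [apply Q|].
  assert (A := tip_dist (s + d) d ltac:(lra)). replace (s + d - d) with s in A by ring.
  assert (B := tip_X _ _ _ (HW (s + d)) d ltac:(lra)). cbv beta in B. replace (s + d - d) with s in B by ring.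
  apply Rmult_le_compat; auto; [apply Cmod_ge_0|left; apply exp_pos|].
  apply exp_mono. apply Rmult_le_compat_l; lra.
Qed.

Lemma small_modulus M e : 0 < e -> exists d0, 0 < d0 /\ forall d, 0 <= d < d0 -> (L * d + 2 * sqrt d) * M < e.
Proof.
  intros He. set (K := (L + 2) * (Rabs M + 1)).
  assert (HK : 0 < K) by (assert (P := Rabs_pos M); unfold K; apply Rmult_lt_0_compat; lra).
  exists (Rmin 1 ((e / K) ^ 2)).
  assert (Hp : 0 < e / K) by (apply Rdiv_lt_0_compat; lra).
  split; [apply Rmin_pos; [lra|now apply pow_lt]|].
  intros d Hd. assert (D1 : d < 1) by (eapply Rlt_le_trans; [apply Hd|apply Rmin_l]).
  assert (D2 : d < (e / K) ^ 2) by (eapply Rlt_le_trans; [apply Hd|apply Rmin_r]).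
  assert (S2 := pow2_sqrt d ltac:(lra)). assert (S0 := sqrt_pos d).
  assert (S1 : sqrt d < e / K) by nra.
  assert (S3 : sqrt d <= 1) by (apply pow2_le_inv; lra).
  assert (S4 : L * d + 2 * sqrt d <= (L + 2) * sqrt d).
  { assert (d <= sqrt d) by nra. assert (L * d <= L * sqrt d) by (apply Rmult_le_compat_l; lra). lra. }
  apply Rle_lt_trans with ((L + 2) * sqrt d * (Rabs M + 1)).
  - assert (P := Rle_abs M). assert (P0 := Rabs_pos M).
    apply Rle_trans with ((L * d + 2 * sqrt d) * (Rabs M + 1)).
    + apply Rmult_le_compat_l; [|lra]. assert (0 <= L * d) by (apply Rmult_le_pos; lra). lra.
    + apply Rmult_le_compat_r; lra.
  - replace ((L + 2) * sqrt d * (Rabs M + 1)) with (sqrt d * K) by (unfold K; ring).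
    apply Rmult_lt_reg_r with (/ K); [now apply Rinv_0_lt_compat|].
    rewrite Rmult_assoc, Rinv_r by lra. unfold Rdiv in S1. lra.
Qed.

Lemma tip_curve_unif_cont T e : 0 < e -> exists d0, 0 < d0 /\
  forall s s', 0 <= s <= T -> 0 <= s' <= T -> Rabs (s' - s) < d0 ->
  Cmod (tip_curve s' - tip_curve s)%C < e.
Proof.
  intros He. destruct (small_modulus (exp (L / 2 * (L * T))) e He) as [d0 [Hd H]].
  exists d0; split; auto.
  assert (W : forall s s', 0 <= s <= s' -> s' <= T -> s' - s < d0 -> Cmod (tip_curve s' - tip_curve s)%C < e).
  { intros s s' Hs Hs' Hd'. assert (Q := tip_curve_modulus s (s' - s) ltac:(lra) ltac:(lra)).
    replace (s + (s' - s)) with s' in Q by ring.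
    eapply Rle_lt_trans; [apply Q|]. eapply Rle_lt_trans; [|apply (H (s' - s) ltac:(lra))].
    apply Rmult_le_compat_l.
    - assert (P := sqrt_pos (s' - s)). assert (0 <= L * (s' - s)) by (apply Rmult_le_pos; lra). lra.
    - apply exp_mono. apply Rmult_le_compat_l; [lra|]. apply Rmult_le_compat_l; lra. }
  intros s s' Hs Hs' Hd'. apply Rabs_lt_between in Hd'. destruct (Rle_dec s s').
  - apply W; lra.
  - rewrite Cmod_sub_sym. apply W; lra.
Qed.

Lemma tip_curve_dist_attained t (z : C) : 0 <= t -> exists m, 0 <= m <= t /\
  forall s, 0 <= s <= t -> Cmod (z - tip_curve m)%C <= Cmod (z - tip_curve s)%C.
Proof.
  intros Ht.
  destruct (continuous_min_attained (fun x => Cmod (z - tip_curve (clamp 0 t x))%C) 0 t Ht) as [m [Hm H]].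
  - intros x. apply continuous_eps. intros e He.
    destruct (tip_curve_unif_cont t e He) as [d [Hd Hu]]. exists d; split; auto. intros y Hy.
    eapply Rle_lt_trans; [apply Cmod_lip|].
    replace (z - tip_curve (clamp 0 t y) - (z - tip_curve (clamp 0 t x)))%C with
      (- (tip_curve (clamp 0 t y) - tip_curve (clamp 0 t x)))%C by ring.
    rewrite Cmod_opp. apply Hu; try (now apply clamp_in).
    eapply Rle_lt_trans; [apply clamp_lip|auto].
  - exists m; split; auto. intros s Hs. specialize (H s Hs). rewrite !clamp_id in H by auto. auto.
Qed.

Lemma tip_curve_pos t : 0 < t -> 0 < snd (tip_curve t).
Proof. intros Ht. apply (tip_bl _ _ _ (HW t)); auto. Qed.

Lemma tip_curve_0 : tip_curve 0 = RtoC (le 0).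
Proof. unfold tip_curve. rewrite (tip_0 _ _ _ (HW 0)). now rewrite Rminus_0_r. Qed.

Variables (lam : R -> R) (T : R).
Hypothesis Elam : forall s, 0 <= s <= T -> le s = lam s.

(** The right-hand side is the form in which the flow estimates apply: one complex function with
    two-sided derivatives, which [deriv_extension] provides. *)
Lemma loewner_sol_iff z t : 0 <= t <= T ->
  (exists u v, loewner_sol lam z t u v) <->
  (exists U : R -> C, U 0 = z /\ forall s, 0 <= s <= t -> (U s - le s)%C <> 0%C /\ cder U s (2 / (U s - le s))%C).
Proof.
  intros Ht.
  assert (F : forall s (U : C), 0 <= s <= t -> (U - le s)%C <> 0%C ->
    (2 / (U - le s))%C = ((2 * (fst U - lam s) / ((fst U - lam s) ^ 2 + snd U ^ 2),
      - 2 * snd U / ((fst U - lam s) ^ 2 + snd U ^ 2)) : C)).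
  { intros s U Hs N. rewrite <- Elam by lra.
    replace (U - le s)%C with ((fst U - le s, snd U) : C) in *.
    2: { apply injective_projections; simpl; ring. }
    apply Cinv_coords. apply Cmod_gt_0 in N. assert (P := pow_lt _ 2 N). rewrite Cmod_sq in P.
    exact P. }
  split.
  - intros [u [v [Hu [Hv [N [Du Dv]]]]]].
    destruct (deriv_extension _ _ 0 t ltac:(lra) Du) as [g [Eg Dg]].
    destruct (deriv_extension _ _ 0 t ltac:(lra) Dv) as [h [Eh Dh]].
    exists (fun s => (g s, h s)). split.
    + rewrite Eg, Eh by lra. rewrite Hu, Hv. now destruct z.
    + intros s Hs.
      assert (Nz : (((g s, h s) : C) - le s)%C <> 0%C).
      { rewrite Eg, Eh, Elam by lra. intro E. apply (N s Hs).
        apply (f_equal (fun c : C => (fst c, snd c))) in E. simpl in E.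
        injection E. intros E1 E2. f_equal; lra. }
      split; auto. rewrite F by auto. simpl. split; simpl.
      * specialize (Dg s). rewrite clamp_id in Dg by auto. rewrite Eg, Eh by auto. exact Dg.
      * specialize (Dh s). rewrite clamp_id in Dh by auto. rewrite Eg, Eh by auto. exact Dh.
  - intros [U [U0 HU]]. exists (fun s => fst (U s)), (fun s => snd (U s)).
    repeat split.
    + now rewrite U0.
    + now rewrite U0.
    + intros s Hs E. apply (HU s Hs). injection E; intros E1 E2.
      rewrite Elam by lra. apply injective_projections; simpl; lra.
    + apply has_deriv_on_of_is_derive. intros s Hs. destruct (HU s Hs) as [N [D _]].
      rewrite F in D by auto. exact D.
    + apply has_deriv_on_of_is_derive. intros s Hs. destruct (HU s Hs) as [N [_ D]].
      rewrite F in D by auto. exact D.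
Qed.

Lemma bl_reverse t W s : bl (fun r => le (t - r)) W (t - s) ->
  (W (t - s)%R - le s)%C <> 0%C /\ cder (fun x => W (t - x)) s (2 / (W (t - s)%R - le s))%C.
Proof.
  intros H. assert (N := bl_nonzero _ _ _ H). cbv beta in N.
  destruct H as [D P]. replace (t - (t - s)) with s in * by ring. split; auto.
  eapply cder_eq.
  - apply cder_comp; [apply D|]. apply @is_derive_minus; [apply @is_derive_const|apply @is_derive_id].
  - unfold minus, plus, opp, zero, one; simpl. replace (0 + - (1)) with (-1) by ring.
    replace (t - (t - s)) with s by ring. rewrite RtoC_m1, RtoC_m2. field; auto.
Qed.

(** A backward flow line read in reverse solves the forward equation. Starting at [a] rather than 0
    covers flow lines that are regular only after a positive time, such as the tip solutions. *)
Lemma reversed_not_in_hull t W a : 0 <= a <= t -> t - a <= T ->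
  (forall r, a <= r <= t -> bl (fun r => le (t - r)) W r) -> not_in_hull lam (t - a) (W t).
Proof.
  intros Ha HT H. split; [apply H; lra|]. apply loewner_sol_iff; [lra|].
  exists (fun s => W (t - s)). split; [now rewrite Rminus_0_r|].
  intros s Hs. apply bl_reverse. apply H; lra.
Qed.

(** A solution of the forward equation on [[0, t]] keeps a positive distance [c] from the driver by
    compactness. By uniqueness it would retrace the tip flow, whose distance to the driver tends to
    0 as the time approaches [t]. *)
Lemma tip_curve_in_hull t : 0 < t <= T -> ~ not_in_hull lam t (tip_curve t).
Proof.
  intros Ht [_ H]. apply loewner_sol_iff in H; [|lra]. destruct H as [U [U0 HU]].
  assert (CU : forall s, 0 <= s <= t -> ccont (fun s => U s - le s)%C s).
  { intros s Hs. apply ccont_minus; [apply (cder_ccont _ _ _ (proj2 (HU s Hs)))|].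
    apply ccont_RtoC, le_cont. }
  destruct (continuity_ab_min (fun s => Cmod (U s - le s)%C) 0 t ltac:(lra)) as [m [Hm Hmt]].
  { intros s Hs. apply continuity_pt_filterlim. apply Cmod_cont. auto. }
  set (c := Cmod (U m - le m)%C) in *.
  assert (Hc : 0 < c) by (apply Cmod_gt_0, HU; auto).
  assert (E : forall b, 0 <= b < t -> U b = Wt t (t - b)).
  { intros b Hb.
    set (y0 := snd (Wt t (t - b))).
    assert (Hy0 : 0 < y0) by (apply (tip_bl _ _ _ (HW t)); lra).
    (* Uniqueness up to [b < t]: the two denominators are at least [c] and [y0], the height of the
       tip flow at backward time [t - b]. *)
    set (K := 2 / (c * y0)).
    assert (G := growth_weighted (fun s => U s - Wt t (t - s)%R)%C
      (fun s => - (2) / ((U s - le s) * (Wt t (t - s)%R - le s)))%C (fun _ => 0%C)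
      (fun s => exp (- K * (s - 0))) (fun s => - K * exp (- K * (s - 0))) (fun _ => 0) (fun _ => 0) 0 b ltac:(lra)).
    cbv beta in G.
    assert (G' : exp (- K * (b - 0)) * Cmod (U b - Wt t (t - b)%R)%C <=
      exp (- K * (0 - 0)) * Cmod (U 0%R - Wt t (t - 0)%R)%C + (0 - 0)).
    { apply G.
      - intros s Hs. destruct (HU s ltac:(lra)) as [N1 D1].
        destruct (bl_reverse t (Wt t) s) as [N2 D2]; [apply (tip_bl _ _ _ (HW t)); lra|].
        eapply cder_eq; [apply cder_minus; [apply D1|apply D2]|]. field; auto.
      - intros; apply is_derive_exp_lin.
      - intros; apply exp_pos.
      - intros s Hs. destruct (HU s ltac:(lra)) as [N1 _].
        destruct (bl_reverse t (Wt t) s) as [N2 _]; [apply (tip_bl _ _ _ (HW t)); lra|].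
        rewrite (Rmult_comm (- K)), <- Rmult_plus_distr_l.
        apply Rmult_le_0_l; [left; apply exp_pos|].
        enough (fst (- (2) / ((U s - le s) * (Wt t (t - s)%R - le s)))%C <= K) by lra.
        eapply Rle_trans; [apply Rle_abs|]. eapply Rle_trans; [apply Cmod_fst|].
        rewrite Cmod_div, Cmod_mult, Cmod_opp, Cmod_R, Rabs_right by (try lra; now apply Cmult_neq_0).
        unfold K. apply Rmult_le_compat_l; [lra|].
        assert (A1 := Hm s ltac:(lra)). cbv beta in A1. fold c in A1.
        assert (A2 : y0 <= Cmod (Wt t (t - s)%R - le s)%C).
        { eapply Rle_trans; [|apply Cmod_snd]. eapply Rle_trans; [|apply Rle_abs]. simpl.
          rewrite Ropp_0, Rplus_0_r.
          apply (bl_Y_mono (fun r => le (t - r)) (Wt t) (t - b) (t - s)); [lra|].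
          intros; apply (tip_bl _ _ _ (HW t)); lra. }
        apply Rinv_le_contravar; [nra|]. apply Rmult_le_compat; lra.
      - intros; apply @is_derive_const.
      - intros; rewrite Cmod_0; lra. }
    rewrite U0 in G'. replace (Wt t (t - 0)) with (tip_curve t) in G' by (unfold tip_curve; now rewrite Rminus_0_r).
    replace (tip_curve t - tip_curve t)%C with (RtoC 0) in G' by ring.
    rewrite Cmod_0 in G'.
    assert (Z : Cmod (U b - Wt t (t - b)%R)%C = 0).
    { apply Rle_antisym; [|apply Cmod_ge_0]. assert (P := exp_pos (- K * (b - 0))). nra. }
    apply Cmod_eq_0 in Z. replace (U b) with (U b - Wt t (t - b)%R + Wt t (t - b)%R)%C by ring.
    rewrite Z; ring. }
  destruct (small_modulus 1 c Hc) as [d [Hd Hs]].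
  set (r := Rmin t (d / 2)).
  assert (Hr : 0 < r <= t) by (unfold r, Rmin; destruct Rle_dec; lra).
  assert (Hrd : r < d) by (unfold r, Rmin in *; destruct Rle_dec; lra).
  assert (A := Hm (t - r) ltac:(lra)). cbv beta in A. fold c in A.
  rewrite E in A by lra. assert (B := tip_dist t r ltac:(lra)).
  replace (t - (t - r)) with r in A by ring. specialize (Hs r ltac:(lra)). lra.
Qed.

Lemma continuous_sign (f : R -> R) a b : a <= b -> (forall x, continuous f x) ->
  0 < f a -> (forall x, a <= x <= b -> f x <> 0) -> 0 < f b.
Proof.
  intros ab Hf Ha N. apply Rnot_le_lt; intro K.
  destruct (IVT_gen f a b 0) as [x [Hx E]].
  - intros x; apply continuity_pt_filterlim, Hf.
  - split; [eapply Rle_trans; [apply Rmin_r|auto]|eapply Rle_trans; [|apply Rmax_l]; lra].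
  - rewrite Rmin_left, Rmax_right in Hx by auto. apply (N x Hx E).
Qed.

(** Solve the forward equation truncated at a small distance [e] from the driver. If the solution
    came that close at a time [q], then read backwards it would be a flow line started within [e] of
    the singularity, and stability would put [z] within [e * C0] of [tip_curve q], closer than the
    distance [d] of [z] to the tips. *)
Lemma off_tip_curve_not_in_hull t (z : C) : 0 <= t <= T -> 0 < snd z ->
  (forall s, 0 <= s <= t -> z <> tip_curve s) -> not_in_hull lam t z.
Proof.
  intros Ht Hz H.
  destruct (tip_curve_dist_attained t z ltac:(lra)) as [m [Hm Hmin]].
  set (d := Cmod (z - tip_curve m)%C) in *.
  assert (Hd : 0 < d).
  { apply Cmod_gt_0. intro E. apply (H m Hm). replace z with (z - tip_curve m + tip_curve m)%C by ring.
    rewrite E; ring. }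
  set (C0 := exp (L / 2 * (1 + L * t))). assert (HC0 : 0 < C0) by apply exp_pos.
  (* The three bounds serve, in order, to make [C0] an upper bound of the stability constant, to
     make [e * C0] smaller than [d], and to start above the truncation level. *)
  set (e := Rmin 1 (Rmin (d / (2 * C0)) (snd z / 2))).
  assert (He : 0 < e).
  { repeat apply Rmin_pos; try lra. apply Rdiv_lt_0_compat; lra. }
  assert (He1 : e <= 1) by apply Rmin_l.
  assert (He2 : e <= d / (2 * C0)) by (eapply Rle_trans; [apply Rmin_r|apply Rmin_l]).
  assert (He3 : e <= snd z / 2) by (eapply Rle_trans; [apply Rmin_r|apply Rmin_r]).
  clearbody e.
  destruct (trunc_flow le (-1) e 0 z le_cont) as [U [U0 DU]]; [rewrite Rabs_left; lra|auto|].
  assert (CU : forall s, ccont U s) by (intros; eapply cder_ccont; apply DU).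
  assert (PU : forall s, 0 <= s -> 0 < snd (U s)).
  { intros s Hs.
    (* The height decays at most exponentially under the truncated field, so it never vanishes and
       by continuity keeps its sign. *)
    assert (Sq : forall x, 0 <= x -> snd z ^ 2 <= snd (U x) ^ 2 * exp (4 / e ^ 2 * (x - 0))).
    { intros x Hx.
      assert (Q := is_derive_incr (fun x => snd (U x) ^ 2 * exp (4 / e ^ 2 * (x - 0)))
        (fun x => (INR 2 * snd (signed_field (-1) e (U x - le x)%C) * snd (U x) ^ pred 2) * exp (4 / e ^ 2 * (x - 0))
          + snd (U x) ^ 2 * (4 / e ^ 2 * exp (4 / e ^ 2 * (x - 0)))) 0 x Hx).
      cbv beta in Q. rewrite U0, (Rminus_diag 0), Rmult_0_r, exp_0, Rmult_1_r in Q. apply Q.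
      - intros y Hy.
        exact (Derive.is_derive_mult (fun x => snd (U x) ^ 2) (fun x => exp (4 / e ^ 2 * (x - 0))) y _ _
          (is_derive_pow (fun x => snd (U x)) 2 y _ (proj2 (DU y))) (is_derive_exp_lin (4 / e ^ 2) 0 y)).
      - intros y Hy. set (E := exp _). assert (HE : 0 < E) by apply exp_pos.
        cbn [INR Init.Nat.pred].
        replace (snd (signed_field (-1) e (U y - le y)%C)) with
          (- 2 * Rabs (snd (U y)) / Rmax (Cmod (U y - le y)%C) e ^ 2).
        2: { unfold signed_field, trunc_inv; cbn [fst snd].
             replace (snd (U y - le y)%C) with (snd (U y)) by (simpl; ring). unfold Rdiv; ring. }
        set (N := Rmax _ _). assert (HN : e <= N) by apply Rmax_r.
        assert (I : / N ^ 2 <= / e ^ 2) by (apply Rinv_le_contravar; nra).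
        assert (I0 : 0 < / N ^ 2) by (apply Rinv_0_lt_compat; nra).
        set (y1 := snd (U y)).
        assert (A : Rabs y1 * y1 <= y1 ^ 2).
        { assert (T1 := Rle_abs y1). assert (T2 := Rabs_pos y1). rewrite <- (pow2_abs y1). nra. }
        assert (A0 : 0 <= y1 ^ 2) by apply pow2_ge_0.
        replace ((1 + 1) * (-2 * Rabs y1 / N ^ 2) * y1 ^ 1 * E + y1 ^ 2 * (4 / e ^ 2 * E)) with
          (4 * E * (y1 ^ 2 * / e ^ 2 - Rabs y1 * y1 * / N ^ 2)) by (field; split; lra).
        apply Rmult_le_pos; [lra|].
        assert (Rabs y1 * y1 * / N ^ 2 <= y1 ^ 2 * / N ^ 2) by (apply Rmult_le_compat_r; lra).
        assert (y1 ^ 2 * / N ^ 2 <= y1 ^ 2 * / e ^ 2) by (apply Rmult_le_compat_l; lra). lra. }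
    apply (continuous_sign (fun x => snd (U x)) 0 s Hs); [intros; apply CU|rewrite U0; auto|].
    intros x Hx E. specialize (Sq x ltac:(lra)). rewrite E in Sq.
    assert (0 < snd z ^ 2) by (apply pow_lt; auto). simpl in Sq. simpl in H0. lra. }
  assert (CZ : forall s, continuous (fun s => Cmod (U s - le s)%C) s).
  { intros s. apply Cmod_cont, ccont_minus; auto. apply ccont_RtoC, le_cont. }
  assert (Fld : forall s, 0 <= s -> e <= Cmod (U s - le s)%C -> cder U s (2 / (U s - le s))%C).
  { intros s Hs Hes. eapply cder_eq; [apply DU|].
    rewrite signed_field_inv; auto.
    - replace (-1 * 2) with (- (2)) by ring. rewrite RtoC_opp. field.
      intro E; rewrite E, Cmod_0 in Hes; lra.
    - simpl. specialize (PU s Hs). lra. }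
  assert (Big : forall s, 0 <= s <= t -> e <= Cmod (U s - le s)%C).
  { intros s Hs. apply Rnot_lt_le; intro K.
    destruct (first_crossing (fun s => Cmod (U s - le s)%C) e s CZ) as [q [Hq [Eq Hlow]]]; auto; try lra.
    { rewrite U0. apply Rlt_le_trans with (Rabs (snd (z - le 0)%C)); [|apply Cmod_snd].
      eapply Rlt_le_trans; [|apply Rle_abs]. simpl. lra. }
    assert (Q := tip_stable _ _ _ (HW q) (fun r => U (q - r)) q ltac:(lra)).
    cbv beta in Q. rewrite Rminus_diag, Rminus_0_r, U0, Eq in Q.
    assert (B : forall r, 0 <= r <= q -> bl (fun r => le (q - r)) (fun r => U (q - r)) r).
    { intros r Hr. split; [|apply PU; lra]. eapply cder_eq.
      - apply cder_comp; [apply Fld; [lra|apply Hlow; lra]|].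
        apply @is_derive_minus; [apply @is_derive_const|apply @is_derive_id].
      - unfold minus, plus, opp, zero, one; simpl. replace (0 + - (1)) with (-1) by ring.
        rewrite RtoC_m1, RtoC_m2. field. intro E. specialize (Hlow (q - r) ltac:(lra)). cbv beta in Hlow.
        rewrite E, Cmod_0 in Hlow; lra. }
    specialize (Q B). fold (tip_curve q) in Q.
    specialize (Hmin q ltac:(lra)).
    assert (X : Rabs (fst (U q) - le q) <= e).
    { rewrite <- Eq. eapply Rle_trans; [|apply Cmod_fst]. simpl. right; reflexivity. }
    assert (EC : exp (L / 2 * (Rabs (fst (U q) - le q) + L * q)) <= C0).
    { apply exp_mono. apply Rmult_le_compat_l; [lra|].
      assert (L * q <= L * t) by (apply Rmult_le_compat_l; lra). lra. }
    assert (e * C0 <= d / 2).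
    { apply Rle_trans with (d / (2 * C0) * C0); [apply Rmult_le_compat_r; lra|]. right; field; lra. }
    assert (e * exp (L / 2 * (Rabs (fst (U q) - le q) + L * q)) <= e * C0) by (apply Rmult_le_compat_l; lra).
    lra. }
  split; auto. apply loewner_sol_iff; auto.
  exists U; split; auto. intros s Hs. specialize (Big s Hs). split.
  - intro E; rewrite E, Cmod_0 in Big; lra.
  - apply Fld; lra.
Qed.

(** Start the backward flow at height [h] above [le t]: its endpoint is off the hull, and stability
    puts it within [h * C0] of the tip. *)
Lemma tip_curve_approach t e : 0 < t <= T -> 0 < e ->
  exists z, not_in_hull lam t z /\ Cmod (z - tip_curve t)%C < e.
Proof.
  intros Ht He. set (C0 := exp (L / 2 * (0 + L * t))). assert (HC0 : 0 < C0) by apply exp_pos.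
  set (h := e / (2 * C0)). assert (Hh : 0 < h) by (apply Rdiv_lt_0_compat; lra).
  destruct (bl_exists (fun r => le (t - r)) 0 ((le t, h) : C) (driver_cont t) Hh) as [W [W0 HB]].
  exists (W t). split.
  - replace t with (t - 0) at 1 by ring. apply reversed_not_in_hull; try lra. intros; apply HB; lra.
  - assert (Q := tip_stable _ _ _ (HW t) W t ltac:(lra) ltac:(intros; apply HB; lra)).
    rewrite W0 in Q. cbn [fst] in Q. rewrite Rminus_0_r, Rminus_diag, Rabs_R0 in Q. fold C0 in Q.
    assert (M : Cmod (((le t, h) : C) - le t)%C <= h).
    { eapply Rle_trans; [apply Cmod_le_sum|]. simpl.
      replace (le t + - le t) with 0 by ring. rewrite Rabs_R0, Ropp_0, Rplus_0_r, Rplus_0_l.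
      rewrite Rabs_right; lra. }
    eapply Rle_lt_trans; [apply Q|]. apply Rle_lt_trans with (h * C0); [apply Rmult_le_compat_r; lra|].
    unfold h. replace (e / (2 * C0) * C0) with (e / 2) by (field; lra). lra.
Qed.

(** The forward flow started at the tip of time [t] is still regular at every [s < t], so
    [tip_curve t] lies off the hull of time [s], which contains [tip_curve s]. *)
Lemma tip_curve_injective s t : 0 < s <= t -> t <= T -> tip_curve s = tip_curve t -> s = t.
Proof.
  intros Hs Ht E. destruct (Req_dec s t) as [|N]; auto. exfalso.
  apply (tip_curve_in_hull s); [lra|]. rewrite E. unfold tip_curve.
  replace s with (t - (t - s)) at 1 by ring.
  apply reversed_not_in_hull; try lra. intros; apply (tip_bl _ _ _ (HW t)); lra.
Qed.

(** The segment from [w] to [z] misses the curve because [z] is nearer to [w] than every point of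
    it, so an escaping path from [z] can be prolonged back to [w]. *)
Lemma prepend_segment (gam : R -> R * R) t (z w : C) : 0 < snd w ->
  (forall s, 0 < s <= t -> Cmod (z - w)%C < Cmod (gam s - w)%C) ->
  in_unbounded_comp gam t z -> in_unbounded_comp gam t w.
Proof.
  intros Hw Hd [[Hz Az] Hub].
  assert (Seg : forall x, 0 <= x <= 1 -> avoids gam t
     ((fst w + x * (fst z - fst w), snd w + x * (snd z - snd w)) : C)).
  { intros x Hx. split; [unfold Hp in *; simpl; nra|].
    intros s Hs E. specialize (Hd s Hs). rewrite E in Hd.
    replace ((((fst w + x * (fst z - fst w))%R, (snd w + x * (snd z - snd w))%R) : C) - w)%C
      with (RtoC x * (z - w))%C in Hd by (apply injective_projections; simpl; ring).
    rewrite Cmod_mult, Cmod_R, Rabs_right in Hd by lra.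
    assert (P := Cmod_ge_0 (z - w)%C). nra. }
  split.
  { assert (A := Seg 0 ltac:(lra)).
    replace (((fst w + 0 * (fst z - fst w), snd w + 0 * (snd z - snd w)) : C)) with w in A; auto.
    apply injective_projections; simpl; ring. }
  intros Rb. destruct (Hub Rb) as [p [C1 [C2 [P0 [Pa Pb]]]]].
  assert (Lin : forall k c x, continuous (fun x => clamp 0 1 (k * x + c)) x).
  { intros k c x. apply (continuous_comp (fun x => k * x + c) (clamp 0 1)).
    - apply @ex_derive_continuous. auto_derive; auto.
    - apply (cont_on_clamp (fun y => y) 0 1); [lra|]. apply cont_on_of_continuous; intros; apply continuous_id. }
  (* The segment for [r <= / 2], then [p]. The two clamped parameters move one after the other, so
     the formula is continuous without a case distinction. *)
  exists (fun r => (fst w + clamp 0 1 (2 * r + 0) * (fst z - fst w) + (fst (p (clamp 0 1 (2 * r + (-1)))) - fst z),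
               snd w + clamp 0 1 (2 * r + 0) * (snd z - snd w) + (snd (p (clamp 0 1 (2 * r + (-1)))) - snd z))).
  assert (K : forall (f : R -> R) a b c, cont_on 0 1 f -> cont_on 0 1
     (fun r => a + clamp 0 1 (2 * r + 0) * b + (f (clamp 0 1 (2 * r + (-1))) - c))).
  { intros f a b c Hf. apply cont_on_of_continuous. intros x Hx.
    apply @continuous_plus; [apply @continuous_plus; [apply @continuous_const|]|].
    - apply @continuous_scal_l, Lin.
    - apply @continuous_minus; [|apply @continuous_const].
      apply continuous_ext with (f := fun r => f (clamp 0 1 (clamp 0 1 (2 * r + (-1))))).
      { intros r. now rewrite (clamp_id 0 1 (clamp _ _ _)) by (apply clamp_in; lra). }
      apply (continuous_comp (fun r => clamp 0 1 (2 * r + (-1))) (fun y => f (clamp 0 1 y))); [apply Lin|].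
      apply cont_on_clamp; [lra|auto]. }
  assert (E : forall r, 0 <= r <= 1 -> forall a b f, f 0 = b ->
     a + clamp 0 1 (2 * r + 0) * (b - a) + (f (clamp 0 1 (2 * r + (-1))) - b) =
     if Rle_dec r (/ 2) then a + (2 * r) * (b - a) else f (2 * r - 1) :> R).
  { intros r Hr a b f Hf. destruct Rle_dec.
    - rewrite (clamp_id 0 1 (2 * r + 0)) by lra.
      replace (clamp 0 1 (2 * r + -1)) with 0.
      2: { unfold clamp, Rmax, Rmin; repeat destruct Rle_dec; lra. }
      rewrite Hf. ring.
    - rewrite (clamp_id 0 1 (2 * r + (-1))) by lra.
      replace (clamp 0 1 (2 * r + 0)) with 1.
      2: { unfold clamp, Rmax, Rmin; repeat destruct Rle_dec; lra. }
      replace (2 * r - 1) with (2 * r + -1) by ring. ring. }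
  assert (F1 := fun r Hr => E r Hr (fst w) (fst z) (fun y => fst (p y)) (f_equal fst P0)).
  assert (F2 := fun r Hr => E r Hr (snd w) (snd z) (fun y => snd (p y)) (f_equal snd P0)).
  cbv beta in F1, F2.
  split; [apply (K (fun y => fst (p y))); auto|].
  split; [apply (K (fun y => snd (p y))); auto|].
  split.
  { rewrite F1, F2 by lra. destruct Rle_dec; [|lra]. destruct w; simpl; f_equal; ring. }
  split.
  - intros r Hr. rewrite F1, F2 by lra. destruct Rle_dec.
    + apply Seg; lra.
    + rewrite <- surjective_pairing. apply Pa; lra.
  - rewrite F1, F2 by lra. destruct Rle_dec; [lra|].
    rewrite <- surjective_pairing. replace (2 * 1 - 1) with 1 by ring. auto.
Qed.

(** Every point of [gam] in the open half-plane is a tip of an earlier or equal time: otherwise it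
    would lie off the hull, hence off [gam]. Conversely, a tip missed by [gam] up to time [t] would
    have a neighbourhood free of [gam] and containing a point off the hull; a segment to that point
    would take the tip itself off the hull. So [tip_curve t = gam r = tip_curve q] with
    [q <= r <= t], and injectivity gives [r = t]. *)
Lemma generated_curve_eq (gam : R -> R * R) : generates lam T gam ->
  forall t, 0 < t <= T -> gam t = tip_curve t.
Proof.
  intros [C1 [C2 [Pos Gen]]].
  assert (A1 : forall s, 0 < s <= T -> 0 < snd (gam s) -> exists q, 0 < q <= s /\ gam s = tip_curve q).
  { intros s Hs Hp. destruct (Classical_Prop.classic (exists q, 0 <= q <= s /\ gam s = tip_curve q)) as [[q [Hq E]]|N].
    - exists q; split; auto. destruct (Req_dec q 0) as [Z|]; [|lra].
      rewrite E, Z, tip_curve_0 in Hp. simpl in Hp; lra.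
    - exfalso. assert (H : not_in_hull lam s (gam s)).
      { apply off_tip_curve_not_in_hull; auto; [lra|]. intros q Hq E. apply N. exists q; auto. }
      apply Gen in H; [|lra]. destruct H as [[_ H] _]. apply (H s); lra || auto. }
  assert (CG : forall x, ccont (fun y => gam (clamp 0 T y)) x \/ T < 0).
  { intros x. destruct (Rle_dec 0 T); [left|right; lra]. split.
    - now apply (cont_on_clamp (fun y => fst (gam y))).
    - now apply (cont_on_clamp (fun y => snd (gam y))). }
  intros t Ht.
  assert (CG' : forall x, ccont (fun y => gam (clamp 0 T y)) x) by (intros x; destruct (CG x); [auto|lra]).
  clear CG.
  (* Curve points of positive height are tips, whose height is at most [2 * sqrt q]; the constant 32
     makes this smaller than [c / 2]. The value at time 0 matters because the minimal distance below
     is taken over a closed interval. *)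
  assert (A2 : snd (gam 0) = 0).
  { apply Rle_antisym; [|apply Pos; lra]. apply Rnot_lt_le; intro K.
    set (c := snd (gam 0)) in *.
    destruct (C2 0 ltac:(lra) (c / 2)) as [d [Hd Hy]]; [lra|].
    set (s := Rmin (d / 2) (Rmin T (c ^ 2 / 32))).
    assert (Hc2 : 0 < c ^ 2 / 32) by (apply Rdiv_lt_0_compat; [apply pow_lt; auto|lra]).
    assert (Hs : 0 < s) by (repeat apply Rmin_pos; lra).
    assert (S1 : s <= d / 2) by apply Rmin_l.
    assert (S2 : s <= T) by (eapply Rle_trans; [apply Rmin_r|apply Rmin_l]).
    assert (S3 : s <= c ^ 2 / 32) by (eapply Rle_trans; [apply Rmin_r|apply Rmin_r]).
    specialize (Hy s). simpl in Hy. unfold Rdist in Hy.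
    assert (Hy' : Rabs (snd (gam s) - snd (gam 0)) < c / 2).
    { apply Hy. split; [lra|]. rewrite Rminus_0_r, Rabs_right; lra. }
    fold c in Hy'. apply Rabs_lt_between in Hy'.
    destruct (A1 s ltac:(lra) ltac:(lra)) as [q [Hq E]].
    assert (Q := tip_Y _ _ _ (HW q) q ltac:(lra)). fold (tip_curve q) in Q. rewrite <- E in Q.
    assert ((c / 2) ^ 2 <= snd (gam s) ^ 2) by (apply pow_incr; lra).
    replace ((c / 2) ^ 2) with (8 * (c ^ 2 / 32)) in H by field. lra. }
  assert (A3 : exists r, 0 < r <= t /\ gam r = tip_curve t).
  { apply Classical_Prop.NNPP. intro N.
    assert (Av : forall s, 0 <= s <= t -> 0 < Cmod (gam s - tip_curve t)%C).
    { intros s Hs. apply Cmod_gt_0. intro E.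
      assert (E' : gam s = tip_curve t).
      { replace (gam s) with ((gam s - tip_curve t) + tip_curve t)%C by ring. rewrite E.
        apply injective_projections; simpl; ring. }
      destruct (Req_dec s 0) as [Z|].
      - assert (P := tip_curve_pos t ltac:(lra)). rewrite <- E', Z, A2 in P. lra.
      - apply N. exists s; split; auto; lra. }
    destruct (continuous_min_attained (fun x => Cmod (gam (clamp 0 T x) - tip_curve t)%C) 0 t ltac:(lra)) as [m [Hm Hmin]].
    { intros x. apply Cmod_cont. apply (ccont_minus (fun x => gam (clamp 0 T x))); auto. apply ccont_const. }
    cbv beta in Hmin. rewrite clamp_id in Hmin by lra.
    destruct (tip_curve_approach t (Cmod (gam m - tip_curve t)%C) Ht) as [z [Hz Hzt]]; [apply Av; lra|].
    apply (tip_curve_in_hull t Ht). apply Gen; [lra|].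
    apply prepend_segment with (z := z); [apply tip_curve_pos; lra| |apply Gen; [lra|auto]].
    intros s Hs. specialize (Hmin s ltac:(lra)). rewrite clamp_id in Hmin by lra.
    eapply Rlt_le_trans; [exact Hzt|exact Hmin]. }
  destruct A3 as [r [Hr E]].
  assert (P := tip_curve_pos t ltac:(lra)). rewrite <- E in P.
  destruct (A1 r ltac:(lra) P) as [q [Hq E2]].
  assert (q = t) by (apply tip_curve_injective; [lra|lra|congruence]).
  replace r with t in E by lra. auto.
Qed.

End Hull.

(** * Decay of differences of flow lines *)

(* For a constant driver the distance [Z] from the tip solution to the driver is exactly
   [2 i sqrt r]. *)
Definition near (e r : R) (Z : C) : Prop := 0 < snd Z /\ Cmod (Z * Z + 4 * r)%C <= e.

Lemma near_Cmod e r Z : e <= r / 2 -> near e r Z -> 7 / 2 * r <= Cmod Z ^ 2 <= 9 / 2 * r.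
Proof.
  intros He [_ H]. assert (H0 : 0 <= e) by (eapply Rle_trans; [apply Cmod_ge_0|exact H]).
  assert (A := Cmod_lip (Z * Z)%C (- (4 * r))%C).
  replace (Z * Z - - (4 * r))%C with (Z * Z + 4 * r)%C in A by ring.
  rewrite Cmod_opp, !Cmod_mult, !Cmod_R, (Rabs_right 4), (Rabs_right r) in A by lra.
  apply Rabs_le_between in A. simpl. lra.
Qed.

Lemma near_snd e r Z : e <= r / 2 -> near e r Z -> r <= snd Z ^ 2.
Proof.
  intros He H. assert (N := near_Cmod e r Z He H). destruct H as [_ H].
  assert (A := Cmod_fst (Z * Z + 4 * r)%C). simpl in A.
  assert (B := Cmod_sq Z). assert (C := Cmod_ge_0 (Z * Z + 4 * r)%C).
  apply Rabs_le_between in A. assert (P := pow2_ge_0 (fst Z)). nra.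
Qed.

(** [Z^2 + 4 r] factors as [(Z - 2 i sqrt r) (Z + 2 i sqrt r)], and the second factor has imaginary
    part above [2 sqrt r]. *)
Lemma near_axis e r Z : 0 < r -> near e r Z ->
  Cmod (Z - 2 * Ci * sqrt r)%C * (2 * sqrt r) <= e.
Proof.
  intros Hr [Hz H]. assert (S := sqrt_lt_R0 r Hr). assert (S2 := pow2_sqrt r ltac:(lra)).
  replace (Z * Z + 4 * r)%C with ((Z - 2 * Ci * sqrt r) * (Z + 2 * Ci * sqrt r))%C in H.
  2: { rewrite <- S2 at 3. apply injective_projections; simpl; ring. }
  rewrite Cmod_mult in H. eapply Rle_trans; [|exact H].
  apply Rmult_le_compat_l; [apply Cmod_ge_0|].
  eapply Rle_trans; [|apply Cmod_snd]. eapply Rle_trans; [|apply Rle_abs]. simpl. lra.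
Qed.

(* Both [Z1] and [Z2] are close to [2 i sqrt r]. *)
Lemma near_product e r Z1 Z2 : 0 < r -> e <= r / 2 -> near e r Z1 -> near e r Z2 ->
  fst (2 / (Z1 * Z2))%C <= - / (2 * r) + e / r ^ 2 /\ Cmod (2 / (Z1 * Z2))%C <= / r.
Proof.
  intros Hr He H1 H2.
  assert (N1 := near_Cmod e r Z1 He H1). assert (N2 := near_Cmod e r Z2 He H2).
  assert (D1 := near_axis e r Z1 Hr H1). assert (D2 := near_axis e r Z2 Hr H2).
  assert (C1 := Cmod_ge_0 Z1). assert (C2 := Cmod_ge_0 Z2).
  assert (P1 : Z1 <> 0%C) by (intro E; rewrite E, Cmod_0 in N1; simpl in N1; lra).
  assert (P2 : Z2 <> 0%C) by (intro E; rewrite E, Cmod_0 in N2; simpl in N2; lra).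
  assert (S := sqrt_lt_R0 r Hr). assert (S2 := pow2_sqrt r ltac:(lra)).
  assert (He0 : 0 <= e) by (destruct H1 as [_ H1]; eapply Rle_trans; [apply Cmod_ge_0|exact H1]).
  assert (M : 7 / 2 * r <= Cmod Z1 * Cmod Z2).
  { apply pow2_le_inv; [apply Rmult_le_pos; auto|]. rewrite (Rpow_mult_distr (Cmod Z1)).
    replace ((7 / 2 * r) ^ 2) with ((7 / 2 * r) * (7 / 2 * r)) by ring. apply Rmult_le_compat; lra. }
  assert (Bd : Cmod (2 / (Z1 * Z2))%C <= / r).
  { rewrite Cmod_div, Cmod_mult, Cmod_R, Rabs_right by (try lra; now apply Cmult_neq_0).
    apply Rmult_le_reg_r with (Cmod Z1 * Cmod Z2); [nra|].
    unfold Rdiv; rewrite Rmult_assoc, Rinv_l by nra.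
    apply Rmult_le_reg_l with r; auto.
    replace (r * (/ r * (Cmod Z1 * Cmod Z2))) with (Cmod Z1 * Cmod Z2) by (field; lra). lra. }
  split; auto.
  assert (Q : Cmod (2 / (Z1 * Z2) + / (2 * r))%C <= e / r ^ 2).
  { set (d1 := Cmod (Z1 - 2 * Ci * sqrt r)%C) in *. set (d2 := Cmod (Z2 - 2 * Ci * sqrt r)%C) in *.
    assert (T : Cmod (Z1 * Z2 + 4 * r)%C <= Cmod Z1 * d2 + 2 * sqrt r * d1).
    { replace (Z1 * Z2 + 4 * r)%C with (Z1 * (Z2 - 2 * Ci * sqrt r) + 2 * Ci * sqrt r * (Z1 - 2 * Ci * sqrt r))%C.
      2: { rewrite <- S2 at 4. apply injective_projections; simpl; ring. }
      eapply Rle_trans; [apply Cmod_triangle|]. rewrite !Cmod_mult, Cmod_Ci, !Cmod_R, !Rabs_right by lra.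
      fold d1 d2. lra. }
    assert (U1 : Cmod Z1 <= 5 / 2 * sqrt r) by (apply pow2_le_inv; [lra|rewrite Rpow_mult_distr, S2; lra]).
    assert (d10 : 0 <= d1) by apply Cmod_ge_0. assert (d20 : 0 <= d2) by apply Cmod_ge_0.
    assert (T2 : Cmod (Z1 * Z2 + 4 * r)%C <= 9 / 4 * e).
    { assert (Cmod Z1 * d2 <= 5 / 2 * sqrt r * d2) by (apply Rmult_le_compat_r; lra). lra. }
    replace (2 / (Z1 * Z2) + / (2 * r))%C with ((Z1 * Z2 + 4 * r) / (2 * r * (Z1 * Z2)))%C.
    2: { field. repeat split; auto. intro E; apply (f_equal fst) in E; simpl in E; lra. }
    rewrite Cmod_div.
    2: { repeat apply Cmult_neq_0; auto; intro E; apply (f_equal fst) in E; simpl in E; lra. }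
    rewrite (Cmod_mult (2 * r)), (Cmod_mult 2), (Cmod_mult Z1), !Cmod_R, (Rabs_right 2), (Rabs_right r) by lra.
    apply Rle_trans with (9 / 4 * e / (2 * r * (7 / 2 * r))).
    - unfold Rdiv at 1 3. apply Rmult_le_compat; [apply Cmod_ge_0| |exact T2|].
      + left; apply Rinv_0_lt_compat. nra.
      + apply Rinv_le_contravar; nra.
    - replace (9 / 4 * e / (2 * r * (7 / 2 * r))) with (9 / 28 * (e / r ^ 2)) by (field; lra).
      assert (0 <= e / r ^ 2) by (apply Rdiv_le_0_compat; nra). lra. }
  assert (A := Rle_trans _ _ _ (Rle_abs _) (Rle_trans _ _ _ (Cmod_fst _) Q)).
  replace (fst (2 / (Z1 * Z2) + / (2 * r))%C) with (fst (2 / (Z1 * Z2))%C + / (2 * r)) in A.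
  - lra.
  - rewrite <- RtoC_mult, <- RtoC_inv by lra. reflexivity.
Qed.

(** The weight [sqrt r] balances the main part [- 1 / (2 r)] of the coefficient. The error of the
    coefficient, at most [B0 * a / r^2 + B1 / sqrt r], has an integral bounded by [B0 + 2 * B1], so
    the exponential in [m] stays between fixed bounds. A source [m0 / r] weighted by [sqrt r]
    integrates to at most [2 * m0 * sqrt b], which is of order [m0] after division by [sqrt b]. *)
Lemma near_comparison (d Z1 Z2 G : R -> C) (a b B0 B1 m0 : R) : 0 < a <= b -> b <= 1 ->
  0 <= B0 -> 0 <= B1 -> 0 <= m0 ->
  (forall r, a <= r <= b -> B0 * a + B1 * (r * sqrt r) <= r / 2) ->
  (forall r, a <= r <= b -> near (B0 * a + B1 * (r * sqrt r)) r (Z1 r)) ->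
  (forall r, a <= r <= b -> near (B0 * a + B1 * (r * sqrt r)) r (Z2 r)) ->
  (forall r, a <= r <= b -> cder d r (2 / (Z1 r * Z2 r) * d r + G r)%C) ->
  (forall r, a <= r <= b -> Cmod (G r) <= m0 / r) ->
  sqrt b * Cmod (d b) <= exp (B0 + 2 * B1) * (sqrt a * Cmod (d a) + 2 * m0 * sqrt b).
Proof.
  intros Hab Hb HB0 HB1 Hm0 He N1 N2 D HG.
  set (m := fun r => sqrt r * exp (B0 * a / r - 2 * B1 * sqrt r)).
  set (m' := fun r => m r * (/ (2 * r) - B0 * a / r ^ 2 - B1 / sqrt r)).
  assert (Sq : forall r, a <= r <= b -> 0 < sqrt r /\ sqrt r ^ 2 = r /\ sqrt r <= 1).
  { intros r Hr. split; [apply sqrt_lt_R0; lra|]. assert (E := pow2_sqrt r ltac:(lra)).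
    split; auto. apply pow2_le_inv; lra. }
  assert (Ub : forall r, a <= r <= b -> m r <= sqrt r * exp B0).
  { intros r Hr. destruct (Sq r Hr) as [S _]. apply Rmult_le_compat_l; [lra|]. apply exp_mono.
    assert (B0 * a / r <= B0).
    { apply Rmult_le_reg_r with r; [lra|]. unfold Rdiv; rewrite Rmult_assoc, Rinv_l by lra. nra. }
    assert (0 <= B1 * sqrt r) by (apply Rmult_le_pos; lra). lra. }
  assert (Lb : forall r, a <= r <= b -> sqrt r * exp (- 2 * B1) <= m r).
  { intros r Hr. destruct (Sq r Hr) as [S [_ S1]]. apply Rmult_le_compat_l; [lra|]. apply exp_mono.
    assert (0 <= B0 * a / r) by (apply Rdiv_le_0_compat; [apply Rmult_le_pos|]; lra).
    assert (B1 * sqrt r <= B1 * 1) by (apply Rmult_le_compat_l; lra). lra. }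
  assert (K := growth_weighted d (fun r => 2 / (Z1 r * Z2 r))%C G m m'
    (fun r => 2 * exp B0 * m0 * sqrt r) (fun r => exp B0 * m0 / sqrt r) a b ltac:(lra) D).
  assert (K' : m b * Cmod (d b) <= m a * Cmod (d a) + (2 * exp B0 * m0 * sqrt b - 2 * exp B0 * m0 * sqrt a)).
  { apply K.
    - intros r Hr. destruct (Sq r Hr) as [S [S2 _]]. unfold m', m. auto_derive; [lra|].
      replace (B0 * a * / r + - (2 * B1 * sqrt r)) with (B0 * a / r - 2 * B1 * sqrt r) by (field; lra).
      set (E := exp _). set (q := sqrt r) in *. rewrite <- S2. field. lra.
    - intros r Hr. destruct (Sq r Hr) as [S _]. apply Rmult_lt_0_compat; [lra|apply exp_pos].
    - intros r Hr. destruct (Sq r Hr) as [S [S2 _]]. unfold m'. rewrite <- Rmult_plus_distr_l.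
      apply Rmult_le_0_l.
      + apply Rmult_le_pos; [lra|left; apply exp_pos].
      + destruct (near_product _ r (Z1 r) (Z2 r) ltac:(lra) (He r Hr) (N1 r Hr) (N2 r Hr)) as [Q _].
        replace ((B0 * a + B1 * (r * sqrt r)) / r ^ 2) with (B0 * a / r ^ 2 + B1 / sqrt r) in Q; [lra|].
        set (q := sqrt r) in *. rewrite <- S2. field. lra.
    - intros r Hr. destruct (Sq r Hr) as [S [S2 _]]. auto_derive; [lra|]. field; lra.
    - intros r Hr. destruct (Sq r Hr) as [S [S2 _]].
      apply Rle_trans with (sqrt r * exp B0 * (m0 / r)).
      + apply Rmult_le_compat; auto; [|apply Cmod_ge_0]. apply Rmult_le_pos; [lra|left; apply exp_pos].
      + right. set (q := sqrt r) in *. rewrite <- S2. field. lra. }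
  destruct (Sq a ltac:(lra)) as [Sa _]. destruct (Sq b ltac:(lra)) as [Sb _].
  specialize (Lb b ltac:(lra)). specialize (Ub a ltac:(lra)).
  assert (E0 := exp_pos B0). assert (E1 := exp_pos (- 2 * B1)).
  apply Rmult_le_reg_l with (exp (- 2 * B1)); auto.
  rewrite <- (Rmult_assoc (exp _) (exp _)), <- exp_plus.
  replace (-2 * B1 + (B0 + 2 * B1)) with B0 by ring.
  assert (A1 : sqrt b * exp (-2 * B1) * Cmod (d b) <= m b * Cmod (d b)) by (apply Rmult_le_compat_r; [apply Cmod_ge_0|auto]).
  assert (A2 : m a * Cmod (d a) <= sqrt a * exp B0 * Cmod (d a)) by (apply Rmult_le_compat_r; [apply Cmod_ge_0|auto]).
  assert (A3 : 0 <= exp B0 * m0 * sqrt a) by (repeat apply Rmult_le_pos; lra).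
  lra.
Qed.

(** * Flow lines close to [2 i sqrt r] *)

Section Flow.
Variables (xi xi' : R -> R) (L : R).
Hypothesis (HL : 0 < L) (Dxi : forall t, is_derive xi t (xi' t)) (Bxi : forall t, Rabs (xi' t) <= L).

(** For [Z = W - xi] the derivative of [Z^2 + 4 r] is [- 2 Z xi']. Since [|Z| <= 6 * sqrt r], it is
    at most [12 * L * sqrt r], whose primitive is [8 * L * r^(3/2)]. *)
Lemma bl_near W a b : 0 < a <= b -> 20 * L * sqrt b <= 1 ->
  (forall r, a <= r <= b -> bl xi W r) ->
  Cmod ((W a - xi a) * (W a - xi a) + 4 * a)%C <= a / 10 ->
  forall r, a <= r <= b -> near (/ 10 * a + 8 * L * (r * sqrt r)) r (W r - xi r)%C.
Proof.
  intros Hab HLb H Ha r Hr.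
  split. { simpl. rewrite Ropp_0, Rplus_0_r. apply H; auto. }
  assert (Na : Cmod (W a - xi a)%C ^ 2 <= 41 / 10 * a).
  { assert (A := Cmod_lip ((W a - xi a) * (W a - xi a))%C (- (4 * a))%C).
    replace ((W a - xi a) * (W a - xi a) - - (4 * a))%C with ((W a - xi a) * (W a - xi a) + 4 * a)%C in A by ring.
    rewrite Cmod_opp, !Cmod_mult, !Cmod_R, (Rabs_right 4), (Rabs_right a) in A by lra.
    apply Rabs_le_between in A. simpl; lra. }
  assert (Sz : forall x, a <= x <= b -> Cmod (W x - xi x)%C <= 6 * sqrt x).
  { intros x Hx. assert (S := sqrt_lt_R0 x ltac:(lra)). assert (S2 := pow2_sqrt x ltac:(lra)).
    assert (Sb := pow2_sqrt b ltac:(lra)). assert (Sb0 := sqrt_pos b).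
    assert (Sxb : sqrt x <= sqrt b) by (apply sqrt_le_1_alt; lra).
    assert (X := bl_X_bound xi xi' L Dxi Bxi W a x ltac:(lra) ltac:(intros; apply H; lra)).
    assert (Y := bl_Y_upper xi W a x ltac:(lra) ltac:(intros; apply H; lra)).
    assert (Xa : Rabs (fst (W a) - xi a) <= 21 / 10 * sqrt x).
    { eapply Rle_trans; [apply (Cmod_fst (W a - xi a)%C)|]. apply pow2_le_inv; [lra|].
      rewrite Rpow_mult_distr, S2. lra. }
    assert (Ya : snd (W a) ^ 2 <= 41 / 10 * a).
    { rewrite Cmod_sq in Na. assert (P := pow2_ge_0 (fst (W a - xi a)%C)). simpl in Na, P. simpl. lra. }
    assert (X2 : Rabs (fst (W x) - xi x) <= 31 / 10 * sqrt x).
    { assert (L * (x - a) <= sqrt x).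
      { apply Rle_trans with (L * sqrt b * sqrt x); [|nra].
        rewrite Rmult_assoc. apply Rmult_le_compat_l; [lra|]. nra. }
      lra. }
    apply pow2_le_inv; [lra|]. rewrite Cmod_sq.
    replace (fst (W x - xi x)%C) with (fst (W x) - xi x) by (simpl; ring).
    replace (snd (W x - xi x)%C) with (snd (W x)) by (simpl; ring).
    rewrite <- (pow2_abs (fst _ - _)).
    assert (Rabs (fst (W x) - xi x) ^ 2 <= (31 / 10 * sqrt x) ^ 2) by (apply pow_incr; split; [apply Rabs_pos|auto]).
    rewrite Rpow_mult_distr, S2 in *. lra. }
  assert (K := growth (fun x => (W x - xi x) * (W x - xi x) + 4 * x)%C (fun _ => 0%C)
    (fun x => - (2 * (W x - xi x) * xi' x))%C (fun x => 8 * L * (x * sqrt x)) (fun x => 12 * L * sqrt x) a r ltac:(lra)).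
  cbv beta in K.
  assert (K' : Cmod ((W r - xi r) * (W r - xi r) + 4 * r)%C <=
    Cmod ((W a - xi a) * (W a - xi a) + 4 * a)%C + (8 * L * (r * sqrt r) - 8 * L * (a * sqrt a))).
  { apply K.
    - intros x Hx. assert (Nz := bl_nonzero xi W x (H x ltac:(lra))).
      assert (DZ : cder (fun x => W x - xi x)%C x (-2 / (W x - xi x) - xi' x)%C).
      { apply cder_minus; [apply H; lra|]. now apply cder_RtoC. }
      eapply cder_eq.
      + apply cder_plus; [apply cder_mult; exact DZ|].
        apply (cder_mult (fun _ => RtoC 4) (fun x => RtoC x)); [apply cder_const|apply cder_RtoC, @is_derive_id].
      + unfold one; simpl. rewrite RtoC_m2. field; auto.
    - intros; simpl; lra.
    - intros x Hx. assert (S := sqrt_lt_R0 x ltac:(lra)). assert (S2 := pow2_sqrt x ltac:(lra)).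
      auto_derive; [lra|]. set (q := sqrt x) in *. rewrite <- S2. field. lra.
    - intros x Hx. rewrite Cmod_opp, !Cmod_mult, !Cmod_R, (Rabs_right 2) by lra.
      specialize (Sz x ltac:(lra)). specialize (Bxi x).
      assert (Cmod (W x - xi x)%C * Rabs (xi' x) <= 6 * sqrt x * L).
      { apply Rmult_le_compat; auto; [apply Cmod_ge_0|apply Rabs_pos]. }
      lra. }
  assert (S := sqrt_pos a). assert (0 <= L * (a * sqrt a)) by (repeat apply Rmult_le_pos; lra). lra.
Qed.

Lemma near_small a r : 0 < a <= r -> 20 * L * sqrt r <= 1 ->
  / 10 * a + 8 * L * (r * sqrt r) <= r / 2.
Proof. intros Ha Hr. assert (r * (20 * L * sqrt r) <= r * 1) by (apply Rmult_le_compat_l; lra). lra. Qed.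

(** Up to [r0], [near_comparison] without a source gains [sqrt (a / r0)]. From [r0] on both flow
    lines have height at least [sqrt r0], and crude stability costs only a constant. *)
Lemma bl_decay W1 W2 a r0 b : 0 < a <= r0 -> r0 <= b -> r0 <= 1 -> 20 * L * sqrt r0 <= 1 ->
  (forall r, a <= r <= b -> bl xi W1 r) -> (forall r, a <= r <= b -> bl xi W2 r) ->
  Cmod ((W1 a - xi a) * (W1 a - xi a) + 4 * a)%C <= a / 10 ->
  Cmod ((W2 a - xi a) * (W2 a - xi a) + 4 * a)%C <= a / 10 ->
  Cmod (W1 b - W2 b)%C <=
  exp (/ 10 + 16 * L) * / sqrt r0 * exp (2 / r0 * (b - r0)) * (sqrt a * Cmod (W1 a - W2 a)%C).
Proof.
  intros Ha Hb Hr1 HLr H1 H2 N1 N2.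
  assert (E1 := bl_near W1 a r0 Ha HLr ltac:(intros; apply H1; lra) N1).
  assert (E2 := bl_near W2 a r0 Ha HLr ltac:(intros; apply H2; lra) N2).
  assert (Sm : forall r, a <= r <= r0 -> / 10 * a + 8 * L * (r * sqrt r) <= r / 2).
  { intros r Hr. apply near_small; [lra|].
    assert (sqrt r <= sqrt r0) by (apply sqrt_le_1_alt; lra). nra. }
  assert (S := sqrt_lt_R0 r0 ltac:(lra)). assert (S2 := pow2_sqrt r0 ltac:(lra)).
  assert (K := near_comparison (fun t => W1 t - W2 t)%C (fun t => W1 t - xi t)%C (fun t => W2 t - xi t)%C
    (fun _ => 0%C) a r0 (/ 10) (8 * L) 0 Ha Hr1 ltac:(lra) ltac:(lra) (Rle_refl 0) Sm E1 E2
    ltac:(intros; apply bl_diff; [apply H1|apply H2]; lra)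
    ltac:(intros; cbv beta; rewrite Cmod_0; unfold Rdiv; lra)).
  cbv beta in K. replace (2 * (8 * L)) with (16 * L) in K by ring.
  assert (Y : forall W, near (/ 10 * a + 8 * L * (r0 * sqrt r0)) r0 (W r0 - xi r0)%C -> sqrt r0 <= snd (W r0)).
  { intros W N. assert (Q := near_snd _ _ _ (Sm r0 ltac:(lra)) N). destruct N as [N _].
    simpl in N. rewrite Ropp_0, Rplus_0_r in N. apply pow2_le_inv; [lra|]. rewrite S2.
    replace (snd (W r0 - xi r0)%C) with (snd (W r0)) in Q by (simpl; ring). auto. }
  assert (Cr := bl_stability_crude xi W1 W2 (sqrt r0) r0 b Hb S ltac:(intros; apply H1; lra)
    ltac:(intros; apply H2; lra) (Y W1 (E1 r0 ltac:(lra))) (Y W2 (E2 r0 ltac:(lra)))).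
  rewrite S2 in Cr. eapply Rle_trans; [apply Cr|].
  assert (P := exp_pos (2 / r0 * (b - r0))).
  rewrite (Rmult_comm (Cmod _)), (Rmult_comm _ (exp (2 / r0 * _))), !Rmult_assoc.
  apply Rmult_le_compat_l; [lra|].
  apply Rmult_le_reg_l with (sqrt r0); auto.
  eapply Rle_trans; [apply K|]. right. field. lra.
Qed.

End Flow.

(** * Power series at the tip *)

(* The variables are the coefficients [c] of the driver, the shift [s] and the square root [x]. *)
Inductive polyf : ((nat -> R) -> C -> C -> C) -> Prop :=
| pf_const (k : C) : polyf (fun _ _ _ => k)
| pf_coef i : polyf (fun c _ _ => RtoC (c i))
| pf_s : polyf (fun _ s _ => s)
| pf_x : polyf (fun _ _ x => x)
| pf_add f g : polyf f -> polyf g -> polyf (fun c s x => f c s x + g c s x)%C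
| pf_mul f g : polyf f -> polyf g -> polyf (fun c s x => f c s x * g c s x)%C.

Lemma pf_pow f k : polyf f -> polyf (fun c s x => f c s x ^ k)%C.
Proof.
  intros Hf. induction k; simpl; [apply (pf_const 1%C)|]. now apply pf_mul.
Qed.

Lemma pf_bound f M : polyf f -> exists B, 0 <= B /\ forall c s x,
  (forall i, Rabs (c i) <= M) -> Cmod s <= 1 -> Cmod x <= 1 -> Cmod (f c s x) <= B.
Proof.
  induction 1 as [k|i| | |f g _ [B1 [P1 H1]] _ [B2 [P2 H2]]|f g _ [B1 [P1 H1]] _ [B2 [P2 H2]]].
  - exists (Cmod k); split; [apply Cmod_ge_0|intros; lra].
  - exists (Rabs M); split; [apply Rabs_pos|]. intros c s x H _ _. rewrite Cmod_R.
    eapply Rle_trans; [apply H|apply Rle_abs].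
  - exists 1; split; [lra|auto].
  - exists 1; split; [lra|auto].
  - exists (B1 + B2); split; [lra|]. intros. eapply Rle_trans; [apply Cmod_triangle|].
    apply Rplus_le_compat; auto.
  - exists (B1 * B2); split; [nra|]. intros. rewrite Cmod_mult.
    apply Rmult_le_compat; auto using Cmod_ge_0.
Qed.

(** Division by [x] after removing the value at [x = 0]; this isolates the coefficient that
    [tip_series] has to cancel. *)
Lemma pf_dec f : polyf f -> polyf (fun c s _ => f c s 0%C) /\
  exists f1, polyf f1 /\ forall c s x, f c s x = (f c s 0 + x * f1 c s x)%C.
Proof.
  induction 1 as [k|i| | |f g Hf [F0 [f1 [F1 F]]] Hg [G0 [g1 [G1 G]]]|f g Hf [F0 [f1 [F1 F]]] Hg [G0 [g1 [G1 G]]]].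
  - split; [apply pf_const|]. exists (fun _ _ _ => 0%C); split; [apply pf_const|intros; ring].
  - split; [apply pf_coef|]. exists (fun _ _ _ => 0%C); split; [apply pf_const|intros; ring].
  - split; [apply pf_s|]. exists (fun _ _ _ => 0%C); split; [apply pf_const|intros; ring].
  - split; [apply (pf_const 0%C)|]. exists (fun _ _ _ => 1%C); split; [apply pf_const|intros; ring].
  - split; [now apply (pf_add (fun c s _ => f c s 0%C))|].
    exists (fun c s x => f1 c s x + g1 c s x)%C; split; [now apply pf_add|].
    intros. rewrite F, G. ring.
  - split; [now apply (pf_mul (fun c s _ => f c s 0%C))|].
    exists (fun c s x => f1 c s x * g c s x + f c s 0 * g1 c s x)%C; split.
    + apply pf_add; apply pf_mul; auto.
    + intros. rewrite F at 1. rewrite (G c s x). ring.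
Qed.

(** The partial derivative in [x], expressed by the chain rule along curves, the form in which it
    enters the flow equation. *)
Definition pder (f f' : (nat -> R) -> C -> C -> C) : Prop :=
  forall c s (x : R -> C) t l, cder x t l -> cder (fun t => f c s (x t)) t (l * f' c s (x t))%C.

Lemma pder_ext f f' g' : pder f f' -> (forall c s x, f' c s x = g' c s x) -> pder f g'.
Proof. intros H E c s x t l D. rewrite <- E. now apply H. Qed.

Lemma pder_add f f' g g' : pder f f' -> pder g g' ->
  pder (fun c s x => f c s x + g c s x)%C (fun c s x => f' c s x + g' c s x)%C.
Proof.
  intros F G c s x t l D. eapply cder_eq; [apply cder_plus; [apply F, D|apply G, D]|]. ring.
Qed.

Lemma pder_mul f f' g g' : pder f f' -> pder g g' ->
  pder (fun c s x => f c s x * g c s x)%C (fun c s x => f' c s x * g c s x + f c s x * g' c s x)%C.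
Proof.
  intros F G c s x t l D. eapply cder_eq; [apply cder_mult; [apply F, D|apply G, D]|]. cbv beta; ring.
Qed.

Lemma pder_const (k : (nat -> R) -> C -> C) : pder (fun c s _ => k c s) (fun _ _ _ => 0%C).
Proof. intros c s x t l D. eapply cder_eq; [apply cder_const|ring]. Qed.

Lemma pder_x : pder (fun _ _ x => x) (fun _ _ _ => 1%C).
Proof. intros c s x t l D. eapply cder_eq; [exact D|ring]. Qed.

Lemma pder_pow m : pder (fun _ _ x => x ^ S m)%C (fun _ _ x => INR (S m) * x ^ m)%C.
Proof.
  induction m.
  - eapply pder_ext; [apply pder_mul; [apply pder_x|apply (pder_const (fun _ _ => 1%C))]|].
    intros; simpl; ring.
  - eapply pder_ext; [exact (pder_mul _ _ (fun _ _ x => x ^ S m)%C _ pder_x IHm)|].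
    intros. rewrite (S_INR (S m)), RtoC_plus. rewrite !Cpow_S. ring.
Qed.

(** [n] is the number of coefficients, so the degree is below [n]; [Qpoly (S n)] is the complex
    counterpart of [peval n]. *)
Fixpoint Qpoly (n : nat) (c : nat -> R) (y : C) : C :=
  match n with O => 0%C | S n => (Qpoly n c y + c n * y ^ n)%C end.

Lemma pf_Qpoly n : polyf (fun c s x => Qpoly n c (s - x * x)%C).
Proof.
  induction n; simpl; [apply pf_const|].
  apply pf_add; auto. apply pf_mul; [apply pf_coef|]. apply pf_pow.
  apply (pf_add (fun _ s _ => s) (fun _ _ x => - (x * x))%C); [apply pf_s|].
  assert (H : polyf (fun _ _ x => (- (1)) * (x * x))%C) by (repeat apply pf_mul; constructor).
  assert (E : (fun (_ : nat -> R) (_ x : C) => (- (1)) * (x * x))%C = (fun _ _ x => - (x * x))%C).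
  { do 3 (apply FunctionalExtensionality.functional_extensionality; intro). ring. }
  now rewrite <- E.
Qed.

(* With [u = x^2] and driver derivative [Q], the function [x A(x)] solves
   [d/du (x A) = - 2 / (x A) + Q (s - u)] up to an error [O (x^m)]. *)
Lemma tip_series n m : exists A A' a e, polyf A /\ polyf A' /\ polyf a /\ polyf e /\ pder A A' /\
  (forall c s x, A c s x = (2 * Ci + x * a c s x)%C) /\
  (forall c s x, (A c s x * (A c s x + x * A' c s x) + 4 - 2 * x * A c s x * Qpoly n c (s - x * x)
     = x ^ S m * e c s x)%C).
Proof.
  assert (C2 : (Ci * Ci = - (1))%C) by (apply injective_projections; simpl; ring).
  induction m as [|m [A [A' [a [e [HA [HA' [Ha [He [D [EA ER]]]]]]]]]]].
  (* For a constant driver the solution is exactly [2 i x]; the derivative of the driver leaves an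
     error of first order in [x]. *)
  - exists (fun _ _ _ => (2 * Ci)%C), (fun _ _ _ => 0%C), (fun _ _ _ => 0%C),
      (fun c s x => (- (4 * Ci)) * Qpoly n c (s - x * x))%C.
    split; [apply pf_const|split; [apply pf_const|split; [apply pf_const|split; [|split; [|split]]]]].
    + apply (pf_mul (fun _ _ _ => (- (4 * Ci))%C)); [apply pf_const|apply pf_Qpoly].
    + apply (pder_const (fun _ _ => (2 * Ci)%C)).
    + intros; ring.
    + intros. rewrite Cpow_S. simpl Cpow.
      replace (2 * Ci * (2 * Ci + x * 0))%C with (4 * (Ci * Ci))%C by ring. rewrite C2. ring.
  - destruct (pf_dec e He) as [He0 [e1 [He1 Ee]]].
    set (M := RtoC (INR (S m))).
    (* Adding [k * x^(m+1)] to [A] changes the residual at order [x^(m+1)] by [(M + 2) * k * 2 i],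
       where [M = m + 1]; the factor [g] makes this cancel the value of [e] at [x = 0]. *)
    set (g := (Ci / (2 * (M + 2)))%C).
    set (k := fun c s => (e c s 0 * g)%C).
    assert (HM : (M + 2)%C <> 0%C).
    { intro E; apply (f_equal fst) in E. unfold M in E. simpl fst in E.
      assert (P := pos_INR (S m)). change (INR (S m) + 2 = 0) in E. lra. }
    assert (Hk : forall c s, ((M + 2) * k c s * (2 * Ci) = - e c s 0)%C).
    { intros. unfold k, g. transitivity (e c s 0 * (Ci * Ci))%C; [field; auto|]. rewrite C2; ring. }
    assert (Pk : polyf (fun c s _ => k c s)).
    { apply (pf_mul (fun c s _ => e c s 0%C)); [auto|apply pf_const]. }
    assert (Px : forall j, polyf (fun _ _ x => x ^ j)%C) by (intros; apply (pf_pow (fun _ _ x => x)), pf_x).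
    exists (fun c s x => A c s x + k c s * x ^ S m)%C.
    exists (fun c s x => A' c s x + M * (k c s * x ^ m))%C.
    exists (fun c s x => a c s x + k c s * x ^ m)%C.
    exists (fun c s x => e1 c s x + ((M + 2) * (k c s * a c s x) + (k c s * A' c s x +
       ((M + 1) * (k c s * (k c s * x ^ m)) + (- (2)) * (k c s * Qpoly n c (s - x * x))))))%C.
    assert (Pkc : forall f, polyf f -> polyf (fun c s x => k c s * f c s x)%C) by (intros; now apply (pf_mul (fun c s _ => k c s))).
    assert (Pcc : forall (b : C) f, polyf f -> polyf (fun c s x => b * f c s x)%C)
      by (intros; apply (pf_mul (fun _ _ _ => b)); [apply pf_const|auto]).
    split; [|split; [|split; [|split; [|split; [|split]]]]].
    + apply pf_add; [auto|]. apply (Pkc (fun _ _ x => x ^ S m)%C); auto.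
    + apply pf_add; [auto|]. apply Pcc, (Pkc (fun _ _ x => x ^ m)%C); auto.
    + apply pf_add; [auto|]. apply (Pkc (fun _ _ x => x ^ m)%C); auto.
    + apply pf_add; [auto|]. apply pf_add; [apply Pcc, Pkc; auto|].
      apply pf_add; [apply Pkc; auto|]. apply pf_add; [apply Pcc, Pkc, (Pkc (fun _ _ x => x ^ m)%C); auto|].
      apply Pcc, Pkc, pf_Qpoly.
    + eapply pder_ext; [exact (pder_add _ _ _ _ D (pder_mul _ _ _ _ (pder_const k) (pder_pow m)))|].
      intros; cbv beta. fold M. ring.
    + intros. rewrite EA, Cpow_S. ring.
    + intros c s x. specialize (ER c s x). specialize (Hk c s). specialize (EA c s x). specialize (Ee c s x).
      set (Q := Qpoly n c (s - x * x)) in *. set (X := (x ^ m)%C) in *. rewrite !Cpow_S in *. fold X in ER. fold X.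
      generalize dependent (k c s). intros K HK.
      set (Av := A c s x) in *. set (Av' := A' c s x) in *. set (av := a c s x) in *.
      set (ev := e c s x) in *. set (e1v := e1 c s x) in *. set (e0 := e c s 0%C) in *.
      transitivity ((Av * (Av + x * Av') + 4 - 2 * x * Av * Q) +
        x * X * ((M + 2) * K * Av + K * (x * Av') + (M + 1) * K * K * (x * X) - 2 * x * K * Q))%C; [ring|].
      rewrite ER, Ee. rewrite EA at 1.
      transitivity (x * X * (e0 + x * e1v) + x * X * ((M + 2) * K * (2 * Ci) + (M + 2) * K * (x * av) +
        K * (x * Av') + (M + 1) * K * K * (x * X) - 2 * x * K * Q))%C; [ring|].
      rewrite HK. ring.
Qed.

(** The principal square root through the half-angle formulas; it is used where the real part is
    positive, so that the denominator does not vanish. *)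
Definition csqrt (u : C) : C :=
  (sqrt ((Cmod u + fst u) / 2), snd u / (2 * sqrt ((Cmod u + fst u) / 2))).

Lemma csqrt_spec (u : C) : 0 < fst u -> 0 < fst (csqrt u) /\ (csqrt u * csqrt u)%C = u.
Proof.
  intros Hu. assert (P := Cmod_ge_0 u).
  assert (H : 0 < (Cmod u + fst u) / 2) by lra.
  assert (S := sqrt_lt_R0 _ H). assert (S2 := pow2_sqrt _ (Rlt_le _ _ H)).
  unfold csqrt; cbn [fst]. split; auto.
  set (a := sqrt _) in *. assert (M := Cmod_sq u).
  apply injective_projections; simpl; [|field; lra].
  replace (a * a) with (a ^ 2) by ring.
  replace (snd u / (2 * a) * (snd u / (2 * a))) with (snd u ^ 2 / (4 * a ^ 2)) by (field; lra).
  replace (snd u ^ 2) with ((Cmod u - fst u) * (Cmod u + fst u)) by lra.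
  rewrite S2. field. lra.
Qed.

Lemma csqrt_cder (w : C) t : 0 < fst w + t ->
  cder (fun t : R => csqrt (w + t)%C) t (/ (2 * csqrt (w + t)))%C.
Proof.
  intros H. destruct (csqrt_spec (w + t)%C) as [S E]; [simpl; lra|].
  set (N := fun t => sqrt ((fst w + t) ^ 2 + snd w ^ 2)).
  assert (EN : forall t : R, Cmod (w + t)%C = N t).
  { intros; unfold Cmod, N; simpl. rewrite !Rplus_0_r. reflexivity. }
  assert (Pos : 0 < (fst w + t) ^ 2 + snd w ^ 2).
  { assert (0 < (fst w + t) ^ 2) by (apply pow_lt; auto). assert (P := pow2_ge_0 (snd w)). lra. }
  assert (HN : 0 < N t) by (apply sqrt_lt_R0; auto).
  assert (DN : is_derive N t ((fst w + t) / N t)).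
  { unfold N. auto_derive; [simpl in Pos; lra|]. fold (N t).
    change (sqrt ((fst w + t) * ((fst w + t) * 1) + snd w * (snd w * 1))) with (N t). field; lra. }
  assert (DA : is_derive (fun t => sqrt ((N t + (fst w + t)) / 2)) t
    (sqrt ((N t + (fst w + t)) / 2) / (2 * N t))).
  { assert (P : 0 < (N t + (fst w + t)) / 2) by lra.
    eapply is_derive_eq.
    - apply is_derive_sqrt; [|exact P].
      apply is_derive_ext with (f := fun t => / 2 * (N t + (fst w + t))); [intros y; apply Rmult_comm|].
      apply is_derive_scal. apply @is_derive_plus; [apply DN|].
      apply @is_derive_plus; [apply @is_derive_const|apply @is_derive_id].
    - unfold plus, zero, one; simpl. assert (S3 := sqrt_lt_R0 _ P). assert (S2 := pow2_sqrt _ (Rlt_le _ _ P)).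
      set (q := sqrt _) in *. apply Rmult_eq_reg_r with (4 * q * N t); [|nra].
      field_simplify; [|lra|lra]. rewrite S2. field. }
  set (A := fun t => sqrt ((N t + (fst w + t)) / 2)) in *.
  assert (EC : forall t : R, csqrt (w + t)%C = ((A t, snd w / (2 * A t)) : C)).
  { intros. unfold csqrt. rewrite EN. unfold A. simpl. rewrite Rplus_0_r. reflexivity. }
  assert (SA : 0 < A t) by (rewrite EC in S; exact S).
  assert (NA : N t = A t ^ 2 + (snd w / (2 * A t)) ^ 2).
  { rewrite <- EN, <- E, Cmod_mult. transitivity (Cmod (csqrt (w + t)%C) ^ 2); [ring|].
    rewrite Cmod_sq, EC. reflexivity. }
  apply cder_ext with (f := fun t => ((A t, snd w / (2 * A t)) : C)); [intros; now rewrite EC|].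
  rewrite EC. clear EC. change (is_derive A t (A t / (2 * N t))) in DA. clearbody A N.
  set (b := snd w / (2 * A t)) in *.
  assert (Inv : (/ (2 * ((A t, b) : C)))%C = ((A t / (2 * N t), - b / (2 * N t)) : C)).
  { rewrite NA. assert (P2 := pow2_ge_0 b). assert (0 < A t ^ 2) by (apply pow_lt; auto).
    apply injective_projections; simpl; field; nra. }
  rewrite Inv. split; cbn [fst snd]; [exact DA|].
  eapply is_derive_eq.
  - apply (is_derive_div (fun _ => snd w) (fun t => 2 * A t)); [apply @is_derive_const| |lra].
    apply is_derive_scal, DA.
  - unfold zero, b; simpl. field. lra.
Qed.

(** The model flow line is [G = x * A] with [x^2 = (s - d) + r], so [x * x - r] is the complex
    displacement [s - d]. The constants depend on the coefficients only through their bound [Mb],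
    hence not on the point at which the driver is expanded. Since [A = 2 i + x * a], one has [G^2 +
    4 r = x^2 * (x a) * (x a + 4 i) - 4 * (x^2 - r)], which gives the two terms inside [near]. *)
Lemma tip_approx n p Mb : exists G B r1, polyf G /\ 1 <= B /\ 0 < r1 <= / 4 /\
  forall c (s x : C) r, (forall i, Rabs (c i) <= Mb) -> Cmod s <= 1 -> 0 < fst x -> 0 < r <= r1 ->
    Cmod (x * x - r)%C <= r / 10 ->
    near (4 * Cmod (x * x - r)%C + B * (r * sqrt r)) r (G c s x) /\
    forall (xf : R -> C) t, xf t = x -> cder xf t (/ (2 * x))%C -> exists E,
      Cmod E <= B * r ^ p /\
      cder (fun t => G c s (xf t)) t (-2 / G c s x + Qpoly n c (s - x * x) + E)%C.
Proof.
  (* The order in [x] is [2 * p] because [x^2] is comparable to [r]. *)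
  destruct (tip_series n (2 * p)) as [A [A' [a [e [HA [HA' [Ha [He [D [EA ER]]]]]]]]]].
  destruct (pf_bound a Mb Ha) as [Ba [Ba0 Hba]]. destruct (pf_bound e Mb He) as [Be [Be0 Hbe]].
  (* This radius forces [|x * a| <= 6 / 10], hence [|A| >= 1]. *)
  set (r1 := Rmin (/ 4) (/ (4 * (Ba + 1) ^ 2))).
  assert (P1 : 0 < / (4 * (Ba + 1) ^ 2)) by (apply Rinv_0_lt_compat; assert (0 < (Ba + 1) ^ 2) by (apply pow_lt; lra); lra).
  assert (P2 : 0 < 2 ^ p) by (apply pow_lt; lra).
  exists (fun c s x => x * A c s x)%C, (1 + 2 * (Ba * (4 + Ba)) + 2 ^ p * Be), r1.
  split; [apply (pf_mul (fun _ _ x => x)); [apply pf_x|auto]|].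
  assert (Ba1 : 0 <= Ba * (4 + Ba)) by nra.
  assert (Be1 : 0 <= 2 ^ p * Be) by nra.
  split; [lra|].
  split; [split; [apply Rmin_pos; lra|apply Rmin_l]|].
  intros c s x r Hc Hs Hx Hr Hxr.
  assert (Sr := sqrt_lt_R0 r ltac:(lra)). assert (Sr2 := pow2_sqrt r ltac:(lra)).
  assert (Hr4 : r <= / 4) by (eapply Rle_trans; [apply Hr|apply Rmin_l]).
  assert (Hr5 : r <= / (4 * (Ba + 1) ^ 2)) by (eapply Rle_trans; [apply Hr|apply Rmin_r]).
  assert (Srb : sqrt r * (Ba + 1) <= / 2).
  { apply pow2_le_inv; [lra|]. rewrite Rpow_mult_distr, Sr2.
    assert (Q : 0 < (Ba + 1) ^ 2) by (apply pow_lt; lra).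
    apply Rle_trans with (/ (4 * (Ba + 1) ^ 2) * (Ba + 1) ^ 2); [apply Rmult_le_compat_r; lra|].
    right; field; lra. }
  assert (Sr12 : sqrt r <= / 2) by (apply pow2_le_inv; lra).
  assert (X2 : Cmod x ^ 2 <= 11 / 10 * r).
  { assert (Q := Cmod_lip (x * x)%C (RtoC r)). rewrite Cmod_mult, Cmod_R, (Rabs_right r) in Q by lra.
    apply Rabs_le_between in Q. simpl; lra. }
  assert (X0 := Cmod_ge_0 x).
  assert (X1 : Cmod x <= 11 / 10 * sqrt r) by (apply pow2_le_inv; [lra|]; rewrite Rpow_mult_distr, Sr2; lra).
  assert (X11 : Cmod x <= 1) by lra.
  assert (Rx : 9 / 10 * sqrt r <= fst x).
  { apply pow2_le_inv; [lra|]. rewrite Rpow_mult_distr, Sr2.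
    assert (Q := Rle_trans _ _ _ (Cmod_fst (x * x - r)%C) Hxr). simpl in Q. apply Rabs_le_between in Q.
    assert (Q2 := pow2_ge_0 (snd x)). lra. }
  specialize (Hba c s x Hc Hs X11). specialize (Hbe c s x Hc Hs X11). specialize (EA c s x).
  set (av := a c s x) in *. set (Av := A c s x) in *.
  assert (XA : Cmod (x * av)%C <= Cmod x * Ba) by (rewrite Cmod_mult; apply Rmult_le_compat_l; auto).
  assert (XB : Cmod x * Ba <= 6 / 10).
  { apply Rle_trans with (11 / 10 * sqrt r * Ba); [apply Rmult_le_compat_r; lra|]. nra. }
  assert (A1 : 1 <= Cmod Av).
  { assert (Q := Cmod_lip (2 * Ci)%C Av). rewrite Cmod_mult, Cmod_Ci, Cmod_R, (Rabs_right 2) in Q by lra.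
    replace (2 * Ci - Av)%C with (- (x * av))%C in Q by (rewrite EA; ring).
    rewrite Cmod_opp in Q. apply Rabs_le_between in Q. lra. }
  assert (NA : Av <> 0%C) by (intro Z; rewrite Z, Cmod_0 in A1; lra).
  assert (NX : x <> 0%C) by (intro Z; rewrite Z in Hx; simpl in Hx; lra).
  split.
  - split.
    + rewrite EA. replace (x * (2 * Ci + x * av))%C with (2 * Ci * x + x * (x * av))%C by ring.
      replace (snd (2 * Ci * x + x * (x * av))%C) with (2 * fst x + snd (x * (x * av))%C) by (simpl; ring).
      assert (Q := Cmod_snd (x * (x * av))%C). apply Rabs_le_between in Q.
      assert (Cmod (x * (x * av))%C <= 11 / 10 * sqrt r * (6 / 10)).
      { rewrite Cmod_mult. apply Rmult_le_compat; try apply Cmod_ge_0; lra. }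
      lra.
    + replace (x * Av * (x * Av) + 4 * r)%C with (x * x * ((x * av) * (x * av + 4 * Ci)) - 4 * (x * x - r))%C.
      2: { rewrite EA. assert (C2 : (Ci * Ci = - (1))%C) by (apply injective_projections; simpl; ring).
           transitivity (x * x * ((x * av) * (x * av + 4 * Ci)) + 4 * (Ci * Ci) * (x * x) + 4 * r)%C; [rewrite C2; ring|ring]. }
      unfold Cminus at 1. eapply Rle_trans; [apply Cmod_triangle|]. rewrite Cmod_opp.
      rewrite (Cmod_mult 4), Cmod_R, (Rabs_right 4) by lra.
      assert (Cmod (x * x * (x * av * (x * av + 4 * Ci)))%C <= 2 * (Ba * (4 + Ba)) * (r * sqrt r)).
      { assert (T : Cmod (x * av + 4 * Ci)%C <= Ba + 4).
        { eapply Rle_trans; [apply Cmod_triangle|]. rewrite (Cmod_mult 4), Cmod_Ci, Cmod_R, (Rabs_right 4) by lra.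
          assert (Cmod x * Ba <= 1 * Ba) by (apply Rmult_le_compat_r; lra). lra. }
        rewrite (Cmod_mult (x * x)), (Cmod_mult x x), (Cmod_mult (x * av)).
        replace (Cmod x * Cmod x) with (Cmod x ^ 2) by ring.
        apply Rle_trans with (11 / 10 * r * ((11 / 10 * sqrt r * Ba) * (Ba + 4))).
        - apply Rmult_le_compat; auto; [apply pow2_ge_0|apply Rmult_le_pos; apply Cmod_ge_0|].
          apply Rmult_le_compat; auto; try apply Cmod_ge_0.
          eapply Rle_trans; [exact XA|]. apply Rmult_le_compat_r; lra.
        - assert (0 <= (Ba * (4 + Ba)) * (r * sqrt r)) by (repeat apply Rmult_le_pos; lra). lra. }
      assert (0 <= r * sqrt r) by (apply Rmult_le_pos; lra).
      assert (0 <= (2 ^ p * Be) * (r * sqrt r)) by (apply Rmult_le_pos; lra). lra.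
  (* The residual of [tip_series] divided by [2 * x * A], the factor by which the flow equation was
     multiplied there. *)
  - intros xf t Ext Dx. exists (x ^ (2 * p) * e c s x / (2 * Av))%C. split.
    + rewrite Cmod_div by (apply Cmult_neq_0; auto; intro Z; apply (f_equal fst) in Z; simpl in Z; lra).
      rewrite (Cmod_mult (x ^ _)), (Cmod_mult 2), Cmod_pow, Cmod_R, (Rabs_right 2) by lra.
      rewrite pow_mult.
      assert (T : (Cmod x ^ 2) ^ p <= 2 ^ p * r ^ p).
      { rewrite <- Rpow_mult_distr. apply pow_incr. split; [apply pow2_ge_0|lra]. }
      assert (T0 : 0 <= (Cmod x ^ 2) ^ p) by (apply pow_le, pow2_ge_0).
      assert (T1 : 0 <= r ^ p) by (apply pow_le; lra).
      apply Rle_trans with ((2 ^ p * r ^ p) * Be * 1).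
      * unfold Rdiv. apply Rmult_le_compat; auto.
        -- apply Rmult_le_pos; auto using Cmod_ge_0.
        -- left; apply Rinv_0_lt_compat; lra.
        -- apply Rmult_le_compat; auto using Cmod_ge_0.
        -- rewrite <- Rinv_1. apply Rinv_le_contravar; lra.
      * assert (0 <= (1 + 2 * (Ba * (4 + Ba))) * r ^ p) by (apply Rmult_le_pos; lra). lra.
    + specialize (ER c s x). fold Av in ER.
      assert (Dm := cder_mult xf (fun t => A c s (xf t)) t _ _ Dx (D c s xf t _ Dx)).
      eapply cder_eq; [exact Dm|]. cbv beta. rewrite Ext. fold Av.
      set (Q := Qpoly n c (s - x * x)%C) in *. set (Av' := A' c s x) in *.
      rewrite Cpow_S in ER.
      assert (N2 : (2 : C) <> 0%C) by (intro Z; apply (f_equal fst) in Z; simpl in Z; lra).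
      transitivity ((Av * (Av + x * Av')) / (2 * x * Av))%C; [field; auto|].
      replace (Av * (Av + x * Av'))%C with (x * x ^ (2 * p) * e c s x - 4 + 2 * x * Av * Q)%C.
      2: { rewrite <- ER; ring. }
      rewrite RtoC_m2. field. auto.
Qed.

(** * Holomorphic dependence on parameters *)

(* Holomorphy is encoded by a Lipschitz difference quotient [F], which makes sense on any set
   [D] and is all that Cauchy's estimates need. *)
Definition holo_with (D : C -> Prop) (f : C -> C) (F : C -> C -> C) (K : R) : Prop :=
  0 <= K /\ (forall z, D z -> Cmod (f z) <= K) /\
  (forall z1 z2, D z1 -> D z2 -> (f z1 - f z2 = (z1 - z2) * F z1 z2)%C /\ Cmod (F z1 z2) <= K) /\
  (forall z1 z2 w1 w2, D z1 -> D z2 -> D w1 -> D w2 ->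
     Cmod (F z1 z2 - F w1 w2)%C <= K * (Cmod (z1 - w1)%C + Cmod (z2 - w2)%C)).

Definition holo (D : C -> Prop) (f : C -> C) : Prop := exists F K, holo_with D f F K.

Lemma holo_ext D f g : (forall z, D z -> f z = g z) -> holo D f -> holo D g.
Proof.
  intros E [F [K [H0 [H1 [H2 H3]]]]]. exists F, K. split; [auto|split; [|split; [|auto]]].
  - intros; rewrite <- E; auto.
  - intros; rewrite <- !E; auto.
Qed.

Lemma holo_const D k : holo D (fun _ => k).
Proof.
  exists (fun _ _ => 0%C), (Cmod k). split; [apply Cmod_ge_0|split; [intros; lra|split]].
  - intros; rewrite Cmod_0; split; [ring|apply Cmod_ge_0].
  - intros. replace (0 - 0)%C with (RtoC 0) by ring. rewrite Cmod_0.
    apply Rmult_le_pos; [apply Cmod_ge_0|]. assert (P := Cmod_ge_0 (z1 - w1)%C). assert (Q := Cmod_ge_0 (z2 - w2)%C). lra.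
Qed.

Lemma holo_id (D : C -> Prop) M : (forall z, D z -> Cmod z <= M) -> holo D (fun z => z).
Proof.
  intros H. exists (fun _ _ => 1%C), (Rabs M + 1). assert (P0 := Rabs_pos M). split; [lra|split; [|split]].
  - intros z Hz. assert (Q := Rle_abs M). specialize (H z Hz). lra.
  - intros; rewrite Cmod_1; split; [ring|lra].
  - intros. replace (1 - 1)%C with (RtoC 0) by ring. rewrite Cmod_0.
    apply Rmult_le_pos; [lra|]. assert (P := Cmod_ge_0 (z1 - w1)%C). assert (Q := Cmod_ge_0 (z2 - w2)%C). lra.
Qed.

Lemma holo_add D f g : holo D f -> holo D g -> holo D (fun z => f z + g z)%C.
Proof.
  intros [F [K [H0 [H1 [H2 H3]]]]] [G [K' [H0' [H1' [H2' H3']]]]].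
  exists (fun z w => F z w + G z w)%C, (K + K'). split; [lra|split; [|split]].
  - intros. eapply Rle_trans; [apply Cmod_triangle|]. apply Rplus_le_compat; auto.
  - intros z1 z2 D1 D2. destruct (H2 z1 z2 D1 D2) as [E B]. destruct (H2' z1 z2 D1 D2) as [E' B']. split.
    + transitivity ((f z1 - f z2) + (g z1 - g z2))%C; [ring|]. rewrite E, E'. ring.
    + eapply Rle_trans; [apply Cmod_triangle|]. lra.
  - intros. replace (F z1 z2 + G z1 z2 - (F w1 w2 + G w1 w2))%C with
      ((F z1 z2 - F w1 w2) + (G z1 z2 - G w1 w2))%C by ring.
    eapply Rle_trans; [apply Cmod_triangle|]. specialize (H3 z1 z2 w1 w2). specialize (H3' z1 z2 w1 w2).
    rewrite Rmult_plus_distr_r. apply Rplus_le_compat; auto.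
Qed.

Lemma holo_lip D f F K : holo_with D f F K -> forall z w, D z -> D w -> Cmod (f z - f w)%C <= K * Cmod (z - w)%C.
Proof.
  intros [H0 [H1 [H2 H3]]] z w Hz Hw. destruct (H2 z w Hz Hw) as [E B]. rewrite E, Cmod_mult, Rmult_comm.
  apply Rmult_le_compat_r; [apply Cmod_ge_0|auto].
Qed.

Lemma Cmod_mult_diff (a b c d : C) A B da db : Cmod a <= A -> Cmod d <= B ->
  Cmod (a - c)%C <= da -> Cmod (b - d)%C <= db -> Cmod (a * b - c * d)%C <= A * db + B * da.
Proof.
  intros. replace (a * b - c * d)%C with (a * (b - d) + d * (a - c))%C by ring.
  eapply Rle_trans; [apply Cmod_triangle|]. rewrite !Cmod_mult.
  apply Rplus_le_compat; apply Rmult_le_compat; auto using Cmod_ge_0.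
Qed.

Lemma holo_mul D f g : holo D f -> holo D g -> holo D (fun z => f z * g z)%C.
Proof.
  intros [F [K HF]] [G [K' HG]].
  assert (LF := holo_lip _ _ _ _ HF). assert (LG := holo_lip _ _ _ _ HG).
  destruct HF as [H0 [H1 [H2 H3]]]. destruct HG as [H0' [H1' [H2' H3']]].
  exists (fun z w => F z w * g z + f w * G z w)%C, (4 * K * K').
  assert (PK : 0 <= K * K') by (apply Rmult_le_pos; auto).
  split; [lra|split; [|split]].
  - intros. rewrite Cmod_mult. apply Rle_trans with (K * K'); [|lra]. apply Rmult_le_compat; auto using Cmod_ge_0.
  - intros z1 z2 D1 D2. destruct (H2 z1 z2 D1 D2) as [E B]. destruct (H2' z1 z2 D1 D2) as [E' B']. split.
    + transitivity ((f z1 - f z2) * g z1 + f z2 * (g z1 - g z2))%C; [ring|]. rewrite E, E'. ring.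
    + eapply Rle_trans; [apply Cmod_triangle|]. rewrite !Cmod_mult.
      assert (Cmod (F z1 z2) * Cmod (g z1) <= K * K') by (apply Rmult_le_compat; auto using Cmod_ge_0).
      assert (Cmod (f z2) * Cmod (G z1 z2) <= K * K') by (apply Rmult_le_compat; auto using Cmod_ge_0).
      lra.
  - intros z1 z2 w1 w2 Z1 Z2 W1 W2.
    replace (F z1 z2 * g z1 + f z2 * G z1 z2 - (F w1 w2 * g w1 + f w2 * G w1 w2))%C with
      ((F z1 z2 * g z1 - F w1 w2 * g w1) + (f z2 * G z1 z2 - f w2 * G w1 w2))%C by ring.
    eapply Rle_trans; [apply Cmod_triangle|].
    assert (A1 := Cmod_mult_diff (F z1 z2) (g z1) (F w1 w2) (g w1) _ _ _ _ (proj2 (H2 _ _ Z1 Z2)) (H1' _ W1)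
      (H3 _ _ _ _ Z1 Z2 W1 W2) (LG _ _ Z1 W1)).
    assert (A2 := Cmod_mult_diff (f z2) (G z1 z2) (f w2) (G w1 w2) _ _ _ _ (H1 _ Z2) (proj2 (H2' _ _ W1 W2))
      (LF _ _ Z2 W2) (H3' _ _ _ _ Z1 Z2 W1 W2)).
    assert (P := Cmod_ge_0 (z1 - w1)%C). assert (Q := Cmod_ge_0 (z2 - w2)%C).
    assert (0 <= K * K' * Cmod (z1 - w1)%C) by (apply Rmult_le_pos; auto).
    assert (0 <= K * K' * Cmod (z2 - w2)%C) by (apply Rmult_le_pos; auto). lra.
Qed.

Lemma holo_comp (D E : C -> Prop) f g : holo D f -> holo E g -> (forall z, D z -> E (f z)) ->
  holo D (fun z => g (f z)).
Proof.
  intros [F [K HF]] [G [K' HG]] DE.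
  assert (LF := holo_lip _ _ _ _ HF).
  destruct HF as [H0 [H1 [H2 H3]]]. destruct HG as [H0' [H1' [H2' H3']]].
  exists (fun z w => G (f z) (f w) * F z w)%C, (K' + 2 * K * K' + K' * K * K).
  assert (PK : 0 <= K * K') by (apply Rmult_le_pos; auto).
  assert (PK2 : 0 <= K' * K * K) by (repeat apply Rmult_le_pos; auto).
  assert (PK3 : 0 <= K' * K) by (apply Rmult_le_pos; auto).
  split; [lra|split; [|split]].
  - intros z Hz. specialize (H1' (f z) (DE z Hz)). lra.
  - intros z1 z2 D1 D2. destruct (H2 z1 z2 D1 D2) as [Ef B].
    destruct (H2' (f z1) (f z2) (DE _ D1) (DE _ D2)) as [E' B']. split.
    + rewrite E', Ef. ring.
    + rewrite Cmod_mult. assert (Cmod (G (f z1) (f z2)) * Cmod (F z1 z2) <= K' * K)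
        by (apply Rmult_le_compat; auto using Cmod_ge_0). lra.
  - intros z1 z2 w1 w2 Z1 Z2 W1 W2.
    assert (B1 := proj2 (H2' (f z1) (f z2) (DE _ Z1) (DE _ Z2))).
    assert (B2 := H3' (f z1) (f z2) (f w1) (f w2) (DE _ Z1) (DE _ Z2) (DE _ W1) (DE _ W2)).
    assert (A1 := Cmod_mult_diff (G (f z1) (f z2)) (F z1 z2) (G (f w1) (f w2)) (F w1 w2) _ _ _ _ B1 (proj2 (H2 _ _ W1 W2))
      B2 (H3 _ _ _ _ Z1 Z2 W1 W2)).
    assert (L1 := LF _ _ Z1 W1). assert (L2 := LF _ _ Z2 W2).
    assert (P := Cmod_ge_0 (z1 - w1)%C). assert (Q := Cmod_ge_0 (z2 - w2)%C).
    set (x := Cmod (z1 - w1)%C) in *. set (y := Cmod (z2 - w2)%C) in *.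
    assert (T : K * (K' * (Cmod (f z1 - f w1)%C + Cmod (f z2 - f w2)%C)) <= K * (K' * (K * x + K * y))).
    { apply Rmult_le_compat_l; auto. apply Rmult_le_compat_l; auto. lra. }
    assert (0 <= K' * (x + y)) by (apply Rmult_le_pos; lra).
    assert (0 <= K * K' * (x + y)) by (apply Rmult_le_pos; lra). lra.
Qed.

Lemma holo_polyf D f c s x : polyf f -> holo D s -> holo D x -> holo D (fun z => f c (s z) (x z)).
Proof.
  intros Hf Hs Hx. induction Hf.
  - apply holo_const.
  - apply holo_const.
  - auto.
  - auto.
  - now apply holo_add.
  - now apply holo_mul.
Qed.

Lemma Csqrt_sum_low (u v : C) c : 0 < c -> c <= fst u -> c <= fst v ->
  sqrt c <= Cmod (csqrt u + csqrt v)%C /\ csqrt u <> (- csqrt v)%C.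
Proof.
  intros Hc Hu Hv.
  assert (L : forall u : C, c <= fst u -> sqrt c <= fst (csqrt u)).
  { intros w Hw. unfold csqrt; cbn [fst]. apply sqrt_le_1_alt.
    assert (Q := Cmod_fst w). assert (Q2 := Rle_abs (fst w)). lra. }
  assert (Lu := L u Hu). assert (Lv := L v Hv). assert (S := sqrt_lt_R0 c Hc).
  split.
  - eapply Rle_trans; [|apply Cmod_fst]. eapply Rle_trans; [|apply Rle_abs]. cbn [fst Cplus]. lra.
  - intro E. apply (f_equal fst) in E. cbn [fst Copp] in E. lra.
Qed.

Lemma csqrt_diff (u v : C) : 0 < fst u -> 0 < fst v ->
  (csqrt u - csqrt v = (u - v) * / (csqrt u + csqrt v))%C.
Proof.
  intros Hu Hv. destruct (csqrt_spec u Hu) as [Su Eu]. destruct (csqrt_spec v Hv) as [Sv Ev].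
  assert (N : (csqrt u + csqrt v)%C <> 0%C).
  { intro E; apply (f_equal fst) in E. cbn [fst Cplus RtoC] in E. lra. }
  rewrite <- Eu at 2. rewrite <- Ev at 2. field; auto.
Qed.

(** The difference quotient is [1 / (csqrt u + csqrt v)]; real parts at least [c] keep its
    denominator above [sqrt c]. *)
Lemma holo_csqrt (D : C -> Prop) c M : 0 < c -> (forall z, D z -> c <= fst z /\ Cmod z <= M) -> holo D csqrt.
Proof.
  intros Hc HD. assert (S := sqrt_lt_R0 c Hc). set (q := sqrt c) in *.
  assert (Iq : 0 < / q) by now apply Rinv_0_lt_compat.
  assert (Low : forall u v, D u -> D v -> q <= Cmod (csqrt u + csqrt v)%C /\ (csqrt u + csqrt v)%C <> 0%C).
  { intros u v Hu Hv. destruct (Csqrt_sum_low u v c Hc (proj1 (HD u Hu)) (proj1 (HD v Hv))) as [A B].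
    split; auto. intro E. apply B. replace (csqrt u) with (csqrt u + csqrt v - csqrt v)%C by ring. rewrite E; ring. }
  assert (Bd : forall u v, D u -> D v -> Cmod (/ (csqrt u + csqrt v))%C <= / q).
  { intros u v Hu Hv. destruct (Low u v Hu Hv) as [A B]. rewrite Cmod_inv by auto. apply Rinv_le_contravar; auto. }
  assert (Lip : forall u v, D u -> D v -> Cmod (csqrt u - csqrt v)%C <= / q * Cmod (u - v)%C).
  { intros u v Hu Hv. rewrite csqrt_diff by (eapply Rlt_le_trans; [exact Hc|apply HD; auto]).
    rewrite Cmod_mult, Rmult_comm. apply Rmult_le_compat_r; [apply Cmod_ge_0|auto]. }
  exists (fun u v => / (csqrt u + csqrt v))%C, (/ q + Rabs M + 1 + / q * / q * / q).
  assert (I3 : 0 < / q * / q * / q) by (repeat apply Rmult_lt_0_compat; auto).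
  assert (PM := Rabs_pos M). split; [lra|split; [|split]].
  - intros z Hz. assert (Hz2 := HD z Hz). assert (RM := Rle_abs M).
    assert (E := f_equal Cmod (proj2 (csqrt_spec z ltac:(lra)))). rewrite Cmod_mult in E.
    apply Rle_trans with (Rabs M + 1); [|lra]. apply Rnot_lt_le; intro K. nra.
  - intros z1 z2 D1 D2. split.
    + apply csqrt_diff; eapply Rlt_le_trans; try exact Hc; apply HD; auto.
    + eapply Rle_trans; [apply Bd; auto|]. lra.
  - intros z1 z2 w1 w2 Z1 Z2 W1 W2.
    destruct (Low z1 z2 Z1 Z2) as [_ N1]. destruct (Low w1 w2 W1 W2) as [_ N2].
    replace (/ (csqrt z1 + csqrt z2) - / (csqrt w1 + csqrt w2))%C with
      (- (/ (csqrt z1 + csqrt z2) * / (csqrt w1 + csqrt w2) * ((csqrt z1 - csqrt w1) + (csqrt z2 - csqrt w2))))%C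
      by (field; auto).
    rewrite Cmod_opp, !Cmod_mult.
    assert (T : Cmod (csqrt z1 - csqrt w1 + (csqrt z2 - csqrt w2))%C <= / q * (Cmod (z1 - w1)%C + Cmod (z2 - w2)%C)).
    { eapply Rle_trans; [apply Cmod_triangle|]. rewrite Rmult_plus_distr_l. apply Rplus_le_compat; auto. }
    apply Rle_trans with (/ q * / q * (/ q * (Cmod (z1 - w1)%C + Cmod (z2 - w2)%C))).
    + apply Rmult_le_compat; auto using Cmod_ge_0.
      * apply Rmult_le_pos; apply Cmod_ge_0.
      * apply Rmult_le_compat; auto using Cmod_ge_0.
    + rewrite <- Rmult_assoc. apply Rmult_le_compat_r; [|lra].
      assert (P := Cmod_ge_0 (z1 - w1)%C). assert (Q := Cmod_ge_0 (z2 - w2)%C). lra.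
Qed.

Lemma linear_bound (y A B : R -> C) K be a b : a <= b -> 0 <= K ->
  (forall t, a <= t <= b -> cder y t (A t * y t + B t)%C) ->
  (forall t, a <= t <= b -> Cmod (A t) <= K) -> (forall t, a <= t <= b -> Cmod (B t) <= be) ->
  Cmod (y b) <= (Cmod (y a) + be * (b - a)) * exp (K * (b - a)).
Proof.
  intros ab HK D HA HB.
  assert (Hbe : 0 <= be) by (eapply Rle_trans; [apply Cmod_ge_0|apply (HB a); lra]).
  assert (G := growth_weighted y A B (fun t => exp (- K * (t - a))) (fun t => - K * exp (- K * (t - a)))
    (fun t => be * t) (fun t => be) a b ab D).
  cbv beta in G. rewrite (Rminus_diag a), Rmult_0_r, exp_0 in G.
  assert (G' : exp (- K * (b - a)) * Cmod (y b) <= 1 * Cmod (y a) + (be * b - be * a)).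
  { apply G.
    - intros; apply is_derive_exp_lin.
    - intros; apply exp_pos.
    - intros t Ht. rewrite (Rmult_comm (- K)), <- Rmult_plus_distr_l.
      apply Rmult_le_0_l; [left; apply exp_pos|].
      assert (Q := Rle_trans _ _ _ (Rle_abs _) (Rle_trans _ _ _ (Cmod_fst (A t)) (HA t Ht))). lra.
    - intros; auto_derive; auto; ring.
    - intros t Ht. apply Rle_trans with (1 * Cmod (B t)); [|rewrite Rmult_1_l; auto].
      apply Rmult_le_compat_r; [apply Cmod_ge_0|]. rewrite <- exp_0. apply exp_mono. nra. }
  apply Rmult_le_reg_l with (exp (- K * (b - a))); [apply exp_pos|].
  eapply Rle_trans; [apply G'|].
  rewrite (Rmult_comm (exp _)), Rmult_assoc, <- exp_plus.
  replace (K * (b - a) + - K * (b - a)) with 0 by ring. rewrite exp_0; lra.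
Qed.

Lemma ccont_mult f g t : ccont f t -> ccont g t -> ccont (fun x => f x * g x)%C t.
Proof.
  intros [A B] [D E]; split; simpl.
  - apply @continuous_minus; apply @continuous_mult; auto.
  - apply @continuous_plus; apply @continuous_mult; auto.
Qed.

(** Freezing the coefficient before time [a] makes it bounded and continuous on the whole line, as
    [picard] demands. *)
Lemma linear_solution (c : R -> C) K a : 0 < K ->
  (forall t, a <= t -> ccont c t) -> (forall t, a <= t -> Cmod (c t) <= K) ->
  exists P : R -> C, P a = 1%C /\ forall t, a <= t -> cder P t (c t * P t)%C.
Proof.
  intros HK Cc Bc. set (c' := fun t => c (Rmax a t)).
  assert (Cc' : forall t, ccont c' t).
  { intros t. assert (Lip : forall y, Rabs (Rmax a y - Rmax a t) <= Rabs (y - t)).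
    { intros y. rewrite !(Rmax_comm a). apply Rmax_lip. }
    assert (Cm : continuous (fun t => Rmax a t) t).
    { apply continuous_eps. intros e He. exists e; split; auto. intros y Hy. eapply Rle_lt_trans; [apply Lip|auto]. }
    destruct (Cc (Rmax a t) (Rmax_l _ _)) as [C1 C2]. split.
    - apply (continuous_comp (fun t => Rmax a t) (fun t => fst (c t))); auto.
    - apply (continuous_comp (fun t => Rmax a t) (fun t => snd (c t))); auto. }
  destruct (picard (fun t w => c' t * w)%C K K a 1%C HK) as [P [P0 HP]].
  - intros t w w'. replace (c' t * w - c' t * w')%C with (c' t * (w - w'))%C by ring.
    rewrite Cmod_mult. apply Rmult_le_compat_r; [apply Cmod_ge_0|]. apply Bc, Rmax_l.
  - intros t. rewrite Cmult_1_r. apply Bc, Rmax_l.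
  - intros w Hw t. now apply ccont_mult.
  - exists P; split; auto. intros t Ht. specialize (HP t). unfold c' in HP. now rewrite Rmax_right in HP.
Qed.

(** * Holomorphy of the flow in its starting point *)

Section FlowHolo.
Variables (xi xi' : R -> R).
Hypothesis Dxi : forall t, is_derive xi t (xi' t).

(** The quotient [P = (Phi z1 - Phi z2) / (z1 - z2)] satisfies [P' = 2 / (Z1 * Z2) * P] with
    [P a = 1]. Defining [P] by this linear equation covers [z1 = z2] as well, and its Lipschitz
    dependence on the two points follows from that of the coefficient. *)
Lemma flow_holo (Phi : C -> R -> C) a b y0 M : a <= b -> 0 < y0 ->
  (forall z, 0 < snd z -> Phi z a = z /\ forall r, a <= r -> bl xi (Phi z) r) ->
  holo (fun z => y0 <= snd z /\ Cmod z <= M) (fun z => Phi z b).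
Proof.
  intros ab Hy HP. set (D := fun z : C => y0 <= snd z /\ Cmod z <= M).
  assert (P0 : forall z, D z -> Phi z a = z) by (intros z [Hz _]; apply HP; lra).
  assert (P1 : forall z r, D z -> a <= r -> bl xi (Phi z) r) by (intros z r [Hz _] Hr; apply HP; lra).
  assert (Low : forall z r, D z -> a <= r -> y0 <= Cmod (Phi z r - xi r)%C).
  { intros z r Hz Hr. assert (Q := bl_Y_mono xi (Phi z) a r Hr ltac:(intros; apply P1; auto; lra)).
    rewrite P0 in Q by auto. eapply Rle_trans; [|apply Cmod_snd]. eapply Rle_trans; [|apply Rle_abs].
    simpl. destruct Hz. lra. }
  assert (Nz : forall z r, D z -> a <= r -> (Phi z r - xi r)%C <> 0%C) by (intros; apply bl_nonzero; auto).
  set (co := fun z1 z2 r => (2 / ((Phi z1 r - xi r) * (Phi z2 r - xi r)))%C).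
  set (K := 2 / y0 ^ 2). assert (Hy2 : 0 < y0 ^ 2) by (apply pow_lt; auto).
  assert (HK : 0 < K) by (apply Rdiv_lt_0_compat; lra).
  assert (Bco : forall z1 z2 r, D z1 -> D z2 -> a <= r -> Cmod (co z1 z2 r) <= K).
  { intros z1 z2 r D1 D2 Hr. unfold co, K.
    rewrite Cmod_div, Cmod_mult, Cmod_R, Rabs_right by (try lra; apply Cmult_neq_0; auto).
    apply Rmult_le_compat_l; [lra|]. apply Rinv_le_contravar; auto.
    replace (y0 ^ 2) with (y0 * y0) by ring. apply Rmult_le_compat; auto; lra. }
  assert (Cco : forall z1 z2 r, D z1 -> D z2 -> a <= r -> ccont (co z1 z2) r).
  { intros z1 z2 r D1 D2 Hr. unfold co.
    assert (DZ : forall z, D z -> cder (fun r => Phi z r - xi r)%C r (-2 / (Phi z r - xi r) - xi' r)%C).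
    { intros z Hz. apply cder_minus; [apply P1; auto|now apply cder_RtoC]. }
    eapply cder_ccont. apply cder_mult; [apply cder_const|]. apply cder_inv.
    - apply Cmult_neq_0; auto.
    - apply cder_mult; apply DZ; auto. }
  assert (ExP : forall p : C * C, exists P : R -> C, D (fst p) -> D (snd p) ->
     P a = 1%C /\ forall r, a <= r -> cder P r (co (fst p) (snd p) r * P r)%C).
  { intros [z1 z2]. destruct (Classical_Prop.classic (D z1 /\ D z2)) as [[D1 D2]|N].
    - destruct (linear_solution (co z1 z2) K a HK) as [P HPP]; auto. exists P; auto.
    - exists (fun _ => 0%C). simpl. tauto. }
  apply fun_choice in ExP. destruct ExP as [P HPP].
  set (E := exp (K * (b - a))). assert (HE : 0 < E) by apply exp_pos.
  assert (Ba : 0 <= b - a) by lra.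
  assert (PB : forall z1 z2 r, D z1 -> D z2 -> a <= r <= b -> Cmod (P (z1, z2) r) <= E).
  { intros z1 z2 r D1 D2 Hr. destruct (HPP (z1, z2) D1 D2) as [E0 DP]. cbn [fst snd] in DP.
    assert (Q := linear_bound (P (z1, z2)) (co z1 z2) (fun _ => 0%C) K 0 a r ltac:(lra) ltac:(lra)
      ltac:(intros; eapply cder_eq; [apply DP; lra|ring]) ltac:(intros; apply Bco; auto; lra)
      ltac:(intros; cbv beta; rewrite Cmod_0; lra)).
    rewrite E0, Cmod_1 in Q. eapply Rle_trans; [apply Q|].
    rewrite Rmult_0_l, Rplus_0_r, Rmult_1_l. apply exp_mono. apply Rmult_le_compat_l; lra. }
  assert (Lip : forall z w r, D z -> D w -> a <= r <= b -> Cmod (Phi z r - Phi w r)%C <= E * Cmod (z - w)%C).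
  { intros z w r Hz Hw Hr.
    assert (Q := linear_bound (fun r => Phi z r - Phi w r)%C (co z w) (fun _ => 0%C) K 0 a r ltac:(lra) ltac:(lra)
      ltac:(intros; apply bl_diff; apply P1; auto; lra) ltac:(intros; apply Bco; auto; lra)
      ltac:(intros; cbv beta; rewrite Cmod_0; lra)).
    cbv beta in Q. rewrite !P0, Rmult_0_l, Rplus_0_r in Q by auto. eapply Rle_trans; [apply Q|].
    rewrite Rmult_comm. apply Rmult_le_compat_r; [apply Cmod_ge_0|]. apply exp_mono. apply Rmult_le_compat_l; lra. }
  set (K2 := 2 / y0 ^ 3). assert (Hy3 : 0 < y0 ^ 3) by (apply pow_lt; auto).
  assert (HK2 : 0 < K2) by (apply Rdiv_lt_0_compat; lra).
  set (G := E + K2 * E * E * (b - a) * E + Rabs M + 2 / y0 * (b - a)).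
  assert (G1 : 0 <= K2 * E * E * (b - a) * E).
  { apply Rmult_le_pos; [apply Rmult_le_pos; [apply Rmult_le_pos; [apply Rmult_le_pos|]|]|]; lra. }
  assert (G2 := Rabs_pos M).
  assert (G3 : 0 <= 2 / y0 * (b - a)) by (apply Rmult_le_pos; [apply Rdiv_le_0_compat|]; lra).
  exists (fun z w => P (z, w) b), G. split; [unfold G; lra|split; [|split]].
  - intros z Hz.
    assert (Q := linear_bound (Phi z) (fun _ => 0%C) (fun r => (-2 / (Phi z r - xi r))%C) 0 (2 / y0) a b ab
      (Rle_refl 0)
      ltac:(intros; eapply cder_eq; [apply P1; auto; lra|ring]) ltac:(intros; cbv beta; rewrite Cmod_0; lra)).
    rewrite Rmult_0_l, exp_0, Rmult_1_r, P0 in Q by auto.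
    assert (Q' : Cmod (Phi z b) <= Cmod z + 2 / y0 * (b - a)).
    { apply Q. intros r Hr. rewrite RtoC_m2, Cmod_div, Cmod_opp, Cmod_R, Rabs_right by (try lra; apply Nz; auto; lra).
      apply Rmult_le_compat_l; [lra|]. apply Rinv_le_contravar; [lra|apply Low; auto; lra]. }
    destruct Hz as [_ Hz]. assert (RM := Rle_abs M). unfold G. lra.
  - intros z1 z2 D1 D2. destruct (HPP (z1, z2) D1 D2) as [E0 DP]. cbn [fst snd] in DP. split.
    + assert (Q := linear_bound (fun r => (Phi z1 r - Phi z2 r) - (z1 - z2) * P (z1, z2) r)%C (co z1 z2) (fun _ => 0%C)
        K 0 a b ab ltac:(lra)).
      cbv beta in Q. rewrite !P0, E0, Rmult_0_l, Rplus_0_r in Q by auto.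
      replace (z1 - z2 - (z1 - z2) * 1)%C with (RtoC 0) in Q by ring. rewrite Cmod_0, Rmult_0_l in Q.
      assert (Z : Cmod (Phi z1 b - Phi z2 b - (z1 - z2) * P (z1, z2) b)%C = 0).
      { apply Rle_antisym; [|apply Cmod_ge_0]. apply Q.
        - intros t Ht. eapply cder_eq.
          + apply cder_minus; [apply bl_diff; apply P1; auto; lra|].
            apply cder_mult; [apply cder_const|apply DP; lra].
          + change (2 / ((Phi z1 t - xi t) * (Phi z2 t - xi t)))%C with (co z1 z2 t). cbv beta; ring.
        - intros; apply Bco; auto; lra.
        - intros; cbv beta; rewrite ?Cmod_0; lra. }
      apply Cmod_eq_0 in Z.
      replace (Phi z1 b - Phi z2 b)%C with (Phi z1 b - Phi z2 b - (z1 - z2) * P (z1, z2) b + (z1 - z2) * P (z1, z2) b)%C by ring.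
      rewrite Z; ring.
    + assert (Q := PB z1 z2 b D1 D2 ltac:(lra)). unfold G; lra.
  - intros z1 z2 w1 w2 Z1 Z2 W1 W2.
    destruct (HPP (z1, z2) Z1 Z2) as [E0 DP]. destruct (HPP (w1, w2) W1 W2) as [E0' DP']. cbn [fst snd] in *.
    set (dd := Cmod (z1 - w1)%C + Cmod (z2 - w2)%C).
    assert (Hdd : 0 <= dd) by (assert (Q1 := Cmod_ge_0 (z1 - w1)%C); assert (Q2 := Cmod_ge_0 (z2 - w2)%C); unfold dd; lra).
    assert (Dc : forall r, a <= r <= b -> Cmod (co z1 z2 r - co w1 w2 r)%C <= K2 * (E * dd)).
    { intros r Hr. unfold co.
      assert (N1 := Nz z1 r Z1 ltac:(lra)). assert (N2 := Nz z2 r Z2 ltac:(lra)).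
      assert (N3 := Nz w1 r W1 ltac:(lra)). assert (N4 := Nz w2 r W2 ltac:(lra)).
      assert (L1 := Low z1 r Z1 ltac:(lra)). assert (L2 := Low z2 r Z2 ltac:(lra)).
      assert (L3 := Low w1 r W1 ltac:(lra)). assert (L4 := Low w2 r W2 ltac:(lra)).
      assert (Q1 := Lip z1 w1 r Z1 W1 Hr). assert (Q2 := Lip z2 w2 r Z2 W2 Hr).
      replace (Phi z1 r - Phi w1 r)%C with ((Phi z1 r - xi r) - (Phi w1 r - xi r))%C in Q1 by ring.
      replace (Phi z2 r - Phi w2 r)%C with ((Phi z2 r - xi r) - (Phi w2 r - xi r))%C in Q2 by ring.
      set (u1 := (Phi z1 r - xi r)%C) in *. set (u2 := (Phi z2 r - xi r)%C) in *.
      set (v1 := (Phi w1 r - xi r)%C) in *. set (v2 := (Phi w2 r - xi r)%C) in *.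
      replace (2 / (u1 * u2) - 2 / (v1 * v2))%C with
        (- (2 * (/ u1 * / v1 * / u2 * (u1 - v1) + / v1 * / u2 * / v2 * (u2 - v2))))%C by (field; auto).
      rewrite Cmod_opp, Cmod_mult, Cmod_R, (Rabs_right 2) by lra.
      assert (Bi : forall u : C, u <> 0%C -> y0 <= Cmod u -> Cmod (/ u)%C <= / y0).
      { intros u Nu Lu. rewrite Cmod_inv by auto. apply Rinv_le_contravar; auto. }
      assert (Iy : 0 < / y0) by now apply Rinv_0_lt_compat.
      assert (B3 : forall u v w : C, u <> 0%C -> v <> 0%C -> w <> 0%C -> y0 <= Cmod u -> y0 <= Cmod v -> y0 <= Cmod w ->
        forall x X, Cmod x <= X -> Cmod (/ u * / v * / w * x)%C <= / y0 ^ 3 * X).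
      { intros u v w Nu Nv Nw Lu Lv Lw x X HX. rewrite !Cmod_mult.
        replace (/ y0 ^ 3) with (/ y0 * / y0 * / y0) by (field; lra).
        apply Rmult_le_compat; auto using Cmod_ge_0; [repeat apply Rmult_le_pos; apply Cmod_ge_0|].
        apply Rmult_le_compat; auto using Cmod_ge_0; [apply Rmult_le_pos; apply Cmod_ge_0|].
        apply Rmult_le_compat; auto using Cmod_ge_0. }
      unfold K2, dd. eapply Rle_trans; [apply Rmult_le_compat_l; [lra|apply Cmod_triangle]|].
      assert (T1 := B3 u1 v1 u2 N1 N3 N2 L1 L3 L2 _ _ Q1).
      assert (T2 := B3 v1 u2 v2 N3 N2 N4 L3 L2 L4 _ _ Q2).
      unfold Rdiv. lra. }
    assert (Q := linear_bound (fun r => P (z1, z2) r - P (w1, w2) r)%C (co z1 z2)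
      (fun r => (co z1 z2 r - co w1 w2 r) * P (w1, w2) r)%C K (K2 * (E * dd) * E) a b ab ltac:(lra)).
    cbv beta in Q. rewrite E0, E0' in Q. replace (1 - 1)%C with (RtoC 0) in Q by ring. rewrite Cmod_0, Rplus_0_l in Q.
    fold E in Q. eapply Rle_trans; [apply Q|].
    + intros t Ht. eapply cder_eq; [apply cder_minus; [apply DP|apply DP']; lra|]. ring.
    + intros; apply Bco; auto; lra.
    + intros t Ht. rewrite Cmod_mult. apply Rmult_le_compat; auto using Cmod_ge_0.
    + replace (K2 * (E * dd) * E * (b - a) * E) with (K2 * E * E * (b - a) * E * dd) by ring.
      apply Rmult_le_compat_r; auto. unfold G; lra.
Qed.

End FlowHolo.

(** * Cauchy's estimates *)

Lemma cder_eps_inv (p : R -> C) t l : cder p t l -> forall e, 0 < e -> exists d, 0 < d /\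
  forall y, Rabs (y - t) < d -> Cmod (p y - p t - RtoC (y - t) * l)%C <= e * Rabs (y - t).
Proof.
  intros [A B] e He.
  assert (K : forall (f : R -> R) l, is_derive f t l -> exists d, 0 < d /\
    forall y, Rabs (y - t) < d -> Rabs (f y - f t - (y - t) * l) <= e / 2 * Rabs (y - t)).
  { intros f l0 H. apply is_derive_Reals in H. destruct (H (e / 2)) as [d Hd]; [lra|].
    exists d; split; [apply cond_pos|]. intros y Hy.
    destruct (Req_dec (y - t) 0) as [Z|Z].
    { replace y with t by lra. replace (f t - f t - (t - t) * l0) with 0 by ring. replace (t - t) with 0 by ring.
      rewrite Rabs_R0. lra. }
    specialize (Hd (y - t) Z Hy). replace (t + (y - t)) with y in Hd by ring.
    replace (f y - f t - (y - t) * l0) with (((f y - f t) / (y - t) - l0) * (y - t)) by (field; auto).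
    rewrite Rabs_mult. apply Rmult_le_compat_r; [apply Rabs_pos|lra]. }
  destruct (K _ _ A) as [d1 [P1 Q1]]. destruct (K _ _ B) as [d2 [P2 Q2]].
  exists (Rmin d1 d2); split; [now apply Rmin_pos|]. intros y Hy.
  specialize (Q1 y (Rlt_le_trans _ _ _ Hy (Rmin_l _ _))).
  specialize (Q2 y (Rlt_le_trans _ _ _ Hy (Rmin_r _ _))). cbv beta in Q1, Q2.
  eapply Rle_trans; [apply Cmod_le_sum|]. simpl.
  replace (fst (p y) + - fst (p t) + - ((y - t) * fst l - 0 * snd l)) with (fst (p y) - fst (p t) - (y - t) * fst l) by ring.
  replace (snd (p y) + - snd (p t) + - ((y - t) * snd l + 0 * fst l)) with (snd (p y) - snd (p t) - (y - t) * snd l) by ring.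
  lra.
Qed.

Lemma cder_eps (p : R -> C) t l :
  (forall e, 0 < e -> exists d, 0 < d /\
    forall y, Rabs (y - t) < d -> Cmod (p y - p t - RtoC (y - t) * l)%C <= e * Rabs (y - t)) -> cder p t l.
Proof.
  intros H. split; apply is_derive_eps; intros e He; destruct (H e He) as [d [Hd Hy]]; exists d; split; auto;
    intros y Hyt; specialize (Hy y Hyt); (eapply Rle_trans; [|exact Hy]).
  - eapply Rle_trans; [|apply Cmod_fst]. simpl. right; f_equal; ring.
  - eapply Rle_trans; [|apply Cmod_snd]. simpl. right; f_equal; ring.
Qed.

(** The complex derivative of [f] is the diagonal value of the difference quotient. *)
Lemma holo_chain D f F K (p : R -> C) t l : holo_with D f F K -> (forall y, D (p y)) -> cder p t l ->
  cder (fun y => f (p y)) t (l * F (p t) (p t))%C.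
Proof.
  intros [H0 [_ [H2 H3]]] Dp Hp. apply cder_eps. intros e He.
  set (M := Cmod l + 1). assert (M0 := Cmod_ge_0 l).
  destruct (cder_eps_inv p t l Hp (Rmin 1 (e / (2 * (K + 1))))) as [d1 [P1 Q1]].
  { apply Rmin_pos; [lra|]. apply Rdiv_lt_0_compat; lra. }
  set (d2 := e / (2 * (K + 1) * (M * M))).
  assert (HM : 0 < M * M) by (unfold M; apply Rmult_lt_0_compat; lra).
  assert (Hd2 : 0 < d2) by (apply Rdiv_lt_0_compat; [lra|]; repeat apply Rmult_lt_0_compat; try lra; unfold M; lra).
  exists (Rmin d1 d2). split; [now apply Rmin_pos|]. intros y Hy.
  specialize (Q1 y (Rlt_le_trans _ _ _ Hy (Rmin_l _ _))).
  assert (Y2 := Rlt_le_trans _ _ _ Hy (Rmin_r _ _)).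
  set (h := Rabs (y - t)) in *. assert (Hh : 0 <= h) by apply Rabs_pos.
  destruct (H2 (p y) (p t) (Dp y) (Dp t)) as [E B]. rewrite E.
  assert (R1 : Cmod (p y - p t)%C <= M * h).
  { replace (p y - p t)%C with ((p y - p t - RtoC (y - t) * l) + RtoC (y - t) * l)%C by ring.
    eapply Rle_trans; [apply Cmod_triangle|]. rewrite (Cmod_mult (RtoC _)), Cmod_R. fold h.
    assert (Rmin 1 (e / (2 * (K + 1))) * h <= 1 * h) by (apply Rmult_le_compat_r; [auto|apply Rmin_l]).
    unfold M. lra. }
  replace ((p y - p t) * F (p y) (p t) - RtoC (y - t) * (l * F (p t) (p t)))%C with
    ((p y - p t - RtoC (y - t) * l) * F (p y) (p t) + RtoC (y - t) * l * (F (p y) (p t) - F (p t) (p t)))%C by ring.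
  eapply Rle_trans; [apply Cmod_triangle|]. rewrite !Cmod_mult, Cmod_R. fold h.
  assert (B3 := H3 (p y) (p t) (p t) (p t) (Dp y) (Dp t) (Dp t) (Dp t)).
  replace (p t - p t)%C with (RtoC 0) in B3 by ring. rewrite Cmod_0, Rplus_0_r in B3.
  assert (S1 : Cmod (p y - p t - RtoC (y - t) * l)%C * Cmod (F (p y) (p t)) <= (e / (2 * (K + 1)) * h) * (K + 1)).
  { apply Rmult_le_compat; auto using Cmod_ge_0; [|lra].
    eapply Rle_trans; [exact Q1|]. apply Rmult_le_compat_r; [auto|apply Rmin_r]. }
  assert (S2 : h * Cmod l * Cmod (F (p y) (p t) - F (p t) (p t))%C <= h * M * ((K + 1) * (M * d2))).
  { apply Rmult_le_compat; auto using Cmod_ge_0.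
    - apply Rmult_le_pos; auto.
    - apply Rmult_le_compat_l; auto. unfold M; lra.
    - eapply Rle_trans; [exact B3|]. apply Rmult_le_compat; auto using Cmod_ge_0; [lra|].
      eapply Rle_trans; [exact R1|]. apply Rmult_le_compat_l; [unfold M; lra|lra]. }
  replace (e / (2 * (K + 1)) * h * (K + 1)) with (e / 2 * h) in S1 by (field; lra).
  replace (h * M * ((K + 1) * (M * d2))) with (e / 2 * h) in S2.
  2: { assert (HM1 : 0 < M) by (unfold M; lra). unfold d2. field. split; lra. }
  lra.
Qed.

Lemma ccont_bound (h p : R -> C) K t : (forall y, Cmod (h y - h t)%C <= K * Cmod (p y - p t)%C) ->
  ccont p t -> ccont h t.
Proof.
  intros Hk Hp. assert (C1 : continuous (fun y => Cmod (p y - p t)%C) t).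
  { apply Cmod_cont, ccont_minus; [auto|apply ccont_const]. }
  assert (Z : Cmod (p t - p t)%C = 0) by (replace (p t - p t)%C with (RtoC 0) by ring; apply Cmod_0).
  assert (Key : forall e, 0 < e -> exists d, 0 < d /\ forall y, Rabs (y - t) < d -> Cmod (h y - h t)%C < e).
  { intros e He. assert (K0 := Rabs_pos K). assert (K1 := Rle_abs K).
    destruct (continuous_eps_inv _ _ C1 (e / (Rabs K + 1))) as [d [Hd Hy]]; [apply Rdiv_lt_0_compat; lra|].
    exists d; split; auto. intros y Hyt. specialize (Hy y Hyt). rewrite Z, Rminus_0_r in Hy.
    rewrite Rabs_right in Hy by (apply Rle_ge, Cmod_ge_0).
    eapply Rle_lt_trans; [apply Hk|]. assert (P := Cmod_ge_0 (p y - p t)%C).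
    apply Rle_lt_trans with ((Rabs K + 1) * Cmod (p y - p t)%C); [nra|].
    apply Rlt_le_trans with ((Rabs K + 1) * (e / (Rabs K + 1))); [apply Rmult_lt_compat_l; lra|].
    right; field; lra. }
  split; apply continuous_eps; intros e He; destruct (Key e He) as [d [Hd Hy]]; exists d; split; auto;
    intros y Hyt; eapply Rle_lt_trans; [|apply (Hy y Hyt)| |apply (Hy y Hyt)].
  - apply (Cmod_fst (h y - h t)%C).
  - apply (Cmod_snd (h y - h t)%C).
Qed.

Lemma ccont_ex_RInt (h : R -> C) a b : (forall t, ccont h t) ->
  ex_RInt (fun t => fst (h t)) a b /\ ex_RInt (fun t => snd (h t)) a b.
Proof.
  intros H; split.
  - exact (ex_RInt_continuous (fun t => fst (h t)) a b (fun t _ => proj1 (H t))).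
  - exact (ex_RInt_continuous (fun t => snd (h t)) a b (fun t _ => proj2 (H t))).
Qed.

Lemma CInt_bound (h : R -> C) a b B : a <= b -> (forall t, ccont h t) ->
  (forall t, a <= t <= b -> Cmod (h t) <= B) -> Cmod (CInt h a b) <= 2 * (b - a) * B.
Proof.
  intros ab Hc Hb. destruct (ccont_ex_RInt h a b Hc) as [E1 E2].
  eapply Rle_trans; [apply Cmod_le_sum|]. unfold CInt; cbn [fst snd].
  assert (A1 := abs_RInt_le_const _ a b B ab E1 ltac:(intros t Ht; eapply Rle_trans; [apply Cmod_fst|apply Hb; auto])).
  assert (A2 := abs_RInt_le_const _ a b B ab E2 ltac:(intros t Ht; eapply Rle_trans; [apply Cmod_snd|apply Hb; auto])).
  lra.
Qed.

Lemma CInt_ext (f g : R -> C) a b : (forall t, f t = g t) -> CInt f a b = CInt g a b.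
Proof. intros H. unfold CInt. f_equal; apply RInt_ext; intros; now rewrite H. Qed.

Lemma is_RInt_FTC (F f : R -> R) a b : (forall t, is_derive F t (f t)) -> (forall t, continuous f t) ->
  RInt f a b = F b - F a.
Proof.
  intros D Cf. apply is_RInt_unique.
  exact (is_RInt_derive F f a b (fun t _ => D t) (fun t _ => Cf t)).
Qed.

Lemma CInt_FTC (F f : R -> C) a b : (forall t, cder F t (f t)) -> (forall t, ccont f t) ->
  CInt f a b = (F b - F a)%C.
Proof.
  intros D Cf. unfold CInt. apply injective_projections; cbn [fst snd Cminus Cplus Copp].
  - exact (is_RInt_FTC (fun t => fst (F t)) (fun t => fst (f t)) a b (fun t => proj1 (D t)) (fun t => proj1 (Cf t))).
  - exact (is_RInt_FTC (fun t => snd (F t)) (fun t => snd (f t)) a b (fun t => proj2 (D t)) (fun t => proj2 (Cf t))).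
Qed.

Lemma cder_CInt (f : R -> C) a t : (forall t, ccont f t) -> cder (fun t => CInt f a t) t (f t).
Proof.
  intros Hf. eapply cder_ext; [|apply (cder_primitive f a 0%C Hf)]. intros; simpl. ring.
Qed.

Lemma CInt_plus (f g : R -> C) a b : (forall t, ccont f t) -> (forall t, ccont g t) ->
  CInt (fun t => f t + g t)%C a b = (CInt f a b + CInt g a b)%C.
Proof.
  intros Hf Hg.
  rewrite (CInt_FTC (fun t => CInt f a t + CInt g a t)%C (fun t => f t + g t)%C).
  - unfold CInt at 3 4. rewrite !RInt_point. apply injective_projections; simpl; unfold zero; simpl; ring.
  - intros t. apply cder_plus; now apply cder_CInt.
  - intros t. destruct (Hf t), (Hg t). split; simpl; now apply @continuous_plus.
Qed.

Lemma CInt_scal (k : C) (f : R -> C) a b : (forall t, ccont f t) ->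
  CInt (fun t => k * f t)%C a b = (k * CInt f a b)%C.
Proof.
  intros Hf.
  rewrite (CInt_FTC (fun t => k * CInt f a t)%C (fun t => k * f t)%C).
  - unfold CInt at 2. rewrite !RInt_point. apply injective_projections; simpl; unfold zero; simpl; ring.
  - intros t. eapply cder_eq; [apply cder_mult; [apply cder_const|now apply cder_CInt]|]. cbv beta; ring.
  - intros t. apply ccont_mult; auto. apply ccont_const.
Qed.

(** * The unit circle and integrals of its powers *)

Definition circ (t : R) : C := (cos t, sin t).

Lemma Cmod_circ t : Cmod (circ t) = 1.
Proof.
  unfold Cmod, circ; cbn [fst snd]. rewrite <- sqrt_1. f_equal.
  assert (H := sin2_cos2 t). unfold Rsqr in H. simpl. lra.
Qed.

Lemma circ_conj t : (circ t * circ (- t) = 1)%C.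
Proof.
  unfold circ. rewrite cos_neg, sin_neg. assert (H := sin2_cos2 t). unfold Rsqr in H.
  apply injective_projections; simpl; lra.
Qed.

Lemma cder_circ t : cder circ t (Ci * circ t)%C.
Proof.
  split; simpl; auto_derive; auto; ring.
Qed.

Lemma cder_circ_neg t : cder (fun t => circ (- t)) t (- (Ci * circ (- t)))%C.
Proof.
  eapply cder_eq.
  - apply (cder_comp circ (fun t => - t)); [apply cder_circ|]. apply @is_derive_opp, @is_derive_id.
  - unfold opp, one; simpl. rewrite RtoC_opp. ring.
Qed.

Lemma cder_circ_pow k t : cder (fun t => circ (- t) ^ k)%C t (- (INR k * Ci * circ (- t) ^ k))%C.
Proof.
  induction k.
  - apply cder_eq with (l := RtoC 0); [exact (cder_const 1%C t)|]. simpl INR. ring.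
  - eapply cder_eq.
    + exact (cder_mult _ _ t _ _ (cder_circ_neg t) IHk).
    + cbv beta. rewrite S_INR, RtoC_plus, !Cpow_S. ring.
Qed.

Lemma circ_pow_ccont k t : ccont (fun t => circ (- t) ^ k)%C t.
Proof. eapply cder_ccont, cder_circ_pow. Qed.

Lemma circ_2PI : circ (2 * PI) = circ 0.
Proof. unfold circ. now rewrite cos_2PI, sin_2PI, cos_0, sin_0. Qed.

Lemma circ_m2PI : circ (- (2 * PI)) = circ (- 0).
Proof. unfold circ. rewrite !cos_neg, !sin_neg. now rewrite cos_2PI, sin_2PI, cos_0, sin_0. Qed.

Lemma CInt_circ_pow k : CInt (fun t => circ (- t) ^ S k)%C 0 (2 * PI) = 0%C.
Proof.
  assert (N : RtoC (INR (S k)) <> 0%C).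
  { intro E; apply (f_equal fst) in E. assert (P := lt_0_INR (S k) ltac:(lia)). change (INR (S k) = 0) in E. lra. }
  assert (C2 : (Ci * Ci = - (1))%C) by (apply injective_projections; simpl; ring).
  rewrite (CInt_FTC (fun t => (Ci / INR (S k)) * circ (- t) ^ S k)%C).
  - rewrite circ_m2PI. ring.
  - intros t. eapply cder_eq; [apply cder_mult; [apply cder_const|apply cder_circ_pow]|]. cbv beta.
    transitivity (- (Ci * Ci) * circ (- t) ^ S k)%C; [field; auto|]. rewrite C2; ring.
  - intros; apply circ_pow_ccont.
Qed.

Lemma CInt_circ : CInt circ 0 (2 * PI) = 0%C.
Proof.
  assert (C2 : (Ci * Ci = - (1))%C) by (apply injective_projections; simpl; ring).
  rewrite (CInt_FTC (fun t => - Ci * circ t)%C).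
  - rewrite circ_2PI. ring.
  - intros t. eapply cder_eq; [apply cder_mult; [apply cder_const|apply cder_circ]|]. cbv beta.
    transitivity (- (Ci * Ci) * circ t)%C; [ring|]. rewrite C2; ring.
  - intros; eapply cder_ccont, cder_circ.
Qed.

(** Cutting [[0, 1]] into [n] equal steps bounds the total change by [K / n]. *)
Lemma const_of_quadratic (g : R -> C) K : (forall t t', 0 <= t <= 1 -> 0 <= t' <= 1 ->
  Cmod (g t' - g t)%C <= K * (t' - t) ^ 2) -> g 1 = g 0.
Proof.
  intros H.
  assert (HK : 0 <= K).
  { assert (Q := H 0 1 ltac:(lra) ltac:(lra)). assert (P := Cmod_ge_0 (g 1 - g 0)%C). lra. }
  assert (S : forall n, (0 < n)%nat -> Cmod (g 1%R - g 0%R)%C <= K / INR n).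
  { intros n Hn. assert (Pn := lt_0_INR n Hn).
    assert (T : forall j, (j <= n)%nat -> Cmod (g (INR j / INR n)%R - g 0%R)%C <= INR j * (K / INR n ^ 2)).
    { induction j; intros Hj.
      - simpl INR. unfold Rdiv at 1. rewrite !Rmult_0_l. replace (g 0%R - g 0%R)%C with (RtoC 0) by ring. rewrite Cmod_0; lra.
      - eapply Rle_trans; [apply (Cmod_sub_triangle _ (g (INR j / INR n)))|].
        rewrite S_INR. specialize (IHj ltac:(lia)).
        assert (Rg : forall i, (i <= n)%nat -> 0 <= INR i / INR n <= 1).
        { intros i Hi. split; [apply Rdiv_le_0_compat; [apply pos_INR|auto]|].
          apply Rmult_le_reg_r with (INR n); auto. unfold Rdiv; rewrite Rmult_assoc, Rinv_l by lra.
          apply le_INR in Hi. lra. }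
        assert (Q := H (INR j / INR n) (INR (S j) / INR n) (Rg j ltac:(lia)) (Rg (S j) Hj)).
        rewrite S_INR in Q.
        replace (((INR j + 1) / INR n - INR j / INR n) ^ 2) with (/ INR n ^ 2) in Q by (field; lra).
        unfold Rdiv in *. lra. }
    specialize (T n (Nat.le_refl n)).
    replace (INR n / INR n) with 1 in T by (field; lra).
    replace (INR n * (K / INR n ^ 2)) with (K / INR n) in T by (field; lra). auto. }
  assert (Z : Cmod (g 1%R - g 0%R)%C = 0).
  { apply Rle_antisym; [|apply Cmod_ge_0]. apply Rnot_lt_le; intro P.
    destruct (archimed_cor1 (Cmod (g 1%R - g 0%R)%C / (K + 1))) as [n [Hn Hn0]]; [apply Rdiv_lt_0_compat; lra|].
    specialize (S n Hn0). assert (Pn := lt_0_INR n Hn0).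
    assert (In : 0 < / INR n) by now apply Rinv_0_lt_compat.
    assert (K / INR n <= (K + 1) * / INR n) by (unfold Rdiv; apply Rmult_le_compat_r; lra).
    assert ((K + 1) * / INR n < (K + 1) * (Cmod (g 1%R - g 0%R)%C / (K + 1))) by (apply Rmult_lt_compat_l; lra).
    replace ((K + 1) * (Cmod (g 1%R - g 0%R)%C / (K + 1))) with (Cmod (g 1%R - g 0%R)%C) in H1 by (field; lra). lra. }
  apply Cmod_eq_0 in Z. replace (g 1) with (g 1%R - g 0%R + g 0%R)%C by ring. rewrite Z; ring.
Qed.

Definition unit_disc (z : C) : Prop := Cmod z <= 1.

Section Cauchy.
Variables (f : C -> C) (F : C -> C -> C) (K e : R).
Hypothesis (Hf : holo_with unit_disc f F K) (Be : forall z, unit_disc z -> Cmod (f z) <= e).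
Variable x : R.
Hypothesis Hx : Rabs x <= / 2.

(** Cauchy's kernel [zeta / (zeta - x)] at [zeta = circ t], written with [circ (- t) = 1 / zeta];
    the factor [zeta] comes from [d zeta = i zeta dt]. *)
Definition kern (t : R) : C := (/ (1 - x * circ (- t)))%C.

Lemma kern_den t : / 2 <= Cmod (1 - x * circ (- t))%C.
Proof.
  assert (T := Cmod_triangle (1 - x * circ (- t))%C (x * circ (- t))%C).
  replace (1 - x * circ (- t) + x * circ (- t))%C with (RtoC 1) in T by ring.
  rewrite Cmod_1, Cmod_mult, Cmod_R, Cmod_circ in T. lra.
Qed.

Lemma kern_den_neq t : (1 - x * circ (- t))%C <> 0%C.
Proof. intro E. assert (Q := kern_den t). rewrite E, Cmod_0 in Q. lra. Qed.

Lemma kern_bound t : Cmod (kern t) <= 2.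
Proof.
  unfold kern. rewrite Cmod_inv by apply kern_den_neq. replace 2 with (/ / 2) by field.
  apply Rinv_le_contravar; [lra|apply kern_den].
Qed.

Lemma kern_ccont t : ccont kern t.
Proof.
  eapply cder_ccont. apply cder_inv; [apply kern_den_neq|].
  apply cder_minus; [apply cder_const|]. apply cder_mult; [apply cder_const|apply cder_circ_neg].
Qed.

Lemma kern_circ t : ((circ t - x) * kern t = circ t)%C.
Proof.
  assert (N := kern_den_neq t). unfold kern.
  replace (circ t - x)%C with (circ t * (1 - x * circ (- t)) + (circ t * circ (- t) - 1) * x)%C by ring.
  rewrite circ_conj. field. auto.
Qed.

(** One step of the geometric series: [kern = 1 + x * circ (- t) * kern]. Repeating it produces
    Taylor's formula with an explicit remainder. *)
Lemma kern_expand (h : R -> C) m : (forall t, ccont h t) ->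
  CInt (fun t => h t * circ (- t) ^ m * kern t)%C 0 (2 * PI) =
  (CInt (fun t => h t * circ (- t) ^ m)%C 0 (2 * PI) +
   x * CInt (fun t => h t * circ (- t) ^ S m * kern t)%C 0 (2 * PI))%C.
Proof.
  intros Hh.
  assert (C1 : forall k t, ccont (fun t => h t * circ (- t) ^ k)%C t)
    by (intros; apply ccont_mult; auto; apply circ_pow_ccont).
  rewrite <- CInt_scal by (intros; apply ccont_mult; [apply C1|apply kern_ccont]).
  rewrite <- CInt_plus.
  - apply CInt_ext. intros t. assert (N := kern_den_neq t). unfold kern. rewrite Cpow_S. field. auto.
  - apply C1.
  - intros t. apply ccont_mult; [apply ccont_const|]. apply ccont_mult; [apply C1|apply kern_ccont].
Qed.

Lemma CInt_kern : CInt kern 0 (2 * PI) = RtoC (2 * PI).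
Proof.
  assert (P := PI_RGT_0).
  set (J := fun m => CInt (fun t => 1 * circ (- t) ^ m * kern t)%C 0 (2 * PI)).
  assert (J0 : CInt kern 0 (2 * PI) = J 0%nat).
  { apply CInt_ext. intros; simpl; ring. }
  assert (J1 : J 0%nat = (RtoC (2 * PI) + x * J 1%nat)%C).
  { unfold J. rewrite (kern_expand (fun _ => 1%C) 0) by (intros; apply ccont_const). f_equal.
    rewrite (CInt_FTC (fun t => RtoC t)).
    - rewrite RtoC_mult. change (RtoC 0) with (RtoC 0). ring.
    - intros t. eapply cder_eq; [apply cder_RtoC, @is_derive_id|]. simpl. unfold one; simpl. ring.
    - intros; apply ccont_mult; [apply ccont_const|apply circ_pow_ccont]. }
  assert (J2 : forall m, J (S m) = (x * J (S (S m)))%C).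
  { intros m. unfold J. rewrite (kern_expand (fun _ => 1%C) (S m)) by (intros; apply ccont_const).
    rewrite (CInt_ext (fun t => 1 * circ (- t) ^ S m)%C (fun t => circ (- t) ^ S m)%C) by (intros; ring).
    rewrite CInt_circ_pow. ring. }
  assert (J3 : forall m, J 0%nat = (RtoC (2 * PI) + x ^ S m * J (S m))%C).
  { induction m; [rewrite J1; simpl; ring|]. rewrite IHm, J2, (Cpow_S _ (S m)). rewrite !Cpow_S. ring. }
  rewrite J0. apply geom_Cmod_eq with (/ 2) (2 * (2 * PI) * 2); [lra|]. intros m.
  rewrite (J3 m). replace (RtoC (2 * PI) + x ^ S m * J (S m) - RtoC (2 * PI))%C with (x ^ S m * J (S m))%C by ring.
  rewrite Cmod_mult, Cmod_pow, Cmod_R.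
  assert (B : Cmod (J (S m)) <= 2 * (2 * PI - 0) * 2).
  { apply CInt_bound; [lra| |].
    - intros; apply ccont_mult; [apply ccont_mult; [apply ccont_const|apply circ_pow_ccont]|apply kern_ccont].
    - intros t _. rewrite !Cmod_mult, Cmod_pow, Cmod_circ, Cmod_1, pow1, !Rmult_1_l. apply kern_bound. }
  rewrite Rminus_0_r in B.
  assert (Rabs x ^ S m <= (/ 2) ^ m).
  { apply Rle_trans with ((/ 2) ^ S m); [apply pow_incr; split; [apply Rabs_pos|auto]|].
    assert (0 < (/ 2) ^ m) by (apply pow_lt; lra). simpl; lra. }
  rewrite Rmult_comm. apply Rmult_le_compat; auto using Cmod_ge_0. apply pow_le, Rabs_pos.
Qed.

(** Contract the circle to the point [x] along [z s t]. The formal derivative in [s] is the integral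
    of [circ t * f' (z s t)] over a period, which vanishes because [i s] times the integrand is the
    derivative of [f (z s t)] in [t]. Instead of differentiating under the integral sign, the
    Lipschitz quotient [F] gives a quadratic bound on increments, and [const_of_quadratic]
    concludes. *)
Lemma cauchy_formula : (2 * PI * f x = CInt (fun t => f (circ t) * kern t) 0 (2 * PI))%C.
Proof.
  assert (P := PI_RGT_0).
  set (z := fun (s t : R) => (x + s * (circ t - x))%C).
  assert (Cx : Cmod (RtoC x) <= / 2) by (rewrite Cmod_R; auto).
  assert (Dz : forall s, 0 <= s <= 1 -> forall t, unit_disc (z s t)).
  { intros s Hs t. unfold unit_disc, z.
    replace (x + s * (circ t - x))%C with (RtoC (1 - s) * x + s * circ t)%C by (rewrite RtoC_minus; ring).
    eapply Rle_trans; [apply Cmod_triangle|]. rewrite !Cmod_mult, Cmod_circ, !(Cmod_R (1 - s)), !(Cmod_R s), !Rabs_right by lra.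
    assert ((1 - s) * Cmod (RtoC x) <= (1 - s) * / 2) by (apply Rmult_le_compat_l; lra). lra. }
  assert (Cz : forall s t, cder (z s) t (s * (Ci * circ t))%C).
  { intros s t. unfold z. eapply cder_eq.
    - apply cder_plus; [apply cder_const|]. apply cder_mult; [apply cder_const|].
      apply cder_minus; [apply cder_circ|apply cder_const].
    - cbv beta; ring. }
  assert (Cfz : forall s, 0 <= s <= 1 -> forall t, ccont (fun t => f (z s t)) t).
  { intros s Hs t. eapply cder_ccont. apply (holo_chain unit_disc f F K (z s)); auto. }
  set (g := fun s => CInt (fun t => f (z s t) * kern t)%C 0 (2 * PI)).
  assert (E : g 1 = g 0).
  { destruct Hf as [H0 [H1 [H2 H3]]].
    assert (CF : forall s s', 0 <= s <= 1 -> 0 <= s' <= 1 -> forall t, ccont (fun t => F (z s' t) (z s t)) t).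
    { intros s s' Hs Hs' t. apply ccont_bound with (K := 2 * K) (p := circ); [|eapply cder_ccont, cder_circ].
      intros y. eapply Rle_trans; [apply H3; auto|].
      assert (Lz : forall s, 0 <= s <= 1 -> Cmod (z s y - z s t)%C <= Cmod (circ y - circ t)%C).
      { intros q Hq. unfold z. replace (x + q * (circ y - x) - (x + q * (circ t - x)))%C with (q * (circ y - circ t))%C by ring.
        rewrite Cmod_mult, Cmod_R, Rabs_right by lra. assert (Q := Cmod_ge_0 (circ y - circ t)%C). nra. }
      assert (L1 := Lz s Hs). assert (L2 := Lz s' Hs').
      rewrite (Rmult_comm 2), Rmult_assoc. apply Rmult_le_compat_l; [auto|lra]. }
    (* The first-order term of the increment; the case [s = 0] is separate because the primitive
       contains [1 / s]. *)
    assert (Z0 : forall s, 0 <= s <= 1 -> CInt (fun t => circ t * F (z s t) (z s t))%C 0 (2 * PI) = 0%C).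
    { intros s Hs. destruct (Req_dec s 0) as [Es|Ns].
      - rewrite (CInt_ext _ (fun t => F x x * circ t)%C).
        + rewrite CInt_scal by (intros; eapply cder_ccont, cder_circ). rewrite CInt_circ. ring.
        + intros t. replace (z s t) with (RtoC x); [ring|]. unfold z. rewrite Es. ring.
      - assert (Ns' : RtoC s <> 0%C) by (intro Q; apply (f_equal fst) in Q; simpl in Q; auto).
        assert (C2 : (Ci * Ci = - (1))%C) by (apply injective_projections; simpl; ring).
        rewrite (CInt_FTC (fun t => (- Ci / s) * f (z s t))%C).
        + assert (Ez : z s (2 * PI) = z s 0) by (unfold z; now rewrite circ_2PI). rewrite Ez; ring.
        + intros t. eapply cder_eq.
          * apply cder_mult; [apply cder_const|]. apply (holo_chain unit_disc f F K (z s)); auto.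
          * cbv beta. transitivity (- (Ci * Ci) * (circ t * F (z s t) (z s t)))%C; [field; auto|]. rewrite C2; ring.
        + intros t. apply ccont_mult; [eapply cder_ccont, cder_circ|auto]. }
    apply const_of_quadratic with (K := 2 * (2 * PI) * (2 * K)). intros s s' Hs Hs'.
    assert (E : (g s' - g s = RtoC (s' - s) * CInt (fun t => circ t * (F (z s' t) (z s t) - F (z s t) (z s t))) 0 (2 * PI))%C).
    { assert (CcF : forall q q', 0 <= q <= 1 -> 0 <= q' <= 1 -> forall t, ccont (fun t => circ t * F (z q' t) (z q t))%C t).
      { intros q q' Hq Hq' t. apply (ccont_mult circ); [exact (cder_ccont _ _ _ (cder_circ t))|exact (CF q q' Hq Hq' t)]. }
      assert (CfK : forall q, 0 <= q <= 1 -> forall t, ccont (fun t => f (z q t) * kern t)%C t).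
      { intros q Hq t. apply (ccont_mult (fun t => f (z q t))); [exact (Cfz q Hq t)|exact (kern_ccont t)]. }
      rewrite (CInt_ext (fun t => circ t * (F (z s' t) (z s t) - F (z s t) (z s t)))%C
        (fun t => circ t * F (z s' t) (z s t) - circ t * F (z s t) (z s t))%C) by (intros; ring).
      rewrite <- (CInt_minus _ _ 0 (2 * PI) (CcF s s' Hs Hs') (CcF s s Hs Hs)).
      rewrite (Z0 s Hs). unfold g.
      rewrite (CInt_minus _ _ 0 (2 * PI) (CfK s' Hs') (CfK s Hs)).
      rewrite (CInt_ext _ (fun t => RtoC (s' - s) * (circ t * F (z s' t) (z s t)))%C).
      - rewrite (CInt_scal _ _ 0 (2 * PI) (CcF s s' Hs Hs')). ring.
      - intros t. destruct (H2 (z s' t) (z s t) (Dz s' Hs' t) (Dz s Hs t)) as [E _].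
        transitivity ((f (z s' t) - f (z s t)) * kern t)%C; [ring|]. rewrite E.
        replace (z s' t - z s t)%C with (RtoC (s' - s) * (circ t - x))%C by (unfold z; rewrite RtoC_minus; ring).
        transitivity (RtoC (s' - s) * ((circ t - x) * kern t) * F (z s' t) (z s t))%C; [ring|].
        rewrite kern_circ. ring. }
    rewrite E, Cmod_mult, Cmod_R.
    assert (B : Cmod (CInt (fun t => circ t * (F (z s' t) (z s t) - F (z s t) (z s t)))%C 0 (2 * PI)) <=
      2 * (2 * PI - 0) * (2 * K * Rabs (s' - s))).
    { apply CInt_bound; [lra| |].
      - intros. apply ccont_mult; [eapply cder_ccont, cder_circ|apply ccont_minus; apply CF; auto].
      - intros t _. rewrite Cmod_mult, Cmod_circ, Rmult_1_l. eapply Rle_trans; [apply H3; auto|].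
        replace (z s t - z s t)%C with (RtoC 0) by ring. rewrite Cmod_0, Rplus_0_r.
        replace (z s' t - z s t)%C with (RtoC (s' - s) * (circ t - x))%C by (unfold z; rewrite RtoC_minus; ring).
        rewrite Cmod_mult, Cmod_R.
        assert (T : Cmod (circ t - x)%C <= 2).
        { unfold Cminus. eapply Rle_trans; [apply Cmod_triangle|]. rewrite Cmod_opp, Cmod_circ. lra. }
        assert (Q := Rabs_pos (s' - s)).
        replace (2 * K * Rabs (s' - s)) with (K * (Rabs (s' - s) * 2)) by ring.
        apply Rmult_le_compat_l; auto. apply Rmult_le_compat_l; auto. }
    rewrite <- (pow2_abs (s' - s)). assert (Q := Rabs_pos (s' - s)).
    apply Rle_trans with (Rabs (s' - s) * (2 * (2 * PI - 0) * (2 * K * Rabs (s' - s)))); [apply Rmult_le_compat_l; auto|].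
    right; ring. }
  transitivity (g 1).
  - rewrite E. unfold g. rewrite (CInt_ext _ (fun t => f x * kern t)%C).
    + rewrite CInt_scal by apply kern_ccont. rewrite CInt_kern, RtoC_mult. ring.
    + intros t. do 2 f_equal. unfold z. ring.
  - unfold g. apply CInt_ext. intros t. do 2 f_equal. unfold z. ring.
Qed.

End Cauchy.

(** * Real Taylor polynomials of functions holomorphic on the unit disc *)

Definition peval (m : nat) (c : nat -> R) (x : R) : R := sum_f_R0 (fun k => c k * x ^ k) m.

(** Expand the kernel in Cauchy's formula [m + 1] times. The remainder integral is at most
    [2 * (2 * PI) * (e * 2)], and division by [2 * PI] leaves [4 * e]; one factor 2 is the bound of
    [kern] for [|x| <= / 2], the other that of [CInt_bound]. *)
Lemma cauchy_poly m (f : C -> C) e : holo unit_disc f -> (forall z, unit_disc z -> Cmod (f z) <= e) ->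
  exists a b, forall x, Rabs x <= / 2 ->
    Rabs (fst (f x) - peval m a x) <= 4 * e * Rabs x ^ S m /\
    Rabs (snd (f x) - peval m b x) <= 4 * e * Rabs x ^ S m.
Proof.
  intros [F [K Hf]] Be. assert (P := PI_RGT_0).
  set (J := fun k => CInt (fun t => f (circ t) * circ (- t) ^ k)%C 0 (2 * PI)).
  assert (Cf : forall t, ccont (fun t => f (circ t)) t).
  { intros t. eapply cder_ccont. apply (holo_chain unit_disc f F K circ); [auto| |apply cder_circ].
    intros y. unfold unit_disc. rewrite Cmod_circ. lra. }
  exists (fun k => fst (J k) / (2 * PI)), (fun k => snd (J k) / (2 * PI)). intros x Hx.
  set (I := fun k => CInt (fun t => f (circ t) * circ (- t) ^ k * kern x t)%C 0 (2 * PI)).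
  assert (E0 := cauchy_formula f F K Hf x Hx).
  rewrite (CInt_ext _ (fun t => f (circ t) * circ (- t) ^ 0 * kern x t)%C) in E0 by (intros; simpl; ring).
  fold (I 0%nat) in E0.
  assert (Step : forall k, I k = (J k + x * I (S k))%C) by (intros; apply kern_expand; auto).
  assert (B : forall k, Cmod (I k) <= 2 * (2 * PI) * (e * 2)).
  { intros k. rewrite <- (Rminus_0_r (2 * PI)). apply CInt_bound; [lra| |].
    - intros; apply ccont_mult; [apply ccont_mult; [apply Cf|apply circ_pow_ccont]|now apply kern_ccont].
    - intros t _. rewrite !Cmod_mult, Cmod_pow, Cmod_circ, pow1, Rmult_1_r.
      apply Rmult_le_compat; auto using Cmod_ge_0; [|now apply kern_bound].
      apply Be. unfold unit_disc. rewrite Cmod_circ; lra. }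
  assert (Sum : forall m, I 0%nat = ((peval m (fun k => fst (J k)) x, peval m (fun k => snd (J k)) x) + RtoC (x ^ S m) * I (S m))%C).
  { induction m0.
    - rewrite Step. unfold peval; simpl. apply injective_projections; simpl; ring.
    - rewrite IHm0, (Step (S m0)). unfold peval. rewrite !(tech5 _ m0).
      apply injective_projections; simpl; ring. }
  rewrite (Sum m) in E0.
  assert (Lin : forall c, peval m (fun k => c k / (2 * PI)) x = peval m c x / (2 * PI)).
  { intros c. unfold peval, Rdiv.
    rewrite (Rmult_comm (sum_f_R0 _ m)), scal_sum. apply sum_eq. intros; ring. }
  rewrite !Lin.
  set (a := peval m _ x) in *. set (b := peval m (fun k => snd (J k)) x) in *.
  specialize (B (S m)). set (r := I (S m)) in *.
  assert (F1 := f_equal fst E0). assert (F2 := f_equal snd E0). simpl in F1, F2. clear E0.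
  fold (x ^ m) in *. 
  assert (X : 0 <= Rabs x ^ S m) by apply pow_le, Rabs_pos.
  assert (G1 : fst (f x) - a / (2 * PI) = x ^ S m * fst r / (2 * PI)).
  { apply Rmult_eq_reg_r with (2 * PI); [|lra]. field_simplify; [|lra|lra]. simpl. lra. }
  assert (G2 : snd (f x) - b / (2 * PI) = x ^ S m * snd r / (2 * PI)).
  { apply Rmult_eq_reg_r with (2 * PI); [|lra]. field_simplify; [|lra|lra]. simpl. lra. }
  assert (Fin : forall q, Rabs q <= Cmod r -> Rabs (x ^ S m * q / (2 * PI)) <= 4 * e * Rabs x ^ S m).
  { intros q Hq. unfold Rdiv. rewrite !Rabs_mult, <- RPow_abs, Rabs_inv, (Rabs_right (2 * PI)) by lra.
    apply Rmult_le_reg_r with (2 * PI); [lra|]. rewrite Rmult_assoc, Rinv_l, Rmult_1_r by lra.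
    apply Rle_trans with (Rabs x ^ S m * (2 * (2 * PI) * (e * 2))); [apply Rmult_le_compat_l; lra|]. lra. }
  rewrite G1, G2. split; apply Fin; [apply Cmod_fst|apply Cmod_snd].
Qed.

(** * Smoothness from polynomial approximation at all scales *)

Lemma peval_S m c x : peval (S m) c x = c 0%nat + x * peval m (fun k => c (S k)) x.
Proof.
  unfold peval. rewrite decomp_sum by lia. simpl pred. simpl (x ^ 0). rewrite Rmult_1_r. f_equal.
  rewrite scal_sum. apply sum_eq. intros; simpl; ring.
Qed.

Lemma peval_plus m c d x : peval m (fun k => c k + d k) x = peval m c x + peval m d x.
Proof. unfold peval. rewrite <- sum_plus. apply sum_eq; intros; ring. Qed.

Lemma peval_scal m k c x : peval m (fun i => k * c i) x = k * peval m c x.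
Proof. unfold peval. rewrite scal_sum. apply sum_eq; intros; ring. Qed.

Lemma peval_ext m c d x : (forall k, (k <= m)%nat -> c k = d k) -> peval m c x = peval m d x.
Proof. intros H. unfold peval. apply sum_eq; intros; now rewrite H. Qed.

Lemma peval_dilate m c l x : peval m (fun k => c k * l ^ k) x = peval m c (l * x).
Proof. unfold peval. apply sum_eq; intros; rewrite Rpow_mult_distr; ring. Qed.

Lemma peval_0 m c : peval m c 0 = c 0%nat.
Proof. destruct m; [unfold peval; simpl; ring|]. rewrite peval_S. ring. Qed.

Lemma peval_shift m : forall c a, exists d, forall x, peval m c (x + a) = peval m d x.
Proof.
  induction m; intros c a.
  - exists c. intros; unfold peval; simpl; ring.
  - destruct (IHm (fun k => c (S k)) a) as [d Hd].
    exists (fun k => match k with O => c 0%nat + a * d 0%nat | S k => d k + a * (if Nat.eq_dec k m then 0 else d (S k)) end).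
    intros x. rewrite !peval_S, Hd. rewrite peval_plus, peval_scal.
    enough (peval m d x = d 0%nat + x * peval m (fun k => if Nat.eq_dec k m then 0 else d (S k)) x) by
      (rewrite H at 1; rewrite Rmult_plus_distr_r; rewrite H; ring).
    destruct m.
    + unfold peval; simpl. ring.
    + rewrite peval_S. f_equal. f_equal. unfold peval. rewrite tech5. destruct (Nat.eq_dec (S m) (S m)); [|lia].
      rewrite Rmult_0_l, Rplus_0_r. apply sum_eq. intros i Hi. destruct (Nat.eq_dec i (S m)); [lia|auto].
Qed.

Definition dpoly (c : nat -> R) (k : nat) : R := INR (S k) * c (S k).

Lemma is_derive_peval m c x : is_derive (peval (S m) c) x (peval m (dpoly c) x).
Proof.
  induction m.
  - apply is_derive_ext with (f := fun x => c 0%nat + c 1%nat * x).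
    { intros t; unfold peval; simpl; ring. }
    unfold peval, dpoly; simpl. auto_derive; auto. ring.
  - apply is_derive_ext with (f := fun x => peval (S m) c x + c (S (S m)) * x ^ S (S m)).
    { intros t; unfold peval. now rewrite (tech5 _ (S m)). }
    eapply is_derive_eq.
    + apply @is_derive_plus; [apply IHm|]. apply is_derive_scal, is_derive_pow, @is_derive_id.
    + unfold peval at 2. rewrite tech5. fold (peval m (dpoly c) x). unfold plus, one; simpl.
      unfold dpoly. rewrite (S_INR (S m)). simpl pow. change (match m with O => 1 | S _ => INR m + 1 end) with (INR (S m)). ring.
Qed.

(** A crude form of Markov's inequality. With [q = 2^(m+2)], the polynomial [p x - q * p (x / 2)] of
    the induction step has lost its top coefficient, while the linear one is multiplied by
    [1 - q / 2], of modulus at least 1. *)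
Lemma markov_unit m : exists C, 0 <= C /\ forall c e,
  (forall x, 0 <= x <= 1 -> Rabs (peval (S m) c x) <= e) -> Rabs (c 1%nat) <= C * e.
Proof.
  induction m as [|m [C [HC IH]]].
  - exists 2; split; [lra|]. intros c e H. assert (A := H 0 ltac:(lra)). assert (B := H 1 ltac:(lra)).
    replace (c 1%nat) with (peval 1 c 1 - peval 1 c 0) by (unfold peval; simpl; ring).
    eapply Rle_trans; [apply Rabs_triang|]. rewrite Rabs_Ropp. lra.
  - set (q := 2 ^ S (S m)). assert (Hq : 0 < q) by (apply pow_lt; lra).
    exists (C * (1 + q)); split; [apply Rmult_le_pos; lra|]. intros c e H.
    set (d := fun k => c k * (1 - q * (/ 2) ^ k)).
    assert (Hd : Rabs (d 1%nat) <= C * ((1 + q) * e)).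
    { apply IH. intros x Hx.
      replace (peval (S m) d x) with (peval (S (S m)) c x - q * peval (S (S m)) c (/ 2 * x)).
      - assert (A := H x Hx). assert (B := H (/ 2 * x) ltac:(lra)).
        unfold Rminus. eapply Rle_trans; [apply Rabs_triang|]. rewrite Rabs_Ropp, Rabs_mult, (Rabs_right q) by lra.
        assert (q * Rabs (peval (S (S m)) c (/ 2 * x)) <= q * e) by (apply Rmult_le_compat_l; lra). lra.
      - rewrite <- peval_dilate. unfold Rminus. rewrite Ropp_mult_distr_l, <- peval_scal, <- peval_plus.
        unfold peval. rewrite (tech5 _ (S m)).
        replace (c (S (S m)) + - q * (c (S (S m)) * (/ 2) ^ S (S m))) with 0.
        + rewrite Rmult_0_l, Rplus_0_r. apply sum_eq; intros; unfold d; ring.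
        + unfold q. rewrite pow_inv. field. apply pow_nonzero; lra. }
    assert (Q : 2 <= q * / 2).
    { unfold q. simpl. assert (1 <= 2 ^ m) by (apply pow_R1_Rle; lra). lra. }
    unfold d in Hd. rewrite Rabs_mult in Hd. simpl pow in Hd. rewrite Rmult_1_r in Hd.
    rewrite (Rabs_left1 (1 - q * / 2)) in Hd by lra.
    assert (P := Rabs_pos (c 1%nat)). nra.
Qed.

Lemma markov m : exists C, 0 <= C /\ forall c e l, l <> 0 ->
  (forall x, 0 <= x <= 1 -> Rabs (peval (S m) c (l * x)) <= e) -> Rabs (c 1%nat) <= C * e / Rabs l.
Proof.
  destruct (markov_unit m) as [C [HC H]]. exists C; split; auto. intros c e l Hl Hx.
  assert (Q := H (fun k => c k * l ^ k) e). cbv beta in Q.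
  assert (Q' : Rabs (c 1%nat * l ^ 1) <= C * e).
  { apply Q. intros x Hx'. rewrite peval_dilate. auto. }
  rewrite pow_1, Rabs_mult in Q'. assert (P := Rabs_pos_lt _ Hl).
  apply Rmult_le_reg_r with (Rabs l); auto. unfold Rdiv; rewrite Rmult_assoc, Rinv_l by lra. lra.
Qed.

Lemma dyadic_bracket h A : 0 < h <= A -> exists i, A * (/ 2) ^ S i < h <= A * (/ 2) ^ i.
Proof.
  intros Hh. destruct (geom_small (/ 2) A h ltac:(lra) ltac:(lra)) as [n Hn].
  induction n.
  - simpl in Hn; lra.
  - destruct (Rlt_dec (A * (/ 2) ^ n) h); [auto|]. exists n. split; lra.
Qed.

(** Near an endpoint of [[a, b]] only one side is available, which is why the scale [l] in [markov]
    may have either sign. *)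
Lemma interval_side a b s l : a <= s <= b -> 0 < l <= (b - a) / 2 -> exists k, Rabs k = l /\
  forall x, 0 <= x <= 1 -> a <= s + k * x <= b.
Proof.
  intros Hs Hl. destruct (Rle_dec s ((a + b) / 2)).
  - exists l. split; [apply Rabs_right; lra|]. intros x Hx. assert (0 <= l * x <= l) by nra. lra.
  - exists (- l). split; [rewrite Rabs_Ropp; apply Rabs_right; lra|]. intros x Hx. assert (0 <= l * x <= l) by nra. lra.
Qed.

(* With [w = 2^(-be)] this is polynomial approximation at every point and every scale
   [A = rho 2^(-j)], with an error [O (A^be)], [N < be <= N + 1].  The degree is [S N] rather
   than [N] because of the case [be = N + 1], which leads to the Zygmund class. *)
Definition approx (a b : R) (N : nat) (w : R) (f : R -> R) : Prop :=
  exists C rho, 0 <= C /\ 0 < rho /\ forall s j, a <= s <= b -> exists c,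
    forall t, a <= t <= b -> Rabs (t - s) <= rho * (/ 2) ^ j ->
      Rabs (f t - peval (S N) c (t - s)) <= C * w ^ j.

(** [rho] is shrunk to at most half of the interval so that [interval_side] provides a segment of
    that length at every point. *)
Lemma approx_choice a b N w f : a < b -> approx a b N w f ->
  exists C rho (c : R -> nat -> nat -> R), 0 <= C /\ 0 < rho <= (b - a) / 2 /\
    forall s j t, a <= s <= b -> a <= t <= b -> Rabs (t - s) <= rho * (/ 2) ^ j ->
      Rabs (f t - peval (S N) (c s j) (t - s)) <= C * w ^ j.
Proof.
  intros ab [C [rho [HC [Hr H]]]].
  assert (H' : forall p : R * nat, exists c, a <= fst p <= b -> forall t, a <= t <= b ->
    Rabs (t - fst p) <= rho * (/ 2) ^ snd p -> Rabs (f t - peval (S N) c (t - fst p)) <= C * w ^ snd p).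
  { intros [s j]. cbn [fst snd]. destruct (Rle_dec a s); [destruct (Rle_dec s b)|].
    - destruct (H s j ltac:(lra)) as [c Hc]. exists c; auto.
    - exists (fun _ => 0); intros; lra.
    - exists (fun _ => 0); intros; lra. }
  apply fun_choice in H'. destruct H' as [c Hc].
  exists C, (Rmin rho ((b - a) / 2)), (fun s j => c (s, j)).
  split; auto. split; [split; [apply Rmin_pos; lra|apply Rmin_r]|].
  intros s j t Hs Ht Hst. apply (Hc (s, j)); auto. cbn [fst snd].
  eapply Rle_trans; [exact Hst|]. apply Rmult_le_compat_r; [apply pow_le; lra|apply Rmin_l].
Qed.

Lemma approx_cont a b N w f : a < b -> 0 <= w < 1 -> approx a b N w f -> cont_on a b f.
Proof.
  intros ab Hw H. destruct (approx_choice _ _ _ _ _ ab H) as [C [rho [c [HC [Hr Hc]]]]]. clear H.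
  intros x Hx e He.
  destruct (geom_small w (2 * C) (e / 2) Hw ltac:(lra)) as [j Hj].
  assert (Cp : continuous (peval (S N) (c x j)) 0).
  { apply @ex_derive_continuous. eexists. apply is_derive_peval. }
  destruct (continuous_eps_inv _ _ Cp (e / 2)) as [d [Hd Hp]]; [lra|].
  assert (Hj2 : 0 < rho * (/ 2) ^ j) by (apply Rmult_lt_0_compat; [lra|apply pow_lt; lra]).
  exists (Rmin d (rho * (/ 2) ^ j)). split; [now apply Rmin_pos|].
  intros t [Ht Htx]. simpl in *. unfold Rdist in *.
  assert (T1 := Rlt_le_trans _ _ _ Htx (Rmin_l _ _)). assert (T2 := Rlt_le_trans _ _ _ Htx (Rmin_r _ _)).
  assert (A := Hc x j t Hx Ht ltac:(lra)).
  assert (B := Hc x j x Hx Hx ltac:(rewrite Rminus_diag, Rabs_R0; lra)).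
  specialize (Hp (t - x)). rewrite Rminus_0_r in Hp. specialize (Hp T1). rewrite Rminus_diag in B.
  apply Rabs_le_between in A. apply Rabs_le_between in B. apply Rabs_lt_between in Hp.
  apply Rabs_lt_between. lra.
Qed.

Lemma cont_on_bounded a b f : a <= b -> cont_on a b f -> exists M, 0 <= M /\ forall x, a <= x <= b -> Rabs (f x) <= M.
Proof.
  intros ab H. assert (Hc := cont_on_clamp f a b ab H).
  destruct (continuous_min_attained (fun x => - Rabs (f (clamp a b x))) a b ab) as [m [Hm Hmin]].
  { intros x. apply @continuous_opp. apply (continuous_comp (fun x => f (clamp a b x)) Rabs); [apply Hc|].
    apply continuous_Rabs. }
  exists (Rabs (f m)). split; [apply Rabs_pos|]. intros x Hx. specialize (Hmin x Hx).
  cbv beta in Hmin. rewrite !clamp_id in Hmin by auto. lra.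
Qed.

Lemma pow_half_pos j : 0 < (/ 2) ^ j.
Proof. apply pow_lt; lra. Qed.

Lemma half_pow_mul w j : (w / 2) ^ j * 2 ^ j = w ^ j.
Proof. rewrite <- Rpow_mult_distr. f_equal. field. Qed.

(* Two polynomials approximating [f] on a common interval of length comparable to [rho 2^(-j)]
   are close there, hence so are their derivatives, by Markov's inequality. *)
Lemma approx_compare a b N w f C rho c Cm : a < b -> 0 < w -> 0 <= C -> 0 < rho <= (b - a) / 2 -> w <= 2 ->
  (forall s j t, a <= s <= b -> a <= t <= b -> Rabs (t - s) <= rho * (/ 2) ^ j ->
      Rabs (f t - peval (S N) (c s j) (t - s)) <= C * (w / 2) ^ j) ->
  0 <= Cm -> (forall c e l, l <> 0 ->
    (forall x, 0 <= x <= 1 -> Rabs (peval (S N) c (l * x)) <= e) -> Rabs (c 1%nat) <= Cm * e / Rabs l) ->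
  forall s t j, a <= s <= b -> a <= t <= b -> Rabs (t - s) <= rho / 2 * (/ 2) ^ j ->
  Rabs (peval N (dpoly (c s j)) (t - s) - c t (S j) 1%nat) <= 4 * Cm * C / rho * w ^ j.
Proof.
  intros ab Hw HC Hr Hw2 Hc HCm Mk s t j Hs Ht Hst.
  assert (Pj := pow_half_pos j).
  destruct (peval_shift (S N) (c s j) (t - s)) as [d Hd].
  assert (E1 : peval N (dpoly (c s j)) (t - s) = d 1%nat).
  { assert (D1 := is_derive_peval N d 0).
    assert (D2 : is_derive (fun x => peval (S N) (c s j) (x + (t - s))) 0 (peval N (dpoly (c s j)) (t - s))).
    { eapply is_derive_eq.
      - apply (is_derive_comp (peval (S N) (c s j)) (fun x => x + (t - s))); [apply is_derive_peval|].
        apply @is_derive_plus; [apply @is_derive_id|apply @is_derive_const].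
      - unfold scal, plus, one, zero; simpl; unfold mult; simpl. rewrite Rplus_0_l. ring. }
    apply (is_derive_ext _ (peval (S N) d)) in D2; [|intros; apply Hd].
    assert (E := is_derive_unique _ _ _ D1). rewrite (is_derive_unique _ _ _ D2) in E.
    rewrite E, peval_0. unfold dpoly. simpl. ring. }
  rewrite E1.
  set (l := rho * (/ 2) ^ S j).
  assert (Hl : 0 < l <= (b - a) / 2).
  { unfold l. simpl. split; [apply Rmult_lt_0_compat; lra|].
    assert ((/ 2) ^ j <= 1) by (rewrite <- (pow1 j); apply pow_incr; lra).
    assert (rho * (/ 2 * (/ 2) ^ j) <= rho * 1) by (apply Rmult_le_compat_l; lra). lra. }
  destruct (interval_side a b t l Ht Hl) as [k [Hk Hin]].
  assert (Nk : k <> 0) by (intro E; rewrite E, Rabs_R0 in Hk; lra).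
  assert (Q := Mk (fun i => d i + -1 * c t (S j) i) (2 * C * (w / 2) ^ j) k Nk). cbv beta in Q.
  replace (d 1%nat - c t (S j) 1%nat) with (d 1%nat + -1 * c t (S j) 1%nat) by ring.
  eapply Rle_trans; [apply Q|].
  - intros x Hx. specialize (Hin x Hx). set (y := k * x) in *.
    assert (Hy : Rabs y <= l).
    { unfold y. rewrite Rabs_mult, Hk, (Rabs_right x) by lra. nra. }
    rewrite peval_plus, peval_scal, <- Hd.
    assert (Hl2 : l = rho / 2 * (/ 2) ^ j) by (unfold l; simpl; field).
    assert (A := Hc s j (t + y) Hs Hin).
    replace (t + y - s) with (y + (t - s)) in A by ring.
    assert (A' : Rabs (f (t + y) - peval (S N) (c s j) (y + (t - s))) <= C * (w / 2) ^ j).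
    { apply A. eapply Rle_trans; [apply Rabs_triang|]. lra. }
    assert (B := Hc t (S j) (t + y) Ht Hin).
    replace (t + y - t) with y in B by ring. specialize (B Hy).
    assert (B' : C * (w / 2) ^ S j <= C * (w / 2) ^ j).
    { apply Rmult_le_compat_l; auto. simpl. assert (0 < (w / 2) ^ j) by (apply pow_lt; lra). nra. }
    apply Rabs_le_between in A'. apply Rabs_le_between in B. apply Rabs_le. lra.
  (* Division by the length [rho * 2^-(j+1)] turns the rate [w / 2] into [w]. *)
  - rewrite Hk. unfold l. simpl. right. rewrite <- (half_pow_mul w j).
    rewrite pow_inv. field; repeat split; try apply pow_nonzero; lra.
Qed.

(** The derivative at [s] is the limit of the linear coefficients of the approximating polynomials:
    consecutive ones differ by [O (w^j)], by [approx_compare] at [t = s]. The differentiated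
    polynomials approximate it, one degree lower and with the rate doubled. *)
Lemma approx_derivative a b N w f : a < b -> 0 < w < 1 -> approx a b (S N) (w / 2) f ->
  exists g, approx a b N w g /\ has_deriv_on a b f g.
Proof.
  intros ab Hw H. destruct (approx_choice _ _ _ _ _ ab H) as [C [rho [c [HC [Hr Hc]]]]]. clear H.
  destruct (markov (S N)) as [Cm [HCm Mk]].
  set (K := 4 * Cm * C / rho).
  assert (HK : 0 <= K).
  { apply Rdiv_le_0_compat; [|lra]. repeat apply Rmult_le_pos; lra. }
  assert (Cmp : forall s t j, a <= s <= b -> a <= t <= b -> Rabs (t - s) <= rho / 2 * (/ 2) ^ j ->
    Rabs (peval (S N) (dpoly (c s j)) (t - s) - c t (S j) 1%nat) <= K * w ^ j).
  { apply (approx_compare a b (S N) w f C rho c Cm); auto; lra. }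
  assert (Lim : forall s, exists g, a <= s <= b -> forall j, Rabs (c s j 1%nat - g) <= K / (1 - w) * w ^ j).
  { intros s. destruct (Rle_dec a s); [destruct (Rle_dec s b)|].
    2, 3: exists 0; intros; lra.
    destruct (geom_lim (fun j => c s j 1%nat) K w ltac:(lra)) as [g Hg].
    - intros j. assert (Q := Cmp s s j ltac:(lra) ltac:(lra)). rewrite Rminus_diag, Rabs_R0 in Q.
      assert (Pj := pow_half_pos j).
      assert (Q' := Q ltac:(apply Rmult_le_pos; lra)). rewrite peval_0 in Q'. unfold dpoly in Q'. simpl INR in Q'.
      rewrite Rmult_1_l in Q'. rewrite <- Rabs_Ropp, Ropp_minus_distr. exact Q'.
    - exists g; auto. }
  apply fun_choice in Lim. destruct Lim as [g Hg].
  assert (HK1 : 0 <= K / (1 - w)) by (apply Rdiv_le_0_compat; lra).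
  set (C' := K + K / (1 - w)).
  assert (Ga : forall s j t, a <= s <= b -> a <= t <= b -> Rabs (t - s) <= rho / 2 * (/ 2) ^ j ->
     Rabs (g t - peval (S N) (dpoly (c s j)) (t - s)) <= C' * w ^ j).
  { intros s j t Hs Ht Hst. assert (A := Cmp s t j Hs Ht Hst). assert (B := Hg t Ht (S j)).
    assert (K / (1 - w) * w ^ S j <= K / (1 - w) * w ^ j).
    { apply Rmult_le_compat_l; auto. simpl. assert (0 < w ^ j) by (apply pow_lt; lra). nra. }
    apply Rabs_le_between in A. apply Rabs_le_between in B. unfold C'. apply Rabs_le. lra. }
  assert (App : approx a b N w g).
  { exists C', (rho / 2). split; [unfold C'; lra|split; [lra|]]. intros s j Hs. exists (dpoly (c s j)).
    intros t Ht Hst. auto. }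
  exists g. split; auto.
  assert (Cg := approx_cont a b N w g ab ltac:(lra) App).
  intros x Hx e He. destruct (Cg x Hx (e / 4) ltac:(lra)) as [d1 [Hd1 Hg1]]. simpl in Hg1. unfold Rdist in Hg1.
  destruct (geom_small w (8 * C / rho + C') (e / 4) ltac:(lra) ltac:(lra)) as [J HJ].
  set (A := rho / 2 * (/ 2) ^ J). assert (HA : 0 < A) by (apply Rmult_lt_0_compat; [lra|apply pow_half_pos]).
  exists (Rmin d1 A). split; [now apply Rmin_pos|].
  intros t [[Ht Htx] Hd]. simpl in *. unfold Rdist in *.
  assert (T1 := Rlt_le_trans _ _ _ Hd (Rmin_l _ _)). assert (T2 := Rlt_le_trans _ _ _ Hd (Rmin_r _ _)).
  set (h := Rabs (t - x)) in *. assert (Hh : 0 < h) by (apply Rabs_pos_lt; lra).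
  (* The scale is chosen comparable to [h = |t - x|], so that dividing the error [(w / 2)^j] by [h]
     leaves a multiple of [w^j]. *)
  destruct (dyadic_bracket h A ltac:(lra)) as [i [I1 I2]].
  set (j := (J + i)%nat).
  assert (Ej : A * (/ 2) ^ i = rho / 2 * (/ 2) ^ j) by (unfold A, j; rewrite pow_add; ring).
  assert (Ej' : A * (/ 2) ^ S i = rho / 4 * (/ 2) ^ j) by (simpl; rewrite <- Rmult_assoc, (Rmult_comm A), Rmult_assoc, Ej; field).
  rewrite Ej in I2. rewrite Ej' in I1.
  assert (Pj := pow_half_pos j). assert (Wj : 0 < w ^ j) by (apply pow_lt; lra).
  assert (Wj2 : w ^ j <= w ^ J).
  { unfold j. rewrite pow_add. assert (0 < w ^ J) by (apply pow_lt; lra).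
    assert (w ^ i <= 1) by (rewrite <- (pow1 i); apply pow_incr; lra). nra. }
  destruct (MVT_gen (peval (S (S N)) (c x j)) 0 (t - x) (peval (S N) (dpoly (c x j)))) as [y [Hy Ey]].
  { intros; apply is_derive_peval. }
  { intros; apply continuity_pt_filterlim, @ex_derive_continuous; eexists; apply is_derive_peval. }
  assert (Hy2 : Rabs y <= h /\ a <= x + y <= b).
  { unfold h, Rmin, Rmax in *. destruct (Rle_dec 0 (t - x)).
    - rewrite !Rabs_right by lra. lra.
    - rewrite !Rabs_left1 by lra. lra. }
  destruct Hy2 as [Hy2 Hy3].
  assert (G1 := Ga x j (x + y) Hx Hy3). replace (x + y - x) with y in G1 by ring. specialize (G1 ltac:(lra)).
  assert (G2 : Rabs (g (x + y) - g x) < e / 4).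
  { apply Hg1. split; auto. replace (x + y - x) with y by ring. lra. }
  assert (F1 := Hc x j t Hx Ht ltac:(fold h; lra)).
  assert (F2 := Hc x j x Hx Hx ltac:(rewrite Rminus_diag, Rabs_R0; apply Rmult_le_pos; lra)).
  rewrite Rminus_diag in F2.
  set (p := peval (S (S N)) (c x j)) in *.
  replace ((f t - f x) / (t - x) - g x) with
    (((f t - p (t - x)) - (f x - p 0)) / (t - x) + (peval (S N) (dpoly (c x j)) y - g x)).
  2: { rewrite Rminus_0_r in Ey. field_simplify_eq; [|lra]. rewrite <- Ey || idtac.
       replace (peval (S N) (dpoly (c x j)) y * t - peval (S N) (dpoly (c x j)) y * x) with
         (peval (S N) (dpoly (c x j)) y * (t - x)) by ring. 
       transitivity (f t - f x - (p (t - x) - p 0) + peval (S N) (dpoly (c x j)) y * (t - x) - g x * t + g x * x); [ring|].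
       rewrite Ey. ring. }
  eapply Rle_lt_trans; [apply Rabs_triang|].
  assert (F3 : Rabs ((f t - p (t - x) - (f x - p 0)) / (t - x)) <= 8 * C / rho * w ^ j).
  { unfold Rdiv at 1. rewrite Rabs_mult, Rabs_inv. fold h.
    apply Rmult_le_reg_r with h; auto. rewrite Rmult_assoc, Rinv_l by lra. rewrite Rmult_1_r.
    apply Rle_trans with (2 * C * (w / 2) ^ j).
    - apply Rabs_le_between in F1. apply Rabs_le_between in F2. apply Rabs_le. lra.
    - apply Rle_trans with (8 * C / rho * w ^ j * (rho / 4 * (/ 2) ^ j)).
      + right. rewrite <- (half_pow_mul w j), pow_inv. field; repeat split; try apply pow_nonzero; lra.
      + apply Rmult_le_compat_l; [|lra]. apply Rmult_le_pos; [|lra]. apply Rdiv_le_0_compat; lra. }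
  assert (F4 : (8 * C / rho + C') * w ^ j <= (8 * C / rho + C') * w ^ J).
  { apply Rmult_le_compat_l; auto. assert (0 <= 8 * C / rho) by (apply Rdiv_le_0_compat; lra). unfold C'; lra. }
  assert (F5 : Rabs (peval (S N) (dpoly (c x j)) y - g x) <= C' * w ^ j + e / 4).
  { apply Rabs_le_between in G1. apply Rabs_lt_between in G2. apply Rabs_le. lra. }
  lra.
Qed.

(** Each derivative doubles the rate, so [w / 2^N] becomes [w] after [N] of them. *)
Lemma approx_tower a b N : a < b -> forall w f, 0 < w < 1 -> approx a b N (w / 2 ^ N) f ->
  exists D, derivs_on a b f D N /\ (forall k, (k <= N)%nat -> cont_on a b (D k)) /\ approx a b 0 w (D N).
Proof.
  intros ab. induction N; intros w f Hw H.
  - simpl in H. replace (w / 1) with w in H by field. exists (fun _ => f). split; [split; [auto|intros; lia]|].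
    split; [intros; now apply (approx_cont a b 0 w f ab ltac:(lra))|auto].
  - assert (Hp : 1 <= 2 ^ N) by (apply pow_R1_Rle; lra).
    assert (Hw' : 0 < w / 2 ^ N < 1).
    { split; [apply Rdiv_lt_0_compat; lra|]. apply Rmult_lt_reg_r with (2 ^ N); [lra|].
      unfold Rdiv; rewrite Rmult_assoc, Rinv_l by lra. lra. }
    replace (w / 2 ^ S N) with (w / 2 ^ N / 2) in H by (simpl; field; lra).
    destruct (approx_derivative a b N (w / 2 ^ N) f ab Hw' H) as [g [Hg Dg]].
    destruct (IHN w g Hw Hg) as [D [[D0 D1] [Dc Da]]].
    exists (fun k => match k with O => f | S k => D k end). split; [split; [auto|]|split; [|auto]].
    + intros k Hk. destruct k.
      * eapply has_deriv_on_ext; [| |exact Dg]; [auto|]. intros; now rewrite D0.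
      * apply D1; lia.
    + intros k Hk. destruct k; [|apply Dc; lia].
      apply (approx_cont a b (S N) (w / 2 ^ N / 2) f ab); [lra|auto].
Qed.

Lemma uniform_bound a b N (D : nat -> R -> R) : a <= b -> (forall k, (k <= N)%nat -> cont_on a b (D k)) ->
  exists M, 0 <= M /\ forall k x, (k <= N)%nat -> a <= x <= b -> Rabs (D k x) <= M.
Proof.
  intros ab. induction N; intros H.
  - destruct (cont_on_bounded a b (D 0%nat) ab (H 0%nat ltac:(lia))) as [M [HM Hx]].
    exists M; split; auto. intros k x Hk. replace k with 0%nat by lia. auto.
  - destruct (cont_on_bounded a b (D (S N)) ab (H (S N) ltac:(lia))) as [M [HM Hx]].
    destruct IHN as [M' [HM' Hx']]; [intros; apply H; lia|].
    exists (M + M'). split; [lra|]. intros k x Hk Hxx. destruct (Nat.eq_dec k (S N)) as [->|].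
    + specialize (Hx x Hxx). lra.
    + specialize (Hx' k x ltac:(lia) Hxx). lra.
Qed.

(** At a scale comparable to [d], the second difference annihilates the polynomial of degree one and
    leaves the error [O (2^-j)]. Steps beyond [rho] are covered by the boundedness of [f]. *)
Lemma approx_zygmund a b f : a < b -> approx a b 0 (/ 2) f -> Zygmund a b f.
Proof.
  intros ab H. assert (Cf := approx_cont a b 0 (/ 2) f ab ltac:(lra) H). split; auto.
  destruct (cont_on_bounded a b f ltac:(lra) Cf) as [M [HM Hb]].
  destruct (approx_choice _ _ _ _ _ ab H) as [C [rho [c [HC [Hr Hc]]]]]. clear H.
  exists (8 * C / rho + 4 * M / rho). intros s d Hd Hsa Hsb.
  assert (P1 : 0 <= C / rho) by (apply Rdiv_le_0_compat; lra).
  assert (P2 : 0 <= M / rho) by (apply Rdiv_le_0_compat; lra).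
  apply Rmult_le_reg_r with d; auto. unfold Rdiv at 1. rewrite Rmult_assoc, Rinv_l, Rmult_1_r by lra.
  destruct (Rle_dec d rho) as [Hdr|Hdr].
  - destruct (dyadic_bracket d rho ltac:(lra)) as [j [I1 I2]]. simpl in I1. assert (Pj := pow_half_pos j).
    assert (A1 := Hc s j (s + d) ltac:(lra) ltac:(lra)). replace (s + d - s) with d in A1 by ring.
    rewrite (Rabs_right d) in A1 by lra. specialize (A1 I2).
    assert (A2 := Hc s j (s - d) ltac:(lra) ltac:(lra)). replace (s - d - s) with (- d) in A2 by ring.
    rewrite (Rabs_Ropp d), (Rabs_right d) in A2 by lra. specialize (A2 I2).
    assert (A3 := Hc s j s ltac:(lra) ltac:(lra)). rewrite Rminus_diag, Rabs_R0 in A3. specialize (A3 ltac:(lra)).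
    unfold peval in A1, A2, A3. simpl in A1, A2, A3.
    apply Rabs_le_between in A1. apply Rabs_le_between in A2. apply Rabs_le_between in A3.
    assert (B : C * (/ 2) ^ j <= 2 * (C / rho) * d).
    { apply Rle_trans with (2 * (C / rho) * (rho * (/ 2 * (/ 2) ^ j))); [right; field; lra|].
      apply Rmult_le_compat_l; lra. }
    assert (0 <= M / rho * d) by (apply Rmult_le_pos; lra).
    apply Rabs_le. unfold Rdiv in *. lra.
  - assert (B1 := Hb (s + d) ltac:(lra)). assert (B2 := Hb (s - d) ltac:(lra)). assert (B3 := Hb s ltac:(lra)).
    apply Rabs_le_between in B1. apply Rabs_le_between in B2. apply Rabs_le_between in B3.
    assert (M <= M / rho * d).
    { apply Rle_trans with (M / rho * rho); [right; field; lra|]. apply Rmult_le_compat_l; lra. }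
    assert (0 <= C / rho * d) by (apply Rmult_le_pos; lra).
    apply Rabs_le. unfold Rdiv in *. lra.
Qed.

Lemma Rpower_half_pow al j : Rpower 2 (- al) ^ j = Rpower ((/ 2) ^ j) al.
Proof.
  rewrite <- Rpower_pow by apply exp_pos. rewrite Rpower_mult.
  rewrite <- (Rpower_pow j (/ 2)) by lra. rewrite Rpower_mult.
  unfold Rpower. f_equal. rewrite ln_Rinv by lra. ring.
Qed.

Lemma Rpower_mono x y al : 0 < x <= y -> 0 <= al -> Rpower x al <= Rpower y al.
Proof. intros; apply Rle_Rpower_l; auto. Qed.

(** From one scale to the next the linear coefficients change by [O ((2 w)^j)]; since [2 w > 1] for
    [al < 1], they are [O ((2 w)^j)] themselves and contribute [O (w^j)] over a distance [2^-j]. At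
    [al = 1] the sum would produce a logarithm, which is why that case ends in the Zygmund class. *)
Lemma approx_holder a b al f : a < b -> 0 < al < 1 -> approx a b 0 (Rpower 2 (- al)) f ->
  exists M, 0 <= M /\ forall s t, a <= s <= b -> a <= t <= b -> s <> t ->
    Rabs (f t - f s) / Rpower (Rabs (t - s)) al <= M.
Proof.
  intros ab Hal H. set (w := Rpower 2 (- al)) in *.
  assert (Hw : / 2 < w < 1).
  { unfold w. split.
    - rewrite <- (Rpower_1 2) at 1 by lra. rewrite <- Rpower_Ropp. apply Rpower_lt; lra.
    - rewrite <- (Rpower_O 2) by lra. apply Rpower_lt; lra. }
  destruct (cont_on_bounded a b f ltac:(lra) (approx_cont a b 0 w f ab ltac:(lra) H)) as [M [HM Hb]].
  destruct (approx_choice _ _ _ _ _ ab H) as [C [rho [c [HC [Hr Hc]]]]]. clear H.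
  destruct (markov 0) as [Cm [HCm Mk]].
  (* Only the linear coefficient at the coarsest scale needs a bound of its own, from the bound of
     [f] and Markov's inequality. *)
  assert (C0 : forall s, a <= s <= b -> Rabs (c s 0%nat 1%nat) <= Cm * (M + C) / rho).
  { intros s Hs. destruct (interval_side a b s rho Hs ltac:(lra)) as [k [Hk Hin]].
    rewrite <- Hk. apply Mk; [intro E; rewrite E, Rabs_R0 in Hk; lra|].
    intros x Hx. specialize (Hin x Hx).
    assert (A := Hc s 0%nat (s + k * x) Hs Hin). replace (s + k * x - s) with (k * x) in A by ring.
    assert (Hkx : Rabs (k * x) <= rho * (/ 2) ^ 0).
    { simpl. rewrite Rabs_mult, Hk, (Rabs_right x) by lra. nra. }
    specialize (A Hkx). simpl pow in A. assert (B := Hb _ Hin).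
    apply Rabs_le_between in A. apply Rabs_le_between in B. apply Rabs_le. lra. }
  set (K0 := Cm * (M + C) / rho) in *. set (K := 4 * Cm * C / rho).
  assert (HK0 : 0 <= K0) by (apply Rdiv_le_0_compat; [apply Rmult_le_pos|]; lra).
  assert (HK : 0 <= K) by (apply Rdiv_le_0_compat; [repeat apply Rmult_le_pos|]; lra).
  set (K2 := K0 + K / (2 * w - 1)).
  assert (HK2 : 0 <= K / (2 * w - 1)) by (apply Rdiv_le_0_compat; lra).
  assert (Cj : forall s, a <= s <= b -> forall j, Rabs (c s j 1%nat) <= K0 + K / (2 * w - 1) * ((2 * w) ^ j - 1)).
  { intros s Hs. induction j.
    - simpl pow. specialize (C0 s Hs). lra.
    - assert (Q := approx_compare a b 0 (2 * w) f C rho c Cm ab ltac:(lra) HC Hr ltac:(lra)).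
      replace (2 * w / 2) with w in Q by field.
      specialize (Q Hc HCm Mk s s j Hs Hs). rewrite Rminus_diag, Rabs_R0 in Q.
      assert (Pj := pow_half_pos j). specialize (Q ltac:(apply Rmult_le_pos; lra)).
      unfold peval, dpoly in Q. simpl sum_f_R0 in Q. rewrite Rmult_1_l, Rmult_1_r in Q. fold K in Q.
      assert (E : K / (2 * w - 1) * ((2 * w) ^ S j - 1) = K / (2 * w - 1) * ((2 * w) ^ j - 1) + K * (2 * w) ^ j)
        by (simpl; field; lra).
      rewrite E. apply Rabs_le_between in Q. apply Rabs_le_between in IHj. apply Rabs_le. lra. }
  assert (Cj2 : forall s, a <= s <= b -> forall j, Rabs (c s j 1%nat) <= K2 * (2 * w) ^ j).
  { intros s Hs j. eapply Rle_trans; [apply Cj; auto|].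
    assert (1 <= (2 * w) ^ j) by (apply pow_R1_Rle; lra). unfold K2. nra. }
  set (K3 := (2 * C + K2 * rho) * Rpower (2 / rho) al + 2 * M * Rpower (/ rho) al).
  assert (HK3 : 0 <= 2 * C + K2 * rho).
  { assert (0 <= K2 * rho) by (apply Rmult_le_pos; [unfold K2|]; lra). lra. }
  assert (Pp : forall x, 0 < Rpower x al) by (intros; apply exp_pos).
  assert (T1 : 0 <= (2 * C + K2 * rho) * Rpower (2 / rho) al) by (apply Rmult_le_pos; [auto|left; auto]).
  assert (T2 : 0 <= 2 * M * Rpower (/ rho) al) by (apply Rmult_le_pos; [lra|left; auto]).
  exists K3. split; [unfold K3; lra|]. intros s t Hs Ht Nst.
  set (h := Rabs (t - s)). assert (Hh : 0 < h) by (apply Rabs_pos_lt; lra).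
  apply Rmult_le_reg_r with (Rpower h al); auto. unfold Rdiv at 1. rewrite Rmult_assoc, Rinv_l, Rmult_1_r.
  2: specialize (Pp h); lra.
  unfold K3. rewrite Rmult_plus_distr_r, !(Rmult_assoc _ (Rpower _ _) (Rpower _ _)).
  assert (I0 : 0 < / rho) by (apply Rinv_0_lt_compat; lra).
  rewrite !Rpower_mult_distr by (try lra; apply Rdiv_lt_0_compat; lra).
  destruct (Rle_dec h rho) as [Hhr|Hhr].
  - destruct (dyadic_bracket h rho ltac:(lra)) as [j [I1 I2]]. simpl in I1. assert (Pj := pow_half_pos j).
    assert (A1 := Hc s j t Hs Ht I2).
    assert (A3 := Hc s j s Hs Hs). rewrite Rminus_diag, Rabs_R0 in A3. specialize (A3 ltac:(apply Rmult_le_pos; lra)).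
    unfold peval in A1, A3. simpl sum_f_R0 in A1, A3.
    assert (B : Rabs (c s j 1%nat * (t - s)) <= K2 * rho * w ^ j).
    { rewrite Rabs_mult. fold h. apply Rle_trans with (K2 * (2 * w) ^ j * (rho * (/ 2) ^ j)).
      - apply Rmult_le_compat; auto using Rabs_pos. lra.
      - right. rewrite Rpow_mult_distr, pow_inv. field. apply pow_nonzero; lra. }
    assert (W : w ^ j <= Rpower (2 / rho * h) al).
    { unfold w. rewrite Rpower_half_pow. apply Rpower_mono; [|lra]. split; auto.
      apply Rmult_le_reg_l with (rho / 2); [lra|]. replace (rho / 2 * (2 / rho * h)) with h by (field; lra). lra. }
    assert (Rabs (f t - f s) <= (2 * C + K2 * rho) * w ^ j).
    { apply Rabs_le_between in A1. apply Rabs_le_between in A3. apply Rabs_le_between in B. apply Rabs_le. lra. }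
    assert ((2 * C + K2 * rho) * w ^ j <= (2 * C + K2 * rho) * Rpower (2 / rho * h) al) by (apply Rmult_le_compat_l; auto).
    assert (0 <= 2 * M * Rpower (/ rho * h) al) by (apply Rmult_le_pos; [lra|left; auto]). lra.
  - assert (B1 := Hb t Ht). assert (B3 := Hb s Hs).
    apply Rabs_le_between in B1. apply Rabs_le_between in B3.
    assert (1 <= Rpower (/ rho * h) al).
    { rewrite <- (Rpower_O (/ rho * h)) by (apply Rmult_lt_0_compat; lra). apply Rle_Rpower; [|lra].
      apply Rmult_le_reg_l with rho; [lra|]. rewrite <- Rmult_assoc, Rinv_r by lra. lra. }
    assert (2 * M * 1 <= 2 * M * Rpower (/ rho * h) al) by (apply Rmult_le_compat_l; lra).
    assert (0 <= (2 * C + K2 * rho) * Rpower (2 / rho * h) al) by (apply Rmult_le_pos; [auto|left; auto]).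
    apply Rabs_le. lra.
Qed.

Lemma approx_Cnalpha a b N al f : a < b -> 0 < al < 1 -> approx a b N (Rpower 2 (- al) / 2 ^ N) f ->
  Cnalpha a b N al f.
Proof.
  intros ab Hal H.
  assert (Hw : 0 < Rpower 2 (- al) < 1).
  { split; [apply exp_pos|]. rewrite <- (Rpower_O 2) by lra. apply Rpower_lt; lra. }
  destruct (approx_tower a b N ab _ f Hw H) as [D [HD [Dc Da]]].
  destruct (uniform_bound a b N D ltac:(lra) Dc) as [M1 [HM1 B1]].
  destruct (approx_holder a b al (D N) ab Hal Da) as [M2 [HM2 B2]].
  exists (M1 + M2 + 1). split; [lra|]. exists D. split; auto. split; auto. split.
  - intros k x Hk Hx. specialize (B1 k x Hk Hx). lra.
  - intros s t Hs Ht N0. specialize (B2 s t Hs Ht N0). lra.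
Qed.

Lemma approx_Zygmund_n a b N f : a < b -> approx a b N (/ 2 / 2 ^ N) f -> Zygmund_n a b N f.
Proof.
  intros ab H.
  destruct (approx_tower a b N ab (/ 2) f ltac:(lra) H) as [D [HD [Dc Da]]].
  destruct (uniform_bound a b N D ltac:(lra) Dc) as [M1 [HM1 B1]].
  exists D. split; auto. split; [intros; apply Dc; lia|]. split.
  - exists M1. intros k x Hk Hx. apply B1; [lia|auto].
  - now apply approx_zygmund.
Qed.

(** * Holomorphic approximations of the curve *)

Lemma near_mono e e' r Z : e <= e' -> near e r Z -> near e' r Z.
Proof. intros He [H1 H2]. split; auto. lra. Qed.

Section TipNear.
Variables (xi xi' : R -> R) (L : R).
Hypothesis (HL : 0 < L) (Dxi : forall t, is_derive xi t (xi' t)) (Bxi : forall t, Rabs (xi' t) <= L).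
Variable W : R -> C.
Hypothesis HW : tip_solution xi L W.

Lemma tip_size r : 0 < r -> L * sqrt r <= 1 -> Cmod (W r - xi r)%C <= 3 * sqrt r.
Proof.
  intros Hr HLr. eapply Rle_trans; [apply Cmod_le_sum|]. simpl. rewrite Ropp_0, Rplus_0_r.
  assert (S := sqrt_lt_R0 r Hr). assert (S2 := pow2_sqrt r ltac:(lra)).
  assert (X := tip_X _ _ _ HW r ltac:(lra)). assert (Y := tip_Y _ _ _ HW r ltac:(lra)).
  assert (Rabs (snd (W r)) <= 2 * sqrt r) by (apply pow2_le_inv; [lra|]; rewrite pow2_abs, Rpow_mult_distr, S2; lra).
  assert (L * r <= sqrt r) by (rewrite <- S2 at 1; nra). unfold Rminus in X. lra.
Qed.

(** [bl_near] cannot start at the singularity, so the growth estimate starts at a small [a], where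
    the quantity is at most [13 * a]: [9 * a] from [Z^2] and [4 * a] besides. Then [a] tends to
    0. *)
Lemma tip_near r : 0 < r -> L * sqrt r <= 1 -> near (4 * L * (r * sqrt r)) r (W r - xi r)%C.
Proof.
  intros Hr HLr. split. { simpl. rewrite Ropp_0, Rplus_0_r. apply (tip_bl _ _ _ HW); auto. }
  assert (Sr := sqrt_lt_R0 r Hr).
  assert (K : forall a, 0 < a <= r -> Cmod ((W r - xi r) * (W r - xi r) + 4 * r)%C <= 13 * a + 4 * L * (r * sqrt r)).
  { intros a Ha.
    assert (K := growth (fun x => (W x - xi x) * (W x - xi x) + 4 * x)%C (fun _ => 0%C)
      (fun x => - (2 * (W x - xi x) * xi' x))%C (fun x => 4 * L * (x * sqrt x)) (fun x => 6 * L * sqrt x) a r ltac:(lra)).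
    cbv beta in K.
    assert (K' : Cmod ((W r - xi r) * (W r - xi r) + 4 * r)%C <=
      Cmod ((W a - xi a) * (W a - xi a) + 4 * a)%C + (4 * L * (r * sqrt r) - 4 * L * (a * sqrt a))).
    { apply K.
      - intros x Hx. assert (Hb := tip_bl _ _ _ HW x ltac:(lra)). assert (Nz := bl_nonzero xi W x Hb).
        assert (DZ : cder (fun x => W x - xi x)%C x (-2 / (W x - xi x) - xi' x)%C).
        { apply cder_minus; [apply Hb|]. now apply cder_RtoC. }
        eapply cder_eq.
        + apply cder_plus; [apply cder_mult; exact DZ|].
          apply (cder_mult (fun _ => RtoC 4) (fun x => RtoC x)); [apply cder_const|apply cder_RtoC, @is_derive_id].
        + unfold one; simpl. rewrite RtoC_m2. field; auto.
      - intros; simpl; lra.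
      - intros x Hx. assert (S := sqrt_lt_R0 x ltac:(lra)). assert (S2 := pow2_sqrt x ltac:(lra)).
        auto_derive; [lra|]. set (q := sqrt x) in *. rewrite <- S2. field. lra.
      - intros x Hx. rewrite Cmod_opp, !Cmod_mult, !Cmod_R, (Rabs_right 2) by lra.
        assert (sqrt x <= sqrt r) by (apply sqrt_le_1_alt; lra).
        assert (Sz := tip_size x ltac:(lra) ltac:(nra)). specialize (Bxi x).
        assert (Cmod (W x - xi x)%C * Rabs (xi' x) <= 3 * sqrt x * L).
        { apply Rmult_le_compat; auto; [apply Cmod_ge_0|apply Rabs_pos]. }
        lra. }
    assert (S := sqrt_pos a). assert (0 <= L * (a * sqrt a)) by (repeat apply Rmult_le_pos; lra).
    assert (Sa2 := pow2_sqrt a ltac:(lra)). assert (sqrt a <= sqrt r) by (apply sqrt_le_1_alt; lra).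
    assert (Sz := tip_size a ltac:(lra) ltac:(nra)).
    assert (Cmod ((W a - xi a) * (W a - xi a) + 4 * a)%C <= 13 * a).
    { eapply Rle_trans; [apply Cmod_triangle|]. rewrite !Cmod_mult, !Cmod_R, (Rabs_right 4), (Rabs_right a) by lra.
      assert (Cmod (W a - xi a)%C * Cmod (W a - xi a)%C <= 3 * sqrt a * (3 * sqrt a))
        by (apply Rmult_le_compat; auto using Cmod_ge_0). nra. }
    lra. }
  apply le_epsilon. intros e He.
  specialize (K (Rmin r (e / 13)) ltac:(split; [apply Rmin_pos; lra|apply Rmin_l])).
  assert (Q := Rmin_r r (e / 13)). lra.
Qed.
End TipNear.

(** * The approximation near one time [c0]: [q] replaces the driver, with error at most [em A] up to
    distance [A] *)

Section Local.
Variables (le le' : R -> R) (L : R).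
Hypothesis (HL : 0 < L) (Dle : forall t, is_derive le t (le' t)) (Ble : forall t, Rabs (le' t) <= L).
Variable Wt : R -> R -> C.
Hypothesis HWt : forall t, tip_solution (fun r => le (t - r)) L (Wt t).
Variables (T c0 : R) (n p : nat) (c : nat -> R) (q q' : R -> R) (G : (nat -> R) -> C -> C -> C) (B r0 : R) (em : R -> R).
Hypothesis Dq : forall y, is_derive q y (q' y).
Hypothesis Eq : forall y : R, Qpoly n c y = RtoC (q' y).
Hypothesis (HB : 1 <= B) (Hr0 : 0 < r0 <= / 4) (Hr0c : 2 * r0 <= c0 <= T).
Hypothesis HG : forall (s x : C) r, Cmod s <= 1 -> 0 < fst x -> 0 < r <= r0 ->
    Cmod (x * x - r)%C <= r / 10 ->
    near (4 * Cmod (x * x - r)%C + B * (r * sqrt r)) r (G c s x) /\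
    forall (xf : R -> C) t, xf t = x -> cder xf t (/ (2 * x))%C -> exists E,
      Cmod E <= B * r ^ p /\
      cder (fun t => G c s (xf t)) t (-2 / G c s x + Qpoly n c (s - x * x) + E)%C.
Hypothesis PG : polyf G.
Hypothesis Herr : forall y A, 0 < A <= 1 -> Rabs y <= A -> 0 <= c0 + y <= T -> Rabs (le (c0 + y) - q y) <= em A.
Hypothesis Hem : forall r A, 0 < r <= A -> A <= 1 -> B * r ^ p * r <= em A.
Hypothesis Hsm : forall A, 0 < A <= r0 -> 1000 * em A <= A.
Hypothesis (HLr : 160 * L * sqrt r0 <= 1) (HBr : 100 * B * sqrt r0 <= 1).

Lemma em_pos A : 0 < A <= 1 -> 0 <= em A.
Proof.
  intros HA. eapply Rle_trans; [|apply (Hem A A); lra]. repeat apply Rmult_le_pos; try lra. apply pow_le; lra.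
Qed.

(* The approximate tip solution for the polynomial driver [q] and the time [c0 + s], in the
   time variable of the flow ending at [c0 + d]; only its value at [r = a], [d = 0] is continued
   by the true flow in [approx_curve]. *)
Definition tipV (d : R) (s : C) (r : R) : C := (RtoC (q (d - r)) + G c s (csqrt (s - d + r)))%C.

Lemma sqrt_small r : 0 < r <= r0 -> 0 < sqrt r /\ sqrt r ^ 2 = r /\ 160 * L * sqrt r <= 1 /\ 100 * B * sqrt r <= 1 /\ sqrt r <= / 2.
Proof.
  intros Hr. assert (S := sqrt_lt_R0 r ltac:(lra)). assert (S2 := pow2_sqrt r ltac:(lra)).
  assert (sqrt r <= sqrt r0) by (apply sqrt_le_1_alt; lra).
  split; [auto|]. split; [auto|]. split; [nra|]. split; [nra|]. apply pow2_le_inv; lra.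
Qed.

Lemma csqrt_shift (d : R) (s : C) r : Cmod (s - d)%C <= r / 10 -> 0 < r ->
  0 < fst (csqrt (s - d + r)%C) /\ (csqrt (s - d + r) * csqrt (s - d + r) = s - d + r)%C /\ 0 < fst (s - d)%C + r.
Proof.
  intros Hs Hr. assert (Q := Rle_trans _ _ _ (Cmod_fst (s - d)%C) Hs). apply Rabs_le_between in Q.
  assert (P : 0 < fst (s - d + r)%C) by (simpl in *; lra).
  destruct (csqrt_spec _ P). split; [auto|]. split; [auto|]. lra.
Qed.

Lemma tipV_near (d : R) (s : C) r : 0 < r <= r0 -> Cmod s <= 1 -> Cmod (s - d)%C <= r / 10 ->
  near (4 * Cmod (s - d)%C + B * (r * sqrt r)) r (tipV d s r - q (d - r)%R)%C.
Proof.
  intros Hr Hs Hd. destruct (csqrt_shift d s r Hd ltac:(lra)) as [X1 [X2 _]].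
  unfold tipV. set (x := csqrt (s - d + r)%C) in *.
  replace (RtoC (q (d - r)) + G c s x - q (d - r)%R)%C with (G c s x) by ring.
  assert (E : (x * x - r)%C = (s - d)%C) by (rewrite X2; ring).
  destruct (HG s x r Hs X1 Hr ltac:(rewrite E; auto)) as [N _]. rewrite E in N. auto.
Qed.

Lemma tipV_ode (d : R) (s : C) r : 0 < r <= r0 -> Cmod s <= 1 -> Cmod (s - d)%C <= r / 10 ->
  exists E, Cmod E <= B * r ^ p /\ cder (tipV d s) r (-2 / (tipV d s r - q (d - r)%R) + E)%C.
Proof.
  intros Hr Hs Hd. destruct (csqrt_shift d s r Hd ltac:(lra)) as [X1 [X2 X3]].
  set (x := csqrt (s - d + r)%C) in *.
  assert (E : (x * x - r)%C = (s - d)%C) by (rewrite X2; ring).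
  destruct (HG s x r Hs X1 Hr ltac:(rewrite E; auto)) as [_ D].
  destruct (D (fun t : R => csqrt (s - d + t)%C) r eq_refl) as [E0 [BE DE]].
  { unfold x. apply csqrt_cder. auto. }
  exists E0; split; auto. unfold tipV at 1. eapply cder_eq.
  - apply cder_plus; [|exact DE]. apply (cder_RtoC (fun r => q (d - r)) r (- q' (d - r))).
    eapply is_derive_eq.
    + apply (is_derive_comp q (fun r => d - r)); [apply Dq|]. apply @is_derive_minus; [apply @is_derive_const|apply @is_derive_id].
    + unfold scal, minus, plus, opp, zero, one; simpl; unfold mult; simpl; ring.
  - unfold tipV. fold x. replace (RtoC (q (d - r)) + G c s x - q (d - r)%R)%C with (G c s x) by ring.
    replace (s - x * x)%C with (RtoC (d - r)) by (rewrite X2, RtoC_minus; ring).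
    rewrite Eq, RtoC_opp. ring.
Qed.

Lemma e_small a r : 0 < a <= r -> r <= r0 -> / 10 * a + (8 * L + B) * (r * sqrt r) <= r / 2.
Proof.
  intros Ha Hr. destruct (sqrt_small r ltac:(lra)) as [S [S2 [SL [SB _]]]].
  assert (r * (160 * L * sqrt r) <= r * 1) by (apply Rmult_le_compat_l; lra).
  assert (r * (100 * B * sqrt r) <= r * 1) by (apply Rmult_le_compat_l; lra). lra.
Qed.

(** [Z1] and [Z2] are measured from different drivers. Rewriting the equation of [W - tipV] with the
    driver error [mu] gives the source [- 2 / (Z1 * Z2) * mu - E]. As [|2 / (Z1 * Z2)| <= / r] and
    the truncation error satisfies [|E| * r <= em A], it is at most [2 * em A / r]. *)
Lemma tipV_compare (d : R) (s : C) (W : R -> C) a b A : 0 < a <= b -> b <= r0 -> b <= A <= 1 -> Cmod s <= 1 ->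
  Cmod (s - d)%C <= a / 100 ->
  (forall r, a <= r <= b -> bl (fun r => le (c0 + d - r)) W r) ->
  (forall r, a <= r <= b -> near (/ 10 * a + 8 * L * (r * sqrt r)) r (W r - le (c0 + d - r)%R)%C) ->
  (forall r, a <= r <= b -> 0 <= c0 + d - r <= T /\ Rabs (d - r) <= A) ->
  sqrt b * Cmod (W b - tipV d s b)%C <=
  exp (/ 10 + 2 * (8 * L + B)) * (sqrt a * Cmod (W a - tipV d s a)%C + 2 * (2 * em A) * sqrt b).
Proof.
  intros Hab Hb HA Hs Hd HW NW Hrg.
  assert (Ho : forall r, exists E, a <= r <= b -> Cmod E <= B * r ^ p /\
    cder (tipV d s) r (-2 / (tipV d s r - q (d - r)%R) + E)%C).
  { intros r. destruct (Rle_dec a r); [destruct (Rle_dec r b)|].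
    - destruct (tipV_ode d s r ltac:(lra) Hs ltac:(lra)) as [E HE]. exists E; auto.
    - exists 0%C; intros; lra.
    - exists 0%C; intros; lra. }
  apply fun_choice in Ho. destruct Ho as [E HE].
  set (Z1 := fun r => (W r - le (c0 + d - r)%R)%C). set (Z2 := fun r => (tipV d s r - q (d - r)%R)%C).
  set (mu := fun r => le (c0 + d - r) - q (d - r)).
  assert (Hmu : forall r, a <= r <= b -> Rabs (mu r) <= em A).
  { intros r Hr. unfold mu. destruct (Hrg r Hr) as [R1 R2].
    replace (c0 + d - r) with (c0 + (d - r)) in * by ring. apply Herr; auto; lra. }
  assert (N1 : forall r, a <= r <= b -> near (/ 10 * a + (8 * L + B) * (r * sqrt r)) r (Z1 r)).
  { intros r Hr. eapply near_mono; [|apply NW; auto].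
    assert (S := sqrt_pos r). assert (0 <= r * sqrt r) by (apply Rmult_le_pos; lra).
    assert (0 <= B * (r * sqrt r)) by (apply Rmult_le_pos; lra). lra. }
  assert (N2 : forall r, a <= r <= b -> near (/ 10 * a + (8 * L + B) * (r * sqrt r)) r (Z2 r)).
  { intros r Hr. eapply near_mono; [|apply tipV_near; auto; lra].
    assert (S := sqrt_pos r). assert (0 <= r * sqrt r) by (apply Rmult_le_pos; lra).
    assert (0 <= L * (r * sqrt r)) by (apply Rmult_le_pos; lra). lra. }
  assert (Sm : forall r, a <= r <= b -> / 10 * a + (8 * L + B) * (r * sqrt r) <= r / 2)
    by (intros; apply e_small; lra).
  assert (NZ : forall Z r, 0 < snd Z -> Z <> RtoC r).
  { intros Z r HZ HE0. rewrite HE0 in HZ. simpl in HZ. lra. }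
  apply (near_comparison (fun r => W r - tipV d s r)%C Z1 Z2
    (fun r => - (2 / (Z1 r * Z2 r)) * mu r - E r)%C a b (/ 10) (8 * L + B) (2 * em A)); auto; try lra.
  - assert (Q := em_pos A ltac:(lra)). lra.
  - intros r Hr. destruct (HE r Hr) as [_ DE]. destruct (HW r Hr) as [DW _].
    assert (Z1n := NZ _ 0 (proj1 (N1 r Hr))). assert (Z2n := NZ _ 0 (proj1 (N2 r Hr))).
    eapply cder_eq; [apply cder_minus; [exact DW|exact DE]|].
    change (W r - le (c0 + d - r))%C with (Z1 r). change (tipV d s r - q (d - r)%R)%C with (Z2 r).
    replace (W r - tipV d s r)%C with (Z1 r - Z2 r + mu r)%C.
    2: { unfold Z1, Z2, mu. rewrite RtoC_minus. ring. }
    rewrite RtoC_m2. field. auto.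
  - intros r Hr. destruct (HE r Hr) as [BE _].
    destruct (near_product _ r (Z1 r) (Z2 r) ltac:(lra) (Sm r Hr) (N1 r Hr) (N2 r Hr)) as [_ BP].
    unfold Cminus. eapply Rle_trans; [apply Cmod_triangle|]. rewrite !Cmod_opp, Cmod_mult, Cmod_opp, Cmod_R.
    apply Rmult_le_reg_r with r; [lra|]. replace (2 * em A / r * r) with (2 * em A) by (field; lra).
    specialize (Hmu r Hr). assert (Q := Hem r A ltac:(lra) ltac:(lra)).
    assert (Cmod (2 / (Z1 r * Z2 r))%C * Rabs (mu r) <= / r * em A) by (apply Rmult_le_compat; auto using Cmod_ge_0, Rabs_pos).
    assert (/ r * em A * r = em A) by (field; lra).
    rewrite Rmult_plus_distr_r.
    assert (Cmod (2 / (Z1 r * Z2 r))%C * Rabs (mu r) * r <= / r * em A * r) by (apply Rmult_le_compat_r; lra).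
    assert (Cmod (E r) * r <= B * r ^ p * r) by (apply Rmult_le_compat_r; lra). lra.
Qed.

Let xi := fun r => le (c0 - r).
Let xi' := fun r => - le' (c0 - r).

Lemma xi_deriv r : is_derive xi r (xi' r).
Proof. apply driver_deriv; auto. Qed.

Lemma xi_bound r : Rabs (xi' r) <= L.
Proof. unfold xi'. rewrite Rabs_Ropp; apply Ble. Qed.

(** The driver error at scale [a] is at most [a / 1000], so even when measured from the true driver
    the model is close enough to [2 i sqrt a] for [bl_near] and [bl_decay] to start there. *)
Lemma tipV_start (s : C) a : 0 < a <= r0 -> Cmod s <= a / 100 ->
  Cmod ((tipV 0 s a - xi a) * (tipV 0 s a - xi a) + 4 * a)%C <= a / 10 /\ sqrt a <= snd (tipV 0 s a) /\
  Cmod (tipV 0 s a - q (0 - a)%R)%C <= 3 * sqrt a.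
Proof.
  intros Ha Hs. destruct (sqrt_small a Ha) as [S [S2 [SL [SB Sh]]]].
  assert (Es : (s - 0)%C = s) by ring.
  assert (N := tipV_near 0 s a Ha ltac:(lra) ltac:(rewrite Es; lra)). rewrite Es in N.
  set (g := (tipV 0 s a - q (0 - a)%R)%C) in *.
  assert (HBa : B * (a * sqrt a) <= a / 100) by (assert (a * (100 * B * sqrt a) <= a * 1) by (apply Rmult_le_compat_l; lra); lra).
  assert (He : 4 * Cmod s + B * (a * sqrt a) <= a / 2) by lra.
  assert (Ng := near_Cmod _ _ _ He N). assert (Sg := near_snd _ _ _ He N).
  destruct N as [Pg Cg].
  assert (Hg : Cmod g <= 3 * sqrt a) by (apply pow2_le_inv; [lra|]; rewrite Rpow_mult_distr, S2; lra).
  set (mu := q (0 - a) - le (c0 - a)).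
  assert (Hmu : Rabs mu <= a / 1000).
  { unfold mu. rewrite Rabs_minus_sym. replace (c0 - a) with (c0 + (0 - a)) by ring.
    eapply Rle_trans; [apply (Herr (0 - a) a)|]; try lra.
    - rewrite Rabs_left; lra.
    - assert (Q := Hsm a ltac:(lra)). lra. }
  split; [|split; auto].
  - replace (tipV 0 s a - xi a)%C with (g + mu)%C by (unfold g, mu, xi; rewrite RtoC_minus; ring).
    replace ((g + mu) * (g + mu) + 4 * a)%C with ((g * g + 4 * a) + (2 * g * mu + mu * mu))%C by ring.
    eapply Rle_trans; [apply Cmod_triangle|].
    assert (Cmod (2 * g * mu + mu * mu)%C <= 2 * (3 * sqrt a) * (a / 1000) + a / 1000 * (a / 1000)).
    { eapply Rle_trans; [apply Cmod_triangle|]. rewrite !Cmod_mult, !Cmod_R, (Rabs_right 2) by lra.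
      apply Rplus_le_compat; apply Rmult_le_compat; auto using Rabs_pos.
      - apply Rmult_le_pos; [lra|apply Cmod_ge_0].
      - apply Rmult_le_compat_l; lra. }
    nra.
  - replace (snd (tipV 0 s a)) with (snd g) by (unfold g; simpl; ring).
    apply pow2_le_inv; lra.
Qed.

Variable FL : R -> C -> R -> C.
Hypothesis HFL : forall a z, 0 < snd z -> FL a z a = z /\ forall r, a <= r -> bl xi (FL a z) r.

Definition approx_curve (a : R) (s : C) : C := FL a (tipV 0 s a) c0.

Let K0 := exp (/ 10 + 16 * L) * / sqrt r0 * exp (2 / r0 * (c0 - r0)).
Let K1 := exp (/ 10 + 2 * (8 * L + B)).

(** From [a] to [2 * a] the true flow started on the model is compared with the model; they agree at
    [a], so their distance at [2 * a] is [O (em (2 * a))]. Afterwards both values follow the true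
    flow, and [bl_decay] adds the factor [sqrt (2 * a)]. *)
Lemma approx_curve_step a (s : C) : 0 < 2 * a <= r0 -> Cmod s <= a / 100 ->
  Cmod (approx_curve a s - approx_curve (2 * a) s)%C <= K0 * (sqrt (2 * a) * (K1 * (4 * em (2 * a)))).
Proof.
  intros Ha Hs.
  destruct (tipV_start s a ltac:(lra) Hs) as [St1 [Y1 _]].
  destruct (tipV_start s (2 * a) ltac:(lra) ltac:(lra)) as [St2 [Y2 _]].
  destruct (sqrt_small a ltac:(lra)) as [S1 _]. destruct (sqrt_small (2 * a) ltac:(lra)) as [S2 [S22 [SL2 [SB2 _]]]].
  destruct (HFL a (tipV 0 s a) ltac:(lra)) as [I1 B1].
  destruct (HFL (2 * a) (tipV 0 s (2 * a)) ltac:(lra)) as [I2 B2].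
  set (W1 := FL a (tipV 0 s a)) in *. set (W2 := FL (2 * a) (tipV 0 s (2 * a))) in *.
  assert (N1 := bl_near xi xi' L HL xi_deriv xi_bound W1 a (2 * a) ltac:(lra) ltac:(assert (0 <= L * sqrt (2 * a)) by (apply Rmult_le_pos; lra); lra)
    ltac:(intros; apply B1; lra) ltac:(rewrite I1; exact St1)).
  assert (Ex : forall r, c0 + 0 - r = c0 - r) by (intros; ring).
  assert (Cm := tipV_compare 0 s W1 a (2 * a) (2 * a) ltac:(lra) ltac:(lra) ltac:(lra) ltac:(lra)
    ltac:(replace (s - 0)%C with s by ring; auto)).
  assert (D : Cmod (W1 (2 * a)%R - tipV 0 s (2 * a))%C <= K1 * (4 * em (2 * a))).
  { apply Rmult_le_reg_l with (sqrt (2 * a)); auto. eapply Rle_trans; [apply Cm|].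
    - intros r Hr. destruct (B1 r ltac:(lra)) as [D P]. split; auto. rewrite Ex. exact D.
    - intros r Hr. rewrite Ex. apply N1; auto.
    - intros r Hr. rewrite Rabs_left by lra. lra.
    - rewrite I1. replace (tipV 0 s a - tipV 0 s a)%C with (RtoC 0) by ring.
      rewrite Cmod_0. unfold K1. right. ring. }
  assert (N1' := N1 (2 * a) ltac:(lra)). destruct N1' as [_ N1'].
  assert (Hx : 2 * a * (160 * L * sqrt (2 * a)) <= 2 * a * 1) by (apply Rmult_le_compat_l; lra).
  assert (HLr' : 20 * L * sqrt r0 <= 1).
  { assert (0 <= L * sqrt r0) by (apply Rmult_le_pos; [lra|apply sqrt_pos]). lra. }
  assert (Dec := bl_decay xi xi' L HL xi_deriv xi_bound W1 W2 (2 * a) r0 c0 ltac:(lra) ltac:(lra) ltac:(lra) HLr'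
    ltac:(intros; apply B1; lra) ltac:(intros; apply B2; lra) ltac:(unfold xi in *; lra) ltac:(rewrite I2; exact St2)).
  unfold approx_curve. fold W1 W2. eapply Rle_trans; [exact Dec|]. fold K0.
  assert (HK0 : 0 < K0).
  { unfold K0. repeat apply Rmult_lt_0_compat; try apply exp_pos. apply Rinv_0_lt_compat, sqrt_lt_R0; lra. }
  apply Rmult_le_compat_l; [lra|]. apply Rmult_le_compat_l; [lra|]. rewrite I2. exact D.
Qed.

(** The model with [d = s = sg] starts at the same singularity as the true tip of time [c0 + sg], up
    to the driver error, so they can be compared from [a0] near 0 up to [u = a + sg]. Seen from
    [c0], that is from time [a] on, both flow lines have the same driver, and [bl_decay] applies. *)
Lemma approx_curve_tip a sg : 0 < 2 * a <= r0 -> Rabs sg <= a / 100 -> c0 + sg <= T ->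
  Cmod (tip_curve Wt (c0 + sg) - approx_curve a sg)%C <= K0 * (sqrt a * (K1 * (4 * em (2 * a)))).
Proof.
  intros Ha Hs HT. set (t := c0 + sg). set (u := a + sg).
  assert (Hs' := Hs). apply Rabs_le_between in Hs'.
  assert (Hu : 99 / 100 * a <= u <= 101 / 100 * a) by (unfold u; lra).
  assert (Cs : Cmod (RtoC sg) <= a / 100) by (rewrite Cmod_R; auto).
  destruct (tipV_start sg a ltac:(lra) Cs) as [St2 [Y2 _]].
  destruct (sqrt_small a ltac:(lra)) as [Sa _]. destruct (sqrt_small u ltac:(lra)) as [Su [Su2 [SLu [SBu _]]]].
  destruct (HFL a (tipV 0 sg a) ltac:(lra)) as [I2 B2].
  set (W2 := FL a (tipV 0 sg a)) in *.
  assert (Dt : forall r, is_derive (fun r => le (t - r)) r (- le' (t - r))) by (intros; apply driver_deriv; auto).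
  assert (Bt : forall r, Rabs (- le' (t - r)) <= L) by (intros; rewrite Rabs_Ropp; apply Ble).
  assert (Tn : forall r, 0 < r <= u -> near (4 * L * (r * sqrt r)) r (Wt t r - le (t - r)%R)%C).
  { intros r Hr. destruct (sqrt_small r ltac:(lra)) as [Sr [_ [SLr _]]].
    apply (tip_near (fun r => le (t - r)) (fun r => - le' (t - r)) L HL Dt Bt (Wt t) (HWt t)); [lra|].
    assert (0 <= L * sqrt r) by (apply Rmult_le_pos; lra). lra. }
  assert (HK1 : 0 < K1) by apply exp_pos.
  assert (Em := em_pos (2 * a) ltac:(lra)).
  assert (D : Cmod (Wt t u - tipV sg sg u)%C <= K1 * (4 * em (2 * a))).
  { apply Rmult_le_reg_l with (sqrt u); auto. apply le_epsilon. intros e He.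
    (* Small enough for the weighted initial difference, at most [10 * sqrt a0], to cost at most [e]
       after multiplication by [K1]. *)
    set (a0 := Rmin u ((e / (10 * K1)) ^ 2)).
    assert (Pe : 0 < e / (10 * K1)) by (apply Rdiv_lt_0_compat; lra).
    assert (Ha0 : 0 < a0 <= u) by (split; [apply Rmin_pos; [lra|apply pow_lt; auto]|apply Rmin_l]).
    assert (Sa0 : sqrt a0 <= e / (10 * K1)).
    { assert (Q := sqrt_pos a0). apply pow2_le_inv; [lra|]. rewrite pow2_sqrt by lra. apply Rmin_r. }
    assert (Z0 : (RtoC sg - RtoC sg)%C = RtoC 0) by ring.
    assert (Cm := tipV_compare sg sg (Wt t) a0 u (2 * a) Ha0 ltac:(lra) ltac:(lra) ltac:(lra)
      ltac:(rewrite Z0, Cmod_0; lra)). fold t in Cm.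
    assert (Cm' := Cm ltac:(intros; apply (tip_bl _ _ _ (HWt t)); lra)). clear Cm.
    assert (Cm : sqrt u * Cmod (Wt t u - tipV sg sg u)%C <= exp (/ 10 + 2 * (8 * L + B)) *
      (sqrt a0 * Cmod (Wt t a0 - tipV sg sg a0)%C + 2 * (2 * em (2 * a)) * sqrt u)).
    { apply Cm'.
      - intros r Hr. eapply near_mono; [|apply Tn; lra].
        assert (Q := sqrt_pos r). assert (0 <= L * (r * sqrt r)) by (repeat apply Rmult_le_pos; lra). lra.
      - intros r Hr. split; [unfold t; lra|]. apply Rabs_le. unfold t in *. lra. }
    fold K1 in Cm.
    assert (Da : Cmod (Wt t a0 - tipV sg sg a0)%C <= 10).
    { destruct (sqrt_small a0 ltac:(lra)) as [S0 [S02 [SL0 [SB0 Sh]]]].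
      assert (T1 : Cmod (Wt t a0 - le (t - a0)%R)%C <= 3 * sqrt a0).
      { apply (tip_size (fun r => le (t - r)) L (Wt t) (HWt t)); [lra|].
        assert (0 <= L * sqrt a0) by (apply Rmult_le_pos; lra). lra. }
      assert (N := tipV_near sg sg a0 ltac:(lra) ltac:(lra) ltac:(rewrite Z0, Cmod_0; lra)).
      rewrite Z0, Cmod_0 in N.
      assert (T2 : Cmod (tipV sg sg a0 - q (sg - a0)%R)%C <= 3 * sqrt a0).
      { apply pow2_le_inv; [lra|]. rewrite Rpow_mult_distr, S02.
        assert (Q := e_small a0 a0 ltac:(lra) ltac:(lra)).
        assert (0 <= L * (a0 * sqrt a0)) by (repeat apply Rmult_le_pos; lra).
        apply near_Cmod in N; lra. }
      assert (T3 : Rabs (le (t - a0) - q (sg - a0)) <= em (2 * a)).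
      { unfold t. replace (c0 + sg - a0) with (c0 + (sg - a0)) by ring. apply Herr; [lra| |lra].
        apply Rabs_le. lra. }
      assert (Q := Hsm (2 * a) Ha).
      replace (Wt t a0 - tipV sg sg a0)%C with ((Wt t a0 - le (t - a0)%R) + (RtoC (le (t - a0) - q (sg - a0)) -
        (tipV sg sg a0 - q (sg - a0)%R)))%C by (rewrite RtoC_minus; ring).
      eapply Rle_trans; [apply Cmod_triangle|]. unfold Cminus at 2.
      assert (T4 := Cmod_triangle (RtoC (le (t - a0) - q (sg - a0))) (- (tipV sg sg a0 - q (sg - a0)%R))%C).
      rewrite Cmod_opp, Cmod_R in T4. unfold Cminus in *. lra. }
    assert (sqrt a0 * Cmod (Wt t a0 - tipV sg sg a0)%C <= e / (10 * K1) * 10)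
      by (apply Rmult_le_compat; auto using sqrt_pos, Cmod_ge_0).
    assert (E1 : K1 * (e / (10 * K1) * 10) = e) by (field; lra).
    assert (K1 * (sqrt a0 * Cmod (Wt t a0 - tipV sg sg a0)%C) <= K1 * (e / (10 * K1) * 10)) by (apply Rmult_le_compat_l; lra).
    lra. }
  (* The model depends on [d] and [r] only through [d - r], which is [- a] on both sides. *)
  assert (EV : tipV sg sg u = tipV 0 sg a).
  { unfold tipV. replace (sg - u) with (0 - a) by (unfold u; ring).
    replace (sg - sg + u)%C with (sg - 0 + a)%C; [reflexivity|]. unfold u. rewrite RtoC_plus. ring. }
  rewrite EV in D.
  set (W1 := fun r => Wt t (r + sg)).
  assert (B1 : forall r, a <= r -> bl xi W1 r).
  { intros r Hr. assert (Q := bl_shift le t sg r (Wt t)). replace (t - sg) with c0 in Q by (unfold t; ring).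
    apply Q. apply (tip_bl _ _ _ (HWt t)). lra. }
  assert (St1 : Cmod ((W1 a - xi a) * (W1 a - xi a) + 4 * a)%C <= a / 10).
  { unfold W1, xi. fold u. replace (c0 - a) with (t - u) by (unfold t, u; ring).
    destruct (Tn u ltac:(lra)) as [_ N]. set (z := (Wt t u - le (t - u)%R)%C) in *.
    replace (z * z + 4 * a)%C with ((z * z + 4 * u) - 4 * sg)%C by (unfold u; rewrite RtoC_plus; ring).
    unfold Cminus. eapply Rle_trans; [apply Cmod_triangle|]. rewrite Cmod_opp, (Cmod_mult 4), !Cmod_R, (Rabs_right 4) by lra.
    assert (u * (160 * L * sqrt u) <= u * 1) by (apply Rmult_le_compat_l; lra). lra. }
  assert (HLr' : 20 * L * sqrt r0 <= 1).
  { assert (0 <= L * sqrt r0) by (apply Rmult_le_pos; [lra|apply sqrt_pos]). lra. }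
  assert (Dec := bl_decay xi xi' L HL xi_deriv xi_bound W1 W2 a r0 c0 ltac:(lra) ltac:(lra) ltac:(lra) HLr'
    ltac:(intros; apply B1; lra) ltac:(intros; apply B2; lra) St1 ltac:(rewrite I2; exact St2)).
  unfold approx_curve, tip_curve. fold W2. change (Wt t t) with (W1 c0).
  eapply Rle_trans; [exact Dec|]. fold K0.
  assert (HK0 : 0 < K0).
  { unfold K0. repeat apply Rmult_lt_0_compat; try apply exp_pos. apply Rinv_0_lt_compat, sqrt_lt_R0; lra. }
  apply Rmult_le_compat_l; [lra|]. apply Rmult_le_compat_l; [lra|]. rewrite I2. exact D.
Qed.

Lemma approx_curve_bound a (s : C) : 0 < 2 * a <= r0 -> Cmod s <= a / 100 ->
  Cmod (approx_curve a s) <= Rabs (q (0 - a)) + 3 * sqrt a + 2 / sqrt a * (c0 - a).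
Proof.
  intros Ha Hs. destruct (tipV_start s a ltac:(lra) Hs) as [_ [Y1 V1]].
  destruct (sqrt_small a ltac:(lra)) as [Sa _].
  destruct (HFL a (tipV 0 s a) ltac:(lra)) as [I1 B1]. unfold approx_curve. set (W := FL a (tipV 0 s a)) in *.
  assert (Q := linear_bound W (fun _ => 0%C) (fun r => (-2 / (W r - xi r))%C) 0 (2 / sqrt a) a c0 ltac:(lra) (Rle_refl 0)
    ltac:(intros; eapply cder_eq; [apply B1; lra|ring]) ltac:(intros; cbv beta; rewrite Cmod_0; lra)).
  rewrite Rmult_0_l, exp_0, Rmult_1_r, I1 in Q.
  eapply Rle_trans; [apply Q|].
  - intros r Hr. assert (Hb := B1 r ltac:(lra)). assert (N := bl_nonzero _ _ _ Hb).
    rewrite RtoC_m2, Cmod_div, Cmod_opp, Cmod_R, Rabs_right by (try lra; auto).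
    apply Rmult_le_compat_l; [lra|]. apply Rinv_le_contravar; [lra|].
    eapply Rle_trans; [|apply Cmod_snd]. eapply Rle_trans; [|apply Rle_abs]. simpl.
    assert (M := bl_Y_mono xi W a r ltac:(lra) ltac:(intros; apply B1; lra)). rewrite I1 in M. lra.
  - apply Rplus_le_compat_r.
    replace (tipV 0 s a) with (RtoC (q (0 - a)) + (tipV 0 s a - q (0 - a)%R))%C by ring.
    eapply Rle_trans; [apply Cmod_triangle|]. rewrite Cmod_R. lra.
Qed.

(** The ingredients beyond polynomials are the square root, whose argument [s + a] has real part at
    least [a / 2], and the flow, started at height at least [sqrt a]. *)
Lemma approx_curve_holo a : 0 < 2 * a <= r0 -> holo (fun s => Cmod s <= a / 100) (approx_curve a).
Proof.
  intros Ha. set (D := fun s : C => Cmod s <= a / 100).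
  assert (Hid : holo D (fun s => s)) by (apply holo_id with (M := a / 100); auto).
  assert (Hx : holo D (fun s => csqrt (s - RtoC 0 + a)%C)).
  { apply (holo_comp D (fun z => a / 2 <= fst z /\ Cmod z <= 2 * a) (fun s => s - RtoC 0 + a)%C csqrt).
    - apply holo_ext with (f := fun s => (s + RtoC a)%C); [intros; ring|]. apply holo_add; [auto|apply holo_const].
    - apply holo_csqrt with (c := a / 2) (M := 2 * a); [lra|auto].
    - intros z Hz. unfold D in Hz. assert (Q := Rle_trans _ _ _ (Cmod_fst z) Hz). apply Rabs_le_between in Q. split.
      + simpl. lra.
      + replace (z - RtoC 0 + a)%C with (z + a)%C by ring. eapply Rle_trans; [apply Cmod_triangle|].
        rewrite Cmod_R, Rabs_right by lra. lra. }
  assert (HV : holo D (fun s => tipV 0 s a)).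
  { unfold tipV. apply holo_add; [apply holo_const|]. apply (holo_polyf D G c (fun s => s)); auto. }
  destruct HV as [F [K HVF]].
  apply (holo_comp D (fun z => sqrt a <= snd z /\ Cmod z <= K) (fun s => tipV 0 s a) (fun z => FL a z c0)).
  - exists F, K; auto.
  - apply (flow_holo xi xi' xi_deriv (FL a) a c0 (sqrt a) K); [lra|apply sqrt_lt_R0; lra|apply HFL].
  - intros z Hz. split.
    + apply tipV_start; [lra|auto].
    + apply HVF; auto.
Qed.

End Local.

(** * Polynomial approximation of the curve *)

Lemma holo_mono (D D' : C -> Prop) f : (forall z, D' z -> D z) -> holo D f -> holo D' f.
Proof.
  intros H [F [K [H0 [H1 [H2 H3]]]]]. exists F, K. split; [auto|split; [|split]]; intros; auto.
Qed.

Lemma holo_sub D f g : holo D f -> holo D g -> holo D (fun z => f z - g z)%C.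
Proof.
  intros Hf Hg. apply holo_ext with (f := fun z => (f z + (- (1)) * g z)%C); [intros; ring|].
  apply holo_add; auto. apply holo_mul; auto. apply holo_const.
Qed.

Lemma holo_poly_at_scale m (f : C -> C) l e (pr : C -> R) : pr = fst \/ pr = snd -> 0 < l ->
  holo (fun z => Cmod z <= l) f -> (forall z, Cmod z <= l -> Cmod (f z) <= e) ->
  exists c, forall y, Rabs y <= l / 2 -> Rabs (pr (f (RtoC y)) - peval m c y) <= 4 * e * (Rabs y / l) ^ S m.
Proof.
  intros Hpr Hl Hf He.
  assert (Dl : forall z, unit_disc z -> Cmod (RtoC l * z)%C <= l).
  { intros z Hz. rewrite Cmod_mult, Cmod_R, Rabs_right by lra. unfold unit_disc in Hz.
    assert (Q := Cmod_ge_0 z). nra. }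
  destruct (cauchy_poly m (fun z => f (RtoC l * z)%C) e) as [a [b H]].
  - apply (holo_comp unit_disc (fun z => Cmod z <= l) (fun z => RtoC l * z)%C f); auto.
    apply holo_mul; [apply holo_const|apply holo_id with (M := 1); auto].
  - intros z Hz. apply He, Dl, Hz.
  - enough (G : forall y, Rabs y <= l / 2 ->
        Rabs (fst (f (RtoC y)) - peval m (fun k => a k * (/ l) ^ k) y) <= 4 * e * (Rabs y / l) ^ S m /\
        Rabs (snd (f (RtoC y)) - peval m (fun k => b k * (/ l) ^ k) y) <= 4 * e * (Rabs y / l) ^ S m).
    { destruct Hpr as [->| ->]; eexists; intros y Hy; apply G, Hy. }
    intros y Hy. rewrite !peval_dilate.
    set (x := / l * y).
    assert (Hx : Rabs x = Rabs y / l) by (unfold x; rewrite Rabs_mult, Rabs_inv, (Rabs_right l) by lra; unfold Rdiv; ring).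
    assert (Hx2 : Rabs x <= / 2).
    { rewrite Hx. apply Rmult_le_reg_r with l; auto. unfold Rdiv; rewrite Rmult_assoc, Rinv_l by lra. lra. }
    destruct (H x Hx2) as [A1 A2]. rewrite Hx in A1, A2.
    replace (RtoC l * RtoC x)%C with (RtoC y) in A1, A2 by (unfold x; rewrite <- RtoC_mult; f_equal; field; lra).
    auto.
Qed.

(** Add to the polynomial of scale [J] the Taylor polynomial of [ga (S J) - ga J]. The induction
    carries a factor [(|y| / l)^(m+1)] in the error: when the radius [l] is halved the old error
    shrinks by [k = 2^-(m+1)], and [k < w] lets the contributions of all scales sum to [O (w^J)]. *)
Lemma telescoped_polynomials m w C0 r (pr : C -> R) (ga : nat -> C -> C) : pr = fst \/ pr = snd ->
  0 < w -> (/ 2) ^ S m < w -> 0 <= C0 -> 0 < r ->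
  (forall j, holo (fun z => Cmod z <= r * (/ 2) ^ j) (ga j)) ->
  (forall z, Cmod z <= r -> Cmod (ga 0%nat z) <= C0) ->
  (forall j z, Cmod z <= r * (/ 2) ^ S j -> Cmod (ga (S j) z - ga j z)%C <= C0 * w ^ j) ->
  forall J, exists c, forall y, Rabs y <= r * (/ 2) ^ J / 2 ->
    Rabs (pr (ga J (RtoC y)) - peval m c y) <= 4 * (C0 + C0 / w) / (1 - (/ 2) ^ S m / w) * w ^ J.
Proof.
  intros Hpr Hw Hk HC Hr Hh H0 H1 J.
  (* [A] solves [A * w = A * k + 4 * C2 * w]: old error plus new error at the next scale. The
     summand [C0 / w] allows for the difference [ga (S J) - ga J] being bounded by [w^J] rather than
     [w^(J+1)]. *)
  set (C2 := C0 + C0 / w). set (k := (/ 2) ^ S m) in *. set (A := 4 * C2 / (1 - k / w)).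
  assert (HC0w : 0 <= C0 / w) by (apply Rdiv_le_0_compat; lra).
  assert (Hkw : 0 < 1 - k / w).
  { enough (k / w < 1) by lra. apply Rmult_lt_reg_r with w; auto. unfold Rdiv; rewrite Rmult_assoc, Rinv_l by lra. lra. }
  assert (HA : 0 <= A) by (apply Rdiv_le_0_compat; unfold C2; lra).
  assert (Prs : forall z z', pr (z - z')%C = pr z - pr z') by (destruct Hpr as [->| ->]; intros; simpl; ring).
  assert (Main : exists c, forall y, Rabs y <= r * (/ 2) ^ J / 2 ->
    Rabs (pr (ga J (RtoC y)) - peval m c y) <= A * (Rabs y / (r * (/ 2) ^ J)) ^ S m * w ^ J).
  { induction J.
    - destruct (holo_poly_at_scale m (ga 0%nat) r C0 pr Hpr Hr) as [c Hc].
      + eapply holo_mono; [|apply (Hh 0%nat)]. intros z Hz. simpl. lra.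
      + auto.
      + exists c. intros y Hy. simpl in Hy. simpl (_ ^ 0). rewrite !Rmult_1_r.
        assert (Hp : 0 <= (Rabs y / r) ^ S m) by (apply pow_le, Rdiv_le_0_compat; [apply Rabs_pos|auto]).
        eapply Rle_trans; [apply Hc; lra|]. apply Rmult_le_compat_r; auto.
        apply Rmult_le_reg_r with (1 - k / w); auto. replace (A * (1 - k / w)) with (4 * C2) by (unfold A; field; split; lra).
        assert (0 <= k / w) by (apply Rdiv_le_0_compat; [apply pow_le; lra|auto]). unfold C2. nra.
    - destruct IHJ as [c Hc]. set (l := r * (/ 2) ^ S J).
      assert (P2 := pow_half_pos J).
      assert (Hl : 0 < l) by (unfold l; simpl; apply Rmult_lt_0_compat; lra).
      assert (Hl2 : r * (/ 2) ^ J = 2 * l) by (unfold l; simpl; field).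
      assert (Wj : 0 < w ^ J) by (apply pow_lt; auto).
      destruct (holo_poly_at_scale m (fun z => ga (S J) z - ga J z)%C l (C0 * w ^ J) pr Hpr Hl) as [d Hd].
      + apply holo_sub; [apply Hh|]. eapply holo_mono; [|apply (Hh J)]. intros z Hz. rewrite Hl2. lra.
      + intros z Hz. apply H1; auto.
      + exists (fun i => c i + d i). intros y Hy. rewrite peval_plus.
        assert (Hp : 0 <= (Rabs y / l) ^ S m) by (apply pow_le, Rdiv_le_0_compat; [apply Rabs_pos|auto]).
        specialize (Hc y ltac:(rewrite Hl2; fold l in Hy; lra)). specialize (Hd y Hy).
        rewrite Hl2 in Hc. rewrite Prs in Hd.
        replace (Rabs y / (2 * l)) with (/ 2 * (Rabs y / l)) in Hc by (field; lra).
        rewrite Rpow_mult_distr in Hc. fold k in Hc. fold l.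
        replace (pr (ga (S J) (RtoC y)) - (peval m c y + peval m d y)) with
          ((pr (ga J (RtoC y)) - peval m c y) + (pr (ga (S J) (RtoC y)) - pr (ga J (RtoC y)) - peval m d y)) by ring.
        eapply Rle_trans; [apply Rabs_triang|].
        eapply Rle_trans; [apply Rplus_le_compat; [apply Hc|apply Hd]|].
        set (X := (Rabs y / l) ^ S m) in *.
        replace (A * (k * X) * w ^ J + 4 * (C0 * w ^ J) * X) with ((A * k + 4 * C0) * (X * w ^ J)) by ring.
        replace (A * X * w ^ S J) with (A * w * (X * w ^ J)) by (simpl; ring).
        apply Rmult_le_compat_r; [apply Rmult_le_pos; lra|].
        assert (E : A * w = A * k + 4 * C2 * w) by (unfold A; field; split; lra).
        assert (C0 <= C2 * w) by (unfold C2; replace ((C0 + C0 / w) * w) with (C0 * w + C0) by (field; lra);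
          assert (0 <= C0 * w) by (apply Rmult_le_pos; lra); lra).
        lra. }
  destruct Main as [c Hc]. exists c. intros y Hy. eapply Rle_trans; [apply Hc; auto|]. fold C2. fold A.
  assert (P2 := pow_half_pos J). assert (Hl : 0 < r * (/ 2) ^ J) by (apply Rmult_lt_0_compat; lra).
  assert (Wj : 0 < w ^ J) by (apply pow_lt; auto).
  apply Rmult_le_compat_r; [lra|]. rewrite <- (Rmult_1_r A) at 2. apply Rmult_le_compat_l; auto.
  rewrite <- (pow1 (S m)). apply pow_incr. split; [apply Rdiv_le_0_compat; [apply Rabs_pos|auto]|].
  apply Rmult_le_reg_r with (r * (/ 2) ^ J); auto. unfold Rdiv; rewrite Rmult_assoc, Rinv_l by lra. lra.
Qed.

Lemma holo_to_approx a b N w C0 r (eta : R -> C) (pr : C -> R) : pr = fst \/ pr = snd ->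
  0 < w -> (/ 2) ^ S (S N) < w -> 0 <= C0 -> 0 < r ->
  (forall s, a <= s <= b -> exists ga : nat -> C -> C,
    (forall j, holo (fun z => Cmod z <= r * (/ 2) ^ j) (ga j)) /\
    (forall z, Cmod z <= r -> Cmod (ga 0%nat z) <= C0) /\
    (forall j z, Cmod z <= r * (/ 2) ^ S j -> Cmod (ga (S j) z - ga j z)%C <= C0 * w ^ j) /\
    (forall j t, a <= t <= b -> Rabs (t - s) <= r * (/ 2) ^ j -> Cmod (eta t - ga j (RtoC (t - s)))%C <= C0 * w ^ j)) ->
  approx a b N w (fun t => pr (eta t)).
Proof.
  intros Hpr Hw Hk HC Hr H.
  set (A := 4 * (C0 + C0 / w) / (1 - (/ 2) ^ S (S N) / w)).
  assert (HC0w : 0 <= C0 / w) by (apply Rdiv_le_0_compat; lra).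
  assert (HA : 0 <= A).
  { apply Rdiv_le_0_compat; [lra|]. enough ((/ 2) ^ S (S N) / w < 1) by lra.
    apply Rmult_lt_reg_r with w; auto. unfold Rdiv; rewrite Rmult_assoc, Rinv_l by lra. lra. }
  exists (A + C0), (r / 2). split; [lra|split; [lra|]]. intros s j Hs.
  destruct (H s Hs) as [ga [G1 [G2 [G3 G4]]]].
  destruct (telescoped_polynomials (S N) w C0 r pr ga Hpr Hw Hk HC Hr G1 G2 G3 j) as [c Hc].
  exists c. intros t Ht Hst. assert (Pj := pow_half_pos j).
  assert (Q1 := Hc (t - s) ltac:(lra)). fold A in Q1.
  assert (Q2 := G4 j t Ht ltac:(nra)).
  assert (Prs : Rabs (pr (eta t) - pr (ga j (RtoC (t - s)))) <= C0 * w ^ j).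
  { eapply Rle_trans; [|exact Q2]. destruct Hpr as [->| ->].
    - apply (Cmod_fst (eta t - ga j (RtoC (t - s)))%C).
    - apply (Cmod_snd (eta t - ga j (RtoC (t - s)))%C). }
  replace (pr (eta t) - peval (S N) c (t - s)) with
    ((pr (eta t) - pr (ga j (RtoC (t - s)))) + (pr (ga j (RtoC (t - s))) - peval (S N) c (t - s))) by ring.
  eapply Rle_trans; [apply Rabs_triang|]. lra.
Qed.

(** * Taylor polynomials of the driver and the choice of all constants *)

Definition taylor_coef (D : nat -> R -> R) (s : R) (k : nat) : R := D k s / INR (fact k).

Lemma dpoly_taylor D s k : dpoly (taylor_coef D s) k = D (S k) s / INR (fact k).
Proof.
  unfold dpoly, taylor_coef. change (fact (S k)) with ((S k) * fact k)%nat. rewrite mult_INR.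
  field. split; [apply INR_fact_neq_0|apply not_0_INR; lia].
Qed.

(** Induction on [n]: the derivative of the remainder is the remainder of [D 1], and the mean value
    theorem gains one power of [|t - s|]. *)
Lemma taylor_holder a b al M n : a <= b -> 0 <= al -> 0 <= M -> forall D : nat -> R -> R,
  (forall k, (k < n)%nat -> has_deriv_on a b (D k) (D (S k))) ->
  (forall s t, a <= s <= b -> a <= t <= b -> s <> t -> Rabs (D n t - D n s) <= M * Rpower (Rabs (t - s)) al) ->
  forall s t, a <= s <= b -> a <= t <= b -> s <> t ->
    Rabs (D 0%nat t - peval n (taylor_coef D s) (t - s)) <= M * Rpower (Rabs (t - s)) (INR n + al).
Proof.
  intros ab Hal HM. induction n; intros D HD HH s t Hs Ht Nst.
  - simpl INR. rewrite Rplus_0_l. unfold peval, taylor_coef; simpl.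
    replace (D 0%nat s / 1 * 1) with (D 0%nat s) by field. auto.
  - destruct (deriv_extension (D 0%nat) (D 1%nat) a b ab (HD 0%nat ltac:(lia))) as [g [Eg Dg]].
    assert (IH := IHn (fun k => D (S k)) ltac:(intros; apply HD; lia) HH).
    set (h := fun y => g y - peval (S n) (taylor_coef D s) (y - s)).
    set (h' := fun y => D 1%nat (clamp a b y) - peval n (dpoly (taylor_coef D s)) (y - s)).
    assert (Dh : forall y, is_derive h y (h' y)).
    { intros y. apply @is_derive_minus; [apply Dg|]. eapply is_derive_eq.
      - apply (is_derive_comp (peval (S n) (taylor_coef D s)) (fun y => y - s)); [apply is_derive_peval|].
        apply @is_derive_minus; [apply @is_derive_id|apply @is_derive_const].
      - unfold scal, minus, plus, opp, zero, one; simpl; unfold mult; simpl. ring. }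
    assert (Bh : forall y, a <= y <= b -> Rabs (y - s) <= Rabs (t - s) -> Rabs (h' y) <= M * Rpower (Rabs (t - s)) (INR n + al)).
    { intros y Hy Hyt. unfold h'. rewrite clamp_id by auto.
      rewrite (peval_ext n _ (taylor_coef (fun k => D (S k)) s)) by (intros; apply dpoly_taylor).
      destruct (Req_dec s y) as [->|Nsy].
      - rewrite Rminus_diag, peval_0. unfold taylor_coef. change (INR (fact 0)) with 1.
        replace (D 1%nat y - D 1%nat y / 1) with 0 by field. rewrite Rabs_R0.
        apply Rmult_le_pos; [auto|left; apply exp_pos].
      - eapply Rle_trans; [apply IH; auto|]. apply Rmult_le_compat_l; auto. apply Rpower_mono.
        + split; auto. apply Rabs_pos_lt; lra.
        + assert (P := pos_INR n). lra. }
    destruct (MVT_gen h s t h') as [y [Hy Ey]].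
    { intros; apply Dh. }
    { intros; apply continuity_pt_filterlim, @ex_derive_continuous; eexists; apply Dh. }
    assert (Hh0 : h s = 0).
    { unfold h. rewrite Eg, Rminus_diag, peval_0 by auto. unfold taylor_coef. simpl. field. }
    assert (Hht : h t = D 0%nat t - peval (S n) (taylor_coef D s) (t - s)) by (unfold h; now rewrite Eg).
    rewrite <- Hht. rewrite Hh0, Rminus_0_r in Ey. rewrite Ey, Rabs_mult.
    assert (Hpos : 0 < Rabs (t - s)) by (apply Rabs_pos_lt; lra).
    replace (Rpower (Rabs (t - s)) (INR (S n) + al)) with (Rpower (Rabs (t - s)) (INR n + al) * Rabs (t - s)).
    2: { rewrite S_INR. replace (INR n + 1 + al) with (INR n + al + 1) by ring. rewrite (Rpower_plus (INR n + al) 1), Rpower_1; auto. }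
    rewrite <- Rmult_assoc. apply Rmult_le_compat_r; [lra|].
    assert (Hy2 : (a <= y <= b) /\ Rabs (y - s) <= Rabs (t - s)).
    { unfold Rmin, Rmax in Hy. destruct (Rle_dec s t).
      - rewrite !Rabs_right by lra. lra.
      - rewrite !Rabs_left1 by lra. lra. }
    apply Bh; tauto.
Qed.

Lemma Qpoly_real m c y : Qpoly (S m) c (RtoC y) = RtoC (peval m c y).
Proof.
  induction m.
  - unfold peval; simpl. apply injective_projections; simpl; ring.
  - change (Qpoly (S (S m)) c (RtoC y)) with (Qpoly (S m) c (RtoC y) + RtoC (c (S m)) * RtoC y ^ S m)%C.
    rewrite IHm. unfold peval. rewrite tech5, RtoC_plus, RtoC_mult, RtoC_pow. reflexivity.
Qed.

Lemma approx_ext a b N w f g : (forall x, a <= x <= b -> f x = g x) -> approx a b N w f -> approx a b N w g.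
Proof.
  intros E [C0 [rho [HC [Hr H]]]]. exists C0, rho. split; auto. split; auto. intros s j Hs.
  destruct (H s j Hs) as [c Hc]. exists c. intros t Ht Hst. rewrite <- E by auto. auto.
Qed.

Lemma Rpower_antitone A x y : 0 < A <= 1 -> y <= x -> Rpower A x <= Rpower A y.
Proof.
  intros HA Hxy. unfold Rpower. apply exp_mono.
  assert (ln A <= 0) by (rewrite <- ln_1; destruct (Req_dec A 1) as [->|]; [lra|left; apply ln_increasing; lra]). nra.
Qed.

(** All constants are fixed before the expansion point [s], so they are uniform over [[s0, T]]. The
    error at scale [A] is a multiple of [sqrt A * em A = K * A^(be + 1/2)]. *)
Lemma tip_curve_approx (T be : R) (n : nat) (al M : R) (D : nat -> R -> R) (le : R -> R) (Wt : R -> R -> C) :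
  0 < T -> 2 < be -> be = INR (S n) + al -> 0 <= al < 1 -> 0 < M ->
  (forall k, (k < S n)%nat -> has_deriv_on 0 T (D k) (D (S k))) ->
  (forall k x, (k <= S n)%nat -> 0 <= x <= T -> Rabs (D k x) <= M) ->
  (forall s t, 0 <= s <= T -> 0 <= t <= T -> s <> t -> Rabs (D (S n) t - D (S n) s) <= M * Rpower (Rabs (t - s)) al) ->
  (forall x, 0 <= x <= T -> le x = D 0%nat x) ->
  (forall x, is_derive le x (D 1%nat (clamp 0 T x))) ->
  (forall t, tip_solution (fun r => le (t - r)) M (Wt t)) ->
  forall N s0 pr, 0 < s0 < T -> INR N < be + / 2 <= INR N + 1 -> pr = fst \/ pr = snd ->
  approx s0 T N (Rpower 2 (- (be + / 2))) (fun t => pr (tip_curve Wt t)).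
Proof.
  intros HT Hbe Ebe Hal HM HD HB HH Ele Dle HWt N s0 pr Hs0 HN Hpr.
  assert (Ble : forall t, Rabs (D 1%nat (clamp 0 T t)) <= M) by (intros; apply HB; [lia|apply clamp_in; lra]).
  (* The coefficients of the derivative of the Taylor polynomial; the zeros beyond [n] give the
     bound [M] for every index, as [tip_approx] wants. *)
  set (cf := fun s i => if le_lt_dec i n then D (S i) s / INR (fact i) else 0).
  assert (Bcf : forall s, 0 <= s <= T -> forall i, Rabs (cf s i) <= M).
  { intros s Hs i. unfold cf. destruct (le_lt_dec i n) as [Hi|Hi]; [|rewrite Rabs_R0; lra].
    assert (F1 : 1 <= INR (fact i)) by (apply (le_INR 1); apply lt_O_fact).
    unfold Rdiv. rewrite Rabs_mult, Rabs_inv, (Rabs_right (INR _)) by lra.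
    assert (B1 := HB (S i) s ltac:(lia) Hs). assert (I1 : / INR (fact i) <= 1) by (rewrite <- Rinv_1; apply Rinv_le_contravar; lra).
    assert (I0 : 0 < / INR (fact i)) by (apply Rinv_0_lt_compat; lra).
    assert (P := Rabs_pos (D (S i) s)). nra. }
  destruct (tip_approx (S n) (S (S n)) M) as [G [B [r1 [PG [HB1 [Hr1 HG]]]]]].
  set (K := M + B). set (em := fun A => K * Rpower A be).
  assert (Pp : forall x y, 0 < Rpower x y) by (intros; apply exp_pos).
  set (sm := / (160 * M + 100 * B)). assert (Hsm0 : 0 < sm) by (apply Rinv_0_lt_compat; lra).
  (* The four bounds serve [tip_approx], the smallness [1000 * em A <= A], the conditions on
     [sqrt r0] that keep flow lines near [2 i sqrt r], and the room [2 * r0 <= s] below every point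
     of [[s0, T]]. *)
  set (r0 := Rmin (Rmin r1 (/ (1000 * K))) (Rmin (sm ^ 2) (s0 / 2))).
  assert (HKi : 0 < / (1000 * K)) by (apply Rinv_0_lt_compat; unfold K; lra).
  assert (R0 : 0 < r0) by (repeat apply Rmin_pos; try lra; apply pow_lt; auto).
  assert (R1 : r0 <= r1) by (eapply Rle_trans; [apply Rmin_l|apply Rmin_l]).
  assert (R2 : r0 <= / (1000 * K)) by (eapply Rle_trans; [apply Rmin_l|apply Rmin_r]).
  assert (R3 : r0 <= sm ^ 2) by (eapply Rle_trans; [apply Rmin_r|apply Rmin_l]).
  assert (R4 : r0 <= s0 / 2) by (eapply Rle_trans; [apply Rmin_r|apply Rmin_r]).
  clearbody r0.
  assert (Sr0 : sqrt r0 <= sm) by (apply pow2_le_inv; [lra|rewrite pow2_sqrt; lra]).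
  assert (Ssm : 160 * M * sqrt r0 + 100 * B * sqrt r0 <= 1).
  { replace (160 * M * sqrt r0 + 100 * B * sqrt r0) with ((160 * M + 100 * B) * sqrt r0) by ring.
    replace 1 with ((160 * M + 100 * B) * sm) by (unfold sm; field; lra). apply Rmult_le_compat_l; lra. }
  assert (Sr0p := sqrt_pos r0).
  assert (S1 : 0 <= M * sqrt r0) by (apply Rmult_le_pos; lra).
  assert (S2 : 0 <= B * sqrt r0) by (apply Rmult_le_pos; lra).
  assert (Hem : forall r A, 0 < r <= A -> A <= 1 -> B * r ^ S (S n) * r <= em A).
  { intros r A Hr HA. unfold em, K.
    assert (Q : r ^ S (S n) * r <= Rpower A be).
    { replace (r ^ S (S n) * r) with (r ^ S (S (S n))) by (simpl; ring).
      apply Rle_trans with (A ^ S (S (S n))); [apply pow_incr; lra|].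
      rewrite <- Rpower_pow by lra. apply Rpower_antitone; [lra|]. rewrite Ebe, !S_INR. lra. }
    specialize (Pp A be). rewrite Rmult_plus_distr_r, Rmult_assoc.
    assert (B * (r ^ S (S n) * r) <= B * Rpower A be) by (apply Rmult_le_compat_l; lra).
    assert (0 <= M * Rpower A be) by (apply Rmult_le_pos; lra). lra. }
  (* [be > 2] gives [A^be <= A^2], and [r0 <= / (1000 * K)] absorbs one factor [A]. *)
  assert (Hsm : forall A, 0 < A <= r0 -> 1000 * em A <= A).
  { intros A HA. unfold em.
    assert (Q : Rpower A be <= A * A).
    { replace (A * A) with (A ^ 2) by ring. rewrite <- Rpower_pow by lra. apply Rpower_antitone; [lra|]. simpl; lra. }
    assert (K * A * 1000 <= 1).
    { apply Rle_trans with (1000 * K * / (1000 * K)); [|right; field; unfold K; lra].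
      replace (K * A * 1000) with (1000 * K * A) by ring. apply Rmult_le_compat_l; [unfold K|]; lra. }
    assert (K * Rpower A be <= K * (A * A)) by (apply Rmult_le_compat_l; [unfold K|]; lra). nra. }
  set (w := Rpower 2 (- (be + / 2))).
  assert (Hw : 0 < w) by apply exp_pos.
  (* [be + 1/2 <= N + 1], so remainders of order [N + 2] are strictly smaller than the rate even at
     the right end, the Zygmund case. *)
  assert (HwN : (/ 2) ^ S (S N) < w).
  { unfold w. rewrite pow_inv, <- Rpower_pow, <- Rpower_Ropp by lra. apply Rpower_lt; [lra|]. rewrite !S_INR. lra. }
  set (K0 := exp (/ 10 + 16 * M) * / sqrt r0 * exp (2 / r0 * T)).
  set (K1 := exp (/ 10 + 2 * (8 * M + B))).
  set (C1 := K0 * (K1 * (4 * K))).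
  assert (Sr0s : 0 < sqrt r0) by (apply sqrt_lt_R0; lra).
  assert (HK0 : 0 < K0) by (unfold K0; repeat apply Rmult_lt_0_compat; try apply exp_pos; apply Rinv_0_lt_compat; auto).
  assert (HK1 : 0 < K1) by apply exp_pos.
  assert (HC1 : 0 <= C1) by (unfold C1; apply Rmult_le_pos; [lra|apply Rmult_le_pos; [lra|unfold K; lra]]).
  set (a0 := r0 / 2).
  set (C2 := M + 1 + 3 + 2 / sqrt a0 * T).
  assert (Sa0 : 0 < sqrt a0) by (apply sqrt_lt_R0; unfold a0; lra).
  assert (H2a : 0 < 2 / sqrt a0) by (apply Rdiv_lt_0_compat; lra).
  assert (HC2 : 0 <= C2) by (unfold C2; assert (0 <= 2 / sqrt a0 * T) by (apply Rmult_le_pos; lra); lra).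
  assert (Scale : forall j A, 0 < A <= r0 * (/ 2) ^ j -> sqrt A * em A <= K * w ^ j).
  { intros j A HA. unfold em, w. rewrite Rpower_half_pow. assert (Pj := pow_half_pos j).
    replace (sqrt A * (K * Rpower A be)) with (K * (Rpower A be * Rpower A (/ 2))) by (rewrite Rpower_sqrt by lra; ring).
    rewrite <- Rpower_plus. apply Rmult_le_compat_l; [unfold K; lra|]. apply Rpower_mono; [|lra].
    split; [lra|]. nra. }
  apply (holo_to_approx s0 T N w (C1 + C2) (r0 / 200) (tip_curve Wt) pr Hpr Hw HwN); [lra|lra|].
  intros s Hs.
  set (q := peval (S n) (taylor_coef D s)). set (q' := peval n (dpoly (taylor_coef D s))).
  assert (Dq : forall y, is_derive q y (q' y)) by (intros; apply is_derive_peval).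
  assert (Eq : forall y : R, Qpoly (S n) (cf s) y = RtoC (q' y)).
  { intros y. rewrite Qpoly_real. f_equal. apply peval_ext. intros k Hk. rewrite dpoly_taylor.
    unfold cf. destruct (le_lt_dec k n); [auto|lia]. }
  assert (Herr : forall y A, 0 < A <= 1 -> Rabs y <= A -> 0 <= s + y <= T -> Rabs (le (s + y) - q y) <= em A).
  { intros y A HA Hy Hsy. unfold em, K. specialize (Pp A be).
    destruct (Req_dec y 0) as [->|Ny].
    - rewrite Rplus_0_r, Ele by lra. unfold q. rewrite peval_0. unfold taylor_coef. change (INR (fact 0)) with 1.
      replace (D 0%nat s - D 0%nat s / 1) with 0 by field. rewrite Rabs_R0. apply Rmult_le_pos; lra.
    - rewrite Ele by auto.
      assert (Q := taylor_holder 0 T al M (S n) ltac:(lra) ltac:(lra) ltac:(lra) D HD HH s (s + y) ltac:(lra) Hsy ltac:(lra)).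
      replace (s + y - s) with y in Q by ring. rewrite <- Ebe in Q. fold q in Q.
      eapply Rle_trans; [exact Q|].
      assert (Rpower (Rabs y) be <= Rpower A be).
      { apply Rpower_mono; [|lra]. split; auto. now apply Rabs_pos_lt. }
      assert (M * Rpower (Rabs y) be <= M * Rpower A be) by (apply Rmult_le_compat_l; lra).
      assert (0 <= B * Rpower A be) by (apply Rmult_le_pos; lra). lra. }
  set (xi := fun r => le (s - r)).
  assert (ExFL : forall p : R * C, exists W, 0 < snd (snd p) -> W (fst p) = snd p /\ forall r, fst p <= r -> bl xi W r).
  { intros [a z]. cbn [fst snd]. destruct (Rlt_dec 0 (snd z)) as [Hz|Hz].
    - destruct (bl_exists xi a z) as [W HW]; auto.
      { intros t. apply @ex_derive_continuous. eexists. apply (driver_deriv le _ Dle). }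
      exists W; auto.
    - exists (fun _ => 0%C). intros; lra. }
  apply fun_choice in ExFL. destruct ExFL as [FL0 HFL0].
  set (FL := fun a z => FL0 (a, z)).
  assert (HFL : forall a z, 0 < snd z -> FL a z a = z /\ forall r, a <= r -> bl xi (FL a z) r)
    by (intros a z Hz; apply (HFL0 (a, z) Hz)).
  assert (HGs : forall (z x : C) r, Cmod z <= 1 -> 0 < fst x -> 0 < r <= r0 ->
    Cmod (x * x - r)%C <= r / 10 ->
    near (4 * Cmod (x * x - r)%C + B * (r * sqrt r)) r (G (cf s) z x) /\
    forall (xf : R -> C) t, xf t = x -> cder xf t (/ (2 * x))%C -> exists E,
      Cmod E <= B * r ^ S (S n) /\
      cder (fun t => G (cf s) z (xf t)) t (-2 / G (cf s) z x + Qpoly (S n) (cf s) (z - x * x) + E)%C).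
  { intros z x r Hz Hx Hr Hxr. apply HG; auto; [apply Bcf; lra|lra]. }
  assert (Hc0 : 2 * r0 <= s <= T) by lra.
  assert (Hr04 : 0 < r0 <= / 4) by lra.
  assert (HLr : 160 * M * sqrt r0 <= 1) by lra.
  assert (HBr : 100 * B * sqrt r0 <= 1) by lra.
  (* [a0 = r0 / 2] because the estimates need [2 * a <= r0]; the discs of radius [aj j / 100] are
     then those of radius [r0 / 200 * 2^-j]. *)
  set (aj := fun j => a0 * (/ 2) ^ j).
  assert (Haj : forall j, 0 < 2 * aj j <= r0 /\ r0 / 200 * (/ 2) ^ j = aj j / 100 /\ 2 * aj j = r0 * (/ 2) ^ j /\ 2 * aj (S j) = aj j).
  { intros j. unfold aj, a0. assert (Pj := pow_half_pos j).
    assert ((/ 2) ^ j <= 1) by (rewrite <- (pow1 j); apply pow_incr; lra).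
    split; [nra|]. split; [field|]. split; [field|]. simpl; field. }
  assert (K0s : exp (/ 10 + 16 * M) * / sqrt r0 * exp (2 / r0 * (s - r0)) <= K0).
  { unfold K0. apply Rmult_le_compat_l.
    - left; apply Rmult_lt_0_compat; [apply exp_pos|apply Rinv_0_lt_compat; auto].
    - apply exp_mono. apply Rmult_le_compat_l; [|lra]. apply Rdiv_le_0_compat; lra. }
  assert (Fin : forall j A x, 0 < A <= r0 * (/ 2) ^ j -> 0 <= x <= sqrt A ->
     exp (/ 10 + 16 * M) * / sqrt r0 * exp (2 / r0 * (s - r0)) * (x * (K1 * (4 * em A))) <= (C1 + C2) * w ^ j).
  { intros j A x HA Hx. assert (Q := Scale j A HA). assert (Wj : 0 < w ^ j) by (apply pow_lt; auto).
    assert (E0 : 0 <= em A) by (unfold em, K; apply Rmult_le_pos; [lra|left; apply Pp]).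
    assert (Q2 : x * em A <= K * w ^ j) by (eapply Rle_trans; [apply Rmult_le_compat_r; [auto|apply Hx]|auto]).
    replace (x * (K1 * (4 * em A))) with (K1 * (4 * (x * em A))) by ring.
    apply Rle_trans with (K0 * (K1 * (4 * (K * w ^ j)))).
    - apply Rmult_le_compat; auto.
      + left; repeat apply Rmult_lt_0_compat; try apply exp_pos. apply Rinv_0_lt_compat; auto.
      + assert (0 <= x * em A) by (apply Rmult_le_pos; lra). apply Rmult_le_pos; lra.
      + apply Rmult_le_compat_l; lra.
    - unfold C1. assert (0 <= C2 * w ^ j) by (apply Rmult_le_pos; lra). lra. }
  exists (fun j => approx_curve s (cf s) q G FL (aj j)). split; [|split; [|split]].
  - intros j. destruct (Haj j) as [A1 [A2 _]]. rewrite A2.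
    eapply (approx_curve_holo le _ M HM Dle T s (S n) (S (S n)) (cf s) q G B r0 em); eauto; lra.
  - intros z Hz. destruct (Haj 0%nat) as [A1 [A2 _]]. simpl in A2. rewrite Rmult_1_r in A2.
    rewrite A2 in Hz.
    eapply Rle_trans.
    { eapply (approx_curve_bound le M HM T s (S n) (S (S n)) (cf s) q G B r0 em); eauto; lra. }
    unfold aj; simpl pow; rewrite Rmult_1_r.
    assert (A0 : 0 < a0 <= / 8) by (unfold a0; lra).
    assert (Sa : sqrt a0 <= 1) by (apply pow2_le_inv; [lra|rewrite pow2_sqrt; lra]).
    assert (Q1 : Rabs (q (0 - a0)) <= M + 1).
    { assert (Q := Herr (0 - a0) a0 ltac:(lra) ltac:(rewrite Rabs_left; lra) ltac:(unfold a0 in *; lra)).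
      assert (E1 := Hsm a0 ltac:(unfold a0; lra)).
      assert (L1 := HB 0%nat (s + (0 - a0)) ltac:(lia) ltac:(unfold a0 in *; lra)).
      rewrite <- Ele in L1 by (unfold a0 in *; lra).
      apply Rabs_le_between in Q. apply Rabs_le_between in L1. apply Rabs_le. lra. }
    assert (2 / sqrt a0 * (s - a0) <= 2 / sqrt a0 * T) by (apply Rmult_le_compat_l; lra).
    unfold C2. lra.
  - intros j z Hz. destruct (Haj (S j)) as [A1 [A2 [A3 _]]]. destruct (Haj j) as [A1' [_ [A3' A4']]].
    rewrite A2 in Hz.
    assert (Q : Cmod (approx_curve s (cf s) q G FL (aj (S j)) z - approx_curve s (cf s) q G FL (2 * aj (S j)) z)%C <=
      exp (/ 10 + 16 * M) * / sqrt r0 * exp (2 / r0 * (s - r0)) * (sqrt (2 * aj (S j)) * (K1 * (4 * em (2 * aj (S j)))))).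
    { eapply (approx_curve_step le _ M HM Dle Ble T s (S n) (S (S n)) (cf s) q q' G B r0 em); eauto; lra. }
    rewrite A4' in Q. eapply Rle_trans; [exact Q|]. apply Fin; [lra|].
    split; [apply sqrt_pos|lra].
  - intros j t Ht Hst. destruct (Haj j) as [A1 [A2 [A3 _]]]. rewrite A2 in Hst.
    replace t with (s + (t - s)) at 1 by ring.
    eapply Rle_trans.
    { eapply (approx_curve_tip le _ M HM Dle Ble Wt HWt T s (S n) (S (S n)) (cf s) q q' G B r0 em); eauto; lra. }
    apply Fin; [lra|]. split; [apply sqrt_pos|apply sqrt_le_1_alt; lra].
Qed.

Lemma generated_curve_approx T beta lam gam : 0 < T -> 2 < beta -> Cbeta 0 T beta lam -> generates lam T gam ->
  forall N s0 (pr : R * R -> R), 0 < s0 < T -> INR N < beta + / 2 <= INR N + 1 -> pr = fst \/ pr = snd ->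
  approx s0 T N (Rpower 2 (- (beta + / 2))) (fun t => pr (gam t)).
Proof.
  intros HT Hb [n [al [Eb [Hal [M [HM [D [[D0 HD] [_ [HB HH]]]]]]]]]] Hgen N s0 pr Hs0 HN Hpr.
  (* [beta > 2] excludes [n = 0], so the driver has a bounded derivative and can be extended to the
     line. *)
  destruct n as [|n]; [simpl in Eb; lra|].
  destruct (deriv_extension (D 0%nat) (D 1%nat) 0 T ltac:(lra) (HD 0%nat ltac:(lia))) as [le [Ele Dle]].
  assert (Ble : forall t, Rabs (D 1%nat (clamp 0 T t)) <= M) by (intros; apply HB; [lia|apply clamp_in; lra]).
  assert (Ex : forall t, exists W, tip_solution (fun r => le (t - r)) M W).
  { intros t. apply tip_exists with (xi' := fun r => - D 1%nat (clamp 0 T (t - r))); auto.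
    - intros r. apply (driver_deriv le (fun x => D 1%nat (clamp 0 T x)) Dle).
    - intros r. rewrite Rabs_Ropp. apply Ble. }
  apply fun_choice in Ex. destruct Ex as [Wt HWt].
  assert (Elam : forall s, 0 <= s <= T -> le s = lam s) by (intros; rewrite Ele, D0; auto).
  apply approx_ext with (f := fun t => pr (tip_curve Wt t)).
  - intros x Hx. rewrite (generated_curve_eq le _ M HM Dle Wt HWt lam T Elam gam Hgen x); [reflexivity|lra].
  - apply (tip_curve_approx T beta n al M D le Wt); auto.
    intros s t Hs Ht Hst.
    assert (P : 0 < Rpower (Rabs (t - s)) al) by apply exp_pos.
    apply Rmult_le_reg_r with (/ Rpower (Rabs (t - s)) al); [now apply Rinv_0_lt_compat|].
    rewrite Rmult_assoc, Rinv_r, Rmult_1_r by lra. apply HH; auto.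
Qed.

Lemma Rpower_2_split N al : Rpower 2 (- (INR N + al)) = Rpower 2 (- al) / 2 ^ N.
Proof.
  rewrite Ropp_plus_distr, Rplus_comm, Rpower_plus, (Rpower_Ropp 2 (INR N)), Rpower_pow by lra. reflexivity.
Qed.

Theorem theorem1p1 (T beta : R) (lam : R -> R) (gam : R -> R * R) :
  0 < T -> 2 < beta ->
  Cbeta 0 T beta lam ->
  generates lam T gam ->
  ((~ exists n : nat, beta + / 2 = INR n) ->
     forall s0, 0 < s0 < T ->
       Cbeta s0 T (beta + / 2) (fun s => fst (gam s)) /\
       Cbeta s0 T (beta + / 2) (fun s => snd (gam s))) /\
  (forall n : nat, beta + / 2 = INR n ->
     forall s0, 0 < s0 < T ->
       Zygmund_n s0 T (n - 1) (fun s => fst (gam s)) /\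
       Zygmund_n s0 T (n - 1) (fun s => snd (gam s))).
Proof.
  intros HT Hb Hlam Hgen.
  assert (A := generated_curve_approx T beta lam gam HT Hb Hlam Hgen).
  split.
  - intros Hn s0 Hs0.
    (* The integer part of [beta + / 2] is [n] or [S n] according to [al < / 2] or [al > / 2];
       equality is the excluded case. *)
    assert (Ex : exists N al, beta + / 2 = INR N + al /\ 0 < al < 1).
    { destruct Hlam as [n [al [E [Hal _]]]].
      destruct (Rtotal_order al (/ 2)) as [L|[L|L]].
      - exists n, (al + / 2). lra.
      - contradiction Hn. exists (S n). rewrite S_INR. lra.
      - exists (S n), (al - / 2). rewrite S_INR. lra. }
    destruct Ex as [N [al [E Hal]]].
    assert (G : forall pr : R * R -> R, pr = fst \/ pr = snd -> Cbeta s0 T (beta + / 2) (fun s => pr (gam s))).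
    { intros pr Hpr. exists N, al. split; [exact E|split; [lra|]].
      apply approx_Cnalpha; [lra|exact Hal|]. rewrite <- Rpower_2_split, <- E. apply A; auto; lra. }
    split; [apply (G fst)|apply (G snd)]; auto.
  - intros n E s0 Hs0.
    (* [beta + / 2 = N + 1] is the right end of the range in [generated_curve_approx], where the
       rate is [2^-(N+1)]. *)
    destruct n as [|N]; [simpl in E; lra|]. rewrite S_INR in E.
    replace (S N - 1)%nat with N by lia.
    assert (G : forall pr : R * R -> R, pr = fst \/ pr = snd -> Zygmund_n s0 T N (fun s => pr (gam s))).
    { intros pr Hpr. apply approx_Zygmund_n; [lra|].
      replace (/ 2) with (Rpower 2 (- (1))) at 1 by (rewrite Rpower_Ropp, Rpower_1; lra).
      rewrite <- Rpower_2_split, <- E. apply A; auto; lra. }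
    split; [apply (G fst)|apply (G snd)]; auto.
Qed.
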